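(* Let $f \in B(\mathbb R)$ and let $m > 0$ be such that $f \geq m$ on $\mathbb R$. Let $g := \frac12 \log f$, let $u := P[g] : \mathbb U \to \mathbb R$ be the Poisson integral of $g$, let $u_o := u|_{\mathbb U^o}$, let $v_o : \mathbb U^o \to \mathbb R$ be a harmonic function conjugate to $u_o$ (so that $u_o + i v_o$ is holomorphic on $\mathbb U^o$), and let $v : \mathbb U \to \mathbb R$ be the continuous extension of $v_o$ to $\mathbb U$ (which exists). Then $f$ has a spectral factor $s \in B(\mathbb R)$ if and only if there exist $c \in \mathbb R$ and $\theta \in U(\mathbb R)$ such that $$v(x) = c x + \theta(x), \quad x \in \mathbb R.$$
   Context: $\mathbb U := \{z \in \mathbb C : \Im z \geq 0\}$ and $\mathbb U^o := \{z \in \mathbb C : \Im z > 0\}$. For $\omega \in \mathbb R$, $\chi_\omega(x) := e^{i\omega x}$. $C_b(\mathbb R)$ is the space of bounded continuous functions $\mathbb R \to \mathbb C$ with the sup norm $\|\cdot\|$. $U(\mathbb R)$, the algebra of uniformly almost periodic functions, is the closure in $C_b(\mathbb R)$, in the sup norm, of the linear span of $\{\chi_\omega : \omega \in \mathbb R\}$. For $f \in U(\mathbb R)$ the mean value $M(f) := \lim_{L\to\infty} \frac{1}{2L}\int_{-L}^L f(x)\,dx$ exists; put $\widehat f(\omega) := M(f\chi_{-\omega})$ for $\omega \in \mathbb R$, the spectrum $\Omega(f) := \{\omega \in \mathbb R : \widehat f(\omega) \neq 0\}$, and the bandwidth $b(f) := \sup \Omega(f) - \inf\Omega(f) \in [0,\infty]$.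 $B(\mathbb R) := \{f \in U(\mathbb R) : b(f) < \infty\}$. An entire function $F \not\equiv 0$ is of exponential type if $\tau(F) := \limsup_{r\to\infty} r^{-1}\log \max_{|z|\leq r}|F(z)|$ is finite (with $\tau(F)=0$ for nonzero constants); $\tau(F)$ is its type. Every $f \in B(\mathbb R)$ extends to an entire function $F$ of exponential type. Spectral factor: if $f \in B(\mathbb R)$ is nonzero and $f \geq 0$, with entire extension $F$ (for which $\tau(F) = b(f)/2$), a spectral factor of $f$ is a function $s : \mathbb R \to \mathbb C$ with $f = |s|^2$ that extends to an entire function $S$ of exponential type with $\tau(S) = \tau(F)/2 = b(f)/4$ and having no zeros in $\mathbb U^o$. (A spectral factor exists and is unique up to multiplication by a constant of modulus $1$.) Poisson integral: for $f \in C_b(\mathbb R)$, $P[f] : \mathbb U \to \mathbb C$ is defined by $P[f](x) := f(x)$ for $x \in \mathbb R$ and $P[f](x+iy) := \int_{-\infty}^\infty P_y(x-s) f(s)\,ds$ for $y>0$, where $P_y(x) := \frac{y}{\pi}\frac{1}{x^2+y^2}$. *)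

(* Defs.v *)
From Stdlib Require Import Reals.
From Coquelicot Require Import Coquelicot.
Open Scope R_scope.

Definition bounded_continuous (f : R -> C) : Prop :=
  (forall x : R, continuous f x) /\ exists M : R, forall x : R, Cmod (f x) <= M.

(* e^{i omega x} *)
Definition chi (omega x : R) : C := (cos (omega * x), sin (omega * x)).

(* [sum_n a n] has the n+1 terms a 0, ..., a n; zero coefficients are allowed,
   so these are exactly the elements of the linear span of the characters. *)
Definition trig_poly (p : R -> C) : Prop :=
  exists (n : nat) (a : nat -> C) (w : nat -> R),
    forall x : R, p x = sum_n (fun k => Cmult (a k) (chi (w k) x)) n.

Definition almost_periodic (f : R -> C) : Prop :=
  bounded_continuous f /\
  forall eps : R, 0 < eps ->
    exists p : R -> C, trig_poly p /\
      forall x : R, Cmod (Cminus (f x) (p x)) <= eps.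

(* As for [Derive] or [RInt], the value is meaningful only if the limit exists,
   which is the case for almost periodic functions. *)
Definition mean (f : R -> C) : C :=
  iota (T := C_R_CompleteNormedModule)
    (fun l : C =>
       filterlim
         (fun L : R =>
            Cmult (RtoC (/ (2 * L)))
                  (RInt (V := C_R_CompleteNormedModule) f (- L) L))
         (Rbar_locally p_infty) (locally l)).

Definition fourier_coeff (f : R -> C) (omega : R) : C :=
  mean (fun x => Cmult (f x) (chi (- omega) x)).

Definition spectrum (f : R -> C) (omega : R) : Prop :=
  fourier_coeff f omega <> RtoC 0.

(* If the spectrum is empty (f = 0), sup = -oo and inf = +oo, and the difference
   is -oo: the zero function is band-limited below, as it should be. *)
Definition bandwidth (f : R -> C) : Rbar :=
  Rbar_minus (Lub_Rbar (spectrum f)) (Glb_Rbar (spectrum f)).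

Definition band_limited (f : R -> C) : Prop :=
  almost_periodic f /\ Rbar_lt (bandwidth f) p_infty.

(* Complex differentiability: [C_AbsRing] is the field of scalars. *)
Definition holomorphic_on (D : C -> Prop) (F : C -> C) : Prop :=
  forall z : C, D z -> ex_derive (K := C_AbsRing) (V := C_NormedModule) F z.

Definition entire (F : C -> C) : Prop := holomorphic_on (fun _ => True) F.

(* A maximum, hence finite, when F is continuous and r >= 0. *)
Definition max_modulus (F : C -> C) (r : R) : R :=
  real (Lub_Rbar (fun y : R => exists z : C, Cmod z <= r /\ y = Cmod (F z))).

Definition LimSup_p_infty (h : R -> R) : Rbar :=
  Rbar_glb (fun l : Rbar =>
    exists a : R, l = Lub_Rbar (fun y : R => exists r : R, a < r /\ y = h r)).

Definition exp_type (F : C -> C) : Rbar :=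
  LimSup_p_infty (fun r => / r * ln (max_modulus F r)).

Definition of_exponential_type (F : C -> C) : Prop :=
  entire F /\ (exists z : C, F z <> RtoC 0) /\ is_finite (exp_type F).

Definition extends_line (f : R -> C) (F : C -> C) : Prop :=
  forall x : R, F (RtoC x) = f x.

Definition closed_uhp (z : C) : Prop := 0 <= Im z.
Definition open_uhp (z : C) : Prop := 0 < Im z.

(* The entire extensions F and S are unique, so quantifying them existentially
   is the same as speaking of "the" extensions of f and s. *)
Definition spectral_factor (f s : R -> C) : Prop :=
  (forall x : R, f x = RtoC (Cmod (s x) ^ 2)) /\
  exists F S : C -> C,
    extends_line f F /\ of_exponential_type F /\
    extends_line s S /\ of_exponential_type S /\
    real (exp_type S) = real (exp_type F) / 2 /\
    forall z : C, open_uhp z -> S z <> RtoC 0.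

Definition poisson_kernel (y x : R) : R := y / PI * (1 / (x ^ 2 + y ^ 2)).

(* Only the values on [closed_uhp] are meaningful. *)
Definition poisson {V : CompleteNormedModule R_AbsRing} (f : R -> V) (z : C) : V :=
  if Rlt_dec 0 (Im z) then
    RInt_gen (fun s : R => scal (poisson_kernel (Im z) (Re z - s)) (f s))
             (Rbar_locally m_infty) (Rbar_locally p_infty)
  else f (Re z).

Definition harmonic_conjugate (u v : C -> R) : Prop :=
  holomorphic_on open_uhp (fun z => (u z, v z)).

(* [continuous_on] is continuity for the topology relative to [closed_uhp]. *)
Definition continuous_extension (v_o v : C -> R) : Prop :=
  (forall z : C, open_uhp z -> v z = v_o z) /\ continuous_on closed_uhp v.

(* Main.v *)
Require Import Defs.
From Stdlib Require Import Reals ZArith Lra Lia List Classical ClassicalEpsilon.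
From Coquelicot Require Import Coquelicot.
Open Scope R_scope.

(** Write [u + i v] for the holomorphic function of the statement and
    [E = exp (u + i v)] on the closed upper half-plane, so that [E] is bounded and
    bounded away from zero there and [f = |E|^2] on the line.  Both directions
    compare a spectral factor with this outer function.

    The continuous extension of [v] exists because a band-limited function has
    bounded derivatives on the line, hence so does [log f] (log_regularity).  Second
    differences of [log f] of size [O(h^2)] pass to the Poisson integral
    (poisson_second_difference) and bound first [Re H''], then [H'], for
    [H = u + i v], so [H] is Lipschitz up to the line
    (holomorphic_lipschitz_near_line, conjugate_extension_exists).

    If [v(x) = c x + theta(x)], glue [E] above the line to
    [F(z) / conj (E (conj z))] below it.  The two agree on the line, where
    [f = E conj E], so Goursat's lemma off a line and Morera's theorem make the
    result entire (reflect_glue_entire).  After multiplication by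
    [exp (- i tau z / 2)], with [tau] the type of [F], it has type [tau / 2]: this is
    a Phragmen-Lindelof estimate (phragmen_lindelof_type), since a function of type
    [tau] bounded on the line is [O(exp ((tau + e) |Im z|))].  On the line it is
    [sqrt f exp (i theta)] times a character, a Lipschitz function of [f] and
    [theta] up to that character, hence almost periodic; shifting the contour of the
    mean values bounds its spectrum (spectrum_of_exponential_growth,
    spectral_factor_of_argument).

    Conversely let [s] be a spectral factor with extension [S].  The quotient [S / E]
    has no zeros on the closed half-plane and modulus one on the line; it reflects
    to a zero-free entire function [Q(0) exp W], where [Re W] vanishes on the line,
    changes sign under conjugation and is bounded above by a linear function of [|z|]
    in the upper half-plane.  Comparing Fourier coefficients on large circles through
    [|sin 2t| <= 2 |sin t|] shows that [W''] vanishes on the line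
    (second_derivative_vanishes), so [W] is linear there and
    [v(x) = arg s(x) + a linear function].  As [s / |s|] is almost periodic, Bohr's
    theorem says that its continuous argument is linear plus almost periodic
    (bohr_argument, argument_of_spectral_factor).

    Almost periodicity is handled through Bohr's criterion in the following form:
    for every tolerance there are finitely many frequencies such that every near
    period of their characters is a near period of the function.  It is stable under
    Lipschitz functions of several variables.  That it gives back uniform
    approximation by trigonometric polynomials is proved by convolution with powers
    of a product of factors [(1 + cos (w t)) / 2] (bochner_fejer); the same
    convolution finds approximants with frequencies in the spectrum only
    (spectral_approx), which is what makes a band-limited function extend to an
    entire function bounded by [M exp (T |Im z|)]
    (band_limited_entire_extension). *)

(** * Complex-valued functions: continuity, derivatives, integrals *)

Lemma Re_le_Cmod (z : C) : Rabs (Re z) <= Cmod z.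
Proof. apply re_le_Cmod. Qed.

Lemma Im_le_Cmod (z : C) : Rabs (Im z) <= Cmod z.
Proof.
  apply Rle_trans with (2 := Rmax_Cmod z). apply Rmax_r.
Qed.

Lemma Cmod_le_Re_Im (z : C) : Cmod z <= Rabs (Re z) + Rabs (Im z).
Proof.
  destruct z as [x y].
  replace (x, y) with (RtoC x + (0, y))%C
    at 1 by (unfold RtoC, Cplus; simpl; f_equal; ring).
  eapply Rle_trans; [apply Cmod_triangle|].
  rewrite Cmod_R. apply Rplus_le_compat_l. simpl. unfold Cmod; simpl.
  replace (0 * (0 * 1) + y * (y * 1)) with (Rsqr y) by (unfold Rsqr; ring).
  rewrite sqrt_Rsqr_abs. apply Rle_refl.
Qed.

Lemma Cmod_minus_le (z w : C) :
  Cmod (z - w) <= Rabs (Re z - Re w) + Rabs (Im z - Im w).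
Proof.
  eapply Rle_trans; [apply Cmod_le_Re_Im|].
  unfold Cminus. rewrite re_plus, im_plus, re_opp, im_opp. apply Rle_refl.
Qed.

Lemma Re_minus_le (z w : C) : Rabs (Re z - Re w) <= Cmod (z - w).
Proof. apply (Re_le_Cmod (z - w)). Qed.

Lemma Im_minus_le (z w : C) : Rabs (Im z - Im w) <= Cmod (z - w).
Proof. apply (Im_le_Cmod (z - w)). Qed.

Lemma Cmod_minus_sym (z w : C) : Cmod (z - w) = Cmod (w - z).
Proof. rewrite <- Cmod_opp. f_equal. ring. Qed.

Lemma Cmod_triangle_minus (x y z : C) : Cmod (x - z) <= Cmod (x - y) + Cmod (y - z).
Proof. replace (x - z)%C with ((x - y) + (y - z))%C by ring. apply Cmod_triangle. Qed.

Lemma Cmod_reverse_triangle (x y : C) : Cmod x - Cmod y <= Cmod (x - y).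
Proof.
  generalize (Cmod_triangle (x - y) y). replace (x - y + y)%C with x by ring. lra.
Qed.

Lemma C_eq_Re_Im (z w : C) : Re z = Re w -> Im z = Im w -> z = w.
Proof. destruct z, w; simpl; intros -> ->; reflexivity. Qed.

Section ContinuityToC.
Context {T : UniformSpace}.

Lemma continuous_C_split (f : T -> C) (t : T) :
  continuous f t <->
  continuous (fun s => Re (f s)) t /\ continuous (fun s => Im (f s)) t.
Proof.
  split.
  - intros H; split.
    + apply (continuous_comp f (fun z : C => fst z)); [exact H|apply continuous_fst].
    + apply (continuous_comp f (fun z : C => snd z)); [exact H|apply continuous_snd].
  - intros [H1 H2].
    apply continuous_ext with (fun s => (Re (f s), Im (f s))).
    + intros s. symmetry. apply surjective_pairing.
    + apply (continuous_comp_2 (fun s => Re (f s)) (fun s => Im (f s))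
        (fun x y => (x, y))); try assumption.
      apply continuous_ext with (fun p => p); [intros [? ?]; reflexivity|].
      apply continuous_id.
Qed.

Lemma continuous_Cplus (f g : T -> C) (t : T) :
  continuous f t -> continuous g t -> continuous (fun s => (f s + g s)%C) t.
Proof.
  rewrite !continuous_C_split. intros [? ?] [? ?]; split; simpl;
  apply @continuous_plus; assumption.
Qed.

Lemma continuous_Cmult (f g : T -> C) (t : T) :
  continuous f t -> continuous g t -> continuous (fun s => (f s * g s)%C) t.
Proof.
  rewrite !continuous_C_split. intros [? ?] [? ?]; split; simpl.
  - apply @continuous_minus; apply @continuous_mult; assumption.
  - apply @continuous_plus; apply @continuous_mult; assumption.
Qed.

Lemma continuous_Copp (f : T -> C) (t : T) :
  continuous f t -> continuous (fun s => (- f s)%C) t.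
Proof.
  rewrite !continuous_C_split. intros [? ?]; split; simpl;
  apply @continuous_opp; assumption.
Qed.

Lemma continuous_Cminus (f g : T -> C) (t : T) :
  continuous f t -> continuous g t -> continuous (fun s => (f s - g s)%C) t.
Proof. intros; apply continuous_Cplus; [|apply continuous_Copp]; assumption. Qed.

Lemma continuous_Cconj (f : T -> C) (t : T) :
  continuous f t -> continuous (fun s => Cconj (f s)) t.
Proof.
  rewrite !continuous_C_split. intros [? ?]; split; simpl; [assumption|].
  apply @continuous_opp; assumption.
Qed.

Lemma continuous_Cinv (f : T -> C) (t : T) :
  f t <> RtoC 0 -> continuous f t -> continuous (fun s => (/ f s)%C) t.
Proof.
  intros H0. rewrite !continuous_C_split. intros [H1 H2].
  assert (Hd : Re (f t) ^ 2 + Im (f t) ^ 2 <> 0).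
  { intros E. apply H0. apply Cmod_eq_0.
    assert (E2 := Cmod2_alt (f t)). apply RtoC_inj in E2 || idtac.
    assert (Cmod (f t) ^ 2 = 0) by (rewrite E2; exact E). nra. }
  assert (Hc : continuous (fun s => / (Re (f s) ^ 2 + Im (f s) ^ 2)) t).
  { apply (continuous_comp (fun s => Re (f s) ^ 2 + Im (f s) ^ 2) Rinv).
    - simpl. apply @continuous_plus; apply @continuous_mult; try assumption;
        apply @continuous_mult; try assumption; apply continuous_const.
    - apply continuity_pt_filterlim, continuity_pt_inv; [|exact Hd].
      apply derivable_continuous, derivable_id. }
  split.
  - apply continuous_ext with (fun s => Re (f s) * / (Re (f s) ^ 2 + Im (f s) ^ 2));
      [intros s; reflexivity|].
    apply @continuous_mult; assumption.
  - apply continuous_ext with (fun s => - Im (f s) * / (Re (f s) ^ 2 + Im (f s) ^ 2));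
      [intros s; reflexivity|].
    apply @continuous_mult; [|assumption]. apply @continuous_opp; assumption.
Qed.

Lemma continuous_Cpow (f : T -> C) (n : nat) (t : T) :
  continuous f t -> continuous (fun s => (f s ^ n)%C) t.
Proof.
  intros H. induction n as [|n IH]; simpl; [apply continuous_const|].
  apply continuous_Cmult; assumption.
Qed.

Lemma continuous_RtoC (f : T -> R) (t : T) :
  continuous f t -> continuous (fun s => RtoC (f s)) t.
Proof.
  intros H. apply continuous_C_split. split; simpl; [exact H|apply continuous_const].
Qed.

End ContinuityToC.

Lemma ball_C (z w : C) (e : R) :
  ball (M := C_UniformSpace) z e w <-> Rabs (Re w - Re z) < e /\ Rabs (Im w - Im z) < e.
Proof. split; intros [H1 H2]; split; assumption. Qed.

Lemma continuous_C_eps (G : C -> C) (z : C) :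
  continuous G z <->
  forall eps, 0 < eps -> exists d, 0 < d /\
    forall w, Cmod (w - z) < d -> Cmod (G w - G z) < eps.
Proof.
  split.
  - intros H eps He.
    assert (He2 : 0 < eps / 2) by lra.
    destruct (proj1 (filterlim_locally G (G z)) H (mkposreal _ He2)) as [d Hd].
    exists d. split; [apply cond_pos|]. intros w Hw.
    assert (Hb : ball z d w).
    { apply ball_C. split.
      - apply Rle_lt_trans with (2 := Hw). apply Re_minus_le.
      - apply Rle_lt_trans with (2 := Hw). apply Im_minus_le. }
    specialize (Hd w Hb). apply (proj1 (ball_C _ _ _)) in Hd. destruct Hd as [H1 H2]; simpl pos in H1, H2.
    eapply Rle_lt_trans; [apply Cmod_minus_le|]. lra.
  - intros H. apply filterlim_locally. intros eps.
    destruct (H eps (cond_pos eps)) as [d [Hd HG]].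
    assert (Hd2 : 0 < d / 2) by lra.
    exists (mkposreal _ Hd2). intros w Hw.
    apply (proj1 (ball_C _ _ _)) in Hw. destruct Hw as [H1 H2]. simpl (pos _) in H1, H2.
    assert (Hw : Cmod (w - z) < d).
    { eapply Rle_lt_trans; [apply Cmod_minus_le|]. lra. }
    specialize (HG w Hw). apply ball_C. split.
    + apply Rle_lt_trans with (2 := HG). apply Re_minus_le.
    + apply Rle_lt_trans with (2 := HG). apply Im_minus_le.
Qed.

Lemma continuous_R_eps (p : R -> C) (t : R) :
  continuous p t <->
  forall eps, 0 < eps -> exists d, 0 < d /\
    forall s, Rabs (s - t) < d -> Cmod (p s - p t) < eps.
Proof.
  split.
  - intros H eps He.
    assert (He2 : 0 < eps / 2) by lra.
    destruct (proj1 (filterlim_locally p (p t)) H (mkposreal _ He2)) as [d Hd].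
    exists d. split; [apply cond_pos|]. intros w Hw.
    specialize (Hd w Hw). apply (proj1 (ball_C _ _ _)) in Hd. destruct Hd as [H1 H2]; simpl pos in H1, H2.
    eapply Rle_lt_trans; [apply Cmod_minus_le|]. lra.
  - intros H. apply filterlim_locally. intros eps.
    destruct (H eps (cond_pos eps)) as [d [Hd HG]].
    exists (mkposreal _ Hd). intros w Hw.
    specialize (HG w Hw). apply ball_C. split.
    + apply Rle_lt_trans with (2 := HG). apply Re_minus_le.
    + apply Rle_lt_trans with (2 := HG). apply Im_minus_le.
Qed.

Lemma continuous_horizontal (y x : R) : continuous (fun t : R => ((t, y) : C)) x.
Proof.
  apply continuous_C_split. split; simpl; [apply continuous_id|apply continuous_const].
Qed.

Lemma continuous_vertical (x y : R) : continuous (fun t : R => ((x, t) : C)) y.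
Proof.
  apply continuous_C_split. split; simpl; [apply continuous_const|apply continuous_id].
Qed.

(** Caratheodory's form of the complex derivative: with the difference quotient
    packaged as a function continuous at [z], the product, quotient and chain
    rules become identities between quotients. *)
Definition cderiv (F : C -> C) (z l : C) : Prop :=
  exists q : C -> C,
    (forall w, F w = F z + q w * (w - z))%C /\ q z = l /\ continuous q z.

(** The same device for the derivative of a path. *)
Definition rderiv (p : R -> C) (t : R) (l : C) : Prop :=
  exists q : R -> C,
    (forall s, p s = p t + q s * RtoC (s - t))%C /\ q t = l /\ continuous q t.

Lemma cderiv_eps (F : C -> C) (z l : C) :
  cderiv F z l <->
  forall eps, 0 < eps -> exists d, 0 < d /\
    forall w, Cmod (w - z) < d -> Cmod (F w - F z - l * (w - z)) <= eps * Cmod (w - z).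
Proof.
  split.
  - intros [q [Hq [Hl Hc]]] eps He.
    rewrite continuous_C_eps in Hc. destruct (Hc eps He) as [d [Hd Hw]].
    exists d; split; [exact Hd|]. intros w H. specialize (Hw w H).
    rewrite (Hq w). replace (F z + q w * (w - z) - F z - l * (w - z))%C
      with ((q w - q z) * (w - z))%C by (rewrite Hl; ring).
    rewrite Cmod_mult. apply Rmult_le_compat_r; [apply Cmod_ge_0|lra].
  - intros H.
    exists (fun w => if Ceq_dec w z then l else ((F w - F z) / (w - z))%C).
    split; [|split].
    + intros w. destruct (Ceq_dec w z) as [->|Hn]; [ring|].
      field. intros E. apply Hn. apply Ceq_minus. exact E.
    + destruct (Ceq_dec z z); [reflexivity|contradiction].
    + apply continuous_C_eps. intros eps He.
      assert (He2 : 0 < eps / 2) by lra.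
      destruct (H _ He2) as [d [Hd Hw]]. exists d; split; [exact Hd|].
      intros w Hwz. destruct (Ceq_dec z z) as [_|]; [|contradiction].
      destruct (Ceq_dec w z) as [->|Hn].
      * replace (l - l)%C with (RtoC 0) by ring. rewrite Cmod_0. exact He.
      * assert (Hn' : (w - z)%C <> RtoC 0) by (intros E; apply Hn; apply Ceq_minus; exact E).
        specialize (Hw w Hwz).
        replace ((F w - F z) / (w - z) - l)%C
          with ((F w - F z - l * (w - z)) / (w - z))%C by (field; exact Hn').
        rewrite Cmod_div by exact Hn'.
        apply Rle_lt_trans with (eps / 2); [|lra].
        assert (Hp := proj1 (Cmod_gt_0 _) Hn').
        apply Rmult_le_reg_r with (Cmod (w - z)); [exact Hp|].
        unfold Rdiv at 1. rewrite Rmult_assoc, Rinv_l by lra. lra.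
Qed.

Lemma cderiv_continuous (F : C -> C) (z l : C) : cderiv F z l -> continuous F z.
Proof.
  intros [q [Hq [_ Hc]]].
  apply continuous_ext with (fun w => F z + q w * (w - z))%C; [intros; symmetry; apply Hq|].
  apply continuous_Cplus; [apply continuous_const|].
  apply continuous_Cmult; [exact Hc|].
  apply continuous_Cminus; [apply continuous_id|apply continuous_const].
Qed.

Lemma is_derive_cderiv (F : C -> C) (z l : C) :
  is_derive (K := C_AbsRing) (V := C_NormedModule) F z l <-> cderiv F z l.
Proof.
  rewrite cderiv_eps. split.
  - intros [_ H] eps He.
    assert (Hz : is_filter_lim (locally (T := AbsRing_UniformSpace C_AbsRing) z) z)
      by (intros P HP; exact HP).
    destruct (H z Hz (mkposreal _ He)) as [d Hd].
    exists d; split; [apply cond_pos|]. intros w Hw. specialize (Hd w Hw).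
    simpl in Hd.
    replace (F w - F z - l * (w - z))%C with (F w - F z - (w - z) * l)%C by ring.
    exact Hd.
  - intros H. split.
    + apply is_linear_scal_l.
    + intros x Hx.
      assert (E : z = x).
      { apply (is_filter_lim_locally_unique (V := AbsRing_NormedModule C_AbsRing)). exact Hx. }
      subst x. intros eps.
      destruct (H eps (cond_pos eps)) as [d [Hd Hw]].
      exists (mkposreal _ Hd). intros w Hwz. specialize (Hw w Hwz). simpl.
      replace (F w - F z - l * (w - z))%C with (F w - F z - (w - z) * l)%C in Hw by ring.
      exact Hw.
Qed.

Lemma ex_derive_cderiv (F : C -> C) (z : C) :
  ex_derive (K := C_AbsRing) (V := C_NormedModule) F z <-> exists l, cderiv F z l.
Proof.
  split; intros [l H]; exists l; apply is_derive_cderiv; exact H.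
Qed.

Lemma cderiv_ext_loc (F G : C -> C) (z l : C) (d : R) :
  0 < d -> (forall w, Cmod (w - z) < d -> F w = G w) -> cderiv F z l -> cderiv G z l.
Proof.
  intros Hd HFG. rewrite !cderiv_eps. intros H eps He.
  destruct (H eps He) as [d' [Hd' Hw]]. exists (Rmin d d'). split.
  - apply Rmin_pos; assumption.
  - intros w Hwz. rewrite <- !HFG.
    + apply Hw. eapply Rlt_le_trans; [exact Hwz|apply Rmin_r].
    + replace (z - z)%C with (RtoC 0) by ring. rewrite Cmod_0. exact Hd.
    + eapply Rlt_le_trans; [exact Hwz|apply Rmin_l].
Qed.

Lemma cderiv_ext (F G : C -> C) (z l : C) :
  (forall w, F w = G w) -> cderiv F z l -> cderiv G z l.
Proof. intros H. apply cderiv_ext_loc with 1; [lra|intros; apply H]. Qed.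

Lemma cderiv_const (c z : C) : cderiv (fun _ => c) z (RtoC 0).
Proof.
  exists (fun _ => RtoC 0). split; [intros; ring|split; [reflexivity|apply continuous_const]].
Qed.

Lemma cderiv_id (z : C) : cderiv (fun w => w) z (RtoC 1).
Proof.
  exists (fun _ => RtoC 1). split; [intros; ring|split; [reflexivity|apply continuous_const]].
Qed.

Lemma cderiv_plus (F G : C -> C) (z l m : C) :
  cderiv F z l -> cderiv G z m -> cderiv (fun w => F w + G w)%C z (l + m)%C.
Proof.
  intros [q [Hq [Hl Hc]]] [r [Hr [Hm Hd]]].
  exists (fun w => q w + r w)%C. split; [|split].
  - intros w. rewrite (Hq w), (Hr w). ring.
  - rewrite Hl, Hm. reflexivity.
  - apply continuous_Cplus; assumption.
Qed.

Lemma cderiv_mult (F G : C -> C) (z l m : C) :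
  cderiv F z l -> cderiv G z m -> cderiv (fun w => F w * G w)%C z (l * G z + F z * m)%C.
Proof.
  intros [q [Hq [Hl Hc]]] HG. assert (HcG := cderiv_continuous _ _ _ HG).
  destruct HG as [r [Hr [Hm Hd]]].
  exists (fun w => q w * G w + F z * r w)%C. split; [|split].
  - intros w. rewrite (Hq w), (Hr w). ring.
  - rewrite Hl, Hm. reflexivity.
  - apply continuous_Cplus; apply continuous_Cmult; try assumption; apply continuous_const.
Qed.

Lemma cderiv_opp (F : C -> C) (z l : C) :
  cderiv F z l -> cderiv (fun w => - F w)%C z (- l)%C.
Proof.
  intros [q [Hq [Hl Hc]]]. exists (fun w => - q w)%C. split; [|split].
  - intros w. rewrite (Hq w). ring.
  - rewrite Hl. reflexivity.
  - apply continuous_Copp; assumption.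
Qed.

Lemma cderiv_minus (F G : C -> C) (z l m : C) :
  cderiv F z l -> cderiv G z m -> cderiv (fun w => F w - G w)%C z (l - m)%C.
Proof. intros HF HG. apply cderiv_plus; [exact HF|apply cderiv_opp; exact HG]. Qed.

Lemma cderiv_inv (F : C -> C) (z l : C) :
  F z <> RtoC 0 -> cderiv F z l -> cderiv (fun w => / F w)%C z (- l / (F z * F z))%C.
Proof.
  intros H0 HF. assert (HcF := cderiv_continuous _ _ _ HF).
  destruct HF as [q [Hq [Hl Hc]]].
  assert (Hnz : exists d, 0 < d /\ forall w, Cmod (w - z) < d -> F w <> RtoC 0).
  { rewrite continuous_C_eps in HcF.
    destruct (HcF (Cmod (F z)) (proj1 (Cmod_gt_0 _) H0)) as [d [Hd Hw]].
    exists d; split; [exact Hd|]. intros w Hwz E. specialize (Hw w Hwz).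
    rewrite E in Hw. rewrite Cmod_minus_sym in Hw.
    replace (F z - 0)%C with (F z) in Hw by ring. lra. }
  destruct Hnz as [d [Hd Hnz]].
  assert (Hnzz : F z <> RtoC 0) by exact H0.
  exists (fun w => if Ceq_dec w z then (- l / (F z * F z))%C
             else ((/ F w - / F z) / (w - z))%C).
  split; [|split].
  - intros w. destruct (Ceq_dec w z) as [->|Hn]; [ring|].
    unfold Cdiv. rewrite <- Cmult_assoc, Cinv_l; [ring|].
    intros E. apply Hn. apply Ceq_minus. exact E.
  - destruct (Ceq_dec z z); [reflexivity|contradiction].
  - apply (continuous_ext_loc _ (fun w => - q w / (F z * F w))%C).
    + assert (Hd2 : 0 < d / 2) by lra.
      exists (mkposreal _ Hd2). intros w Hb. apply (proj1 (ball_C _ _ _)) in Hb. simpl (pos _) in Hb.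
      assert (Hw : Cmod (w - z) < d).
      { eapply Rle_lt_trans; [apply Cmod_minus_le|]. lra. }
      assert (Fw := Hnz w Hw).
      destruct (Ceq_dec w z) as [->|Hn]; [rewrite Hl; reflexivity|].
      assert (Hn' : (w - z)%C <> RtoC 0) by (intros E; apply Hn; apply Ceq_minus; exact E).
      replace (/ F w - / F z)%C with ((F z - F w) / (F z * F w))%C by (field; split; assumption).
      replace (F z - F w)%C with (- q w * (w - z))%C by (rewrite (Hq w); ring).
      match goal with |- @eq _ ?a ?b => change (@eq C a b) end; field. repeat split; assumption.
    + apply continuous_Cmult.
      * apply continuous_Copp; exact Hc.
      * apply continuous_Cinv.
        -- apply Cmult_neq_0; assumption.
        -- apply continuous_Cmult; [apply continuous_const|exact HcF].
Qed.

Lemma cderiv_comp (F G : C -> C) (z l m : C) :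
  cderiv F (G z) l -> cderiv G z m -> cderiv (fun w => F (G w)) z (l * m)%C.
Proof.
  intros [q [Hq [Hl Hc]]] HG. assert (HcG := cderiv_continuous _ _ _ HG).
  destruct HG as [r [Hr [Hm Hd]]].
  exists (fun w => q (G w) * r w)%C. split; [|split].
  - intros w. rewrite (Hq (G w)). rewrite (Hr w) at 2. ring.
  - rewrite Hl, Hm. reflexivity.
  - apply continuous_Cmult; [|exact Hd]. apply continuous_comp; assumption.
Qed.

Lemma cderiv_pow (n : nat) (z : C) :
  cderiv (fun w => w ^ S n)%C z (RtoC (INR (S n)) * z ^ n)%C.
Proof.
  induction n as [|n IH].
  - apply cderiv_ext with (fun w => w); [intros; simpl; ring|].
    replace (RtoC (INR 1) * z ^ 0)%C with (RtoC 1) by (simpl; ring). apply cderiv_id.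
  - apply cderiv_ext with (fun w => w * w ^ S n)%C; [intros; reflexivity|].
    replace (RtoC (INR (S (S n))) * z ^ S n)%C
      with (RtoC 1 * z ^ S n + z * (RtoC (INR (S n)) * z ^ n))%C.
    + apply (cderiv_mult (fun w => w)); [apply cderiv_id|exact IH].
    + rewrite (S_INR (S n)), RtoC_plus. simpl Cpow. ring.
Qed.

Lemma cderiv_unique (F : C -> C) (z l m : C) : cderiv F z l -> cderiv F z m -> l = m.
Proof.
  rewrite !cderiv_eps. intros Hl Hm.
  destruct (Ceq_dec l m) as [E|N]; [exact E|exfalso].
  assert (Hp : 0 < Cmod (l - m)) by (apply Cmod_gt_0; intros E; apply N, Ceq_minus, E).
  assert (He : 0 < Cmod (l - m) / 4) by lra.
  destruct (Hl _ He) as [d1 [Hd1 H1]]. destruct (Hm _ He) as [d2 [Hd2 H2]].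
  set (h := Rmin d1 d2 / 2).
  assert (Hh : 0 < h) by (unfold h; generalize (Rmin_pos _ _ Hd1 Hd2); lra).
  assert (Hh1 : h < d1) by (unfold h in *; generalize (Rmin_l d1 d2); lra).
  assert (Hh2 : h < d2) by (unfold h in *; generalize (Rmin_r d1 d2); lra).
  set (w := (z + RtoC h)%C).
  assert (Ew : Cmod (w - z) = h).
  { unfold w. replace (z + h - z)%C with (RtoC h) by ring. rewrite Cmod_R.
    apply Rabs_pos_eq; lra. }
  specialize (H1 w). specialize (H2 w). rewrite Ew in H1, H2.
  specialize (H1 Hh1). specialize (H2 Hh2).
  assert (H3 := Cmod_triangle (F w - F z - m * (w - z)) (- (F w - F z - l * (w - z)))).
  rewrite Cmod_opp in H3.
  replace (F w - F z - m * (w - z) + - (F w - F z - l * (w - z)))%C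
    with ((l - m) * (w - z))%C in H3 by ring.
  rewrite Cmod_mult, Ew in H3. nra.
Qed.

Lemma cderiv_conj (F : C -> C) (z l : C) :
  cderiv F (Cconj z) l -> cderiv (fun w => Cconj (F (Cconj w))) z (Cconj l).
Proof.
  intros [q [Hq [Hl Hc]]]. exists (fun w => Cconj (q (Cconj w))). split; [|split].
  - intros w. rewrite (Hq (Cconj w)).
    rewrite Cplus_conj, Cmult_conj, Cminus_conj, !Cconj_conj. reflexivity.
  - rewrite Hl. reflexivity.
  - apply continuous_Cconj. apply (continuous_comp Cconj q); [|exact Hc].
    apply (continuous_Cconj (fun w => w)), continuous_id.
Qed.

Lemma is_derive_caratheodory (f : R -> R) (t l : R) :
  (exists q, (forall s, f s = f t + q s * (s - t)) /\ q t = l /\ continuous q t) <->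
  is_derive f t l.
Proof.
  split.
  - intros [q [Hq [Hl Hc]]]. apply is_derive_Reals.
    intros eps He.
    assert (Hc' := proj1 (filterlim_locally q (q t)) Hc (mkposreal _ He)).
    destruct Hc' as [d Hd]. exists d. intros h Hh Hhd.
    specialize (Hd (t + h)). rewrite (Hq (t + h)).
    replace ((f t + q (t + h) * (t + h - t) - f t) / h - l) with (q (t + h) - q t)
      by (rewrite Hl; field; exact Hh).
    apply Hd. change (Rabs (t + h - t) < d). replace (t + h - t) with h by ring. exact Hhd.
  - intros H. apply is_derive_Reals in H.
    exists (fun s => if Req_EM_T s t then l else (f s - f t) / (s - t)). split; [|split].
    + intros s. destruct (Req_EM_T s t) as [->|N]; [ring|field; lra].
    + destruct (Req_EM_T t t); [reflexivity|contradiction].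
    + apply filterlim_locally. intros eps.
      destruct (H eps (cond_pos eps)) as [d Hd]. exists d. intros s Hs.
      destruct (Req_EM_T t t) as [_|]; [|contradiction].
      destruct (Req_EM_T s t) as [_|N].
      * apply ball_center.
      * assert (Hst : s - t <> 0) by lra.
        specialize (Hd (s - t) Hst Hs). rewrite (Rplus_minus t s : t + (s - t) = s) in Hd.
        exact Hd.
Qed.

Lemma rderiv_split (p : R -> C) (t : R) (l : C) :
  rderiv p t l <->
  is_derive (fun s => Re (p s)) t (Re l) /\ is_derive (fun s => Im (p s)) t (Im l).
Proof.
  rewrite <- !is_derive_caratheodory. split.
  - intros [q [Hq [Hl Hc]]]. apply continuous_C_split in Hc. destruct Hc as [Hr Hi]. split.
    + exists (fun s => Re (q s)). split; [|split; [rewrite Hl; reflexivity|exact Hr]].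
      intros s. rewrite (Hq s), re_plus, re_scal_r. reflexivity.
    + exists (fun s => Im (q s)). split; [|split; [rewrite Hl; reflexivity|exact Hi]].
      intros s. rewrite (Hq s), im_plus, im_scal_r. reflexivity.
  - intros [[q [Hq [Hl Hc]]] [r [Hr [Hm Hd]]]].
    exists (fun s => (q s, r s)). split; [|split].
    + intros s. apply C_eq_Re_Im.
      * rewrite re_plus, re_scal_r. apply Hq.
      * rewrite im_plus, im_scal_r. apply Hr.
    + rewrite Hl, Hm. symmetry. apply surjective_pairing.
    + apply continuous_C_split. split; assumption.
Qed.

Lemma rderiv_comp (F : C -> C) (p : R -> C) (t : R) (l m : C) :
  cderiv F (p t) l -> rderiv p t m -> rderiv (fun s => F (p s)) t (l * m)%C.
Proof.
  intros [q [Hq [Hl Hc]]] [r [Hr [Hm Hd]]].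
  assert (Hcp : continuous p t).
  { apply continuous_ext with (fun s => p t + r s * RtoC (s - t))%C; [intros; symmetry; apply Hr|].
    apply continuous_Cplus; [apply continuous_const|].
    apply continuous_Cmult; [exact Hd|]. apply continuous_RtoC.
    apply @continuous_minus; [apply continuous_id|apply continuous_const]. }
  exists (fun s => q (p s) * r s)%C. split; [|split].
  - intros s. rewrite (Hq (p s)). rewrite (Hr s) at 2. ring.
  - rewrite Hl, Hm. reflexivity.
  - apply continuous_Cmult; [|exact Hd]. apply continuous_comp; assumption.
Qed.

Lemma rderiv_horizontal (y t : R) : rderiv (fun s => (s, y)) t (RtoC 1).
Proof. apply rderiv_split. simpl. split; auto_derive; trivial. Qed.

Lemma rderiv_vertical (x t : R) : rderiv (fun s => (x, s)) t Ci.
Proof. apply rderiv_split. simpl. split; auto_derive; trivial. Qed.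

(** Applied to the real function [Re (conj (p b - p a) * p t)], the mean value
    theorem gives the mean value inequality for paths. *)
Lemma path_mean_value (p dp : R -> C) (a b M : R) :
  a <= b -> (forall t, a <= t <= b -> rderiv p t (dp t)) ->
  (forall t, a <= t <= b -> Cmod (dp t) <= M) ->
  Cmod (p b - p a) <= M * (b - a).
Proof.
  intros Hab Hd HM.
  destruct (Req_dec a b) as [->|Hn].
  { replace (p b - p b)%C with (RtoC 0) by ring. rewrite Cmod_0. lra. }
  set (d := (p b - p a)%C).
  set (q := fun t => Re d * Re (p t) + Im d * Im (p t)).
  destruct (MVT_gen q a b (fun t => Re d * Re (dp t) + Im d * Im (dp t))) as [c [Hc Hq]].
  - rewrite Rmin_left, Rmax_right by lra. intros t Ht.
    destruct (proj1 (rderiv_split _ _ _) (Hd t ltac:(lra))) as [H1 H2].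
    apply @is_derive_plus; apply is_derive_scal; assumption.
  - rewrite Rmin_left, Rmax_right by lra. intros t Ht.
    destruct (proj1 (rderiv_split _ _ _) (Hd t ltac:(lra))) as [H1 H2].
    apply derivable_continuous_pt. exists (Re d * Re (dp t) + Im d * Im (dp t)).
    apply is_derive_Reals. apply @is_derive_plus; apply is_derive_scal; assumption.
  - rewrite Rmin_left, Rmax_right in Hc by lra.
    assert (E : q b - q a = Cmod d ^ 2).
    { assert (E2 := Cmod2_alt d). rewrite E2. unfold q, d.
      unfold Cminus. rewrite !re_plus, !im_plus, !re_opp, !im_opp. ring. }
    assert (B : Rabs (Re d * Re (dp c) + Im d * Im (dp c)) <= Cmod d * Cmod (dp c)).
    { replace (Re d * Re (dp c) + Im d * Im (dp c)) with (Re (Cconj d * dp c))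
        by (rewrite re_mult, re_conj, im_conj; ring).
      rewrite <- (Cmod_conj d), <- Cmod_mult. apply Re_le_Cmod. }
    specialize (HM c Hc). assert (Hd0 := Cmod_ge_0 d).
    destruct (Req_dec (Cmod d) 0) as [Z|NZ].
    + rewrite Z. assert (0 <= Cmod (dp c)) by apply Cmod_ge_0. nra.
    + apply Rmult_le_reg_l with (Cmod d); [lra|].
      replace (Cmod d * Cmod d) with (Cmod d ^ 2) by ring. rewrite <- E, Hq.
      apply Rabs_le_between in B.
      apply Rle_trans with (Cmod d * Cmod (dp c) * (b - a)); [nra|].
      rewrite <- Rmult_assoc. apply Rmult_le_compat_r; [lra|]. apply Rmult_le_compat_l; lra.
Qed.

Definition CI (f : R -> C) (a b : R) : C :=
  (RInt (fun t => Re (f t)) a b, RInt (fun t => Im (f t)) a b).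

Definition cont_between (f : R -> C) (a b : R) : Prop :=
  forall t, Rmin a b <= t <= Rmax a b -> continuous f t.

Lemma cont_between_swap (f : R -> C) (a b : R) : cont_between f a b -> cont_between f b a.
Proof. intros H t Ht. apply H. rewrite Rmin_comm, Rmax_comm. exact Ht. Qed.

Lemma ex_RInt_Re (f : R -> C) (a b : R) :
  cont_between f a b -> ex_RInt (fun t => Re (f t)) a b.
Proof.
  intros H. apply @ex_RInt_continuous. intros t Ht.
  exact (proj1 (proj1 (continuous_C_split f t) (H t Ht))).
Qed.

Lemma ex_RInt_Im (f : R -> C) (a b : R) :
  cont_between f a b -> ex_RInt (fun t => Im (f t)) a b.
Proof.
  intros H. apply @ex_RInt_continuous. intros t Ht.
  exact (proj2 (proj1 (continuous_C_split f t) (H t Ht))).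
Qed.

Lemma RInt_C_eq_CI (f : R -> C) (a b : R) :
  cont_between f a b -> RInt (V := C_R_CompleteNormedModule) f a b = CI f a b.
Proof.
  intros H. apply is_RInt_unique.
  apply (is_RInt_fct_extend_pair (U := R_NormedModule) (V := R_NormedModule) f a b).
  - apply (RInt_correct (V:=R_CompleteNormedModule)), ex_RInt_Re, H.
  - apply (RInt_correct (V:=R_CompleteNormedModule)), ex_RInt_Im, H.
Qed.

Lemma CI_ext (f g : R -> C) (a b : R) :
  (forall t, Rmin a b < t < Rmax a b -> f t = g t) -> CI f a b = CI g a b.
Proof. intros H. unfold CI. f_equal; apply RInt_ext; intros t Ht; rewrite H by exact Ht; reflexivity. Qed.

Lemma CI_plus (f g : R -> C) (a b : R) :
  cont_between f a b -> cont_between g a b ->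
  CI (fun t => f t + g t)%C a b = (CI f a b + CI g a b)%C.
Proof.
  intros Hf Hg. apply C_eq_Re_Im.
  - apply (RInt_plus (V := R_CompleteNormedModule) (fun t => Re (f t)) (fun t => Re (g t)));
      apply ex_RInt_Re; assumption.
  - apply (RInt_plus (V := R_CompleteNormedModule) (fun t => Im (f t)) (fun t => Im (g t)));
      apply ex_RInt_Im; assumption.
Qed.

Lemma CI_scal (c : C) (f : R -> C) (a b : R) :
  cont_between f a b -> CI (fun t => c * f t)%C a b = (c * CI f a b)%C.
Proof.
  intros Hf. assert (H1 := ex_RInt_Re f a b Hf). assert (H2 := ex_RInt_Im f a b Hf).
  apply C_eq_Re_Im.
  - rewrite re_mult. apply is_RInt_unique.
    apply (is_RInt_minus (V := R_NormedModule) (fun t => scal (fst c) (Re (f t)))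
      (fun t => scal (snd c) (Im (f t))));
    apply (is_RInt_scal (V := R_NormedModule));
    apply (RInt_correct (V := R_CompleteNormedModule)); assumption.
  - rewrite im_mult. apply is_RInt_unique.
    apply (is_RInt_plus (V := R_NormedModule) (fun t => scal (fst c) (Im (f t)))
      (fun t => scal (snd c) (Re (f t))));
    apply (is_RInt_scal (V := R_NormedModule));
    apply (RInt_correct (V := R_CompleteNormedModule)); assumption.
Qed.

Lemma cont_between_scal (c : C) (f : R -> C) (a b : R) :
  cont_between f a b -> cont_between (fun t => c * f t)%C a b.
Proof. intros H t Ht. apply continuous_Cmult; [apply continuous_const|apply H, Ht]. Qed.

Lemma CI_minus (f g : R -> C) (a b : R) :
  cont_between f a b -> cont_between g a b ->
  CI (fun t => f t - g t)%C a b = (CI f a b - CI g a b)%C.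
Proof.
  intros Hf Hg.
  rewrite (CI_ext _ (fun t => f t + (- (1)) * g t)%C) by (intros; ring).
  rewrite CI_plus, CI_scal; [ring|exact Hg|exact Hf|].
  apply cont_between_scal; exact Hg.
Qed.

Lemma CI_const (c : C) (a b : R) : CI (fun _ => c) a b = (RtoC (b - a) * c)%C.
Proof.
  unfold CI. rewrite !RInt_const. destruct c as [x y].
  apply C_eq_Re_Im; rewrite ?re_scal_l, ?im_scal_l; reflexivity.
Qed.

Lemma CI_Chasles (f : R -> C) (a b c : R) :
  cont_between f a b -> cont_between f b c -> (CI f a b + CI f b c)%C = CI f a c.
Proof.
  intros H1 H2. apply C_eq_Re_Im.
  - apply @RInt_Chasles; apply ex_RInt_Re; assumption.
  - apply @RInt_Chasles; apply ex_RInt_Im; assumption.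
Qed.

Lemma CI_swap (f : R -> C) (a b : R) : cont_between f a b -> CI f b a = (- CI f a b)%C.
Proof.
  intros H. assert (E := CI_Chasles f a b a H (cont_between_swap _ _ _ H)).
  assert (E2 : CI f a a = RtoC 0).
  { unfold CI. rewrite !RInt_point. reflexivity. }
  rewrite E2 in E. replace (CI f b a) with (CI f a b + CI f b a - CI f a b)%C by ring.
  rewrite E. ring.
Qed.

(** Pairing the integral with its own conjugate reduces the bound to the
    monotonicity of real integrals. *)
Lemma CI_norm_le (f : R -> C) (h : R -> R) (a b : R) :
  a <= b -> cont_between f a b -> ex_RInt h a b ->
  (forall t, a <= t <= b -> Cmod (f t) <= h t) ->
  Cmod (CI f a b) <= RInt h a b.
Proof.
  intros Hab Hf Hh H. set (d := CI f a b).
  assert (E : Cmod d ^ 2 = RInt (fun t => Re (Cconj d * f t)) a b).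
  { assert (E2 := CI_scal (Cconj d) f a b Hf).
    apply (f_equal Re) in E2. change (RInt (fun t => Re (Cconj d * f t)%C) a b = Re (Cconj d * d)) in E2.
    rewrite E2, Cmod2_alt, re_mult, re_conj, im_conj. ring. }
  assert (L : Cmod d ^ 2 <= Cmod d * RInt h a b).
  { rewrite E. replace (Cmod d * RInt h a b) with (RInt (fun t => Cmod d * h t) a b)
      by (apply (RInt_scal (V := R_CompleteNormedModule)); exact Hh).
    apply RInt_le; [exact Hab| |apply (ex_RInt_scal (V := R_NormedModule)); exact Hh|].
    - apply ex_RInt_Re, cont_between_scal, Hf.
    - intros t Ht. eapply Rle_trans; [apply Rle_abs|].
      eapply Rle_trans; [apply Re_le_Cmod|]. rewrite Cmod_mult, Cmod_conj.
      apply Rmult_le_compat_l; [apply Cmod_ge_0|apply H; lra]. }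
  destruct (Req_dec (Cmod d) 0) as [Z|NZ].
  - rewrite Z. apply Rle_trans with (RInt (fun _ => 0) a b).
    + rewrite RInt_const. change (0 <= (b - a) * 0). lra.
    + apply RInt_le; [exact Hab|apply @ex_RInt_const|exact Hh|].
      intros t Ht. eapply Rle_trans; [apply (Cmod_ge_0 (f t))|apply H; lra].
  - assert (0 < Cmod d) by (generalize (Cmod_ge_0 d); lra).
    apply Rmult_le_reg_l with (Cmod d); [assumption|].
    replace (Cmod d * Cmod d) with (Cmod d ^ 2) by ring. exact L.
Qed.

Lemma CI_norm_const (f : R -> C) (a b M : R) :
  cont_between f a b -> (forall t, Rmin a b <= t <= Rmax a b -> Cmod (f t) <= M) ->
  Cmod (CI f a b) <= M * Rabs (b - a).
Proof.
  intros Hf H.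
  destruct (Rle_dec a b) as [Hab|Hab].
  - rewrite Rabs_pos_eq by lra.
    replace (M * (b - a)) with (RInt (fun _ => M) a b)
      by (rewrite RInt_const; change ((b - a) * M = M * (b - a)); ring).
    apply CI_norm_le; [exact Hab|exact Hf|apply @ex_RInt_const|].
    intros t Ht. apply H. rewrite Rmin_left, Rmax_right by lra. exact Ht.
  - rewrite <- (Cmod_opp (CI f a b)), <- (CI_swap f a b Hf).
    rewrite Rabs_left by lra.
    replace (M * - (b - a)) with (RInt (fun _ => M) b a)
      by (rewrite RInt_const; change ((a - b) * M = M * - (b - a)); ring).
    apply CI_norm_le; [lra|apply cont_between_swap; exact Hf|apply @ex_RInt_const|].
    intros t Ht. apply H. rewrite Rmin_right, Rmax_left by lra. exact Ht.
Qed.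

Lemma CI_derive (p dp : R -> C) (a b : R) :
  (forall t, Rmin a b <= t <= Rmax a b -> rderiv p t (dp t)) ->
  cont_between dp a b -> CI dp a b = (p b - p a)%C.
Proof.
  intros Hp Hc. apply C_eq_Re_Im.
  - unfold CI. simpl. apply is_RInt_unique.
    apply (is_RInt_derive (V := R_CompleteNormedModule) (fun t => Re (p t))).
    + intros t Ht. apply (proj1 (rderiv_split _ _ _) (Hp t Ht)).
    + intros t Ht. exact (proj1 (proj1 (continuous_C_split dp t) (Hc t Ht))).
  - unfold CI. simpl. apply is_RInt_unique.
    apply (is_RInt_derive (V := R_CompleteNormedModule) (fun t => Im (p t))).
    + intros t Ht. apply (proj1 (rderiv_split _ _ _) (Hp t Ht)).
    + intros t Ht. exact (proj2 (proj1 (continuous_C_split dp t) (Hc t Ht))).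
Qed.

(** * The complex exponential *)

Definition Cexp (z : C) : C := (exp (Re z) * cos (Im z), exp (Re z) * sin (Im z)).

Lemma Cexp_plus (z w : C) : Cexp (z + w) = (Cexp z * Cexp w)%C.
Proof.
  unfold Cexp. rewrite re_plus, im_plus, exp_plus, cos_plus, sin_plus.
  unfold Cmult; simpl; f_equal; ring.
Qed.

Lemma Cexp_0 : Cexp (RtoC 0) = RtoC 1.
Proof. unfold Cexp; simpl. rewrite exp_0, cos_0, sin_0. unfold RtoC; f_equal; ring. Qed.

Lemma Cmod_Cexp (z : C) : Cmod (Cexp z) = exp (Re z).
Proof.
  apply Rsqr_inj; [apply Cmod_ge_0|left; apply exp_pos|].
  rewrite !Rsqr_pow2, Cmod2_alt. unfold Cexp; simpl.
  generalize (sin2_cos2 (Im z)). unfold Rsqr. intros E.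
  transitivity (exp (Re z) * exp (Re z) * (sin (Im z) * sin (Im z) + cos (Im z) * cos (Im z))).
  - ring.
  - rewrite E; ring.
Qed.

Lemma Cexp_neq_0 (z : C) : Cexp z <> RtoC 0.
Proof. apply Cmod_gt_0. rewrite Cmod_Cexp. apply exp_pos. Qed.

Lemma Cexp_opp (z : C) : Cexp (- z) = (/ Cexp z)%C.
Proof.
  assert (E : (Cexp z * Cexp (- z))%C = RtoC 1).
  { rewrite <- Cexp_plus. replace (z + - z)%C with (RtoC 0) by ring. apply Cexp_0. }
  replace (Cexp (- z)) with (/ Cexp z * (Cexp z * Cexp (- z)))%C
    by (field; apply Cexp_neq_0).
  rewrite E. ring.
Qed.

Lemma continuous_exp (x : R) : continuous exp x.
Proof. apply continuity_pt_filterlim, derivable_continuous_pt, derivable_pt_exp. Qed.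

Lemma continuous_Cexp (z : C) : continuous Cexp z.
Proof.
  apply continuous_C_split. split; apply @continuous_mult.
  1,3: apply (continuous_comp Re exp); [apply continuous_fst|apply continuous_exp].
  - apply (continuous_comp Im cos); [apply continuous_snd|apply continuous_cos].
  - apply (continuous_comp Im sin); [apply continuous_snd|apply continuous_sin].
Qed.

Lemma is_derive_times_const (k t : R) : is_derive (fun s => s * k) t k.
Proof. auto_derive; [trivial|ring]. Qed.

Lemma rderiv_Cexp_line (h : C) (t : R) :
  rderiv (fun s => Cexp (RtoC s * h)) t (h * Cexp (RtoC t * h))%C.
Proof.
  apply rderiv_split. destruct h as [x y]. split.
  - apply is_derive_ext with (fun s => exp (s * x) * cos (s * y)).
    + intros s. unfold Cexp. rewrite re_scal_l, im_scal_l. reflexivity.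
    + unfold Cexp. rewrite re_mult, re_scal_l, im_scal_l. simpl.
      auto_derive; [trivial|]. ring.
  - apply is_derive_ext with (fun s => exp (s * x) * sin (s * y)).
    + intros s. unfold Cexp. rewrite re_scal_l, im_scal_l. reflexivity.
    + unfold Cexp. rewrite im_mult, re_scal_l, im_scal_l. simpl.
      auto_derive; [trivial|]. ring.
Qed.

(** At [0] the mean value inequality bounds [exp h - 1 - h] along the segment
    from [0] to [h]; the addition formula moves the statement to any point. *)
Lemma cderiv_Cexp (z : C) : cderiv Cexp z (Cexp z).
Proof.
  apply cderiv_eps. intros eps He.
  assert (Hp : 0 < exp (Re z)) by apply exp_pos.
  assert (He' : 0 < eps / exp (Re z)) by (apply Rdiv_lt_0_compat; assumption).
  destruct (proj1 (continuous_C_eps _ _) (continuous_Cexp (RtoC 0)) _ He') as [d [Hd Hc]].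
  exists d. split; [exact Hd|]. intros w Hw. set (h := (w - z)%C) in *.
  replace w with (z + h)%C by (unfold h; ring). rewrite Cexp_plus.
  replace (Cexp z * Cexp h - Cexp z - Cexp z * h)%C
    with (Cexp z * (Cexp h - 1 - h))%C by ring.
  rewrite Cmod_mult, Cmod_Cexp.
  assert (B : Cmod ((Cexp (RtoC 1 * h) - RtoC 1 * h) - (Cexp (RtoC 0 * h) - RtoC 0 * h))
     <= (eps / exp (Re z) * Cmod h) * (1 - 0)).
  { apply (path_mean_value (fun t => Cexp (RtoC t * h) - RtoC t * h)%C
      (fun t => h * (Cexp (RtoC t * h) - 1))%C); [lra| |].
    - intros t _.
      destruct (proj1 (rderiv_split _ _ _) (rderiv_Cexp_line h t)) as [H1 H2].
      apply rderiv_split. split.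
      + apply is_derive_ext with (fun s => Re (Cexp (RtoC s * h)) - s * Re h).
        * intros s. unfold Cminus. rewrite re_plus, re_opp, re_scal_l. reflexivity.
        * replace (Re (h * (Cexp (t * h) - 1)))
            with (Re (h * Cexp (t * h)) - Re h)
            by (unfold Rminus; rewrite <- re_opp, <- re_plus; f_equal; ring).
          apply @is_derive_minus; [exact H1|apply is_derive_times_const].
      + apply is_derive_ext with (fun s => Im (Cexp (RtoC s * h)) - s * Im h).
        * intros s. unfold Cminus. rewrite im_plus, im_opp, im_scal_l. reflexivity.
        * replace (Im (h * (Cexp (t * h) - 1)))
            with (Im (h * Cexp (t * h)) - Im h)
            by (unfold Rminus; rewrite <- im_opp, <- im_plus; f_equal; ring).
          apply @is_derive_minus; [exact H2|apply is_derive_times_const].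
    - intros t Ht. rewrite Cmod_mult, Rmult_comm.
      apply Rmult_le_compat_r; [apply Cmod_ge_0|].
      left. rewrite <- Cexp_0. apply Hc.
      replace (t * h - 0)%C with (RtoC t * h)%C by ring.
      rewrite Cmod_mult, Cmod_R, Rabs_pos_eq by lra.
      assert (0 <= Cmod h) by apply Cmod_ge_0. nra. }
  replace ((Cexp (RtoC 1 * h) - RtoC 1 * h) - (Cexp (RtoC 0 * h) - RtoC 0 * h))%C
    with (Cexp h - 1 - h)%C in B.
  - apply Rle_trans with (exp (Re z) * ((eps / exp (Re z) * Cmod h) * (1 - 0))).
    + apply Rmult_le_compat_l; [lra|exact B].
    + right. field. lra.
  - replace (RtoC 0 * h)%C with (RtoC 0) by ring. rewrite Cexp_0.
    replace (RtoC 1 * h)%C with h by ring. ring.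
Qed.

(** * Cauchy theory on half-planes and on the plane *)

Lemma half_pow_small (x eps : R) : 0 <= x -> 0 < eps -> exists n, x * (/ 2) ^ n < eps.
Proof.
  intros Hx He.
  destruct (pow_lt_1_zero (/ 2) ltac:(rewrite Rabs_pos_eq; lra) (eps / (x + 1))) as [n Hn].
  { apply Rdiv_lt_0_compat; lra. }
  exists n. specialize (Hn n (Nat.le_refl n)).
  assert (Hp : 0 < (/ 2) ^ n) by (apply pow_lt; lra).
  rewrite Rabs_pos_eq in Hn by lra.
  apply Rle_lt_trans with ((x + 1) * (/ 2) ^ n); [nra|].
  apply Rlt_le_trans with ((x + 1) * (eps / (x + 1))); [apply Rmult_lt_compat_l; lra|].
  right; field; lra.
Qed.

(** Bisection in the form of an induction principle: a property of closed
    rectangles that passes from the four quarters to the whole and holds for all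
    small rectangles around any given point holds for every rectangle.
    Otherwise some nested sequence of quarters violates it and shrinks to a
    point.  Boundedness, uniform continuity and Goursat's lemma are instances. *)
Lemma rect_induction (P : R -> R -> R -> R -> Prop) (a b c d : R) :
  a <= b -> c <= d ->
  (forall a b c d, a <= b -> c <= d ->
     P a ((a + b) / 2) c ((c + d) / 2) -> P ((a + b) / 2) b c ((c + d) / 2) ->
     P a ((a + b) / 2) ((c + d) / 2) d -> P ((a + b) / 2) b ((c + d) / 2) d -> P a b c d) ->
  (forall x y, a <= x <= b -> c <= y <= d -> exists r, 0 < r /\
     forall a' b' c' d', a <= a' <= x -> x <= b' <= b -> c <= c' <= y -> y <= d' <= d ->
       b' - a' < r -> d' - c' < r -> P a' b' c' d') ->
  P a b c d.
Proof.
  intros Hab Hcd Hsub Hloc. apply NNPP. intros HN.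
  set (good := fun q : R * R * (R * R) =>
    fst (fst q) <= snd (fst q) /\ fst (snd q) <= snd (snd q) /\
    ~ P (fst (fst q)) (snd (fst q)) (fst (snd q)) (snd (snd q))).
  set (quarter := fun q q' : R * R * (R * R) =>
    fst (fst q) <= fst (fst q') /\ snd (fst q') <= snd (fst q) /\
    fst (snd q) <= fst (snd q') /\ snd (snd q') <= snd (snd q) /\
    snd (fst q') - fst (fst q') = (snd (fst q) - fst (fst q)) / 2 /\
    snd (snd q') - fst (snd q') = (snd (snd q) - fst (snd q)) / 2).
  assert (step : forall q : {q | good q}, exists q' : {q | good q},
    quarter (proj1_sig q) (proj1_sig q')).
  { intros [[[a1 b1] [c1 d1]] [H1 [H2 H3]]]. simpl in H1, H2, H3. simpl proj1_sig.
    assert (Hq : ~ P a1 ((a1 + b1) / 2) c1 ((c1 + d1) / 2) \/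
                 ~ P ((a1 + b1) / 2) b1 c1 ((c1 + d1) / 2) \/
                 ~ P a1 ((a1 + b1) / 2) ((c1 + d1) / 2) d1 \/
                 ~ P ((a1 + b1) / 2) b1 ((c1 + d1) / 2) d1).
    { apply NNPP. intros G. apply H3. apply Hsub; try assumption; apply NNPP; tauto. }
    destruct Hq as [G|[G|[G|G]]].
    - assert (gq : good ((a1, (a1 + b1) / 2), (c1, (c1 + d1) / 2)))
        by (unfold good; simpl; repeat split; [lra|lra|exact G]).
      exists (exist _ _ gq). unfold quarter. simpl. lra.
    - assert (gq : good (((a1 + b1) / 2, b1), (c1, (c1 + d1) / 2)))
        by (unfold good; simpl; repeat split; [lra|lra|exact G]).
      exists (exist _ _ gq). unfold quarter. simpl. lra.
    - assert (gq : good ((a1, (a1 + b1) / 2), ((c1 + d1) / 2, d1)))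
        by (unfold good; simpl; repeat split; [lra|lra|exact G]).
      exists (exist _ _ gq). unfold quarter. simpl. lra.
    - assert (gq : good (((a1 + b1) / 2, b1), ((c1 + d1) / 2, d1)))
        by (unfold good; simpl; repeat split; [lra|lra|exact G]).
      exists (exist _ _ gq). unfold quarter. simpl. lra. }
  assert (g0 : good ((a, b), (c, d))) by (unfold good; simpl; repeat split; assumption).
  set (next := fun q => proj1_sig (constructive_indefinite_description _ (step q))).
  set (s := fun n => proj1_sig (Nat.iter n next (exist _ _ g0))).
  set (A := fun n => fst (fst (s n))). set (B := fun n => snd (fst (s n))).
  set (C := fun n => fst (snd (s n))). set (D := fun n => snd (snd (s n))).
  assert (HS : forall n, A n <= A (S n) /\ B (S n) <= B n /\ C n <= C (S n) /\ D (S n) <= D n /\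
     B (S n) - A (S n) = (B n - A n) / 2 /\ D (S n) - C (S n) = (D n - C n) / 2).
  { intros n.
    exact (proj2_sig (constructive_indefinite_description _ (step (Nat.iter n next (exist _ _ g0))))). }
  assert (HG : forall n, A n <= B n /\ C n <= D n /\ ~ P (A n) (B n) (C n) (D n)).
  { intros n. exact (proj2_sig (Nat.iter n next (exist _ _ g0))). }
  assert (HW : forall n, B n - A n = (b - a) * (/ 2) ^ n /\ D n - C n = (d - c) * (/ 2) ^ n).
  { induction n as [|n IH].
    - unfold A, B, C, D, s; simpl. lra.
    - destruct (HS n) as [_ [_ [_ [_ [E1 E2]]]]]. rewrite E1, E2.
      destruct IH as [-> ->]. simpl. lra. }
  assert (mono : forall n k, A n <= A (n + k)%nat /\ B (n + k)%nat <= B n /\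
     C n <= C (n + k)%nat /\ D (n + k)%nat <= D n).
  { intros n k. induction k as [|k IH]; [rewrite Nat.add_0_r; lra|].
    rewrite Nat.add_succ_r. generalize (HS (n + k)%nat). lra. }
  assert (cross : forall n k, A n <= B k /\ C n <= D k).
  { intros n k. generalize (mono n k) (mono k n) (HG (n + k)%nat).
    rewrite (Nat.add_comm k n). lra. }
  assert (sup : forall U V : nat -> R, (forall n k, U n <= V k) ->
     exists x, forall n, U n <= x <= V n).
  { intros U V H.
    destruct (completeness (fun y => exists n, y = U n)) as [x [Hx1 Hx2]].
    - exists (V 0%nat). intros y [n ->]. apply H.
    - exists (U 0%nat). exists 0%nat. reflexivity.
    - exists x. intros n. split; [apply Hx1; exists n; reflexivity|].
      apply Hx2. intros y [k ->]. apply H. }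
  destruct (sup A B (fun n k => proj1 (cross n k))) as [x Hx].
  destruct (sup C D (fun n k => proj2 (cross n k))) as [y Hy].
  destruct (Hloc x y (Hx 0%nat) (Hy 0%nat)) as [r [Hr HP]].
  destruct (half_pow_small ((b - a) + (d - c)) r ltac:(lra) Hr) as [n Hn].
  apply (proj2 (proj2 (HG n))).
  assert (Hm := mono 0%nat n). simpl in Hm.
  change (A 0%nat) with a in Hm. change (B 0%nat) with b in Hm.
  change (C 0%nat) with c in Hm. change (D 0%nat) with d in Hm.
  destruct (HW n) as [W1 W2].
  assert (0 < (/ 2) ^ n) by (apply pow_lt; lra).
  generalize (Hx n) (Hy n); intros. apply HP; try lra; nra.
Qed.

Definition on_rect (Q : C -> Prop) (a b c d : R) : Prop :=
  forall x y, a <= x <= b -> c <= y <= d -> Q (x, y).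

Lemma rect_bounded (G : C -> C) (a b c d : R) :
  a <= b -> c <= d -> on_rect (fun z => continuous G z) a b c d ->
  exists M, 0 < M /\ on_rect (fun z => Cmod (G z) <= M) a b c d.
Proof.
  intros Hab Hcd HG.
  apply (rect_induction (fun a b c d => exists M, 0 < M /\ on_rect (fun z => Cmod (G z) <= M) a b c d));
    try assumption.
  - intros a1 b1 c1 d1 _ _ [M1 [P1 H1]] [M2 [P2 H2]] [M3 [P3 H3]] [M4 [P4 H4]].
    exists (M1 + M2 + M3 + M4). split; [lra|]. intros x y Hx Hy.
    destruct (Rle_dec x ((a1 + b1) / 2)); destruct (Rle_dec y ((c1 + d1) / 2)).
    + generalize (H1 x y ltac:(lra) ltac:(lra)); lra.
    + generalize (H3 x y ltac:(lra) ltac:(lra)); lra.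
    + generalize (H2 x y ltac:(lra) ltac:(lra)); lra.
    + generalize (H4 x y ltac:(lra) ltac:(lra)); lra.
  - intros x y Hx Hy.
    destruct (proj1 (continuous_C_eps G (x, y)) (HG x y Hx Hy) 1 ltac:(lra)) as [r [Hr H]].
    exists (r / 2). split; [lra|]. intros a' b' c' d' ? ? ? ? ? ?.
    exists (Cmod (G (x, y)) + 1). split; [generalize (Cmod_ge_0 (G (x, y))); lra|].
    intros x1 y1 ? ?.
    assert (Hw : Cmod ((x1, y1) - (x, y)) < r).
    { eapply Rle_lt_trans; [apply Cmod_minus_le|]. simpl.
      assert (Rabs (x1 - x) <= b' - a') by (apply Rabs_le; lra).
      assert (Rabs (y1 - y) <= d' - c') by (apply Rabs_le; lra). lra. }
    specialize (H _ Hw). generalize (Cmod_reverse_triangle (G (x1, y1)) (G (x, y))). lra.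
Qed.

Lemma rect_uniformly_continuous (G : C -> C) (a b c d eps : R) :
  a <= b -> c <= d -> on_rect (fun z => continuous G z) a b c d -> 0 < eps ->
  exists r, 0 < r /\
    on_rect (fun z => forall w, Cmod (w - z) < r -> Cmod (G w - G z) <= eps) a b c d.
Proof.
  intros Hab Hcd HG He.
  apply (rect_induction (fun a b c d => exists r, 0 < r /\
    on_rect (fun z => forall w, Cmod (w - z) < r -> Cmod (G w - G z) <= eps) a b c d));
    try assumption.
  - intros a1 b1 c1 d1 _ _ [M1 [P1 H1]] [M2 [P2 H2]] [M3 [P3 H3]] [M4 [P4 H4]].
    exists (Rmin (Rmin M1 M2) (Rmin M3 M4)). split; [repeat apply Rmin_pos; assumption|].
    intros x y Hx Hy w Hw.
    assert (Cmod (w - (x, y)) < M1 /\ Cmod (w - (x, y)) < M2 /\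
            Cmod (w - (x, y)) < M3 /\ Cmod (w - (x, y)) < M4).
    { generalize (Rmin_l (Rmin M1 M2) (Rmin M3 M4)) (Rmin_r (Rmin M1 M2) (Rmin M3 M4))
        (Rmin_l M1 M2) (Rmin_r M1 M2) (Rmin_l M3 M4) (Rmin_r M3 M4). lra. }
    destruct (Rle_dec x ((a1 + b1) / 2)); destruct (Rle_dec y ((c1 + d1) / 2)).
    + apply (H1 x y ltac:(lra) ltac:(lra)); tauto.
    + apply (H3 x y ltac:(lra) ltac:(lra)); tauto.
    + apply (H2 x y ltac:(lra) ltac:(lra)); tauto.
    + apply (H4 x y ltac:(lra) ltac:(lra)); tauto.
  - intros x y Hx Hy.
    destruct (proj1 (continuous_C_eps G (x, y)) (HG x y Hx Hy) (eps / 2) ltac:(lra)) as [r [Hr H]].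
    exists (r / 4). split; [lra|]. intros a' b' c' d' ? ? ? ? ? ?.
    exists (r / 2). split; [lra|].
    intros x1 y1 ? ? w Hw.
    assert (Hz : Cmod ((x1, y1) - (x, y)) < r / 2).
    { eapply Rle_lt_trans; [apply Cmod_minus_le|]. simpl.
      assert (Rabs (x1 - x) <= b' - a') by (apply Rabs_le; lra).
      assert (Rabs (y1 - y) <= d' - c') by (apply Rabs_le; lra). lra. }
    assert (Hwz : Cmod (w - (x, y)) < r)
      by (generalize (Cmod_triangle_minus w (x1, y1) (x, y)); lra).
    generalize (H _ Hwz) (H (x1, y1) ltac:(lra)) (Cmod_triangle_minus (G w) (G (x, y)) (G (x1, y1))).
    rewrite (Cmod_minus_sym (G (x, y))). lra.
Qed.

Definition rect_int (G : C -> C) (a b c d : R) : C :=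
  (CI (fun t => G (t, c)) a b + Ci * CI (fun t => G (b, t)) c d
   - CI (fun t => G (t, d)) a b - Ci * CI (fun t => G (a, t)) c d)%C.

Definition box (z w v : C) : Prop :=
  Rmin (Re z) (Re w) <= Re v <= Rmax (Re z) (Re w) /\
  Rmin (Im z) (Im w) <= Im v <= Rmax (Im z) (Im w).

Lemma cont_between_horizontal (G : C -> C) (a b y : R) :
  (forall t, Rmin a b <= t <= Rmax a b -> continuous G (t, y)) ->
  cont_between (fun t => G (t, y)) a b.
Proof.
  intros H t Ht. apply (continuous_comp (fun t : R => (t, y) : C) G);
    [apply continuous_horizontal|apply H, Ht].
Qed.

Lemma cont_between_vertical (G : C -> C) (x c d : R) :
  (forall t, Rmin c d <= t <= Rmax c d -> continuous G (x, t)) ->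
  cont_between (fun t => G (x, t)) c d.
Proof.
  intros H t Ht. apply (continuous_comp (fun t : R => (x, t) : C) G);
    [apply continuous_vertical|apply H, Ht].
Qed.

Definition cont_box (G : C -> C) (a b c d : R) : Prop :=
  forall x y, Rmin a b <= x <= Rmax a b -> Rmin c d <= y <= Rmax c d -> continuous G (x, y).

Lemma cont_box_h (G : C -> C) (a b c d a' b' y : R) :
  cont_box G a b c d -> Rmin a b <= Rmin a' b' -> Rmax a' b' <= Rmax a b ->
  Rmin c d <= y <= Rmax c d -> cont_between (fun t => G (t, y)) a' b'.
Proof. intros H H1 H2 Hy. apply cont_between_horizontal. intros t Ht. apply H; lra. Qed.

Lemma cont_box_v (G : C -> C) (a b c d c' d' x : R) :
  cont_box G a b c d -> Rmin c d <= Rmin c' d' -> Rmax c' d' <= Rmax c d ->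
  Rmin a b <= x <= Rmax a b -> cont_between (fun t => G (x, t)) c' d'.
Proof. intros H H1 H2 Hy. apply cont_between_vertical. intros t Ht. apply H; lra. Qed.

Lemma Rmin_le_Rmax_ends (a b : R) : Rmin a b <= a <= Rmax a b /\ Rmin a b <= b <= Rmax a b.
Proof. generalize (Rmin_l a b) (Rmin_r a b) (Rmax_l a b) (Rmax_r a b); lra. Qed.

Lemma Rmin_Rmax_sub (a b m : R) : Rmin a b <= m <= Rmax a b ->
  (Rmin a b <= Rmin a m /\ Rmax a m <= Rmax a b) /\ (Rmin a b <= Rmin m b /\ Rmax m b <= Rmax a b).
Proof.
  intros H. generalize (Rmin_le_Rmax_ends a b). intros.
  repeat split; first [apply Rmin_glb | apply Rmax_lub]; lra.
Qed.

Lemma rect_int_split_x (G : C -> C) (a b c d m : R) :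
  cont_box G a b c d -> Rmin a b <= m <= Rmax a b ->
  rect_int G a b c d = (rect_int G a m c d + rect_int G m b c d)%C.
Proof.
  intros H Hm. destruct (Rmin_Rmax_sub a b m Hm) as [[? ?] [? ?]].
  destruct (Rmin_le_Rmax_ends c d) as [Hc Hd].
  unfold rect_int.
  rewrite <- (CI_Chasles (fun t => G (t, c)) a m b), <- (CI_Chasles (fun t => G (t, d)) a m b).
  - ring.
  - apply (cont_box_h G a b c d); assumption.
  - apply (cont_box_h G a b c d); assumption.
  - apply (cont_box_h G a b c d); assumption.
  - apply (cont_box_h G a b c d); assumption.
Qed.

Lemma rect_int_split_y (G : C -> C) (a b c d m : R) :
  cont_box G a b c d -> Rmin c d <= m <= Rmax c d ->
  rect_int G a b c d = (rect_int G a b c m + rect_int G a b m d)%C.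
Proof.
  intros H Hm. destruct (Rmin_Rmax_sub c d m Hm) as [[? ?] [? ?]].
  destruct (Rmin_le_Rmax_ends a b) as [Ha Hb].
  unfold rect_int.
  rewrite <- (CI_Chasles (fun t => G (a, t)) c m d), <- (CI_Chasles (fun t => G (b, t)) c m d).
  - ring.
  - apply (cont_box_v G a b c d); assumption.
  - apply (cont_box_v G a b c d); assumption.
  - apply (cont_box_v G a b c d); assumption.
  - apply (cont_box_v G a b c d); assumption.
Qed.

Lemma cont_box_sub (G : C -> C) (a b c d a' b' c' d' : R) :
  cont_box G a b c d ->
  Rmin a b <= Rmin a' b' -> Rmax a' b' <= Rmax a b ->
  Rmin c d <= Rmin c' d' -> Rmax c' d' <= Rmax c d -> cont_box G a' b' c' d'.
Proof. intros H ? ? ? ? x y ? ?. apply H; lra. Qed.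

Lemma rect_int_swap_x (G : C -> C) (a b c d : R) :
  cont_box G a b c d -> rect_int G b a c d = (- rect_int G a b c d)%C.
Proof.
  intros H. destruct (Rmin_le_Rmax_ends c d) as [Hc Hd].
  unfold rect_int.
  rewrite (CI_swap (fun t => G (t, c)) a b), (CI_swap (fun t => G (t, d)) a b).
  - ring.
  - apply (cont_box_h G a b c d); try assumption; apply Rle_refl.
  - apply (cont_box_h G a b c d); try assumption; apply Rle_refl.
Qed.

Lemma rect_int_swap_y (G : C -> C) (a b c d : R) :
  cont_box G a b c d -> rect_int G a b d c = (- rect_int G a b c d)%C.
Proof.
  intros H. destruct (Rmin_le_Rmax_ends a b) as [Ha Hb].
  unfold rect_int.
  rewrite (CI_swap (fun t => G (a, t)) c d), (CI_swap (fun t => G (b, t)) c d).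
  - ring.
  - apply (cont_box_v G a b c d); try assumption; apply Rle_refl.
  - apply (cont_box_v G a b c d); try assumption; apply Rle_refl.
Qed.

Lemma rect_int_norm (G : C -> C) (a b c d M : R) :
  cont_box G a b c d ->
  (forall x y, Rmin a b <= x <= Rmax a b -> Rmin c d <= y <= Rmax c d -> Cmod (G (x, y)) <= M) ->
  Cmod (rect_int G a b c d) <= 2 * M * (Rabs (b - a) + Rabs (d - c)).
Proof.
  intros H HM. destruct (Rmin_le_Rmax_ends a b) as [Ha Hb].
  destruct (Rmin_le_Rmax_ends c d) as [Hc Hd].
  assert (N1 : Cmod (CI (fun t => G (t, c)) a b) <= M * Rabs (b - a)).
  { apply CI_norm_const; [|intros; apply HM; assumption].
    apply (cont_box_h G a b c d); try assumption; apply Rle_refl. }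
  assert (N2 : Cmod (CI (fun t => G (t, d)) a b) <= M * Rabs (b - a)).
  { apply CI_norm_const; [|intros; apply HM; assumption].
    apply (cont_box_h G a b c d); try assumption; apply Rle_refl. }
  assert (N3 : Cmod (CI (fun t => G (a, t)) c d) <= M * Rabs (d - c)).
  { apply CI_norm_const; [|intros; apply HM; assumption].
    apply (cont_box_v G a b c d); try assumption; apply Rle_refl. }
  assert (N4 : Cmod (CI (fun t => G (b, t)) c d) <= M * Rabs (d - c)).
  { apply CI_norm_const; [|intros; apply HM; assumption].
    apply (cont_box_v G a b c d); try assumption; apply Rle_refl. }
  unfold rect_int, Cminus.
  eapply Rle_trans; [apply Cmod_triangle|].
  eapply Rle_trans; [apply Rplus_le_compat_r, Cmod_triangle|].
  eapply Rle_trans; [apply Rplus_le_compat_r, Rplus_le_compat_r, Cmod_triangle|].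
  rewrite !Cmod_opp, !Cmod_mult, Cmod_Ci. lra.
Qed.

Lemma rect_int_minus (F G : C -> C) (a b c d : R) :
  cont_box F a b c d -> cont_box G a b c d ->
  rect_int (fun z => F z - G z)%C a b c d = (rect_int F a b c d - rect_int G a b c d)%C.
Proof.
  intros HF HG. destruct (Rmin_le_Rmax_ends a b) as [Ha Hb].
  destruct (Rmin_le_Rmax_ends c d) as [Hc Hd].
  unfold rect_int. rewrite !CI_minus; [ring|..].
  all: first [apply (cont_box_h F a b c d) | apply (cont_box_v F a b c d)
             |apply (cont_box_h G a b c d) | apply (cont_box_v G a b c d)];
    try assumption; apply Rle_refl.
Qed.

Lemma rect_int_primitive (Phi G : C -> C) (a b c d : R) :
  cont_box G a b c d ->
  (forall x y, Rmin a b <= x <= Rmax a b -> Rmin c d <= y <= Rmax c d ->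
     cderiv Phi (x, y) (G (x, y))) ->
  rect_int G a b c d = RtoC 0.
Proof.
  intros H HD. destruct (Rmin_le_Rmax_ends a b) as [Ha Hb].
  destruct (Rmin_le_Rmax_ends c d) as [Hc Hd].
  assert (Eh : forall y, Rmin c d <= y <= Rmax c d ->
    CI (fun t => G (t, y)) a b = (Phi (b, y) - Phi (a, y))%C).
  { intros y Hy. rewrite (CI_ext _ (fun t => G (t, y) * 1)%C) by (intros; ring).
    apply (CI_derive (fun t => Phi (t, y))).
    - intros t Ht. apply (rderiv_comp Phi (fun t => (t, y)));
        [apply HD; assumption|apply rderiv_horizontal].
    - intros t Ht. apply continuous_Cmult; [|apply continuous_const].
      revert t Ht. apply (cont_box_h G a b c d); try assumption; apply Rle_refl. }
  assert (Ev : forall x, Rmin a b <= x <= Rmax a b ->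
    (Ci * CI (fun t => G (x, t)) c d = Phi (x, d) - Phi (x, c))%C).
  { intros x Hx.
    assert (Hv : cont_between (fun t => G (x, t)) c d)
      by (apply (cont_box_v G a b c d); try assumption; apply Rle_refl).
    rewrite <- CI_scal by exact Hv.
    rewrite (CI_ext _ (fun t => G (x, t) * Ci)%C) by (intros; ring).
    apply (CI_derive (fun t => Phi (x, t))).
    - intros t Ht. apply (rderiv_comp Phi (fun t => (x, t)));
        [apply HD; assumption|apply rderiv_vertical].
    - intros t Ht. apply continuous_Cmult; [|apply continuous_const]. apply Hv, Ht. }
  unfold rect_int. rewrite !Eh, !Ev by assumption. ring.
Qed.

(** Goursat: near a point of differentiability [G] differs from an affine
    function, which has a primitive, by [o(diameter)], so its integral around a
    small rectangle is [o(diameter^2)]; the bound adds up over the quarters. *)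
Lemma goursat (G : C -> C) (a b c d : R) :
  a <= b -> c <= d -> on_rect (fun z => exists l, cderiv G z l) a b c d ->
  rect_int G a b c d = RtoC 0.
Proof.
  intros Hab Hcd HG. apply Cmod_eq_0. apply Rle_antisym; [|apply Cmod_ge_0].
  apply le_epsilon. intros e He.
  set (W := (b - a) * (b - a) + (d - c) * (d - c) + 1).
  assert (HW : 0 < W) by (unfold W; nra).
  set (eps := e / W). assert (Heps : 0 < eps) by (apply Rdiv_lt_0_compat; lra).
  assert (K : (a <= a /\ b <= b /\ c <= c /\ d <= d) -> Cmod (rect_int G a b c d)
     <= eps * ((b - a) * (b - a) + (d - c) * (d - c))).
  2: { rewrite Rplus_0_l. eapply Rle_trans; [apply K; lra|].
    apply Rle_trans with (eps * W); [apply Rmult_le_compat_l; unfold W; lra|].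
    unfold eps. right. field. lra. }
  assert (Hcont : on_rect (fun z => continuous G z) a b c d).
  { intros x y Hx Hy. destruct (HG x y Hx Hy) as [l Hl]. exact (cderiv_continuous _ _ _ Hl). }
  apply (rect_induction (fun a' b' c' d' => (a <= a' /\ b' <= b /\ c <= c' /\ d' <= d) ->
     Cmod (rect_int G a' b' c' d')
     <= eps * ((b' - a') * (b' - a') + (d' - c') * (d' - c')))); try assumption.
  - intros a1 b1 c1 d1 H1 H2 P1 P2 P3 P4 Hin.
    specialize (P1 ltac:(lra)). specialize (P2 ltac:(lra)).
    specialize (P3 ltac:(lra)). specialize (P4 ltac:(lra)).
    assert (Hb : cont_box G a1 b1 c1 d1).
    { intros x y. rewrite !Rmin_left, !Rmax_right by lra. intros. apply Hcont; lra. }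
    set (m := (a1 + b1) / 2) in *. set (n := (c1 + d1) / 2) in *.
    assert (Hm : a1 <= m <= b1) by (unfold m; lra).
    assert (Hn : c1 <= n <= d1) by (unfold n; lra).
    assert (Hbx : forall a2 b2, a1 <= a2 -> a2 <= b2 -> b2 <= b1 -> cont_box G a2 b2 c1 d1).
    { intros a2 b2 ? ? ?. apply (cont_box_sub G a1 b1 c1 d1); try assumption; try apply Rle_refl;
      rewrite ?Rmin_left, ?Rmax_right by lra; lra. }
    rewrite (rect_int_split_x G a1 b1 c1 d1 m) by (rewrite ?Rmin_left, ?Rmax_right by lra; assumption).
    rewrite (rect_int_split_y G a1 m c1 d1 n)
      by first [apply Hbx; lra|rewrite ?Rmin_left, ?Rmax_right by lra; assumption].
    rewrite (rect_int_split_y G m b1 c1 d1 n)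
      by first [apply Hbx; lra|rewrite ?Rmin_left, ?Rmax_right by lra; assumption].
    eapply Rle_trans; [apply Cmod_triangle|].
    eapply Rle_trans; [apply Rplus_le_compat; apply Cmod_triangle|].
    replace (m - a1) with ((b1 - a1) / 2) in * by (unfold m; lra).
    replace (b1 - m) with ((b1 - a1) / 2) in * by (unfold m; lra).
    replace (n - c1) with ((d1 - c1) / 2) in * by (unfold n; lra).
    replace (d1 - n) with ((d1 - c1) / 2) in * by (unfold n; lra). lra.
  - intros x y Hx Hy. destruct (HG x y Hx Hy) as [l Hl].
    set (z := (x, y) : C) in *.
    destruct (proj1 (cderiv_eps G z l) Hl (eps / 4) ltac:(lra)) as [r [Hr H]].
    exists (r / 2). split; [lra|]. intros a' b' c' d' Ha' Hb' Hc' Hd' Hw Hh _.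
    set (L := fun w => (G z + l * (w - z))%C).
    assert (HbG : cont_box G a' b' c' d').
    { intros x1 y1. rewrite !Rmin_left, !Rmax_right by lra. intros. apply Hcont; lra. }
    assert (HcL : forall w, continuous L w).
    { intros w. apply continuous_Cplus; [apply continuous_const|].
      apply continuous_Cmult; [apply continuous_const|].
      apply continuous_Cminus; [apply continuous_id|apply continuous_const]. }
    assert (HbL : cont_box L a' b' c' d') by (intros x1 y1 _ _; apply HcL).
    assert (E0 : rect_int L a' b' c' d' = RtoC 0).
    { apply (rect_int_primitive (fun w => (G z - l * z) * w + l / 2 * (w * w))%C); [exact HbL|].
      intros x1 y1 _ _. set (w := (x1, y1) : C).
      replace (L w) with ((0 * w + (G z - l * z) * 1) + (0 * (w * w) + l / 2 * (1 * w + w * 1)))%C.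
      - apply cderiv_plus.
        + apply (cderiv_mult (fun _ => (G z - l * z)%C) (fun w => w));
            [apply cderiv_const|apply cderiv_id].
        + apply (cderiv_mult (fun _ => (l / 2)%C) (fun w => w * w)%C); [apply cderiv_const|].
          apply (cderiv_mult (fun w => w) (fun w => w)); apply cderiv_id.
      - unfold L. field. }
    replace (rect_int G a' b' c' d') with (rect_int G a' b' c' d' - rect_int L a' b' c' d')%C
      by (rewrite E0; ring).
    rewrite <- rect_int_minus by assumption.
    set (w := b' - a') in *. set (h := d' - c') in *.
    eapply Rle_trans.
    + apply rect_int_norm with (M := eps / 4 * (w + h)).
      * intros x1 y1 H1 H2. apply continuous_Cminus; [apply HbG; assumption|apply HcL].
      * intros x1 y1. rewrite !Rmin_left, !Rmax_right by lra. intros H1 H2.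
        assert (Hn : Cmod ((x1, y1) - z) <= w + h).
        { eapply Rle_trans; [apply Cmod_minus_le|]. simpl.
          assert (Rabs (x1 - x) <= w) by (unfold w; apply Rabs_le; lra).
          assert (Rabs (y1 - y) <= h) by (unfold h; apply Rabs_le; lra). lra. }
        replace (G (x1, y1) - L (x1, y1))%C with (G (x1, y1) - G z - l * ((x1, y1) - z))%C
          by (unfold L; ring).
        eapply Rle_trans; [apply H; lra|]. apply Rmult_le_compat_l; lra.
    + fold w. fold h. rewrite !Rabs_pos_eq by (unfold w, h; lra).
      replace (2 * (eps / 4 * (w + h)) * (w + h)) with (eps * ((w + h) * (w + h) / 2)) by field.
      apply Rmult_le_compat_l; [lra|]. generalize w h; intros p q; generalize (Rle_0_sqr (p - q)); unfold Rsqr; lra.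
Qed.

(** The domains used are half-planes and the plane.  What the construction of
    primitives needs is openness and stability under taking the axis-parallel
    box spanned by two points. *)
Definition box_domain (D : C -> Prop) : Prop :=
  (forall z, D z -> exists r, 0 < r /\ forall w, Cmod (w - z) < r -> D w) /\
  (forall z w v, D z -> D w -> box z w v -> D v).

(** [holomorphic_on] in terms of [cderiv]; see [ex_derive_cderiv]. *)
Definition holo (D : C -> Prop) (F : C -> C) : Prop :=
  forall z, D z -> exists l, cderiv F z l.

Lemma box_domain_plane : box_domain (fun _ => True).
Proof. split; [intros; exists 1; split; [lra|trivial]|trivial]. Qed.

Lemma box_domain_above (b : R) : box_domain (fun z => b < Im z).
Proof.
  split.
  - intros z Hz. exists (Im z - b). split; [lra|]. intros w Hw.
    generalize (Im_minus_le w z) (Rle_abs (- (Im w - Im z))). rewrite Rabs_Ropp. lra.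
  - intros z w v Hz Hw [_ [H _]]. generalize (Rmin_glb_lt _ _ _ Hz Hw). lra.
Qed.

Lemma box_domain_cont_box (D : C -> Prop) (G : C -> C) (a b c d : R) :
  box_domain D -> (forall z, D z -> continuous G z) -> D (a, c) -> D (b, d) ->
  cont_box G a b c d.
Proof.
  intros [_ HD] HG H1 H2 x y Hx Hy. apply HG. apply (HD _ _ _ H1 H2). split; assumption.
Qed.

Lemma box_domain_corner (D : C -> Prop) (a b c d : R) :
  box_domain D -> D (a, c) -> D (b, d) -> D (a, d).
Proof.
  intros [_ HD] H1 H2. apply (HD _ _ _ H1 H2). split; simpl; apply Rmin_le_Rmax_ends.
Qed.

(** The opposite side may approach the exceptional side [y = c] only as a limit:
    the thin rectangle left over contributes arbitrarily little, by uniform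
    continuity along the long sides and boundedness along the short ones. *)
Lemma rect_int_exceptional_side (G : C -> C) (a b c d : R) :
  a <= b -> c <> d -> cont_box G a b c d ->
  (forall x y, a <= x <= b -> Rmin c d <= y <= Rmax c d -> y <> c ->
     exists l, cderiv G (x, y) l) ->
  rect_int G a b c d = RtoC 0.
Proof.
  intros Hab Hcd Hc HG. apply Cmod_eq_0. apply Rle_antisym; [|apply Cmod_ge_0].
  apply le_epsilon. intros e He. rewrite Rplus_0_l.
  assert (Hord : Rmin c d <= Rmax c d) by (generalize (Rmin_le_Rmax_ends c d); lra).
  assert (Hon : on_rect (fun z => continuous G z) a b (Rmin c d) (Rmax c d)).
  { intros x y Hx Hy. apply Hc; [rewrite Rmin_left, Rmax_right by lra; exact Hx|exact Hy]. }
  destruct (rect_bounded G a b (Rmin c d) (Rmax c d) Hab Hord Hon) as [M [HM HB]].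
  set (eps := e / (2 * (b - a + 1))).
  assert (Heps : 0 < eps) by (apply Rdiv_lt_0_compat; lra).
  destruct (rect_uniformly_continuous G a b (Rmin c d) (Rmax c d) eps Hab Hord Hon Heps)
    as [r [Hr HU]].
  set (q := Rmin 1 (Rmin (r / (2 * Rabs (d - c))) (e / (4 * M * Rabs (d - c))))).
  assert (Hdc : 0 < Rabs (d - c)) by (apply Rabs_pos_lt; lra).
  assert (Hq : 0 < q).
  { unfold q. repeat apply Rmin_pos; [lra|apply Rdiv_lt_0_compat; lra|].
    apply Rdiv_lt_0_compat; [lra|]. apply Rmult_lt_0_compat; lra. }
  assert (Hq1 : q <= 1) by apply Rmin_l.
  assert (Hq2 : q * Rabs (d - c) < r).
  { apply Rle_lt_trans with (r / (2 * Rabs (d - c)) * Rabs (d - c)).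
    - apply Rmult_le_compat_r; [lra|]. unfold q.
      eapply Rle_trans; [apply Rmin_r|apply Rmin_l].
    - replace (r / (2 * Rabs (d - c)) * Rabs (d - c)) with (r / 2) by (field; lra). lra. }
  assert (Hq3 : 2 * M * (q * Rabs (d - c)) <= e / 2).
  { apply Rle_trans with (2 * M * (e / (4 * M * Rabs (d - c)) * Rabs (d - c))).
    - apply Rmult_le_compat_l; [lra|]. apply Rmult_le_compat_r; [lra|]. unfold q.
      eapply Rle_trans; [apply Rmin_r|apply Rmin_r].
    - right. field. lra. }
  set (m := c + q * (d - c)).
  assert (Hm : Rmin c d <= m <= Rmax c d).
  { unfold m. destruct (Rle_dec c d).
    - rewrite Rmin_left, Rmax_right by lra. nra.
    - rewrite Rmin_right, Rmax_left by lra. nra. }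
  assert (Hmc : Rabs (m - c) = q * Rabs (d - c)).
  { unfold m. replace (c + q * (d - c) - c) with (q * (d - c)) by ring.
    rewrite Rabs_mult, (Rabs_pos_eq q) by lra. reflexivity. }
  assert (Esplit := rect_int_split_y G a b c d m Hc Hm).
  assert (E0 : rect_int G a b m d = RtoC 0).
  { assert (Hgood : on_rect (fun z => exists l, cderiv G z l) a b (Rmin m d) (Rmax m d)).
    { intros x y Hx Hy. destruct (Rmin_Rmax_sub c d m Hm) as [_ [? ?]].
      apply HG; [exact Hx|lra|]. intros ->.
      unfold m in Hy. destruct (Rle_dec c d).
      - revert Hy. unfold Rmin at 1. destruct (Rle_dec _ _); intros; nra.
      - revert Hy. unfold Rmax at 1. destruct (Rle_dec _ _); intros; nra. }
    destruct (Rle_dec m d) as [Hmd|Hmd].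
    - rewrite Rmin_left, Rmax_right in Hgood by lra. apply goursat; [lra|lra|exact Hgood].
    - rewrite Rmin_right, Rmax_left in Hgood by lra.
      rewrite (rect_int_swap_y G a b d m).
      + rewrite goursat; [ring|lra|lra|exact Hgood].
      + intros x y Hx Hy. rewrite Rmin_left, Rmax_right in Hx, Hy by lra.
        destruct (Hgood x y Hx Hy) as [l Hl]. exact (cderiv_continuous _ _ _ Hl). }
  rewrite Esplit, E0, Cplus_0_r.
  destruct (Rmin_le_Rmax_ends a b) as [Ha Hb].
  destruct (Rmin_Rmax_sub c d m Hm) as [[S1 S2] _].
  assert (Lh : Cmod (CI (fun t => G (t, c)) a b - CI (fun t => G (t, m)) a b) <= eps * Rabs (b - a)).
  { rewrite <- CI_minus; [|apply (cont_box_h G a b c d); try assumption;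
      try apply Rle_refl; apply Rmin_le_Rmax_ends..].
    apply CI_norm_const.
    - intros t Ht. apply continuous_Cminus; revert t Ht;
      apply (cont_box_h G a b c d); try assumption; try apply Rle_refl; apply Rmin_le_Rmax_ends.
    - intros t Ht. rewrite Rmin_left, Rmax_right in Ht by lra.
      rewrite Cmod_minus_sym. apply (HU t c Ht (proj1 (Rmin_le_Rmax_ends c d))).
      eapply Rle_lt_trans; [apply Cmod_minus_le|]. simpl.
      replace (t - t) with 0 by ring. rewrite Rabs_R0, Hmc. lra. }
  assert (Lv : forall x, a <= x <= b -> Cmod (CI (fun t => G (x, t)) c m) <= M * Rabs (m - c)).
  { intros x Hx. apply CI_norm_const.
    - apply (cont_box_v G a b c d); try assumption. rewrite Rmin_left, Rmax_right by lra. lra.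
    - intros t Ht. apply HB; [exact Hx|lra]. }
  unfold rect_int.
  replace (CI (fun t => G (t, c)) a b + Ci * CI (fun t => G (b, t)) c m
     - CI (fun t => G (t, m)) a b - Ci * CI (fun t => G (a, t)) c m)%C
    with ((CI (fun t => G (t, c)) a b - CI (fun t => G (t, m)) a b)
      + (Ci * CI (fun t => G (b, t)) c m + - (Ci * CI (fun t => G (a, t)) c m)))%C by ring.
  eapply Rle_trans; [apply Cmod_triangle|].
  eapply Rle_trans; [apply Rplus_le_compat_l, Cmod_triangle|].
  rewrite Cmod_opp, !Cmod_mult, Cmod_Ci.
  generalize (Lv a ltac:(lra)) (Lv b ltac:(lra)). rewrite Hmc.
  assert (eps * Rabs (b - a) <= e / 2).
  { rewrite Rabs_pos_eq by lra. apply Rle_trans with (eps * (b - a + 1)).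
    - apply Rmult_le_compat_l; lra.
    - unfold eps. right. field. lra. }
  lra.
Qed.

(** A continuous function that is holomorphic off a horizontal line behaves like
    a holomorphic one: a rectangle meeting the line is cut along it.  This single
    fact gives removability of a point (Cauchy's formula) and the gluing of
    functions across the real line (Schwarz reflection). *)
Lemma goursat_off_line (D : C -> Prop) (G : C -> C) (l a b c d : R) :
  box_domain D -> (forall z, D z -> continuous G z) ->
  (forall z, D z -> Im z <> l -> exists m, cderiv G z m) ->
  D (a, c) -> D (b, d) -> rect_int G a b c d = RtoC 0.
Proof.
  intros HD Hc HG. revert a b c d.
  assert (main : forall a b c d, a <= b -> D (a, c) -> D (b, d) -> rect_int G a b c d = RtoC 0).
  { intros a b c d Hab H1 H2.
    assert (Hbox := box_domain_cont_box D G a b c d HD Hc H1 H2).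
    assert (side : forall c', c' = l -> forall d', c' <> d' ->
      Rmin c d <= c' <= Rmax c d -> Rmin c d <= d' <= Rmax c d -> rect_int G a b c' d' = RtoC 0).
    { intros c' E d' Hcd Hc' Hd'. apply rect_int_exceptional_side; [exact Hab|exact Hcd| |].
      - apply (cont_box_sub G a b c d); try assumption; try apply Rle_refl;
        first [apply Rmin_glb | apply Rmax_lub]; lra.
      - intros x y Hx Hy Hn. apply HG; [|simpl; rewrite <- E; exact Hn].
        apply (proj2 HD _ _ _ H1 H2). split; simpl; [rewrite Rmin_left, Rmax_right by lra; exact Hx|].
        assert (Rmin c d <= Rmin c' d') by (apply Rmin_glb; lra).
        assert (Rmax c' d' <= Rmax c d) by (apply Rmax_lub; lra). lra. }
    destruct (classic (Rmin c d <= l <= Rmax c d)) as [Hl|Hl].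
    - rewrite (rect_int_split_y G a b c d l Hbox Hl).
      destruct (Rmin_le_Rmax_ends c d) as [Ec Ed].
      assert (T1 : rect_int G a b c l = RtoC 0).
      { destruct (Req_dec l c) as [->|N].
        - unfold rect_int. unfold CI. rewrite !RInt_point.
          change (@zero R_CompleteNormedModule, @zero R_CompleteNormedModule) with (RtoC 0). ring.
        - rewrite (rect_int_swap_y G a b l c).
          + rewrite (side l eq_refl c N Hl Ec). ring.
          + apply (cont_box_sub G a b c d); try assumption; try apply Rle_refl;
            first [apply Rmin_glb | apply Rmax_lub]; lra. }
      assert (T2 : rect_int G a b l d = RtoC 0).
      { destruct (Req_dec l d) as [->|N].
        - unfold rect_int. unfold CI. rewrite !RInt_point.
          change (@zero R_CompleteNormedModule, @zero R_CompleteNormedModule) with (RtoC 0). ring.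
        - exact (side l eq_refl d N Hl Ed). }
      rewrite T1, T2. ring.
    - assert (Hgood : on_rect (fun z => exists m, cderiv G z m) a b (Rmin c d) (Rmax c d)).
      { intros x y Hx Hy. apply HG; [|simpl; intros ->; apply Hl; exact Hy].
        apply (proj2 HD _ _ _ H1 H2). split; simpl; [rewrite Rmin_left, Rmax_right by lra; exact Hx|exact Hy]. }
      destruct (Rle_dec c d) as [Hcd|Hcd].
      + rewrite Rmin_left, Rmax_right in Hgood by lra. apply goursat; assumption.
      + rewrite Rmin_right, Rmax_left in Hgood by lra.
        rewrite (rect_int_swap_y G a b d c).
        * rewrite goursat; [ring|lra|lra|exact Hgood].
        * intros x y Hx Hy. apply Hbox; [exact Hx|]. rewrite (Rmin_comm c d), (Rmax_comm c d). exact Hy. }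
  intros a b c d H1 H2. destruct (Rle_dec a b) as [Hab|Hab]; [apply main; assumption|].
  assert (H3 := box_domain_corner D a b c d HD H1 H2).
  assert (H4 : D (b, c)).
  { apply (proj2 HD _ _ _ H1 H2). split; simpl; apply Rmin_le_Rmax_ends. }
  rewrite (rect_int_swap_x G b a c d).
  - rewrite main; [ring|lra|exact H4|exact H3].
  - apply (box_domain_cont_box D); assumption.
Qed.

Definition rect_null (D : C -> Prop) (G : C -> C) : Prop :=
  (forall z, D z -> continuous G z) /\
  (forall a b c d, D (a, c) -> D (b, d) -> rect_int G a b c d = RtoC 0).

(** The primitive integrates along an L-shaped path; vanishing rectangle integrals
    let the corner be moved, so increments are again L-shaped integrals. *)
Lemma rect_null_primitive (D : C -> Prop) (G : C -> C) :
  box_domain D -> rect_null D G -> exists Phi, forall z, D z -> cderiv Phi z (G z).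
Proof.
  intros HD [Hc H0].
  destruct (classic (exists p, D p)) as [[p Hp]|Hn].
  2: { exists G. intros z Hz. exfalso. apply Hn. exists z. exact Hz. }
  set (Phi := fun z => (CI (fun t => G (t, Im p)) (Re p) (Re z)
     + Ci * CI (fun t => G (Re z, t)) (Im p) (Im z))%C).
  assert (pt : forall z : C, D z -> D (Re z, Im z)) by (intros [? ?] H; exact H).
  assert (inc : forall z w, D z -> D w -> (Phi w - Phi z)%C =
     (CI (fun t => G (t, Im z)) (Re z) (Re w) + Ci * CI (fun t => G (Re w, t)) (Im z) (Im w))%C).
  { intros z w Hz Hw.
    assert (C1 : D (Re w, Im p)).
    { apply (proj2 HD _ _ _ Hw Hp). split; simpl; apply Rmin_le_Rmax_ends. }
    assert (C2 : D (Re w, Im z)).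
    { apply (proj2 HD _ _ _ Hw Hz). split; simpl; apply Rmin_le_Rmax_ends. }
    assert (C3 : D (Re z, Im p)).
    { apply (proj2 HD _ _ _ Hz Hp). split; simpl; apply Rmin_le_Rmax_ends. }
    assert (E := H0 (Re z) (Re w) (Im p) (Im z) C3 C2). unfold rect_int in E.
    assert (Eh : (CI (fun t => G (t, Im p)) (Re p) (Re z) + CI (fun t => G (t, Im p)) (Re z) (Re w))%C
       = CI (fun t => G (t, Im p)) (Re p) (Re w)).
    { apply CI_Chasles.
      - apply cont_between_horizontal. intros t Ht. apply Hc.
        apply (proj2 HD _ _ _ Hp C3). split; simpl; [exact Ht|apply Rmin_le_Rmax_ends].
      - apply cont_between_horizontal. intros t Ht. apply Hc.
        apply (proj2 HD _ _ _ C3 C1). split; simpl; [exact Ht|apply Rmin_le_Rmax_ends]. }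
    assert (Ev : (CI (fun t => G (Re w, t)) (Im p) (Im z) + CI (fun t => G (Re w, t)) (Im z) (Im w))%C
       = CI (fun t => G (Re w, t)) (Im p) (Im w)).
    { apply CI_Chasles.
      - apply cont_between_vertical. intros t Ht. apply Hc.
        apply (proj2 HD _ _ _ C1 C2). split; simpl; [apply Rmin_le_Rmax_ends|exact Ht].
      - apply cont_between_vertical. intros t Ht. apply Hc.
        apply (proj2 HD _ _ _ C2 (pt w Hw)). split; simpl; [apply Rmin_le_Rmax_ends|exact Ht]. }
    unfold Phi. rewrite <- Eh, <- Ev.
    match type of E with ?l = _ => transitivity (l + CI (fun t => G (t, Im z)) (Re z) (Re w)
      + Ci * CI (fun t => G (Re w, t)) (Im z) (Im w))%C end; [ring|rewrite E; ring]. }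
  exists Phi. intros z Hz. apply cderiv_eps. intros eps He.
  destruct (proj1 HD z Hz) as [r0 [Hr0 HDr]].
  destruct (proj1 (continuous_C_eps G z) (Hc z Hz) (eps / 2) ltac:(lra)) as [r1 [Hr1 HG]].
  exists (Rmin r0 (r1 / 2)). split; [apply Rmin_pos; lra|]. intros w Hw.
  assert (Hw0 : Cmod (w - z) < r0) by (generalize (Rmin_l r0 (r1 / 2)); lra).
  assert (Hw1 : Cmod (w - z) < r1 / 2) by (generalize (Rmin_r r0 (r1 / 2)); lra).
  assert (HDw := HDr w Hw0). rewrite (inc z w Hz HDw).
  assert (R1 := Re_minus_le w z). assert (R2 := Im_minus_le w z).
  assert (C2 : D (Re w, Im z)).
  { apply (proj2 HD _ _ _ HDw Hz). split; simpl; apply Rmin_le_Rmax_ends. }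
  assert (near : forall a b t, Rmin a b <= t <= Rmax a b -> Rabs (t - a) <= Rabs (b - a)).
  { intros a b t. unfold Rmin, Rmax. destruct (Rle_dec a b); intros Ht; unfold Rabs;
    destruct (Rcase_abs _), (Rcase_abs _); lra. }
  assert (N1 : Cmod (CI (fun t => G (t, Im z) - G z)%C (Re z) (Re w)) <= eps / 2 * Rabs (Re w - Re z)).
  { apply CI_norm_const.
    - intros t Ht. apply continuous_Cminus; [|apply continuous_const].
      revert t Ht. apply cont_between_horizontal. intros t Ht. apply Hc.
      apply (proj2 HD _ _ _ (pt z Hz) C2). split; simpl; [exact Ht|apply Rmin_le_Rmax_ends].
    - intros t Ht. left. apply HG. eapply Rle_lt_trans; [apply Cmod_minus_le|]. simpl.
      generalize (near _ _ _ Ht). replace (Im z - Im z) with 0 by ring. rewrite Rabs_R0. lra. }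
  assert (N2 : Cmod (CI (fun t => G (Re w, t) - G z)%C (Im z) (Im w)) <= eps / 2 * Rabs (Im w - Im z)).
  { apply CI_norm_const.
    - intros t Ht. apply continuous_Cminus; [|apply continuous_const].
      revert t Ht. apply cont_between_vertical. intros t Ht. apply Hc.
      apply (proj2 HD _ _ _ C2 (pt w HDw)). split; simpl; [apply Rmin_le_Rmax_ends|exact Ht].
    - intros t Ht. left. apply HG. eapply Rle_lt_trans; [apply Cmod_minus_le|]. simpl.
      generalize (near _ _ _ Ht). lra. }
  rewrite CI_minus in N1, N2.
  2: { apply cont_between_vertical. intros t Ht. apply Hc.
       apply (proj2 HD _ _ _ C2 (pt w HDw)). split; simpl; [apply Rmin_le_Rmax_ends|exact Ht]. }
  2: { intros t _; apply continuous_const. }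
  2: { apply cont_between_horizontal. intros t Ht. apply Hc.
      apply (proj2 HD _ _ _ (pt z Hz) C2). split; simpl; [exact Ht|apply Rmin_le_Rmax_ends]. }
  2: { intros t _; apply continuous_const. }
  rewrite CI_const in N1, N2.
  assert (Ewz : (w - z)%C = (RtoC (Re w - Re z) + Ci * RtoC (Im w - Im z))%C).
  { apply C_eq_Re_Im; unfold Cminus; rewrite ?re_plus, ?im_plus, ?re_opp, ?im_opp, ?re_mult, ?im_mult;
    simpl; ring. }
  rewrite Ewz at 1.
  match goal with |- Cmod ?e <= _ => replace e with
    ((CI (fun t => G (t, Im z)) (Re z) (Re w) - RtoC (Re w - Re z) * G z)
     + Ci * (CI (fun t => G (Re w, t)) (Im z) (Im w) - RtoC (Im w - Im z) * G z))%C by ring end.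
  eapply Rle_trans; [apply Cmod_triangle|]. rewrite Cmod_mult, Cmod_Ci.
  apply Rle_trans with (eps / 2 * Cmod (w - z) + 1 * (eps / 2 * Cmod (w - z))); [|lra].
  apply Rplus_le_compat; [eapply Rle_trans; [exact N1|]|apply Rmult_le_compat_l; [lra|];
    eapply Rle_trans; [exact N2|]]; apply Rmult_le_compat_l; lra.
Qed.

(** ** Cauchy's formula on circles *)

Definition cis (t : R) : C := (cos t, sin t).

Lemma Cmod_cis (t : R) : Cmod (cis t) = 1.
Proof.
  unfold cis, Cmod; simpl. generalize (sin2_cos2 t). unfold Rsqr. intros E.
  replace (cos t * (cos t * 1) + sin t * (sin t * 1)) with 1 by lra. apply sqrt_1.
Qed.

Lemma cis_neq_0 (t : R) : cis t <> RtoC 0.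
Proof. apply Cmod_gt_0. rewrite Cmod_cis. lra. Qed.

Lemma rderiv_cis (t : R) : rderiv cis t (Ci * cis t)%C.
Proof.
  apply rderiv_split. unfold cis. split; simpl; auto_derive; trivial; ring.
Qed.

Lemma continuous_cis (t : R) : continuous cis t.
Proof. apply continuous_C_split. split; [apply continuous_cos|apply continuous_sin]. Qed.

Definition circle (z0 : C) (r t : R) : C := (z0 + RtoC r * cis t)%C.

Lemma rderiv_circle (z0 : C) (r t : R) : rderiv (circle z0 r) t (RtoC r * (Ci * cis t))%C.
Proof.
  replace (RtoC r * (Ci * cis t))%C
    with ((0 + (0 * cis t + RtoC r * 1)) * (Ci * cis t))%C by ring.
  apply (rderiv_comp (fun w => z0 + RtoC r * w)%C cis); [|apply rderiv_cis].
  apply cderiv_plus; [apply cderiv_const|].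
  apply (cderiv_mult (fun _ => RtoC r)); [apply cderiv_const|apply cderiv_id].
Qed.

Lemma continuous_circle (z0 : C) (r t : R) : continuous (circle z0 r) t.
Proof.
  apply continuous_Cplus; [apply continuous_const|].
  apply continuous_Cmult; [apply continuous_const|apply continuous_cis].
Qed.

Lemma Cmod_circle (z0 : C) (r t : R) : 0 <= r -> Cmod (circle z0 r t - z0) = r.
Proof.
  intros Hr. unfold circle. replace (z0 + RtoC r * cis t - z0)%C with (RtoC r * cis t)%C by ring.
  rewrite Cmod_mult, Cmod_cis, Cmod_R, Rabs_pos_eq by exact Hr. ring.
Qed.

Lemma continuous_circle_speed (r t : R) : continuous (fun t => RtoC r * (Ci * cis t))%C t.
Proof.
  apply continuous_Cmult; [apply continuous_const|].
  apply continuous_Cmult; [apply continuous_const|apply continuous_cis].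
Qed.

Definition circle_int (f : C -> C) (z0 : C) (r : R) : C :=
  CI (fun t => f (circle z0 r t) * (RtoC r * (Ci * cis t)))%C 0 (2 * PI).

Lemma circle_int_primitive (Phi f : C -> C) (z0 : C) (r : R) :
  0 <= r -> (forall z, Cmod (z - z0) = r -> cderiv Phi z (f z) /\ continuous f z) ->
  circle_int f z0 r = RtoC 0.
Proof.
  intros Hr H. unfold circle_int.
  rewrite (CI_derive (fun t => Phi (circle z0 r t))).
  - unfold circle, cis. rewrite cos_2PI, sin_2PI, cos_0, sin_0. ring.
  - intros t _. apply rderiv_comp; [|apply rderiv_circle].
    apply H, Cmod_circle, Hr.
  - intros t _. apply continuous_Cmult.
    + apply continuous_comp; [apply continuous_circle|apply H, Cmod_circle, Hr].
    + apply continuous_circle_speed.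
Qed.

(** The exponent is a parameter because the derivative for [k] is [k] times the
    transform for [k + 1]. *)
Definition cauchy_transform (phi g : R -> C) (a b : R) (k : nat) (z : C) : C :=
  CI (fun t => phi t * / (g t - z) ^ k)%C a b.

Lemma cauchy_transform_cont (phi g : R -> C) (k : nat) (z : C) (t : R) :
  continuous phi t -> continuous g t -> (g t - z)%C <> RtoC 0 ->
  continuous (fun t => phi t * / (g t - z) ^ k)%C t.
Proof.
  intros H1 H2 H3. apply continuous_Cmult; [exact H1|].
  apply continuous_Cinv; [apply Cpow_nz, H3|].
  apply continuous_Cpow, continuous_Cminus; [exact H2|apply continuous_const].
Qed.

Lemma cauchy_kernel_remainder_1 (u h : C) (rho : R) :
  0 < rho -> rho <= Cmod u -> Cmod h <= rho / 2 ->
  Cmod (/ (u - h) ^ 1 - / u ^ 1 - h * / u ^ 2) <= 2 / rho ^ 3 * Cmod h ^ 2.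
Proof.
  intros Hr Hu Hh.
  assert (Hu0 : u <> RtoC 0) by (apply Cmod_gt_0; lra).
  assert (Huh : rho / 2 <= Cmod (u - h)) by (generalize (Cmod_reverse_triangle u h); lra).
  assert (Huh0 : (u - h)%C <> RtoC 0) by (apply Cmod_gt_0; lra).
  replace (/ (u - h) ^ 1 - / u ^ 1 - h * / u ^ 2)%C with (h ^ 2 / (u ^ 2 * (u - h)))%C
    by (field; split; assumption).
  rewrite Cmod_div by (apply Cmult_neq_0; [apply Cpow_nz|]; assumption).
  rewrite Cmod_mult, !Cmod_pow. unfold Rdiv. rewrite Rmult_comm.
  apply Rmult_le_compat_r; [apply pow2_ge_0|].
  replace (2 * / rho ^ 3) with (/ (rho ^ 2 * (rho / 2))) by (field; lra).
  apply Rinv_le_contravar; [apply Rmult_lt_0_compat; [apply pow_lt|]; lra|].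
  apply Rmult_le_compat; [apply pow_le; lra|lra|apply pow_incr; lra|lra].
Qed.

Lemma cauchy_kernel_remainder_2 (u h : C) (rho : R) :
  0 < rho -> rho <= Cmod u -> Cmod h <= rho / 2 ->
  Cmod (/ (u - h) ^ 2 - / u ^ 2 - h * (2 * / u ^ 3)) <= 16 / rho ^ 4 * Cmod h ^ 2.
Proof.
  intros Hr Hu Hh.
  assert (Hu0 : u <> RtoC 0) by (apply Cmod_gt_0; lra).
  assert (Huh : rho / 2 <= Cmod (u - h)) by (generalize (Cmod_reverse_triangle u h); lra).
  assert (Huh0 : (u - h)%C <> RtoC 0) by (apply Cmod_gt_0; lra).
  replace (/ (u - h) ^ 2 - / u ^ 2 - h * (2 * / u ^ 3))%C
    with (h ^ 2 * ((3 * u - 2 * h) / u) / (u ^ 2 * (u - h) ^ 2))%C by (field; split; assumption).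
  rewrite Cmod_div by (apply Cmult_neq_0; apply Cpow_nz; assumption).
  rewrite !Cmod_mult, Cmod_div, !Cmod_pow by assumption.
  assert (B : Cmod (3 * u - 2 * h) / Cmod u <= 4).
  { apply Rmult_le_reg_r with (Cmod u); [lra|]. unfold Rdiv. rewrite Rmult_assoc, Rinv_l, Rmult_1_r by lra.
    eapply Rle_trans; [apply Cmod_triangle|]. rewrite Cmod_opp, !Cmod_mult, !Cmod_R, !Rabs_pos_eq by lra.
    lra. }
  assert (B0 : 0 <= Cmod (3 * u - 2 * h) / Cmod u).
  { apply Rmult_le_pos; [apply Cmod_ge_0|left; apply Rinv_0_lt_compat; lra]. }
  assert (K : / (Cmod u ^ 2 * Cmod (u - h) ^ 2) <= 4 / rho ^ 4).
  { replace (4 / rho ^ 4) with (/ (rho ^ 2 * (rho / 2) ^ 2)) by (field; lra).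
    apply Rinv_le_contravar; [apply Rmult_lt_0_compat; apply pow_lt; lra|].
    apply Rmult_le_compat; [apply pow_le; lra|apply pow_le; lra|apply pow_incr; lra|apply pow_incr; lra]. }
  assert (K0 : 0 <= / (Cmod u ^ 2 * Cmod (u - h) ^ 2)).
  { left. apply Rinv_0_lt_compat, Rmult_lt_0_compat; apply pow_lt; lra. }
  assert (H2 := pow2_ge_0 (Cmod h)).
  unfold Rdiv at 1. rewrite Rmult_assoc.
  replace (16 / rho ^ 4 * Cmod h ^ 2) with (Cmod h ^ 2 * (4 * (4 / rho ^ 4))) by (field; lra).
  apply Rmult_le_compat_l; [exact H2|]. apply Rmult_le_compat; assumption.
Qed.

Lemma cderiv_of_quadratic_remainder (F : C -> C) (z l : C) (K rho : R) :
  0 < rho -> 0 <= K ->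
  (forall h, Cmod h <= rho -> Cmod (F (z + h)%C - F z - l * h) <= K * Cmod h ^ 2) ->
  cderiv F z l.
Proof.
  intros Hr HK H. apply cderiv_eps. intros eps He.
  exists (Rmin rho (eps / (K + 1))). split.
  - apply Rmin_pos; [exact Hr|]. apply Rdiv_lt_0_compat; lra.
  - intros w Hw. specialize (H (w - z)%C).
    replace (z + (w - z))%C with w in H by ring.
    eapply Rle_trans; [apply H; generalize (Rmin_l rho (eps / (K + 1))); lra|].
    assert (B : Cmod (w - z) <= eps / (K + 1)) by (generalize (Rmin_r rho (eps / (K + 1))); lra).
    assert (K * Cmod (w - z) <= eps).
    { apply Rle_trans with ((K + 1) * (eps / (K + 1))); [|right; field; lra].
      assert (0 <= Cmod (w - z)) by apply Cmod_ge_0.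
      apply Rle_trans with ((K + 1) * Cmod (w - z)); [nra|]. apply Rmult_le_compat_l; lra. }
    generalize (Cmod_ge_0 (w - z)); intros; nra.
Qed.

Lemma cont_between_bounded (f : R -> C) (a b : R) :
  a <= b -> cont_between f a b -> exists M, 0 <= M /\ forall t, a <= t <= b -> Cmod (f t) <= M.
Proof.
  intros Hab Hf.
  destruct (continuity_ab_maj (fun t => Cmod (f t)) a b Hab) as [m [Hm _]].
  - intros t Ht. apply continuity_pt_filterlim.
    assert (Hc := Hf t ltac:(rewrite Rmin_left, Rmax_right by lra; lra)).
    apply filterlim_locally. intros eps.
    destruct (proj1 (continuous_R_eps f t) Hc eps (cond_pos eps)) as [d [Hd H]].
    exists (mkposreal _ Hd). intros s Hs. specialize (H s Hs).
    change (Rabs (Cmod (f s) - Cmod (f t)) < eps).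
    generalize (Cmod_reverse_triangle (f s) (f t)) (Cmod_reverse_triangle (f t) (f s)).
    rewrite (Cmod_minus_sym (f t)). intros. apply Rabs_lt_between. lra.
  - exists (Cmod (f m)). split; [apply Cmod_ge_0|exact Hm].
Qed.

Lemma CI_combination (f1 f2 f3 : R -> C) (a b : R) (c h : C) :
  cont_between f1 a b -> cont_between f2 a b -> cont_between f3 a b ->
  (CI f1 a b - CI f2 a b - c * CI f3 a b * h)%C =
  CI (fun t => f1 t - f2 t - h * c * f3 t)%C a b.
Proof.
  intros H1 H2 H3.
  rewrite (CI_minus (fun t => f1 t - f2 t)%C), CI_minus, CI_scal; try assumption.
  - ring.
  - intros t Ht. apply continuous_Cminus; [apply H1|apply H2]; exact Ht.
  - apply cont_between_scal, H3.
Qed.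

Lemma cderiv_cauchy_transform (phi g : R -> C) (a b rho : R) (k : nat) (z : C) :
  a <= b -> 0 < rho -> (k = 1 \/ k = 2)%nat ->
  cont_between phi a b -> cont_between g a b ->
  (forall t, a <= t <= b -> rho <= Cmod (g t - z)) ->
  cderiv (cauchy_transform phi g a b k) z (RtoC (INR k) * cauchy_transform phi g a b (S k) z)%C.
Proof.
  intros Hab Hr Hk Hphi Hg Hd.
  destruct (cont_between_bounded phi a b Hab Hphi) as [M [HM HB]].
  assert (Hnz : forall h t, Cmod h <= rho / 2 -> a <= t <= b -> (g t - (z + h))%C <> RtoC 0).
  { intros h t Hh Ht. apply Cmod_gt_0. replace (g t - (z + h))%C with ((g t - z) - h)%C by ring.
    generalize (Cmod_reverse_triangle (g t - z) h) (Hd t Ht). lra. }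
  assert (Hct : forall h j, Cmod h <= rho / 2 ->
    cont_between (fun t => phi t * / (g t - (z + h)) ^ j)%C a b).
  { intros h j Hh t Ht. apply cauchy_transform_cont; [apply Hphi|apply Hg|apply Hnz]; try assumption.
    rewrite Rmin_left, Rmax_right in Ht by lra. exact Ht. }
  assert (Hct0 : forall j, cont_between (fun t => phi t * / (g t - z) ^ j)%C a b).
  { intros j t Ht. specialize (Hct (RtoC 0) j). rewrite Cmod_0, Cplus_0_r in Hct.
    apply Hct; [lra|exact Ht]. }
  assert (B : forall u h, rho <= Cmod u -> Cmod h <= rho / 2 ->
    Cmod (/ (u - h) ^ k - / u ^ k - h * (RtoC (INR k) * / u ^ S k)) <= (2 / rho ^ 3 + 16 / rho ^ 4) * Cmod h ^ 2).
  { intros u h Hu Hh.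
    assert (0 < 2 / rho ^ 3) by (apply Rdiv_lt_0_compat; [lra|apply pow_lt; lra]).
    assert (0 < 16 / rho ^ 4) by (apply Rdiv_lt_0_compat; [lra|apply pow_lt; lra]).
    assert (H2 := pow2_ge_0 (Cmod h)).
    destruct Hk as [-> | ->].
    - generalize (cauchy_kernel_remainder_1 u h rho Hr Hu Hh). simpl INR.
      replace (RtoC 1 * / u ^ 2)%C with (/ u ^ 2)%C by ring. intros; nra.
    - generalize (cauchy_kernel_remainder_2 u h rho Hr Hu Hh). simpl INR.
      replace (RtoC (1 + 1)) with (RtoC 2) by (f_equal; ring). intros; nra. }
  set (Q := 2 / rho ^ 3 + 16 / rho ^ 4) in *.
  assert (HQ : 0 <= Q).
  { unfold Q. apply Rplus_le_le_0_compat; left; (apply Rdiv_lt_0_compat; [lra|apply pow_lt; lra]). }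
  apply cderiv_of_quadratic_remainder with (M * Q * (b - a)) (rho / 2);
    [lra|apply Rmult_le_pos; [apply Rmult_le_pos; assumption|lra]|].
  intros h Hh. unfold cauchy_transform.
  rewrite (CI_combination (fun t => phi t * / (g t - (z + h)) ^ k)%C
    (fun t => phi t * / (g t - z) ^ k)%C (fun t => phi t * / (g t - z) ^ S k)%C)
    by first [exact (Hct h k Hh) | exact (Hct0 k) | exact (Hct0 (S k))].
  replace (M * Q * (b - a) * Cmod h ^ 2) with (M * (Q * Cmod h ^ 2) * Rabs (b - a))
    by (rewrite Rabs_pos_eq by lra; ring).
  apply CI_norm_const.
  - intros t Ht. apply continuous_Cminus; [apply continuous_Cminus|].
    + exact (Hct h k Hh t Ht).
    + exact (Hct0 k t Ht).
    + exact (cont_between_scal _ _ _ _ (Hct0 (S k)) t Ht).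
  - intros t Ht. rewrite Rmin_left, Rmax_right in Ht by lra.
    specialize (B (g t - z)%C h (Hd t Ht) Hh).
    replace (g t - (z + h))%C with (g t - z - h)%C by ring.
    replace (phi t * / (g t - z - h) ^ k - phi t * / (g t - z) ^ k
      - h * RtoC (INR k) * (phi t * / (g t - z) ^ S k))%C
      with (phi t * (/ (g t - z - h) ^ k - / (g t - z) ^ k - h * (RtoC (INR k) * / (g t - z) ^ S k)))%C
      by ring.
    rewrite Cmod_mult. apply Rmult_le_compat; [apply Cmod_ge_0|apply Cmod_ge_0|apply HB, Ht|exact B].
Qed.

Definition disc_in (D : C -> Prop) (z0 : C) (r : R) : Prop :=
  forall w, Cmod (w - z0) <= r -> D w.

Lemma circle_distance (z0 z : C) (r t : R) :
  0 <= r -> r - Cmod (z - z0) <= Cmod (circle z0 r t - z).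
Proof.
  intros Hr. generalize (Cmod_circle z0 r t Hr) (Cmod_triangle_minus (circle z0 r t) z z0). lra.
Qed.

(** Its derivative in [z] vanishes since [1/(zeta-z)^2] has a primitive on the
    circle, and at the centre the integrand is constant. *)
Lemma circle_int_inv (z0 z : C) (r : R) :
  0 < r -> Cmod (z - z0) < r -> circle_int (fun w => / (w - z))%C z0 r = (RtoC (2 * PI) * Ci)%C.
Proof.
  intros Hr Hz.
  assert (E0 : circle_int (fun w => / (w - z0))%C z0 r = (RtoC (2 * PI) * Ci)%C).
  { unfold circle_int. rewrite (CI_ext _ (fun _ => Ci)).
    - rewrite CI_const. f_equal. f_equal. ring.
    - intros t _. unfold circle. replace (z0 + RtoC r * cis t - z0)%C with (RtoC r * cis t)%C by ring.
      field. split; [apply cis_neq_0|]. intros E. apply RtoC_inj in E. lra. }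
  rewrite <- E0.
  set (phi := fun t => (RtoC r * (Ci * cis t))%C).
  assert (Hphi : forall t, continuous phi t).
  { intros t. unfold phi. apply continuous_circle_speed. }
  set (n := cauchy_transform phi (circle z0 r) 0 (2 * PI) 1).
  assert (En : forall w, circle_int (fun v => / (v - w))%C z0 r = n w).
  { intros w. unfold n, cauchy_transform, circle_int. apply CI_ext. intros t _.
    fold (phi t). rewrite Cpow_1_r. ring. }
  rewrite !En. assert (HPI := PI_RGT_0).
  assert (Hd : forall w, Cmod (w - z0) < r -> cderiv n w (RtoC 0)).
  { intros w Hw.
    replace (RtoC 0) with (RtoC (INR 1) * cauchy_transform phi (circle z0 r) 0 (2 * PI) 2 w)%C.
    - apply (cderiv_cauchy_transform phi (circle z0 r) 0 (2 * PI) (r - Cmod (w - z0)) 1 w); try lra.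
      + left; reflexivity.
      + intros t _. apply Hphi.
      + intros t _. apply continuous_circle.
      + intros t _. apply circle_distance. lra.
    - assert (E : circle_int (fun v => / (v - w) ^ 2)%C z0 r = RtoC 0).
      { apply (circle_int_primitive (fun v => - / (v - w))%C); [lra|]. intros v Hv.
        assert (Hvw : (v - w)%C <> RtoC 0).
        { intros E. apply Ceq_minus in E. subst v. lra. }
        split.
        - replace (/ (v - w) ^ 2)%C with (- (- (1 - 0) / ((v - w) * (v - w))))%C by (field; exact Hvw).
          apply cderiv_opp. apply (cderiv_inv (fun v => v - w)%C); [exact Hvw|].
          apply cderiv_minus; [apply cderiv_id|apply cderiv_const].
        - apply continuous_Cinv; [apply Cpow_nz, Hvw|].
          apply continuous_Cpow, continuous_Cminus; [apply continuous_id|apply continuous_const]. }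
      replace (cauchy_transform phi (circle z0 r) 0 (2 * PI) 2 w) with (RtoC 0); [ring|].
      rewrite <- E. unfold cauchy_transform, circle_int. apply CI_ext. intros t _. fold (phi t). ring. }
  apply Ceq_minus. apply Cmod_eq_0. apply Rle_antisym; [|apply Cmod_ge_0].
  assert (B : Cmod (n (z0 + RtoC 1 * (z - z0))%C - n (z0 + RtoC 0 * (z - z0))%C) <= 0 * (1 - 0)).
  { apply (path_mean_value (fun t => n (z0 + RtoC t * (z - z0))%C) (fun _ => RtoC 0)); [lra| |].
    - intros t Ht. replace (RtoC 0) with (RtoC 0 * (z - z0))%C by ring.
      apply (rderiv_comp n (fun t => z0 + RtoC t * (z - z0))%C).
      + apply Hd. replace (z0 + RtoC t * (z - z0) - z0)%C with (RtoC t * (z - z0))%C by ring.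
        rewrite Cmod_mult, Cmod_R, Rabs_pos_eq by lra. generalize (Cmod_ge_0 (z - z0)). nra.
      + exists (fun _ => (z - z0)%C). split; [|split; [reflexivity|apply continuous_const]].
        intros s. rewrite RtoC_minus. ring.
    - intros t _. rewrite Cmod_0. lra. }
  replace (z0 + RtoC 1 * (z - z0))%C with z in B by ring.
  replace (z0 + RtoC 0 * (z - z0))%C with z0 in B by ring. lra.
Qed.

(** The difference quotient [(F w - F z) / (w - z)] is continuous in [w] and
    holomorphic off the point [z], hence has a primitive. *)
Lemma cauchy_formula (D : C -> Prop) (F : C -> C) (z0 z : C) (r : R) :
  box_domain D -> holo D F -> 0 < r -> disc_in D z0 r -> Cmod (z - z0) < r ->
  circle_int (fun w => F w * / (w - z))%C z0 r = (RtoC (2 * PI) * Ci * F z)%C.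
Proof.
  intros HD HF Hr Hdisc Hz.
  assert (Dz : D z) by (apply Hdisc; lra).
  destruct (HF z Dz) as [l [q [Hq [_ Hcq]]]].
  assert (Hq' : forall w, w <> z -> q w = ((F w - F z) * / (w - z))%C).
  { intros w Hw. rewrite (Hq w). field. intros E. apply Hw. apply Ceq_minus. exact E. }
  assert (Hqd : forall w, D w -> w <> z -> exists m, cderiv q w m).
  { intros w Dw Hw. destruct (HF w Dw) as [m Hm].
    assert (Hwz : (w - z)%C <> RtoC 0) by (intros E; apply Hw; apply Ceq_minus; exact E).
    eexists. apply (cderiv_ext_loc (fun v => (F v - F z) * / (v - z))%C _ _ _ (Cmod (w - z))).
    - apply Cmod_gt_0. exact Hwz.
    - intros v Hv. symmetry. apply Hq'. intros ->. rewrite Cmod_minus_sym in Hv. lra.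
    - apply cderiv_mult.
      + apply cderiv_minus; [exact Hm|apply cderiv_const].
      + apply (cderiv_inv (fun v => v - z)%C); [exact Hwz|]. apply cderiv_minus; [apply cderiv_id|apply cderiv_const]. }
  assert (Hqc : forall w, D w -> continuous q w).
  { intros w Dw. destruct (Ceq_dec w z) as [->|N]; [exact Hcq|].
    destruct (Hqd w Dw N) as [m Hm]. exact (cderiv_continuous _ _ _ Hm). }
  assert (Hnull : rect_null D q).
  { split; [exact Hqc|]. intros a b c d. apply (goursat_off_line D q (Im z)); try assumption.
    intros w Dw Hn. apply Hqd; [exact Dw|]. intros ->. apply Hn. reflexivity. }
  destruct (rect_null_primitive D q HD Hnull) as [Phi HPhi].
  assert (E : circle_int q z0 r = RtoC 0).
  { apply (circle_int_primitive Phi); [lra|]. intros w Hw.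
    assert (Dw : D w) by (apply Hdisc; lra). split; [apply HPhi|apply Hqc]; exact Dw. }
  assert (onc : forall t, (circle z0 r t - z)%C <> RtoC 0).
  { intros t. apply Cmod_gt_0. generalize (circle_distance z0 z r t). lra. }
  assert (E2 : circle_int q z0 r =
    (circle_int (fun w => F w * / (w - z))%C z0 r - F z * circle_int (fun w => / (w - z))%C z0 r)%C).
  { assert (Hci : forall t, continuous (fun t => / (circle z0 r t - z))%C t).
    { intros t. apply continuous_Cinv; [apply onc|].
      apply continuous_Cminus; [apply continuous_circle|apply continuous_const]. }
    assert (Hdz : forall t, continuous (fun t => RtoC r * (Ci * cis t))%C t).
    { intros t. apply continuous_circle_speed. }
    unfold circle_int. rewrite <- CI_scal.
    - rewrite <- CI_minus.
      + apply CI_ext. intros t _. rewrite Hq'.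
        * ring.
        * intros E3. apply (onc t). rewrite E3. ring.
      + intros t _. apply continuous_Cmult; [|apply Hdz]. apply continuous_Cmult; [|apply Hci].
        apply continuous_comp; [apply continuous_circle|].
        destruct (HF (circle z0 r t)) as [m Hm]; [|exact (cderiv_continuous _ _ _ Hm)].
        apply Hdisc. rewrite Cmod_circle; lra.
      + apply cont_between_scal. intros t _. apply continuous_Cmult; [apply Hci|apply Hdz].
    - intros t _. apply continuous_Cmult; [apply Hci|apply Hdz]. }
  rewrite E in E2. rewrite circle_int_inv in E2 by assumption.
  match goal with |- ?l = _ => replace l with (l - F z * (RtoC (2 * PI) * Ci)
    + F z * (RtoC (2 * PI) * Ci))%C by ring end.
  rewrite <- E2. ring.
Qed.

Definition circle_density (F : C -> C) (z0 : C) (r t : R) : C :=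
  (F (circle z0 r t) * (RtoC r * (Ci * cis t)))%C.

Lemma cont_circle_density (D : C -> Prop) (F : C -> C) (z0 : C) (r t : R) :
  holo D F -> 0 < r -> disc_in D z0 r -> continuous (circle_density F z0 r) t.
Proof.
  intros HF Hr Hdisc. apply continuous_Cmult.
  - apply continuous_comp; [apply continuous_circle|].
    destruct (HF (circle z0 r t)) as [m Hm]; [|exact (cderiv_continuous _ _ _ Hm)].
    apply Hdisc. rewrite Cmod_circle; lra.
  - apply continuous_circle_speed.
Qed.

Lemma two_PI_i_neq_0 : (RtoC (2 * PI) * Ci)%C <> RtoC 0.
Proof.
  apply Cmult_neq_0; [|apply Ci_nz]. intros E. apply RtoC_inj in E. generalize PI_RGT_0; lra.
Qed.

(** Cauchy's formula exhibits a holomorphic function as a Cauchy transform, which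
    can be differentiated twice under the integral sign. *)
Lemma cauchy_formula_derivatives (D : C -> Prop) (F F' : C -> C) (z0 : C) (r : R) :
  box_domain D -> (forall z, D z -> cderiv F z (F' z)) -> 0 < r -> disc_in D z0 r ->
  (forall z, Cmod (z - z0) < r -> (RtoC (2 * PI) * Ci * F' z)%C =
     cauchy_transform (circle_density F z0 r) (circle z0 r) 0 (2 * PI) 2 z) /\
  exists l, cderiv F' z0 l /\ (RtoC (2 * PI) * Ci * l)%C =
     (2 * cauchy_transform (circle_density F z0 r) (circle z0 r) 0 (2 * PI) 3 z0)%C.
Proof.
  intros HD HF Hr Hdisc.
  assert (HFh : holo D F) by (intros z Dz; exists (F' z); apply HF, Dz).
  assert (HPI := PI_RGT_0). assert (HK := two_PI_i_neq_0).
  set (A := fun k => cauchy_transform (circle_density F z0 r) (circle z0 r) 0 (2 * PI) k).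
  assert (HA : forall k z, (k = 1 \/ k = 2)%nat -> Cmod (z - z0) < r ->
    cderiv (A k) z (RtoC (INR k) * A (S k) z)%C).
  { intros k z Hk Hz.
    apply (cderiv_cauchy_transform _ _ 0 (2 * PI) (r - Cmod (z - z0)) k z); try lra.
    - exact Hk.
    - intros t _. apply (cont_circle_density D); assumption.
    - intros t _. apply continuous_circle.
    - intros t _. apply circle_distance. lra. }
  assert (E1 : forall z, Cmod (z - z0) < r -> A 1%nat z = (RtoC (2 * PI) * Ci * F z)%C).
  { intros z Hz. rewrite <- (cauchy_formula D F z0 z r HD HFh Hr Hdisc Hz).
    unfold A, cauchy_transform, circle_int, circle_density. apply CI_ext. intros t _.
    rewrite Cpow_1_r. ring. }
  assert (E2 : forall z, Cmod (z - z0) < r -> (RtoC (2 * PI) * Ci * F' z)%C = A 2%nat z).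
  { intros z Hz.
    apply (cderiv_unique (A 1%nat) z).
    - apply (cderiv_ext_loc (fun w => RtoC (2 * PI) * Ci * F w)%C _ _ _ (r - Cmod (z - z0))); [lra| |].
      + intros w Hw. symmetry. apply E1. generalize (Cmod_triangle_minus w z z0). lra.
      + replace (RtoC (2 * PI) * Ci * F' z)%C
          with (0 * F z + RtoC (2 * PI) * Ci * F' z)%C by ring.
        apply (cderiv_mult (fun _ => RtoC (2 * PI) * Ci)%C); [apply cderiv_const|].
        apply HF, Hdisc. lra.
    - replace (A 2%nat z) with (RtoC (INR 1) * A 2%nat z)%C by (simpl; ring).
      apply HA; [left; reflexivity|exact Hz]. }
  assert (Hc0 : Cmod (z0 - z0) < r) by (replace (z0 - z0)%C with (RtoC 0) by ring; rewrite Cmod_0; lra).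
  split; [exact E2|].
  exists (/ (RtoC (2 * PI) * Ci) * (2 * A 3%nat z0))%C. split.
  - apply (cderiv_ext_loc (fun w => / (RtoC (2 * PI) * Ci) * A 2%nat w)%C _ _ _ r Hr).
    + intros w Hw. rewrite <- E2 by exact Hw. rewrite Cmult_assoc, Cinv_l by exact HK. ring.
    + replace (/ (RtoC (2 * PI) * Ci) * (2 * A 3%nat z0))%C
        with (0 * A 2%nat z0 + / (RtoC (2 * PI) * Ci) * (RtoC (INR 2) * A 3%nat z0))%C.
      * apply (cderiv_mult (fun _ => / (RtoC (2 * PI) * Ci))%C); [apply cderiv_const|].
        apply HA; [right; reflexivity|exact Hc0].
      * simpl INR. replace (RtoC (1 + 1)) with (RtoC 2) by (f_equal; ring). ring.
  - rewrite Cmult_assoc, Cinv_r by exact HK. fold (A 3%nat z0). ring.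
Qed.

Lemma small_disc (D : C -> Prop) (z : C) :
  box_domain D -> D z -> exists r, 0 < r /\ disc_in D z r.
Proof.
  intros [HD _] Dz. destruct (HD z Dz) as [r [Hr H]]. exists (r / 2). split; [lra|].
  intros w Hw. apply H. lra.
Qed.

Lemma holo_derivative (D : C -> Prop) (F F' : C -> C) :
  box_domain D -> (forall z, D z -> cderiv F z (F' z)) -> holo D F'.
Proof.
  intros HD HF z Dz. destruct (small_disc D z HD Dz) as [r [Hr Hdisc]].
  destruct (cauchy_formula_derivatives D F F' z r HD HF Hr Hdisc) as [_ [l [Hl _]]].
  exists l; exact Hl.
Qed.

Lemma cauchy_estimate (D : C -> Prop) (F F' : C -> C) (z0 : C) (r M : R) :
  box_domain D -> (forall z, D z -> cderiv F z (F' z)) -> 0 < r -> disc_in D z0 r ->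
  (forall w, Cmod (w - z0) <= r -> Cmod (F w) <= M) -> Cmod (F' z0) <= M / r.
Proof.
  intros HD HF Hr Hdisc HM.
  destruct (cauchy_formula_derivatives D F F' z0 r HD HF Hr Hdisc) as [E _].
  assert (HFh : holo D F) by (intros z Dz; exists (F' z); apply HF, Dz).
  specialize (E z0). replace (z0 - z0)%C with (RtoC 0) in E by ring. rewrite Cmod_0 in E.
  specialize (E Hr). assert (HPI := PI_RGT_0).
  assert (B : Cmod (RtoC (2 * PI) * Ci * F' z0) <= M / r * Rabs (2 * PI - 0)).
  { rewrite E. apply CI_norm_const.
    - intros t _. apply cauchy_transform_cont.
      + apply (cont_circle_density D); assumption.
      + apply continuous_circle.
      + apply Cmod_gt_0. rewrite Cmod_circle; lra.
    - intros t _. unfold circle_density.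
      rewrite !Cmod_mult, Cmod_inv, Cmod_pow, Cmod_circle, Cmod_R, Cmod_Ci, Cmod_cis, Rabs_pos_eq.
      2-4: try lra.
      2: { apply Cpow_nz, Cmod_gt_0. rewrite Cmod_circle; lra. }
      replace (Cmod (F (circle z0 r t)) * (r * (1 * 1)) * / r ^ 2)
        with (Cmod (F (circle z0 r t)) / r) by (field; lra).
      unfold Rdiv. apply Rmult_le_compat_r; [left; apply Rinv_0_lt_compat; lra|].
      apply HM. rewrite Cmod_circle; lra. }
  rewrite !Cmod_mult, Cmod_R, Cmod_Ci, Rminus_0_r in B.
  rewrite !Rabs_pos_eq in B by lra.
  apply Rmult_le_reg_l with (2 * PI); lra.
Qed.

(** Morera: a primitive exists, and the derivative of a holomorphic function is
    holomorphic. *)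
Lemma morera (D : C -> Prop) (G : C -> C) : box_domain D -> rect_null D G -> holo D G.
Proof.
  intros HD HG. destruct (rect_null_primitive D G HD HG) as [Phi HPhi].
  exact (holo_derivative D Phi G HD HPhi).
Qed.

Lemma holo_rect_null (D : C -> Prop) (G : C -> C) : box_domain D -> holo D G -> rect_null D G.
Proof.
  intros HD HG.
  assert (Hc : forall z, D z -> continuous G z)
    by (intros z Dz; destruct (HG z Dz) as [m Hm]; exact (cderiv_continuous _ _ _ Hm)).
  split; [exact Hc|]. intros a b c d.
  apply (goursat_off_line D G 0); [exact HD|exact Hc|].
  intros z Dz _. apply HG, Dz.
Qed.

Lemma holo_off_line (D : C -> Prop) (G : C -> C) (l : R) :
  box_domain D -> (forall z, D z -> continuous G z) ->
  (forall z, D z -> Im z <> l -> exists m, cderiv G z m) -> holo D G.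
Proof.
  intros HD Hc HG. apply morera; [exact HD|]. split; [exact Hc|].
  intros a b c d. apply (goursat_off_line D G l); assumption.
Qed.

Lemma holo_choose (D : C -> Prop) (F : C -> C) :
  holo D F -> exists F', forall z, D z -> cderiv F z (F' z).
Proof.
  intros H.
  exists (fun z => epsilon (inhabits (RtoC 0)) (fun l => cderiv F z l)).
  intros z Dz. apply epsilon_spec. apply H, Dz.
Qed.

(** * Phragmen-Lindelof principles *)

Notation entire_fun := (holo (fun _ => True)).

Lemma exp_le (x y : R) : x <= y -> exp x <= exp y.
Proof. intros [H| ->]; [left; apply exp_increasing, H|apply Rle_refl]. Qed.

Lemma pow_bound_root (a b K : R) : 0 <= a -> 0 < b -> (forall n, a ^ n <= K * b ^ n) -> a <= b.
Proof.
  intros Ha Hb H. apply Rnot_lt_le. intros Hab.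
  assert (Hq : Rabs (a / b) > 1).
  { rewrite Rabs_pos_eq by (apply Rmult_le_pos; [lra|left; apply Rinv_0_lt_compat, Hb]).
    apply Rlt_gt. apply Rmult_lt_reg_r with b; [exact Hb|]. unfold Rdiv.
    rewrite Rmult_assoc, Rinv_l by lra. lra. }
  destruct (Pow_x_infinity (a / b) Hq (K + 1)) as [n Hn].
  specialize (Hn n (Nat.le_refl n)). specialize (H n).
  assert (Hbn : 0 < b ^ n) by (apply pow_lt, Hb).
  rewrite Rabs_pos_eq in Hn
    by (apply pow_le, Rmult_le_pos; [lra|left; apply Rinv_0_lt_compat, Hb]).
  unfold Rdiv in Hn. rewrite Rpow_mult_distr, pow_inv in Hn.
  apply Rge_le in Hn. apply (Rmult_le_compat_r (b ^ n)) in Hn; [|lra].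
  rewrite Rmult_assoc, Rinv_l in Hn by lra. lra.
Qed.

Lemma le_of_limit_exp (a b c : R) :
  0 <= b -> 0 <= c -> (forall d, 0 < d -> a <= b * exp (d * c)) -> a <= b.
Proof.
  intros Hb Hc H. apply Rnot_lt_le. intros Hab.
  destruct (Req_dec b 0) as [->|Hb0]; [specialize (H 1 ltac:(lra)); lra|].
  assert (Hl : 0 < ln (a / b)).
  { rewrite <- ln_1. apply ln_increasing; [lra|].
    apply Rmult_lt_reg_r with b; [lra|]. unfold Rdiv. rewrite Rmult_assoc, Rinv_l by lra. lra. }
  specialize (H (ln (a / b) / (2 * (c + 1)))).
  assert (Hd : 0 < ln (a / b) / (2 * (c + 1))) by (apply Rdiv_lt_0_compat; lra).
  specialize (H Hd).
  assert (E : exp (ln (a / b) / (2 * (c + 1)) * c) < a / b).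
  { rewrite <- (exp_ln (a / b)) at 2 by (apply Rdiv_lt_0_compat; lra).
    apply exp_increasing.
    apply Rmult_lt_reg_r with (2 * (c + 1)); [lra|].
    replace (ln (a / b) / (2 * (c + 1)) * c * (2 * (c + 1))) with (ln (a / b) * c) by (field; lra).
    nra. }
  apply (Rmult_lt_compat_l b) in E; [|lra].
  replace (b * (a / b)) with a in E by (field; lra). lra.
Qed.

Lemma is_derive_atan_scaled (x y t : R) : 0 < y ->
  is_derive (fun t => atan ((t - x) / y)) t (y / ((t - x) ^ 2 + y ^ 2)).
Proof.
  intros Hy. auto_derive; [trivial|]. field.
  generalize (pow2_ge_0 (t - x)) (pow_lt y 2 Hy). split; lra.
Qed.

Lemma continuous_poisson_density (x y t : R) : 0 < y ->
  continuous (fun t => y / ((t - x) ^ 2 + y ^ 2)) t.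
Proof.
  intros Hy. apply @ex_derive_continuous. auto_derive.
  generalize (pow2_ge_0 (t - x)) (pow_lt y 2 Hy). lra.
Qed.

Lemma RInt_poisson_density (x y a b : R) : 0 < y ->
  is_RInt (fun t => y / ((t - x) ^ 2 + y ^ 2)) a b (atan ((b - x) / y) - atan ((a - x) / y)).
Proof.
  intros Hy. apply (is_RInt_derive (V := R_CompleteNormedModule) (fun t => atan ((t - x) / y))).
  - intros t _. apply is_derive_atan_scaled, Hy.
  - intros t _. apply continuous_poisson_density, Hy.
Qed.

Lemma RInt_nonpos (f : R -> R) (a b : R) :
  a <= b -> ex_RInt f a b -> (forall t, a < t < b -> f t <= 0) -> RInt f a b <= 0.
Proof.
  intros Hab Hf H. replace 0 with (RInt (fun _ => 0) a b).
  - apply RInt_le; [exact Hab|exact Hf|apply @ex_RInt_const|exact H].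
  - rewrite RInt_const. apply Rmult_0_r.
Qed.

Lemma Re_inv (z : C) : Re (/ z) = Re z / (Re z ^ 2 + Im z ^ 2).
Proof. reflexivity. Qed.

Lemma Im_inv (z : C) : Im (/ z) = - Im z / (Re z ^ 2 + Im z ^ 2).
Proof. reflexivity. Qed.

Lemma inv_mult_le_half_squares (a b : R) : 0 < a -> 0 < b -> / (a * b) <= (/ a ^ 2 + / b ^ 2) / 2.
Proof.
  intros Ha Hb. rewrite Rinv_mult, <- !pow_inv.
  generalize (Rle_0_sqr (/ a - / b)). unfold Rsqr. lra.
Qed.

Lemma sum_of_squares_pos (x y : R) : x <> 0 -> 0 < x ^ 2 + y ^ 2.
Proof. intros H. generalize (pow2_gt_0 x H) (pow2_ge_0 y). lra. Qed.

(** On the axis through [w] in the direction transversal to the offset [y], both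
    kernels are dominated by Poisson densities, whose mass is at most [PI]. *)
Lemma axis_integral_bound (f : R -> C) (x y A m : R) :
  0 < y -> 0 <= A -> 0 <= m -> cont_between f 0 A ->
  (forall t, 0 <= t <= A -> Cmod (f t) <= m * ((/ ((t - 0) ^ 2 + 1 ^ 2) + / ((t - x) ^ 2 + y ^ 2)) / 2)) ->
  Cmod (CI f 0 A) <= m * ((PI + PI / y) / 2).
Proof.
  intros Hy HA Hm Hc Hf.
  set (h := fun t => m / 2 * (1 / ((t - 0) ^ 2 + 1 ^ 2)) + (m / (2 * y)) * (y / ((t - x) ^ 2 + y ^ 2))).
  assert (Hh : is_RInt h 0 A (m / 2 * (atan ((A - 0) / 1) - atan ((0 - 0) / 1))
     + m / (2 * y) * (atan ((A - x) / y) - atan ((0 - x) / y)))).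
  { apply (is_RInt_plus (V := R_NormedModule)); apply (is_RInt_scal (V := R_NormedModule));
    apply RInt_poisson_density; lra. }
  eapply Rle_trans.
  - apply (CI_norm_le f h); [exact HA|exact Hc|eexists; exact Hh|].
    intros t Ht. eapply Rle_trans; [apply Hf, Ht|]. unfold h. right.
    field. generalize (pow2_ge_0 (t - x)) (pow_lt y 2 Hy) (pow2_ge_0 t); intros; repeat split; lra.
  - apply Rle_trans with (1 := Req_le _ _ (is_RInt_unique _ _ _ _ Hh)).
    generalize (atan_bound ((A - x) / y)) (atan_bound ((0 - x) / y))
      (atan_bound ((A - 0) / 1)) (atan_bound ((0 - 0) / 1)). intros.
    replace (m * ((PI + PI / y) / 2)) with (m / 2 * PI + m / (2 * y) * PI) by (field; lra).
    apply Rplus_le_compat; apply Rmult_le_compat_l; try lra.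
    apply Rmult_le_pos; [lra|]. left. apply Rinv_0_lt_compat. lra.
Qed.

(** Cauchy's formula on a large square for [Q^n / (w + i)]: the kernel makes the
    far sides negligible and the integrals along the axes converge, so
    [|Q|^n <= K M^n] with [K] independent of [n], and the [n]-th root removes [K]. *)
Lemma phragmen_lindelof_quadrant (Q : C -> C) (M K0 : R) :
  entire_fun Q -> 0 < M ->
  (forall x y, 0 <= x -> 0 <= y -> Cmod (Q (x, y)) <= K0) ->
  (forall x, 0 <= x -> Cmod (Q (x, 0)) <= M) ->
  (forall y, 0 <= y -> Cmod (Q (0, y)) <= M) ->
  forall x y, 0 <= x -> 0 <= y -> Cmod (Q (x, y)) <= M.
Proof.
  intros HQ HM HK HR HI x0 y0 Hx0' Hy0'.
  destruct (Req_dec x0 0) as [->|Hx0n]; [apply HI, Hy0'|].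
  destruct (Req_dec y0 0) as [->|Hy0n]; [apply HR, Hx0'|].
  assert (Hx0 : 0 < x0) by lra. assert (Hy0 : 0 < y0) by lra. clear Hx0' Hy0' Hx0n Hy0n.
  assert (HK0 : 0 <= K0) by (eapply Rle_trans; [apply (Cmod_ge_0 (Q (0, 0)))|apply HK; lra]).
  set (z := (x0, y0) : C).
  set (kap := atan (x0 / y0)).
  assert (Hkap : 0 < kap).
  { unfold kap. rewrite <- atan_0. apply atan_increasing. apply Rdiv_lt_0_compat; assumption. }
  set (L := (PI + PI / y0) / 2 + (PI + PI / x0) / 2).
  assert (Hzi : forall w : C, 0 <= Im w -> (w + Ci)%C <> RtoC 0).
  { intros w Hw E. apply (f_equal Im) in E. rewrite im_plus in E. simpl in E. lra. }
  apply pow_bound_root with (L * Cmod (z + Ci) / kap); [apply Cmod_ge_0|exact HM|].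
  intros n.
  set (D := fun w : C => -1 < Im w).
  assert (HD : box_domain D) by apply box_domain_above.
  set (G := fun w => (Q w ^ n * / (w + Ci))%C).
  assert (Hpow : forall w, exists m, cderiv (fun w => Q w ^ n)%C w m).
  { intros w. destruct (HQ w I) as [l Hl]. destruct n as [|k].
    - exists (RtoC 0). exact (cderiv_const (RtoC 1) w).
    - eexists. apply (cderiv_comp (fun v => v ^ S k)%C Q); [apply cderiv_pow|exact Hl]. }
  assert (HG : holo D G).
  { intros w Dw. destruct (Hpow w) as [m Hm]. eexists. apply cderiv_mult; [exact Hm|].
    apply (cderiv_inv (fun w => w + Ci)%C).
    - intros E. apply (f_equal Im) in E. rewrite im_plus in E. unfold D in Dw. simpl in E. lra.
    - apply cderiv_plus; [apply cderiv_id|apply cderiv_const]. }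
  assert (Dz : D z) by (unfold D, z; simpl; lra).
  destruct (HG z Dz) as [l [q [Hq [_ Hcq]]]].
  assert (Hq' : forall w, w <> z -> q w = (G w * / (w - z) - G z * / (w - z))%C).
  { intros w Hw. rewrite (Hq w). field. intros E. apply Hw, Ceq_minus, E. }
  assert (Hqd : forall w, D w -> w <> z -> exists m, cderiv q w m).
  { intros w Dw Hw. destruct (HG w Dw) as [m Hm].
    assert (Hwz : (w - z)%C <> RtoC 0) by (intros E; apply Hw; apply Ceq_minus; exact E).
    eexists. apply (cderiv_ext_loc (fun v => G v * / (v - z) - G z * / (v - z))%C _ _ _ (Cmod (w - z))).
    - apply Cmod_gt_0. exact Hwz.
    - intros v Hv. symmetry. apply Hq'. intros ->. rewrite Cmod_minus_sym in Hv. lra.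
    - assert (Hi : cderiv (fun v => / (v - z))%C w (- (1 - 0) / ((w - z) * (w - z)))%C).
      { apply (cderiv_inv (fun v => v - z)%C); [exact Hwz|].
        apply cderiv_minus; [apply cderiv_id|apply cderiv_const]. }
      apply cderiv_minus; apply cderiv_mult; first [exact Hm|exact Hi|apply cderiv_const]. }
  assert (Hqc : forall w, D w -> continuous q w).
  { intros w Dw. destruct (Ceq_dec w z) as [->|N]; [exact Hcq|].
    destruct (Hqd w Dw N) as [m Hm]. exact (cderiv_continuous _ _ _ Hm). }
  assert (H0 : forall A, 0 <= A -> rect_int q 0 A 0 A = RtoC 0).
  { intros A HA. apply (goursat_off_line D q y0); try assumption.
    - intros w Dw Hn. apply Hqd; [exact Dw|]. intros ->. apply Hn. reflexivity.
    - unfold D; simpl; lra.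
    - unfold D; simpl; lra. }
  (* the inequality for each side length A, from which A is sent to infinity *)
  assert (key : forall A, x0 + y0 < A -> kap * Cmod (G z) <=
     M ^ n * L + K0 ^ n * (/ (A - x0) + / (A - y0))).
  { intros A HA.
    set (k := fun w => (/ (w - z))%C). set (f := fun w => (G w * / (w - z))%C).
    set (S0 := fun t : R => (t, 0) : C). set (S1 := fun t : R => (A, t) : C).
    set (S2 := fun t : R => (t, A) : C). set (S3 := fun t : R => (0, t) : C).
    assert (side : forall S : R -> C, (S = S0 \/ S = S1 \/ S = S2 \/ S = S3) ->
       forall t, 0 <= t <= A -> (S t - z)%C <> RtoC 0 /\ 0 <= Re (S t) /\ 0 <= Im (S t)).
    { intros S HS t Ht. split.
      - intros E. assert (E1 := f_equal Re E). assert (E2 := f_equal Im E).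
        destruct HS as [-> | [-> | [-> | ->]]]; unfold S0, S1, S2, S3, z in E1, E2; simpl in E1, E2; lra.
      - destruct HS as [-> | [-> | [-> | ->]]]; unfold S0, S1, S2, S3; simpl; lra. }
    assert (contS : forall S : R -> C, (S = S0 \/ S = S1 \/ S = S2 \/ S = S3) -> forall t, continuous S t).
    { intros S HS t. destruct HS as [-> | [-> | [-> | ->]]];
      first [apply continuous_horizontal|apply continuous_vertical]. }
    assert (contk : forall S : R -> C, (S = S0 \/ S = S1 \/ S = S2 \/ S = S3) ->
       cont_between (fun t => k (S t)) 0 A).
    { intros S HS t Ht. rewrite Rmin_left, Rmax_right in Ht by lra.
      apply continuous_Cinv; [apply side; assumption|].
      apply continuous_Cminus; [apply contS, HS|apply continuous_const]. }
    assert (contf : forall S : R -> C, (S = S0 \/ S = S1 \/ S = S2 \/ S = S3) ->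
       cont_between (fun t => f (S t)) 0 A).
    { intros S HS t Ht. apply continuous_Cmult; [|apply contk; assumption].
      rewrite Rmin_left, Rmax_right in Ht by lra.
      apply continuous_comp; [apply contS, HS|].
      destruct (HG (S t)) as [m Hm]; [|exact (cderiv_continuous _ _ _ Hm)].
      destruct (side S HS t Ht) as [_ [_ Hi]]. unfold D. lra. }
    assert (split_q : forall S : R -> C, (S = S0 \/ S = S1 \/ S = S2 \/ S = S3) ->
       CI (fun t => q (S t)) 0 A = (CI (fun t => f (S t)) 0 A - G z * CI (fun t => k (S t)) 0 A)%C).
    { intros S HS. rewrite <- CI_scal, <- CI_minus.
      - apply CI_ext. intros t Ht. rewrite Rmin_left, Rmax_right in Ht by lra.
        apply Hq'. intros E. destruct (side S HS t ltac:(lra)) as [N _]. apply N. rewrite E. ring.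
      - apply contf, HS.
      - apply cont_between_scal, contk, HS.
      - apply contk, HS. }
    assert (i0 : S0 = S0 \/ S0 = S1 \/ S0 = S2 \/ S0 = S3) by tauto.
    assert (i1 : S1 = S0 \/ S1 = S1 \/ S1 = S2 \/ S1 = S3) by tauto.
    assert (i2 : S2 = S0 \/ S2 = S1 \/ S2 = S2 \/ S2 = S3) by tauto.
    assert (i3 : S3 = S0 \/ S3 = S1 \/ S3 = S2 \/ S3 = S3) by tauto.
    set (J := (CI (fun t => k (S0 t)) 0 A + Ci * CI (fun t => k (S1 t)) 0 A
      - CI (fun t => k (S2 t)) 0 A - Ci * CI (fun t => k (S3 t)) 0 A)%C).
    assert (E : (G z * J)%C = (CI (fun t => f (S0 t)) 0 A + Ci * CI (fun t => f (S1 t)) 0 A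
      - CI (fun t => f (S2 t)) 0 A - Ci * CI (fun t => f (S3 t)) 0 A)%C).
    { assert (E := H0 A ltac:(lra)). unfold rect_int in E.
      change (fun t : R => q (t, 0)) with (fun t => q (S0 t)) in E.
      change (fun t : R => q (A, t)) with (fun t => q (S1 t)) in E.
      change (fun t : R => q (t, A)) with (fun t => q (S2 t)) in E.
      change (fun t : R => q (0, t)) with (fun t => q (S3 t)) in E.
      rewrite !split_q in E by assumption. unfold J.
      match type of E with ?a = _ => match goal with |- _ = ?b =>
        transitivity (b - a)%C; [ring|rewrite E; ring] end end. }
    (* each side of the square turns counterclockwise around z *)
    assert (HJ : kap <= Cmod J).
    { apply Rle_trans with (Im J); [|eapply Rle_trans; [apply Rle_abs|apply Im_le_Cmod]].
      assert (P0 : kap <= Im (CI (fun t => k (S0 t)) 0 A)).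
      { change (kap <= RInt (fun t => Im (k (S0 t))) 0 A).
        rewrite (RInt_ext _ (fun t => y0 / ((t - x0) ^ 2 + y0 ^ 2))).
        - rewrite (is_RInt_unique _ _ _ _ (RInt_poisson_density x0 y0 0 A Hy0)).
          replace ((0 - x0) / y0) with (- (x0 / y0)) by (field; lra). rewrite atan_opp.
          fold kap. assert (0 < atan ((A - x0) / y0)).
          { rewrite <- atan_0. apply atan_increasing. apply Rdiv_lt_0_compat; lra. }
          lra.
        - intros t _. unfold k. rewrite Im_inv. unfold S0, z; simpl.
          replace (- (0 + - y0)) with y0 by ring. f_equal. ring. }
      assert (P1 : 0 <= Re (CI (fun t => k (S1 t)) 0 A)).
      { change (0 <= RInt (fun t => Re (k (S1 t))) 0 A).
        apply RInt_ge_0; [lra|apply ex_RInt_Re, contk; assumption|].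
        intros t Ht. unfold k. rewrite Re_inv. unfold S1, z; simpl.
        apply Rmult_le_pos; [lra|]. left. apply Rinv_0_lt_compat.
        generalize (sum_of_squares_pos (A + - x0) (t + - y0)). simpl. lra. }
      assert (P2 : Im (CI (fun t => k (S2 t)) 0 A) <= 0).
      { apply RInt_nonpos; [lra|apply ex_RInt_Im, contk; assumption|].
        intros t Ht. unfold k. rewrite Im_inv. unfold S2, z, Cminus.
        rewrite re_plus, im_plus, re_opp, im_opp. simpl Re. simpl Im.
        assert (0 < (A + - y0) ^ 2 + (t + - x0) ^ 2) by (apply sum_of_squares_pos; lra).
        apply Ropp_le_cancel. rewrite Ropp_0.
        replace (- (- (A + - y0) / ((t + - x0) ^ 2 + (A + - y0) ^ 2)))
         with ((A - y0) * / ((A + - y0) ^ 2 + (t + - x0) ^ 2)) by (field; lra).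
        apply Rmult_le_pos; [lra|]. left. apply Rinv_0_lt_compat. assumption. }
      assert (P3 : Re (CI (fun t => k (S3 t)) 0 A) <= 0).
      { apply RInt_nonpos; [lra|apply ex_RInt_Re, contk; assumption|].
        intros t Ht. unfold k. rewrite Re_inv. unfold S3, z, Cminus.
        rewrite re_plus, im_plus, re_opp, im_opp. simpl Re. simpl Im.
        assert (0 < (0 + - x0) ^ 2 + (t + - y0) ^ 2) by (apply sum_of_squares_pos; lra).
        apply Ropp_le_cancel. rewrite Ropp_0.
        replace (- ((0 + - x0) / ((0 + - x0) ^ 2 + (t + - y0) ^ 2)))
         with (x0 * / ((0 + - x0) ^ 2 + (t + - y0) ^ 2)) by (field; lra).
        apply Rmult_le_pos; [lra|]. left. apply Rinv_0_lt_compat. assumption. }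
      unfold J, Cminus. rewrite !im_plus, !im_opp, !im_mult. simpl (Re Ci). simpl (Im Ci). lra. }
    assert (Gb : forall (w : C) (m : R), 0 <= Im w -> Cmod (Q w) <= m ->
       Cmod (f w) <= m ^ n * / (Cmod (w + Ci) * Cmod (w - z))).
    { intros w m Hw Hm. destruct (Ceq_dec w z) as [->|N].
      - unfold f. replace (z - z)%C with (RtoC 0) by ring.
        rewrite Cmod_0, Rmult_0_r, Rinv_0, Rmult_0_r, Cmod_mult.
        replace (/ RtoC 0)%C with (RtoC 0).
        + rewrite Cmod_0. lra.
        + unfold Cinv; simpl. unfold RtoC. f_equal; unfold Rdiv; ring.
      - assert (N' : (w - z)%C <> RtoC 0) by (intros E2; apply N, Ceq_minus, E2).
        unfold f, G. rewrite !Cmod_mult, !Cmod_inv, Cmod_pow, Rinv_mult by first [exact N'|apply Hzi, Hw].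
        rewrite Rmult_assoc. apply Rmult_le_compat_r.
        + apply Rmult_le_pos; left; apply Rinv_0_lt_compat, Cmod_gt_0; [apply Hzi, Hw|exact N'].
        + apply pow_incr. split; [apply Cmod_ge_0|exact Hm]. }
    assert (near : forall (S : R -> C) x y, (S = S0 \/ S = S1 \/ S = S2 \/ S = S3) -> 0 < y ->
      (forall t, 0 <= t <= A -> Cmod (Q (S t)) <= M /\ (t - 0) ^ 2 + 1 ^ 2 <= Cmod (S t + Ci) ^ 2 /\
         (t - x) ^ 2 + y ^ 2 = Cmod (S t - z) ^ 2) ->
      Cmod (CI (fun t => f (S t)) 0 A) <= M ^ n * ((PI + PI / y) / 2)).
    { intros S x y HS Hy H. apply (axis_integral_bound _ x); [exact Hy|lra|apply pow_le; lra|apply contf, HS|].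
      intros t Ht. destruct (H t Ht) as [B1 [B2 B3]]. destruct (side S HS t Ht) as [N [_ Hi]].
      eapply Rle_trans; [apply Gb; [exact Hi|exact B1]|].
      apply Rmult_le_compat_l; [apply pow_le; lra|].
      eapply Rle_trans.
      - apply inv_mult_le_half_squares; apply Cmod_gt_0; [apply Hzi, Hi|exact N].
      - rewrite B3. apply Rmult_le_compat_r; [lra|]. apply Rplus_le_compat_r.
        apply Rinv_le_contravar; [generalize (pow2_ge_0 (t - 0)); simpl; lra|exact B2]. }
    assert (N0 : Cmod (CI (fun t => f (S0 t)) 0 A) <= M ^ n * ((PI + PI / y0) / 2)).
    { apply (near S0 x0 y0 i0 Hy0). intros t Ht. split; [apply HR; lra|].
      rewrite !Cmod2_alt. unfold S0, z. simpl. lra. }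
    assert (N3 : Cmod (CI (fun t => f (S3 t)) 0 A) <= M ^ n * ((PI + PI / x0) / 2)).
    { apply (near S3 y0 x0 i3 Hx0). intros t Ht. split; [apply HI; lra|].
      rewrite !Cmod2_alt. unfold S3, z. simpl. nra. }
    assert (far : forall (S : R -> C) e, (S = S0 \/ S = S1 \/ S = S2 \/ S = S3) -> 0 < e ->
      (forall t, 0 <= t <= A -> A <= Cmod (S t + Ci) /\ e <= Cmod (S t - z)) ->
      Cmod (CI (fun t => f (S t)) 0 A) <= K0 ^ n * / e).
    { intros S e HS He H.
      replace (K0 ^ n * / e) with (K0 ^ n * / (A * e) * Rabs (A - 0))
        by (rewrite Rabs_pos_eq by lra; field; lra).
      apply CI_norm_const; [apply contf, HS|].
      intros t Ht. rewrite Rmin_left, Rmax_right in Ht by lra.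
      destruct (side S HS t Ht) as [N [Hr Hi]]. destruct (H t Ht) as [B1 B2].
      eapply Rle_trans; [apply Gb; [exact Hi|]|].
      - destruct (S t) as [a b]. apply HK; assumption.
      - apply Rmult_le_compat_l; [apply pow_le; lra|].
        apply Rinv_le_contravar; [apply Rmult_lt_0_compat; lra|]. apply Rmult_le_compat; lra. }
    assert (N1 : Cmod (CI (fun t => f (S1 t)) 0 A) <= K0 ^ n * / (A - x0)).
    { apply (far S1); [tauto|lra|]. intros t Ht. split.
      - eapply Rle_trans; [|apply Re_le_Cmod]. eapply Rle_trans; [|apply Rle_abs].
        rewrite re_plus. unfold S1; simpl; lra.
      - eapply Rle_trans; [|apply Re_le_Cmod]. eapply Rle_trans; [|apply Rle_abs].
        unfold Cminus. rewrite re_plus, re_opp. unfold S1, z; simpl; lra. }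
    assert (N2 : Cmod (CI (fun t => f (S2 t)) 0 A) <= K0 ^ n * / (A - y0)).
    { apply (far S2); [tauto|lra|]. intros t Ht. split.
      - eapply Rle_trans; [|apply Im_le_Cmod]. eapply Rle_trans; [|apply Rle_abs].
        rewrite im_plus. unfold S2; simpl; lra.
      - eapply Rle_trans; [|apply Im_le_Cmod]. eapply Rle_trans; [|apply Rle_abs].
        unfold Cminus. rewrite im_plus, im_opp. unfold S2, z; simpl; lra. }
    apply Rle_trans with (Cmod (G z * J)).
    { rewrite Cmod_mult, (Rmult_comm kap). apply Rmult_le_compat_l; [apply Cmod_ge_0|exact HJ]. }
    rewrite E. unfold Cminus.
    eapply Rle_trans; [apply Cmod_triangle|].
    eapply Rle_trans; [apply Rplus_le_compat_r, Cmod_triangle|].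
    eapply Rle_trans; [apply Rplus_le_compat_r, Rplus_le_compat_r, Cmod_triangle|].
    rewrite !Cmod_opp, !Cmod_mult, Cmod_Ci. unfold L. lra. }
  assert (lim : kap * Cmod (G z) <= M ^ n * L).
  { apply le_epsilon. intros e He.
    set (A := x0 + y0 + 1 + 2 * K0 ^ n / e).
    assert (Hp : 0 <= K0 ^ n) by (apply pow_le, HK0).
    assert (He2 : 0 <= 2 * K0 ^ n / e).
    { apply Rmult_le_pos; [lra|left; apply Rinv_0_lt_compat, He]. }
    eapply Rle_trans; [apply (key A); unfold A; lra|]. apply Rplus_le_compat_l.
    assert (T : forall u, 2 * K0 ^ n / e < u -> K0 ^ n * / u <= e / 2).
    { intros u Hu. apply Rmult_le_reg_r with u; [lra|]. rewrite Rmult_assoc, Rinv_l by lra.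
      apply Rmult_lt_compat_r with (r := e) in Hu; [|exact He].
      unfold Rdiv in Hu. rewrite Rmult_assoc, Rinv_l in Hu by lra. lra. }
    rewrite Rmult_plus_distr_l.
    assert (2 * K0 ^ n / e < A - x0) by (unfold A; lra).
    assert (2 * K0 ^ n / e < A - y0) by (unfold A; lra).
    generalize (T _ H) (T _ H1). lra. }
  assert (Ez : Cmod (G z) = Cmod (Q z) ^ n / Cmod (z + Ci)).
  { unfold G. rewrite Cmod_mult, Cmod_pow, Cmod_inv; [reflexivity|]. apply Hzi. unfold z; simpl; lra. }
  assert (Hz0 : 0 < Cmod (z + Ci)) by (apply Cmod_gt_0, Hzi; unfold z; simpl; lra).
  rewrite Ez in lim. fold z.
  apply Rmult_le_reg_l with (kap / Cmod (z + Ci)); [apply Rdiv_lt_0_compat; assumption|].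
  replace (kap / Cmod (z + Ci) * Cmod (Q z) ^ n) with (kap * (Cmod (Q z) ^ n / Cmod (z + Ci))) by (field; lra).
  replace (kap / Cmod (z + Ci) * (L * Cmod (z + Ci) / kap * M ^ n)) with (M ^ n * L) by (field; split; lra).
  exact lim.
Qed.

Lemma Csqrt_quadrant (x y : R) : 0 <= y ->
  exists a b, 0 <= a /\ 0 <= b /\ ((a, b) * (a, b))%C = (x, y).
Proof.
  intros Hy. set (r := sqrt (x ^ 2 + y ^ 2)).
  assert (Hr2 : r * r = x ^ 2 + y ^ 2).
  { apply sqrt_sqrt. generalize (pow2_ge_0 x) (pow2_ge_0 y); lra. }
  assert (Hr : 0 <= r) by apply sqrt_pos.
  assert (H1 : 0 <= (r + x) / 2) by nra. assert (H2 : 0 <= (r - x) / 2) by nra.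
  exists (sqrt ((r + x) / 2)), (sqrt ((r - x) / 2)).
  split; [apply sqrt_pos|split; [apply sqrt_pos|]].
  assert (E : sqrt ((r + x) / 2) * sqrt ((r - x) / 2) = y / 2).
  { rewrite <- sqrt_mult by assumption. rewrite <- (sqrt_Rsqr (y / 2)) by lra. f_equal.
    unfold Rsqr. nra. }
  unfold Cmult; simpl. f_equal.
  - rewrite !sqrt_sqrt by assumption. lra.
  - rewrite (Rmult_comm (sqrt ((r - x) / 2))), E. lra.
Qed.

Lemma cderiv_square (z : C) : cderiv (fun w => w * w)%C z (1 * z + z * 1)%C.
Proof. apply (cderiv_mult (fun w => w) (fun w => w)); apply cderiv_id. Qed.

(** The squaring map opens the quadrant to the half-plane. *)
Lemma phragmen_lindelof_half_plane (Q : C -> C) (M K0 : R) :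
  entire_fun Q -> 0 < M ->
  (forall x y, 0 <= y -> Cmod (Q (x, y)) <= K0) ->
  (forall x, Cmod (Q (x, 0)) <= M) ->
  forall x y, 0 <= y -> Cmod (Q (x, y)) <= M.
Proof.
  intros HQ HM HK HR x y Hy.
  destruct (Csqrt_quadrant x y Hy) as [a [b [Ha [Hb <-]]]].
  apply (phragmen_lindelof_quadrant (fun w => Q (w * w)%C) M K0); try assumption.
  - intros w _. destruct (HQ (w * w)%C I) as [l Hl]. eexists.
    apply (cderiv_comp Q (fun w => w * w)%C); [exact Hl|apply cderiv_square].
  - intros s t Hs Ht. unfold Cmult; simpl. apply HK. nra.
  - intros s Hs. unfold Cmult; simpl.
    replace (s * 0 + 0 * s) with 0 by ring. apply HR.
  - intros t Ht. unfold Cmult; simpl.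
    replace (0 * t + t * 0) with 0 by ring. apply HR.
Qed.

(** The factor [exp (i s w + i d w^2)] has modulus [exp (- s y - 2 d x y)]: it is
    harmless on the axes and for [x] large beats the a priori growth in [y], while
    for bounded [x] the type bound applies.  Then [d] tends to [0]. *)
Lemma phragmen_lindelof_type (Q : C -> C) (K T s : R) :
  entire_fun Q -> 0 < K -> 0 <= T -> 0 <= s ->
  (forall x y, 0 <= x -> 0 <= y -> Cmod (Q (x, y)) <= K * exp (T * y)) ->
  (forall z, Cmod (Q z) <= K * exp (s * Cmod z)) ->
  forall x y, 0 <= x -> 0 <= y -> Cmod (Q (x, y)) <= K * exp (s * y).
Proof.
  intros HQ HK HT Hs HB HE x y Hx Hy.
  assert (main : forall d, 0 < d -> forall x y, 0 <= x -> 0 <= y ->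
    Cmod (Q (x, y)) * exp (- (s * y) - 2 * d * x * y) <= K).
  { intros d Hd.
    set (m := fun w => (Ci * RtoC s * w + Ci * RtoC d * (w * w))%C).
    assert (Em : forall u v, Cmod (Q (u, v) * Cexp (m (u, v))) =
       Cmod (Q (u, v)) * exp (- (s * v) - 2 * d * u * v)).
    { intros u v. rewrite Cmod_mult, Cmod_Cexp. f_equal. f_equal.
      unfold m. unfold Ci, RtoC, Cmult, Cplus; simpl. ring. }
    assert (HX : 0 <= T / (2 * d)) by (apply Rmult_le_pos; [lra|left; apply Rinv_0_lt_compat; lra]).
    intros u v Hu Hv. rewrite <- Em. revert u v Hu Hv.
    apply (phragmen_lindelof_quadrant (fun w => Q w * Cexp (m w))%C K (K * exp (s * (T / (2 * d)))));
      try assumption.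
    - intros w _. destruct (HQ w I) as [l Hl]. eexists. apply cderiv_mult; [exact Hl|].
      apply (cderiv_comp Cexp m); [apply cderiv_Cexp|]. unfold m.
      apply cderiv_plus.
      + apply (cderiv_mult (fun _ => Ci * RtoC s)%C); [apply cderiv_const|apply cderiv_id].
      + apply (cderiv_mult (fun _ => Ci * RtoC d)%C); [apply cderiv_const|apply cderiv_square].
    - intros u v Hu Hv. rewrite Em.
      destruct (Rle_dec T (2 * d * u)) as [L|L].
      + apply Rle_trans with (K * exp (T * v) * exp (- (s * v) - 2 * d * u * v)).
        * apply Rmult_le_compat_r; [left; apply exp_pos|apply HB; assumption].
        * rewrite Rmult_assoc, <- exp_plus. apply Rmult_le_compat_l; [lra|].
          apply exp_le. assert (0 <= s * (T / (2 * d))) by (apply Rmult_le_pos; assumption).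
          assert (0 <= s * v) by (apply Rmult_le_pos; assumption). nra.
      + apply Rle_trans with (K * exp (s * (u + v)) * exp (- (s * v) - 2 * d * u * v)).
        * apply Rmult_le_compat_r; [left; apply exp_pos|]. eapply Rle_trans; [apply HE|].
          apply Rmult_le_compat_l; [lra|]. apply exp_le. apply Rmult_le_compat_l; [lra|].
          eapply Rle_trans; [apply Cmod_le_Re_Im|]. simpl. rewrite !Rabs_pos_eq by lra. lra.
        * rewrite Rmult_assoc, <- exp_plus. apply Rmult_le_compat_l; [lra|].
          apply exp_le.
          assert (u <= T / (2 * d)).
          { apply Rmult_le_reg_r with (2 * d); [lra|]. unfold Rdiv.
            rewrite Rmult_assoc, Rinv_l by lra. lra. }
          assert (s * u <= s * (T / (2 * d))) by (apply Rmult_le_compat_l; assumption).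
          assert (0 <= 2 * d * u * v) by (repeat apply Rmult_le_pos; lra). lra.
    - intros u Hu. rewrite Em. replace (- (s * 0) - 2 * d * u * 0) with 0 by ring.
      rewrite exp_0, Rmult_1_r. eapply Rle_trans; [apply HB; lra|].
      rewrite Rmult_0_r, exp_0. lra.
    - intros v Hv. rewrite Em. replace (- (s * v) - 2 * d * 0 * v) with (- (s * v)) by ring.
      apply Rle_trans with (K * exp (s * v) * exp (- (s * v))).
      + apply Rmult_le_compat_r; [left; apply exp_pos|]. eapply Rle_trans; [apply HE|].
        apply Rmult_le_compat_l; [lra|]. apply exp_le. apply Rmult_le_compat_l; [lra|].
        eapply Rle_trans; [apply Cmod_le_Re_Im|]. simpl. rewrite Rabs_R0, Rabs_pos_eq by lra. lra.
      + rewrite Rmult_assoc, <- exp_plus. replace (s * v + - (s * v)) with 0 by ring.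
        rewrite exp_0. lra. }
  apply le_of_limit_exp with (2 * x * y).
  - apply Rmult_le_pos; [lra|left; apply exp_pos].
  - repeat apply Rmult_le_pos; lra.
  - intros d Hd. specialize (main d Hd x y Hx Hy).
    apply Rmult_le_reg_r with (exp (- (s * y) - 2 * d * x * y)); [apply exp_pos|].
    eapply Rle_trans; [exact main|]. rewrite !Rmult_assoc, <- !exp_plus.
    match goal with |- _ <= K * exp ?e => replace e with 0 by ring end. rewrite exp_0. lra.
Qed.

(** * Almost periodic functions *)

Lemma Cmod_chi (w x : R) : Cmod (chi w x) = 1.
Proof. apply Cmod_cis. Qed.

Lemma chi_plus_l (w v x : R) : chi (w + v) x = (chi w x * chi v x)%C.
Proof.
  unfold chi. replace ((w + v) * x) with (w * x + v * x) by ring.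
  rewrite cos_plus, sin_plus. unfold Cmult; simpl. f_equal; ring.
Qed.

Lemma chi_plus_r (w x y : R) : chi w (x + y) = (chi w x * chi w y)%C.
Proof.
  unfold chi. replace (w * (x + y)) with (w * x + w * y) by ring.
  rewrite cos_plus, sin_plus. unfold Cmult; simpl. f_equal; ring.
Qed.

Lemma chi_0_l (x : R) : chi 0 x = RtoC 1.
Proof. unfold chi. rewrite Rmult_0_l, cos_0, sin_0. reflexivity. Qed.

Lemma chi_opp_r (w x : R) : chi w (- x) = chi (- w) x.
Proof. unfold chi. do 2 f_equal; ring. Qed.

Lemma rderiv_chi (w t : R) : rderiv (chi w) t (Ci * RtoC w * chi w t)%C.
Proof.
  apply rderiv_split. unfold chi. split; simpl; auto_derive; trivial; ring.
Qed.

Lemma continuous_chi (w t : R) : continuous (chi w) t.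
Proof.
  apply continuous_C_split. split; simpl.
  - apply (continuous_comp (fun x => w * x) cos); [|apply continuous_cos].
    apply @continuous_mult; [apply continuous_const|apply continuous_id].
  - apply (continuous_comp (fun x => w * x) sin); [|apply continuous_sin].
    apply @continuous_mult; [apply continuous_const|apply continuous_id].
Qed.

(** ** Trigonometric polynomials as lists of (coefficient, frequency) *)

Definition tpoly (l : list (C * R)) (x : R) : C :=
  fold_right (fun p s => (fst p * chi (snd p) x + s)%C) (RtoC 0) l.

Definition coeff_sum (l : list (C * R)) : R :=
  fold_right (fun p s => Cmod (fst p) + s) 0 l.

Lemma coeff_sum_ge_0 (l : list (C * R)) : 0 <= coeff_sum l.
Proof. induction l as [|p l IH]; simpl; [lra|]. generalize (Cmod_ge_0 (fst p)); lra. Qed.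

Lemma Cmod_tpoly_le (l : list (C * R)) (x : R) : Cmod (tpoly l x) <= coeff_sum l.
Proof.
  induction l as [|p l IH]; simpl; [rewrite Cmod_0; lra|].
  eapply Rle_trans; [apply Cmod_triangle|]. rewrite Cmod_mult, Cmod_chi. lra.
Qed.

Lemma continuous_tpoly (l : list (C * R)) (x : R) : continuous (tpoly l) x.
Proof.
  induction l as [|p l IH]; simpl; [apply continuous_const|].
  apply continuous_Cplus; [|exact IH].
  apply continuous_Cmult; [apply continuous_const|apply continuous_chi].
Qed.

Lemma tpoly_app (l l' : list (C * R)) (x : R) :
  tpoly (l ++ l') x = (tpoly l x + tpoly l' x)%C.
Proof. induction l as [|p l IH]; simpl; [ring|]. rewrite IH. ring. Qed.

Definition tpoly_shift (p : C * R) (l : list (C * R)) : list (C * R) :=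
  map (fun q => ((fst p * fst q)%C, snd p + snd q)) l.

Lemma tpoly_shift_eq (p : C * R) (l : list (C * R)) (x : R) :
  tpoly (tpoly_shift p l) x = (fst p * chi (snd p) x * tpoly l x)%C.
Proof.
  induction l as [|q l IH]; simpl; [ring|]. rewrite IH, chi_plus_l. ring.
Qed.

Definition tpoly_mult (l l' : list (C * R)) : list (C * R) :=
  flat_map (fun p => tpoly_shift p l') l.

Lemma tpoly_mult_eq (l l' : list (C * R)) (x : R) :
  tpoly (tpoly_mult l l') x = (tpoly l x * tpoly l' x)%C.
Proof.
  induction l as [|p l IH]; simpl; [ring|].
  rewrite tpoly_app, IH, tpoly_shift_eq. ring.
Qed.

Lemma tpoly_sum_n (l : list (C * R)) (x : R) :
  tpoly l x = sum_n (fun k => Cmult (fst (nth k l (RtoC 0, 0))) (chi (snd (nth k l (RtoC 0, 0))) x))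
    (length l).
Proof.
  induction l as [|p l IH]; cbn [length].
  - rewrite sum_O. simpl. ring.
  - unfold sum_n in *. rewrite sum_Sn_m by lia. rewrite <- sum_n_m_S.
    change (tpoly (p :: l) x) with (fst p * chi (snd p) x + tpoly l x)%C. rewrite IH. reflexivity.
Qed.

Lemma trig_poly_tpoly (l : list (C * R)) (p : R -> C) :
  (forall x, p x = tpoly l x) -> trig_poly p.
Proof.
  intros H. exists (length l), (fun k => fst (nth k l (RtoC 0, 0))), (fun k => snd (nth k l (RtoC 0, 0))).
  intros x. rewrite H. apply tpoly_sum_n.
Qed.

Lemma trig_poly_list (p : R -> C) : trig_poly p -> exists l, forall x, p x = tpoly l x.
Proof.
  intros [n [a [w H]]].
  assert (K : forall n, exists l, forall x, sum_n (fun k => Cmult (a k) (chi (w k) x)) n = tpoly l x).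
  { clear. induction n as [|n [l IH]].
    - exists ((a 0%nat, w 0%nat) :: nil). intros x. rewrite sum_O. simpl. ring.
    - exists (l ++ (a (S n), w (S n)) :: nil). intros x. rewrite sum_Sn, IH, tpoly_app.
      simpl. change (tpoly l x + a (S n) * chi (w (S n)) x
        = tpoly l x + (a (S n) * chi (w (S n)) x + 0))%C. ring. }
  destruct (K n) as [l Hl]. exists l. intros x. rewrite H. apply Hl.
Qed.

(** ** Averages over symmetric intervals *)

Definition avg (f : R -> C) (L : R) : C := (RtoC (/ (2 * L)) * CI f (- L) L)%C.

Lemma cont_all_between (f : R -> C) (a b : R) : (forall x, continuous f x) -> cont_between f a b.
Proof. intros H t _. apply H. Qed.

Lemma avg_ext (f g : R -> C) (L : R) : (forall t, f t = g t) -> avg f L = avg g L.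
Proof. intros H. unfold avg. f_equal. apply CI_ext. intros t _. apply H. Qed.

Lemma avg_plus (f g : R -> C) (L : R) :
  (forall x, continuous f x) -> (forall x, continuous g x) ->
  avg (fun t => f t + g t)%C L = (avg f L + avg g L)%C.
Proof. intros Hf Hg. unfold avg. rewrite CI_plus by (apply cont_all_between; assumption). ring. Qed.

Lemma avg_minus (f g : R -> C) (L : R) :
  (forall x, continuous f x) -> (forall x, continuous g x) ->
  avg (fun t => f t - g t)%C L = (avg f L - avg g L)%C.
Proof. intros Hf Hg. unfold avg. rewrite CI_minus by (apply cont_all_between; assumption). ring. Qed.

Lemma avg_scal (c : C) (f : R -> C) (L : R) :
  (forall x, continuous f x) -> avg (fun t => c * f t)%C L = (c * avg f L)%C.
Proof. intros Hf. unfold avg. rewrite CI_scal by (apply cont_all_between; assumption). ring. Qed.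

Lemma avg_const (c : C) (L : R) : 0 < L -> avg (fun _ => c) L = c.
Proof.
  intros HL. unfold avg. rewrite CI_const. rewrite Cmult_assoc, <- RtoC_mult.
  replace (/ (2 * L) * (L - - L)) with 1 by (field; lra). ring.
Qed.

Lemma avg_norm_le (f : R -> C) (h : R -> R) (L : R) :
  0 < L -> (forall x, continuous f x) -> (forall x, continuous h x) ->
  (forall t, Cmod (f t) <= h t) -> Cmod (avg f L) <= Re (avg (fun t => RtoC (h t)) L).
Proof.
  intros HL Hf Hh H. unfold avg. rewrite Cmod_mult, re_scal_l, Cmod_R.
  assert (0 < / (2 * L)) by (apply Rinv_0_lt_compat; lra).
  rewrite Rabs_pos_eq by lra. apply Rmult_le_compat_l; [lra|].
  change (Re (CI (fun t => RtoC (h t)) (- L) L)) with (RInt (fun t => h t) (- L) L).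
  apply CI_norm_le; [lra|apply cont_all_between, Hf| |intros; apply H].
  apply @ex_RInt_continuous. intros; apply Hh.
Qed.

Lemma avg_norm_const (f : R -> C) (M L : R) :
  0 < L -> (forall x, continuous f x) -> (forall t, Cmod (f t) <= M) -> Cmod (avg f L) <= M.
Proof.
  intros HL Hf H. eapply Rle_trans.
  - apply (avg_norm_le f (fun _ => M)); try assumption. intros; apply continuous_const.
  - rewrite avg_const by exact HL. apply Rle_refl.
Qed.

Lemma avg_chi_small (w c : R) (L : R) : w <> 0 -> 0 < L ->
  Cmod (avg (fun t => chi w (c - t)) L) <= / (Rabs w * L).
Proof.
  intros Hw HL.
  assert (Hwp : 0 < Rabs w) by (apply Rabs_pos_lt, Hw).
  assert (Hk : (Ci * RtoC w)%C <> RtoC 0).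
  { apply Cmult_neq_0; [apply Ci_nz|]. intros E. apply RtoC_inj in E. contradiction. }
  unfold avg.
  rewrite (CI_ext _ (fun t => chi w c * chi (- w) t)%C).
  2: { intros t _. unfold Rminus. rewrite chi_plus_r, chi_opp_r. reflexivity. }
  rewrite CI_scal by (apply cont_all_between; intros; apply continuous_chi).
  assert (E : (Ci * RtoC (- w) * CI (chi (- w)) (- L) L = chi (- w) L - chi (- w) (- L))%C).
  { rewrite <- CI_scal by (apply cont_all_between; intros; apply continuous_chi).
    apply CI_derive.
    - intros t _. apply rderiv_chi.
    - intros t _. apply continuous_Cmult; [apply continuous_const|apply continuous_chi]. }
  apply (f_equal Cmod) in E. rewrite !Cmod_mult, Cmod_Ci, Cmod_R, Rabs_Ropp in E.
  assert (E2 : Cmod (chi (- w) L - chi (- w) (- L)) <= 2).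
  { eapply Rle_trans; [apply Cmod_triangle|]. rewrite Cmod_opp, !Cmod_chi. lra. }
  rewrite !Cmod_mult, Cmod_chi, Cmod_R, Rabs_pos_eq.
  2: { left. apply Rinv_0_lt_compat. lra. }
  replace (/ (Rabs w * L)) with (/ (2 * L) * (2 / Rabs w)) by (field; split; lra).
  apply Rmult_le_compat_l; [left; apply Rinv_0_lt_compat; lra|].
  rewrite Rmult_1_l. apply Rmult_le_reg_l with (Rabs w); [exact Hwp|].
  replace (Rabs w * (2 / Rabs w)) with 2 by (field; lra). lra.
Qed.

(** A character of nonzero frequency [w] has averages at most [1 / (|w| L)] in
    modulus, whatever the translate. *)
Lemma tpoly_mean (l : list (C * R)) :
  exists m : C, forall eps, 0 < eps -> exists L0, 0 < L0 /\ forall L x, L0 <= L ->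
    Cmod (avg (fun t => tpoly l (x - t)) L - m) <= eps.
Proof.
  induction l as [|[a w] l [m IH]].
  - exists (RtoC 0). intros eps He. exists 1. split; [lra|]. intros L x HL. simpl.
    rewrite avg_const by lra. replace (0 - 0)%C with (RtoC 0) by ring. rewrite Cmod_0. lra.
  - assert (Hc : forall w x t, continuous (fun t => chi w (x - t)) t).
    { intros w' x t. apply continuous_comp; [|apply continuous_chi].
      apply @continuous_minus; [apply continuous_const|apply continuous_id]. }
    assert (Hct : forall x t, continuous (fun t => tpoly l (x - t)) t).
    { intros x t. apply continuous_comp; [|apply continuous_tpoly].
      apply @continuous_minus; [apply continuous_const|apply continuous_id]. }
    assert (Esp : forall x L, avg (fun t => tpoly ((a, w) :: l) (x - t)) L =
      (a * avg (fun t => chi w (x - t)) L + avg (fun t => tpoly l (x - t)) L)%C).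
    { intros x L. rewrite <- avg_scal by (intros; apply Hc). rewrite <- avg_plus.
      - reflexivity.
      - intros t. apply continuous_Cmult; [apply continuous_const|apply Hc].
      - intros t. apply Hct. }
    destruct (Req_dec w 0) as [->|Hw].
    + exists (a + m)%C. intros eps He. destruct (IH eps He) as [L0 [HL0 H]].
      exists L0. split; [exact HL0|]. intros L x HL. rewrite Esp.
      rewrite (avg_ext _ (fun _ => RtoC 1)) by (intros; apply chi_0_l).
      rewrite avg_const by lra.
      replace (a * 1 + avg (fun t => tpoly l (x - t)) L - (a + m))%C
        with (avg (fun t => tpoly l (x - t)) L - m)%C by ring. apply H, HL.
    + exists m. intros eps He. destruct (IH (eps / 2) ltac:(lra)) as [L0 [HL0 H]].
      assert (Hwp : 0 < Rabs w) by (apply Rabs_pos_lt, Hw).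
      assert (Ha : 0 <= Cmod a) by apply Cmod_ge_0.
      set (L1 := 2 * (Cmod a + 1) / (eps * Rabs w)).
      assert (HL1 : 0 < L1).
      { unfold L1. apply Rdiv_lt_0_compat; [lra|]. apply Rmult_lt_0_compat; assumption. }
      exists (L0 + L1). split; [lra|]. intros L x HL. rewrite Esp.
      replace (a * avg (fun t => chi w (x - t)) L + avg (fun t => tpoly l (x - t)) L - m)%C
        with (a * avg (fun t => chi w (x - t)) L + (avg (fun t => tpoly l (x - t)) L - m))%C by ring.
      eapply Rle_trans; [apply Cmod_triangle|]. rewrite Cmod_mult.
      specialize (H L x ltac:(lra)).
      assert (S1 := avg_chi_small w x L Hw ltac:(lra)).
      assert (S2 : Cmod a * / (Rabs w * L) <= eps / 2).
      { apply Rmult_le_reg_r with (Rabs w * L); [apply Rmult_lt_0_compat; lra|].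
        rewrite Rmult_assoc, Rinv_l, Rmult_1_r.
        - apply Rle_trans with (eps / 2 * (Rabs w * L1)).
          + unfold L1. replace (eps / 2 * (Rabs w * (2 * (Cmod a + 1) / (eps * Rabs w))))
              with (Cmod a + 1) by (field; split; lra). lra.
          + repeat (apply Rmult_le_compat_l; [lra|]). lra.
        - apply Rmult_integral_contrapositive. split; lra. }
      apply (Rmult_le_compat_l (Cmod a)) in S1; [|exact Ha]. lra.
Qed.

(** ** Nearly common periods *)

(** These sets are neighbourhoods of [0] for the Bohr topology of the line. *)
Definition near_period (W : list R) (d t : R) : Prop :=
  forall w, In w W -> Cmod (chi w t - 1) < d.

Lemma near_period_app (W W' : list R) (d t : R) :
  near_period (W ++ W') d t -> near_period W d t /\ near_period W' d t.
Proof. intros H. split; intros w Hw; apply H, in_or_app; [left|right]; exact Hw. Qed.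

Lemma near_period_le (W : list R) (d d' t : R) :
  d <= d' -> near_period W d t -> near_period W d' t.
Proof. intros Hd H w Hw. specialize (H w Hw). lra. Qed.

(** Bohr's criterion.  It is equivalent to almost periodicity and, unlike
    approximability, passes at once through Lipschitz functions of several
    almost periodic functions. *)
Definition bohr {V : Type} (dist : V -> V -> R) (h : R -> V) : Prop :=
  forall eps, 0 < eps -> exists W d, 0 < d /\
    forall t, near_period W d t -> forall x, dist (h (x + t)) (h x) <= eps.

Definition bohrC : (R -> C) -> Prop := bohr (fun z w => Cmod (z - w)).

(** Two functions with different value types suffice for sums, products, quotients
    and composition with Lipschitz maps at once; only the modulus of continuity is
    left to check. *)
Lemma bohr_combine {U V Z : Type} (dU : U -> U -> R) (dV : V -> V -> R) (dZ : Z -> Z -> R)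
    (f : R -> U) (g : R -> V) (h : R -> Z) (K : R) :
  0 <= K -> bohr dU f -> bohr dV g ->
  (forall x y, dZ (h x) (h y) <= K * (dU (f x) (f y) + dV (g x) (g y))) -> bohr dZ h.
Proof.
  intros HK Hf Hg H eps He.
  assert (He' : 0 < eps / (2 * (K + 1))) by (apply Rdiv_lt_0_compat; lra).
  destruct (Hf _ He') as [W1 [d1 [Hd1 H1]]]. destruct (Hg _ He') as [W2 [d2 [Hd2 H2]]].
  exists (W1 ++ W2), (Rmin d1 d2). split; [apply Rmin_pos; assumption|].
  intros t Ht x. apply near_period_app in Ht. destruct Ht as [T1 T2].
  apply (near_period_le _ _ _ _ (Rmin_l d1 d2)) in T1.
  apply (near_period_le _ _ _ _ (Rmin_r d1 d2)) in T2.
  eapply Rle_trans; [apply H|]. specialize (H1 t T1 x). specialize (H2 t T2 x).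
  apply Rle_trans with (K * (eps / (K + 1))).
  - apply Rmult_le_compat_l; [exact HK|].
    replace (eps / (K + 1)) with (eps / (2 * (K + 1)) + eps / (2 * (K + 1))) by (field; lra). lra.
  - apply Rle_trans with ((K + 1) * (eps / (K + 1))); [|right; field; lra].
    apply Rmult_le_compat_r; [|lra]. left. apply Rdiv_lt_0_compat; lra.
Qed.

Lemma tpoly_bohr (l : list (C * R)) : bohrC (tpoly l).
Proof.
  intros eps He.
  assert (HS := coeff_sum_ge_0 l).
  exists (map snd l), (eps / (coeff_sum l + 1)).
  assert (Hd : 0 < eps / (coeff_sum l + 1)) by (apply Rdiv_lt_0_compat; lra).
  split; [exact Hd|]. intros t Ht x.
  assert (K : forall l d, 0 < d -> near_period (map snd l) d t ->
    Cmod (tpoly l (x + t) - tpoly l x) <= coeff_sum l * d).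
  { clear. induction l as [|[a w] l IH]; intros d Hd Ht; simpl.
    - replace (0 - 0)%C with (RtoC 0) by ring. rewrite Cmod_0. lra.
    - rewrite chi_plus_r.
      replace (a * (chi w x * chi w t) + tpoly l (x + t) - (a * chi w x + tpoly l x))%C
        with (a * chi w x * (chi w t - 1) + (tpoly l (x + t) - tpoly l x))%C by ring.
      eapply Rle_trans; [apply Cmod_triangle|]. rewrite !Cmod_mult, Cmod_chi.
      assert (H1 := Ht w (or_introl eq_refl)).
      assert (H2 : near_period (map snd l) d t) by (intros v Hv; apply Ht; right; exact Hv).
      specialize (IH d Hd H2). generalize (Cmod_ge_0 a). nra. }
  eapply Rle_trans; [apply (K l _ Hd Ht)|].
  apply Rle_trans with ((coeff_sum l + 1) * (eps / (coeff_sum l + 1))); [|right; field; lra].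
  apply Rmult_le_compat_r; lra.
Qed.

Lemma almost_periodic_approx (f : R -> C) (eps : R) :
  almost_periodic f -> 0 < eps -> exists l, forall x, Cmod (f x - tpoly l x) <= eps.
Proof.
  intros [_ H] He. destruct (H eps He) as [p [Hp Hfp]].
  destruct (trig_poly_list p Hp) as [l Hl]. exists l. intros x. rewrite <- Hl. apply Hfp.
Qed.

Lemma almost_periodic_bohr (f : R -> C) : almost_periodic f -> bohrC f.
Proof.
  intros Hf eps He.
  destruct (almost_periodic_approx f (eps / 3) Hf ltac:(lra)) as [l Hl].
  destruct (tpoly_bohr l (eps / 3) ltac:(lra)) as [W [d [Hd H]]].
  exists W, d. split; [exact Hd|]. intros t Ht x. specialize (H t Ht x).
  generalize (Hl (x + t)) (Hl x).
  replace (f (x + t)%R - f x)%C with ((f (x + t)%R - tpoly l (x + t)%R) +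
    ((tpoly l (x + t)%R - tpoly l x) + - (f x - tpoly l x)))%C by ring. intros.
  eapply Rle_trans; [apply Cmod_triangle|].
  eapply Rle_trans; [apply Rplus_le_compat_l, Cmod_triangle|]. rewrite Cmod_opp. lra.
Qed.

(** Finite coverings of the line by sets on which a character, resp. finitely
    many characters, are nearly constant. *)
Definition finite_cells (R0 : R -> R -> Prop) : Prop :=
  exists (K : nat) (c : R -> nat), (forall t, (c t < K)%nat) /\
    forall t t', c t = c t' -> R0 t t'.

Lemma finite_cells_and (R1 R2 : R -> R -> Prop) :
  finite_cells R1 -> finite_cells R2 -> finite_cells (fun t t' => R1 t t' /\ R2 t t').
Proof.
  intros [K1 [c1 [B1 H1]]] [K2 [c2 [B2 H2]]].
  exists (K1 * K2)%nat, (fun t => c1 t * K2 + c2 t)%nat. split.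
  - intros t. generalize (B1 t) (B2 t). nia.
  - intros t t' E. generalize (B2 t) (B2 t'). intros L1 L2.
    assert (c1 t = c1 t' /\ c2 t = c2 t') as [E1 E2].
    { assert (M : forall p q, (q < K2)%nat -> ((p * K2 + q) / K2 = p)%nat).
      { intros p q Hq. rewrite Nat.div_add_l by lia. rewrite Nat.div_small by exact Hq. lia. }
      assert (c1 t = c1 t').
      { rewrite <- (M (c1 t) (c2 t) L1), <- (M (c1 t') (c2 t') L2), E. reflexivity. }
      split; [assumption|]. nia. }
    split; [apply H1, E1|apply H2, E2].
Qed.

Lemma finite_cells_bounded (f : R -> R) (e : R) :
  0 < e -> (forall t, 0 <= f t <= 2) -> finite_cells (fun t t' => Rabs (f t - f t') < e).
Proof.
  intros He Hf.
  assert (Hp : forall t, 0 <= f t / e).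
  { intros t. apply Rmult_le_pos; [apply Hf|left; apply Rinv_0_lt_compat, He]. }
  assert (Hp2 : 0 <= 2 / e) by (apply Rmult_le_pos; [lra|left; apply Rinv_0_lt_compat, He]).
  destruct (nfloor_ex (2 / e) Hp2) as [K HK].
  exists (S K), (fun t => proj1_sig (nfloor_ex (f t / e) (Hp t))). split.
  - intros t. destruct (nfloor_ex (f t / e) (Hp t)) as [n Hn]. simpl.
    assert (INR n < INR (S K)); [|apply INR_lt; assumption].
    rewrite S_INR. apply Rle_lt_trans with (f t / e); [lra|].
    apply Rle_lt_trans with (2 / e); [|lra].
    apply Rmult_le_compat_r; [left; apply Rinv_0_lt_compat, He|apply Hf].
  - intros t t' E.
    destruct (nfloor_ex (f t / e) (Hp t)) as [n Hn]. destruct (nfloor_ex (f t' / e) (Hp t')) as [n' Hn'].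
    simpl in E. subst n'.
    replace (f t - f t') with ((f t / e - f t' / e) * e) by (field; lra).
    rewrite Rabs_mult, (Rabs_pos_eq e) by lra.
    assert (Rabs (f t / e - f t' / e) < 1) by (apply Rabs_lt_between; lra). nra.
Qed.

Lemma chi_minus_dist (w t t' : R) : Cmod (chi w (t - t') - 1) = Cmod (chi w t - chi w t').
Proof.
  replace (chi w t - chi w t')%C with ((chi w (t - t') - 1) * chi w t')%C.
  - rewrite Cmod_mult, Cmod_chi. ring.
  - replace (chi w t) with (chi w (t - t' + t')) by (f_equal; ring). rewrite chi_plus_r. ring.
Qed.

Lemma finite_cells_near_period (W : list R) (d : R) :
  0 < d -> finite_cells (fun t t' => near_period W d (t - t')).
Proof.
  intros Hd. induction W as [|w W [K [c [B H]]]].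
  - exists 1%nat, (fun _ => 0%nat). split; [intros; lia|]. intros t t' _ w [].
  - assert (F1 := finite_cells_bounded (fun t => cos (w * t) + 1) (d / 2) ltac:(lra)
      ltac:(intros t; generalize (COS_bound (w * t)); lra)).
    assert (F2 := finite_cells_bounded (fun t => sin (w * t) + 1) (d / 2) ltac:(lra)
      ltac:(intros t; generalize (SIN_bound (w * t)); lra)).
    destruct (finite_cells_and _ _ (finite_cells_and _ _ F1 F2)
      (ex_intro _ K (ex_intro _ c (conj B H)))) as [K' [c' [B' H']]].
    exists K', c'. split; [exact B'|]. intros t t' E v [<-|Hv].
    + destruct (H' t t' E) as [[E1 E2] _]. rewrite chi_minus_dist.
      eapply Rle_lt_trans; [apply Cmod_minus_le|]. unfold chi; simpl.
      replace (cos (w * t) - cos (w * t')) with (cos (w * t) + 1 - (cos (w * t') + 1)) by ring.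
      replace (sin (w * t) - sin (w * t')) with (sin (w * t) + 1 - (sin (w * t') + 1)) by ring.
      lra.
    + destruct (H' t t' E) as [_ N]. apply N, Hv.
Qed.

(** Relative density of near periods: sort the line into finitely many cells on
    which the characters are nearly constant; two points of a cell differ by a near
    period. *)
Lemma near_period_cover (W : list R) (d : R) :
  0 < d -> exists rs : list R, forall t, exists r, In r rs /\ near_period W d (t - r).
Proof.
  intros Hd. destruct (finite_cells_near_period W d Hd) as [K [c [B H]]].
  assert (rep : forall n, exists rs : list R, forall t, (c t < n)%nat -> exists r, In r rs /\ c t = c r).
  { induction n as [|n [rs IH]].
    - exists nil. intros t Ht. lia.
    - destruct (classic (exists t0, c t0 = n)) as [[t0 Ht0]|N].
      + exists (t0 :: rs). intros t Ht. destruct (Nat.eq_dec (c t) n) as [E|E].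
        * exists t0. split; [left; reflexivity|congruence].
        * destruct (IH t ltac:(lia)) as [r [Hr Er]]. exists r. split; [right; exact Hr|exact Er].
      + exists rs. intros t Ht. apply IH.
        assert (c t <> n) by (intros E; apply N; exists t; exact E). lia. }
  destruct (rep K) as [rs Hrs]. exists rs. intros t.
  destruct (Hrs t (B t)) as [r [Hr E]]. exists r. split; [exact Hr|apply H, E].
Qed.

(** ** The Bochner-Fejer approximation *)

Definition ravg (h : R -> R) (L : R) : R := / (2 * L) * RInt h (- L) L.

Lemma avg_RtoC (h : R -> R) (L : R) : avg (fun t => RtoC (h t)) L = RtoC (ravg h L).
Proof.
  unfold avg, ravg. rewrite RtoC_mult. f_equal. apply C_eq_Re_Im; [reflexivity|].
  change (RInt (fun _ => 0) (- L) L = 0). rewrite RInt_const. apply Rmult_0_r.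
Qed.

(** A nonnegative trigonometric polynomial with values in [0, 1] that is near [1]
    exactly at the near periods of the frequencies [W]. *)
Definition peak (W : list R) (t : R) : R :=
  fold_right (fun w p => (1 + cos (w * t)) / 2 * p) 1 W.

Lemma peak_factor (w t : R) : (1 + cos (w * t)) / 2 = 1 - Cmod (chi w t - 1) ^ 2 / 4.
Proof.
  rewrite Cmod2_alt. unfold chi; simpl. generalize (sin2_cos2 (w * t)). unfold Rsqr. nra.
Qed.

Lemma peak_bounds (W : list R) (t : R) : 0 <= peak W t <= 1.
Proof.
  induction W as [|w W IH]; simpl; [lra|].
  generalize (COS_bound (w * t)). nra.
Qed.

Lemma peak_even (W : list R) (t : R) : peak W (- t) = peak W t.
Proof.
  induction W as [|w W IH]; simpl; [reflexivity|]. rewrite IH.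
  replace (w * - t) with (- (w * t)) by ring. rewrite cos_neg. reflexivity.
Qed.

Lemma peak_far (W : list R) (d t : R) : 0 < d -> ~ near_period W d t -> peak W t <= 1 - d ^ 2 / 4.
Proof.
  intros Hd HN. apply not_all_ex_not in HN. destruct HN as [w HN].
  apply imply_to_and in HN. destruct HN as [Hw HN]. apply Rnot_lt_le in HN.
  assert (K : peak W t <= 1 - Cmod (chi w t - 1) ^ 2 / 4).
  { induction W as [|v W IH]; [destruct Hw|].
    assert (Hb := peak_bounds W t). simpl. rewrite peak_factor.
    assert (Hc := peak_factor v t). assert (Hcb := COS_bound (v * t)).
    destruct Hw as [-> |Hw].
    - nra.
    - specialize (IH Hw). nra. }
  assert (d ^ 2 <= Cmod (chi w t - 1) ^ 2) by (apply pow_incr; lra). lra.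
Qed.

Lemma peak_near (W : list R) (e : R) : 0 < e ->
  exists d, 0 < d /\ forall t, near_period W d t -> 1 - e <= peak W t.
Proof.
  revert e. induction W as [|w W IH]; intros e He.
  - exists 1. split; [lra|]. intros t _. simpl. lra.
  - destruct (IH (e / 2) ltac:(lra)) as [d [Hd H]].
    exists (Rmin d (Rmin 1 e)). split; [repeat apply Rmin_pos; lra|]. intros t Ht.
    assert (H1 : 1 - e / 2 <= peak W t).
    { apply H. intros v Hv. eapply Rlt_le_trans; [apply Ht; right; exact Hv|apply Rmin_l]. }
    assert (H2 := Ht w (or_introl eq_refl)).
    assert (H3 : Cmod (chi w t - 1) < 1 /\ Cmod (chi w t - 1) < e).
    { generalize (Rmin_r d (Rmin 1 e)) (Rmin_l 1 e) (Rmin_r 1 e). lra. }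
    generalize (Cmod_ge_0 (chi w t - 1)) (peak_bounds W t). intros H4 H5.
    simpl. rewrite peak_factor. simpl.
    set (a := Cmod (chi w t - 1)) in *. set (b := peak W t) in *.
    assert (0 <= a * (a * 1) <= e) by nra. nra.
Qed.

Definition list_cos (w : R) : list (C * R) :=
  (RtoC (/ 2), 0) :: (RtoC (/ 4), w) :: (RtoC (/ 4), - w) :: nil.

Lemma tpoly_cos (w t : R) : tpoly (list_cos w) t = RtoC ((1 + cos (w * t)) / 2).
Proof.
  unfold list_cos, tpoly; simpl. rewrite chi_0_l. unfold chi.
  replace (- w * t) with (- (w * t)) by ring. rewrite cos_neg, sin_neg.
  unfold RtoC, Cmult, Cplus; simpl. f_equal; field.
Qed.

Lemma peak_tpoly (W : list R) : exists l, forall t, RtoC (peak W t) = tpoly l t.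
Proof.
  induction W as [|w W [l IH]].
  - exists ((RtoC 1, 0) :: nil). intros t. simpl. rewrite chi_0_l. ring.
  - exists (tpoly_mult (list_cos w) l). intros t. rewrite tpoly_mult_eq, <- IH, tpoly_cos.
    rewrite <- RtoC_mult. reflexivity.
Qed.

Lemma peak_pow_tpoly (W : list R) (N : nat) : exists l, forall t, RtoC (peak W t ^ N) = tpoly l t.
Proof.
  destruct (peak_tpoly W) as [l1 H1]. induction N as [|N [l IH]].
  - exists ((RtoC 1, 0) :: nil). intros t. simpl. rewrite chi_0_l. ring.
  - exists (tpoly_mult l1 l). intros t. rewrite tpoly_mult_eq, <- IH, <- H1, <- RtoC_mult. reflexivity.
Qed.

Lemma continuous_peak_pow (W : list R) (N : nat) (t : R) : continuous (fun t => peak W t ^ N) t.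
Proof.
  destruct (peak_pow_tpoly W N) as [l Hl].
  apply (continuous_ext (fun t => Re (tpoly l t))); [intros s; rewrite <- Hl; reflexivity|].
  exact (proj1 (proj1 (continuous_C_split _ t) (continuous_tpoly l t))).
Qed.

Lemma continuous_reflect (f : R -> C) (x t : R) :
  (forall s, continuous f s) -> continuous (fun t => f (x - t)) t.
Proof.
  intros H. apply continuous_comp; [|apply H].
  apply @continuous_minus; [apply continuous_const|apply continuous_id].
Qed.

Lemma ravg_plus (f g : R -> R) (L : R) :
  (forall t, continuous f t) -> (forall t, continuous g t) ->
  ravg (fun t => f t + g t) L = ravg f L + ravg g L.
Proof.
  intros Hf Hg. unfold ravg. rewrite <- Rmult_plus_distr_l. f_equal.
  apply (RInt_plus (V := R_CompleteNormedModule)); apply @ex_RInt_continuous; intros; [apply Hf|apply Hg].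
Qed.

Lemma ravg_scal (c : R) (f : R -> R) (L : R) :
  (forall t, continuous f t) -> ravg (fun t => c * f t) L = c * ravg f L.
Proof.
  intros Hf. unfold ravg.
  replace (RInt (fun t => c * f t) (- L) L) with (c * RInt f (- L) L); [ring|].
  symmetry. apply (RInt_scal (V := R_CompleteNormedModule)). apply @ex_RInt_continuous; intros; apply Hf.
Qed.

Lemma ravg_const (c L : R) : 0 < L -> ravg (fun _ => c) L = c.
Proof.
  intros HL. apply RtoC_inj. rewrite <- avg_RtoC. apply avg_const, HL.
Qed.

Lemma ravg_le (f g : R -> R) (L : R) : 0 < L ->
  (forall t, continuous f t) -> (forall t, continuous g t) -> (forall t, f t <= g t) ->
  ravg f L <= ravg g L.
Proof.
  intros HL Hf Hg H. unfold ravg. apply Rmult_le_compat_l.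
  - left. apply Rinv_0_lt_compat. lra.
  - apply RInt_le; [lra| | |intros; apply H]; apply @ex_RInt_continuous; intros; [apply Hf|apply Hg].
Qed.

Definition translate_sum (f : R -> R) (rs : list R) (t : R) : R :=
  fold_right (fun r s => f (r - t) + s) 0 rs.

Lemma translate_sum_ge (f : R -> R) (rs : list R) (r t : R) :
  (forall s, 0 <= f s) -> In r rs -> f (r - t) <= translate_sum f rs t.
Proof.
  intros Hf Hr. induction rs as [|r' rs IH]; [destruct Hr|]. simpl.
  assert (H0 : 0 <= translate_sum f rs t).
  { clear IH Hr. induction rs as [|r0 rs IH]; simpl; [lra|]. generalize (Hf (r0 - t)). lra. }
  destruct Hr as [-> |Hr]; [lra|]. specialize (IH Hr). generalize (Hf (r' - t)). lra.
Qed.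

(** The translates of the peak along a covering by near periods add up to at least
    [(1 - e)^N] everywhere, so the mean of the peak is at least [(1 - e)^N / k],
    with [k] independent of the power [N]. *)
Lemma peak_mean_lower (W : list R) (e : R) : 0 < e < 1 ->
  exists k, 0 < k /\ forall (N : nat) (m : R),
    (forall eps, 0 < eps -> exists L0, 0 < L0 /\ forall L x, L0 <= L ->
       Rabs (ravg (fun t => peak W (x - t) ^ N) L - m) <= eps) ->
    (1 - e) ^ N <= k * m.
Proof.
  intros He. destruct (peak_near W e ltac:(lra)) as [d [Hd Hnear]].
  destruct (near_period_cover W d Hd) as [rs Hrs].
  exists (INR (length rs)). split.
  - destruct rs as [|r rs].
    + destruct (Hrs 0) as [r [[] _]].
    + apply lt_0_INR. simpl. lia.
  - intros N m Hm. apply le_epsilon. intros eps Heps.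
    assert (Hlen := pos_INR (length rs)).
    destruct (Hm (eps / (INR (length rs) + 1)) ltac:(apply Rdiv_lt_0_compat; lra)) as [L0 [HL0 H]].
    set (S := translate_sum (fun t => peak W t ^ N)).
    assert (Hcp : forall r t, continuous (fun t => peak W (r - t) ^ N) t).
    { intros r t. apply (continuous_comp (fun t => r - t) (fun t => peak W t ^ N)).
      - apply @continuous_minus; [apply continuous_const|apply continuous_id].
      - apply continuous_peak_pow. }
    assert (Hcont : forall rs t, continuous (S rs) t).
    { clear -Hcp. induction rs as [|r rs IH]; intros t; [apply continuous_const|].
      apply (continuous_plus (V := R_NormedModule) (fun t => peak W (r - t) ^ N) (S rs));
        [apply Hcp|apply IH]. }
    set (b := m + eps / (INR (length rs) + 1)) in *.
    assert (Hup : forall rs, ravg (S rs) L0 <= INR (length rs) * b).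
    { clear Hrs Hlen. intros rs'. induction rs' as [|r rs' IH].
      - change (S nil) with (fun _ : R => 0). rewrite ravg_const by exact HL0. simpl. lra.
      - assert (E : ravg (S (r :: rs')) L0 = ravg (fun t => peak W (r - t) ^ N) L0 + ravg (S rs') L0).
        { rewrite <- ravg_plus; [reflexivity|apply Hcp|apply Hcont]. }
        rewrite E. specialize (H L0 r (Rle_refl _)). apply Rabs_le_between in H.
        simpl length. rewrite S_INR. fold b in H. unfold b in *. lra. }
    assert (Hlow : (1 - e) ^ N <= ravg (S rs) L0).
    { rewrite <- (ravg_const ((1 - e) ^ N) L0 HL0).
      apply ravg_le; [exact HL0|intros; apply continuous_const|apply Hcont|].
      intros t. destruct (Hrs t) as [r [Hr Hnp]].
      assert (P : (1 - e) ^ N <= peak W (r - t) ^ N).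
      { apply pow_incr. split; [lra|]. rewrite <- peak_even.
        replace (- (r - t)) with (t - r) by ring. apply Hnear, Hnp. }
      eapply Rle_trans; [exact P|].
      apply (translate_sum_ge (fun t => peak W t ^ N)); [|exact Hr].
      intros s. apply pow_le, peak_bounds. }
    eapply Rle_trans; [exact Hlow|]. eapply Rle_trans; [apply Hup|]. unfold b.
    rewrite Rmult_plus_distr_l. apply Rplus_le_compat_l.
    apply Rle_trans with ((INR (length rs) + 1) * (eps / (INR (length rs) + 1))).
    + apply Rmult_le_compat_r; [|lra]. left. apply Rdiv_lt_0_compat; lra.
    + right. field. lra.
Qed.

Definition weighted (h : R -> C) (L : R) (l : list (C * R)) : list (C * R) :=
  map (fun p => ((fst p * avg (fun t => h t * chi (- snd p) t) L)%C, snd p)) l.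

(** [chi w (x - t)] is [chi w x] times a function of [t], so averaging over a
    bounded interval already gives a trigonometric polynomial in [x]. *)
Lemma avg_convolution (h : R -> C) (l : list (C * R)) (L x : R) :
  (forall t, continuous h t) ->
  avg (fun t => h t * tpoly l (x - t))%C L = tpoly (weighted h L l) x.
Proof.
  intros Hh. induction l as [|[a w] l IH].
  - simpl. rewrite (avg_ext _ (fun t => RtoC 0 * h t)%C) by (intros; ring).
    rewrite avg_scal by exact Hh. ring.
  - simpl. rewrite <- IH.
    rewrite (avg_ext _ (fun t => (a * chi w x) * (h t * chi (- w) t) + h t * tpoly l (x - t))%C).
    + rewrite avg_plus, avg_scal.
      * ring.
      * intros t. apply continuous_Cmult; [apply Hh|apply continuous_chi].
      * intros t. apply continuous_Cmult; [apply continuous_const|].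
        apply continuous_Cmult; [apply Hh|apply continuous_chi].
      * intros t. apply continuous_Cmult; [apply Hh|].
        apply continuous_reflect, continuous_tpoly.
    + intros t. unfold Rminus. rewrite chi_plus_r, chi_opp_r. ring.
Qed.

Lemma tpoly_scal_coeff (c : C) (l : list (C * R)) (x : R) :
  tpoly (map (fun p => ((c * fst p)%C, snd p)) l) x = (c * tpoly l x)%C.
Proof. induction l as [|p l IH]; simpl; [ring|]. rewrite IH. ring. Qed.

Lemma pow_lt_1_small (q eps : R) : 0 <= q < 1 -> 0 < eps -> exists N, q ^ N < eps.
Proof.
  intros Hq He. destruct (pow_lt_1_zero q ltac:(rewrite Rabs_pos_eq; lra) eps He) as [N HN].
  exists N. specialize (HN N (Nat.le_refl N)). rewrite Rabs_pos_eq in HN; [exact HN|].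
  apply pow_le; lra.
Qed.

(** Convolution with a high power of the peak.  The mass of that kernel away from
    the near periods is at most [(1 - 2e)^N], negligible against its mean. *)
Lemma bochner_fejer (h : R -> C) (B eps : R) :
  (forall t, continuous h t) -> (forall t, Cmod (h t) <= B) -> bohrC h -> 0 < eps ->
  exists (l : list (C * R)) (L0 : R), 0 < L0 /\
    forall L x, L0 <= L -> Cmod (h x - tpoly (weighted h L l) x) <= eps.
Proof.
  intros Hc HB Hh Heps.
  assert (HB0 : 0 <= B) by (eapply Rle_trans; [apply (Cmod_ge_0 (h 0))|apply HB]).
  set (e := Rmin (eps / 4) 1).
  assert (He : 0 < e) by (apply Rmin_pos; lra).
  assert (He1 : e <= 1) by apply Rmin_r. assert (He4 : 4 * e <= eps) by (generalize (Rmin_l (eps / 4) 1); unfold e; lra).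
  destruct (Hh e He) as [W [d0 [Hd0 Hnp]]].
  set (d := Rmin d0 1). assert (Hd : 0 < d) by (apply Rmin_pos; lra).
  assert (Hd1 : d <= 1) by apply Rmin_r.
  assert (Hnp' : forall t, near_period W d t -> forall x, Cmod (h (x + t) - h x) <= e).
  { intros t Ht. apply Hnp. apply near_period_le with d; [apply Rmin_l|exact Ht]. }
  set (n := d ^ 2 / 8).
  assert (Hn : 0 < n < / 2).
  { unfold n. assert (0 < d ^ 2) by (apply pow_lt; lra). assert (d ^ 2 <= 1) by (simpl; nra). lra. }
  destruct (peak_mean_lower W n ltac:(lra)) as [k [Hk Hmean]].
  set (q := (1 - 2 * n) / (1 - n)).
  assert (Hq : 0 <= q < 1).
  { unfold q. split.
    - apply Rmult_le_pos; [lra|left; apply Rinv_0_lt_compat; lra].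
    - apply Rmult_lt_reg_r with (1 - n); [lra|]. unfold Rdiv. rewrite Rmult_assoc, Rinv_l by lra. lra. }
  destruct (pow_lt_1_small q (e / (2 * B * k + 1)) Hq) as [N HN].
  { apply Rdiv_lt_0_compat; [lra|]. assert (0 <= B * k) by (apply Rmult_le_pos; lra). lra. }
  set (K := fun t => peak W t ^ N).
  destruct (peak_pow_tpoly W N) as [lK HlK]. change (forall t, RtoC (K t) = tpoly lK t) in HlK.
  destruct (tpoly_mean lK) as [mc Hmc]. set (m := Re mc).
  assert (HKc : forall x t, continuous (fun t => K (x - t)) t).
  { intros x t. apply (continuous_comp (fun t => x - t) K).
    - apply @continuous_minus; [apply continuous_const|apply continuous_id].
    - apply continuous_peak_pow. }
  assert (Hm : forall eps, 0 < eps -> exists L0, 0 < L0 /\ forall L x, L0 <= L ->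
       Rabs (ravg (fun t => K (x - t)) L - m) <= eps).
  { intros e1 He1'. destruct (Hmc e1 He1') as [L0 [HL0 H]]. exists L0. split; [exact HL0|].
    intros L x HL. specialize (H L x HL).
    rewrite (avg_ext _ (fun t => RtoC (K (x - t)%R))) in H by (intros; symmetry; apply HlK).
    rewrite avg_RtoC in H. eapply Rle_trans; [|exact H].
    apply (Re_minus_le (RtoC _) mc). }
  assert (Hlow := Hmean N m Hm).
  assert (Hpn : 0 < (1 - n) ^ N) by (apply pow_lt; lra).
  assert (Hm0 : 0 < m) by (apply Rmult_lt_reg_l with k; [exact Hk|]; rewrite Rmult_0_r; lra).
  assert (Hfar : 2 * B * (1 - 2 * n) ^ N <= e * m).
  { assert (E : (1 - 2 * n) ^ N = q ^ N * (1 - n) ^ N).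
    { rewrite <- Rpow_mult_distr. f_equal. unfold q. field. lra. }
    rewrite E.
    assert (Hq0 : 0 <= q ^ N) by (apply pow_le; lra).
    apply Rle_trans with (2 * B * (q ^ N * (k * m))).
    - apply Rmult_le_compat_l; [lra|]. apply Rmult_le_compat_l; [exact Hq0|exact Hlow].
    - replace (2 * B * (q ^ N * (k * m))) with ((2 * B * k * q ^ N) * m) by ring.
      apply Rmult_le_compat_r; [lra|].
      assert (HBk : 0 <= 2 * B * k) by (apply Rmult_le_pos; lra).
      apply Rle_trans with ((2 * B * k + 1) * (e / (2 * B * k + 1))); [nra|]. right. field. lra. }
  set (e' := m * e / (B + 1)).
  assert (He' : 0 < e') by (unfold e'; apply Rdiv_lt_0_compat; [apply Rmult_lt_0_compat|]; lra).
  assert (He'B : e' * B <= e * m /\ e' <= m).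
  { assert (E : e' * (B + 1) = m * e) by (unfold e'; field; lra). split; nra. }
  destruct (Hm e' He') as [L0 [HL0 HL]].
  exists (map (fun p => ((RtoC (/ m) * fst p)%C, snd p)) lK), L0. split; [exact HL0|].
  intros L x HLL. specialize (HL L x HLL).
  assert (Ew : tpoly (weighted h L (map (fun p => ((RtoC (/ m) * fst p)%C, snd p)) lK)) x
     = (RtoC (/ m) * avg (fun t => h t * RtoC (K (x - t)%R)) L)%C).
  { rewrite (avg_ext _ (fun t => h t * tpoly lK (x - t))%C) by (intros t; rewrite HlK; reflexivity).
    rewrite avg_convolution by exact Hc. rewrite <- tpoly_scal_coeff. f_equal.
    unfold weighted. rewrite !map_map. apply map_ext. intros [a w]. simpl. f_equal. ring. }
  rewrite Ew.
  set (a := ravg (fun t => K (x - t)) L) in *.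
  assert (Ediff : (RtoC m * h x - avg (fun t => h t * RtoC (K (x - t)%R)) L)%C =
     (RtoC (m - a) * h x + avg (fun t => (h x - h t) * RtoC (K (x - t)%R)) L)%C).
  { rewrite (avg_ext (fun t => (h x - h t) * RtoC (K (x - t)%R))%C
      (fun t => h x * RtoC (K (x - t)%R) - h t * RtoC (K (x - t)%R))%C) by (intros; ring).
    rewrite avg_minus, avg_scal, avg_RtoC.
    - fold a. rewrite RtoC_minus. ring.
    - intros t. apply continuous_RtoC, HKc.
    - intros t. apply continuous_Cmult; [apply continuous_const|apply continuous_RtoC, HKc].
    - intros t. apply continuous_Cmult; [apply Hc|apply continuous_RtoC, HKc]. }
  assert (Herr : Cmod (avg (fun t => (h x - h t) * RtoC (K (x - t)%R))%C L) <= e * a + 2 * B * (1 - 2 * n) ^ N).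
  { assert (HL' : 0 < L) by lra.
    eapply Rle_trans.
    - apply (avg_norm_le _ (fun t => e * K (x - t) + 2 * B * (1 - 2 * n) ^ N)); [exact HL'| | |].
      + intros t. apply continuous_Cmult; [|apply continuous_RtoC, HKc].
        apply continuous_Cminus; [apply continuous_const|apply Hc].
      + intros t. apply (continuous_plus (V := R_NormedModule) (fun t => e * K (x - t))
          (fun _ => 2 * B * (1 - 2 * n) ^ N)); [|apply continuous_const].
        apply (continuous_scal_r (V := R_NormedModule) e (fun t => K (x - t))), HKc.
      + intros t. rewrite Cmod_mult, Cmod_R.
        assert (HK0 : 0 <= K (x - t)) by (apply pow_le, peak_bounds). rewrite Rabs_pos_eq by exact HK0.
        assert (Hp0 : 0 <= (1 - 2 * n) ^ N) by (apply pow_le; lra).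
        destruct (classic (near_period W d (x - t))) as [Hnr|Hfr].
        * assert (HH := Hnp' _ Hnr t). replace (t + (x - t)) with x in HH by ring.
          assert (0 <= 2 * B * (1 - 2 * n) ^ N) by (apply Rmult_le_pos; lra). nra.
        * assert (HP := peak_far W d (x - t) Hd Hfr).
          assert (HKf : K (x - t) <= (1 - 2 * n) ^ N).
          { apply pow_incr. split; [apply peak_bounds|]. unfold n. lra. }
          assert (HD : Cmod (h x - h t) <= 2 * B).
          { eapply Rle_trans; [apply Cmod_triangle|]. rewrite Cmod_opp. generalize (HB x) (HB t). lra. }
          generalize (Cmod_ge_0 (h x - h t)). intros. nra.
    - rewrite avg_RtoC. simpl.
      rewrite (ravg_plus (fun t => e * K (x - t)) (fun _ => 2 * B * (1 - 2 * n) ^ N)).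
      + rewrite (ravg_scal e (fun t => K (x - t))) by apply HKc. rewrite ravg_const by exact HL'. apply Rle_refl.
      + intros t. apply (continuous_scal_r (V := R_NormedModule) e (fun t => K (x - t))), HKc.
      + intros t. apply continuous_const. }
  assert (Htot : Cmod (RtoC m * h x - avg (fun t => h t * RtoC (K (x - t)%R))%C L) <= m * eps).
  { rewrite Ediff. eapply Rle_trans; [apply Cmod_triangle|]. rewrite Cmod_mult, Cmod_R.
    assert (HL2 : Rabs (m - a) <= e') by (rewrite Rabs_minus_sym; exact HL).
    assert (Ha : a <= m + e') by (apply Rabs_le_between in HL; lra).
    assert (Rabs (m - a) * Cmod (h x) <= e' * B).
    { apply Rmult_le_compat; [apply Rabs_pos|apply Cmod_ge_0|exact HL2|apply HB]. }
    nra. }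
  replace (h x - RtoC (/ m) * avg (fun t => h t * RtoC (K (x - t)%R))%C L)%C
    with (RtoC (/ m) * (RtoC m * h x - avg (fun t => h t * RtoC (K (x - t)%R))%C L))%C.
  - rewrite Cmod_mult, Cmod_R, Rabs_pos_eq by (left; apply Rinv_0_lt_compat, Hm0).
    apply Rmult_le_reg_l with m; [exact Hm0|]. rewrite <- Rmult_assoc, Rinv_r by lra. lra.
  - assert (E : (RtoC (/ m) * RtoC m)%C = RtoC 1) by (rewrite <- RtoC_mult; f_equal; field; lra).
    match goal with |- (?p * (?q * ?r - ?s))%C = _ =>
      transitivity ((p * q) * r - p * s)%C; [ring|rewrite E; ring] end.
Qed.

Lemma bohr_almost_periodic (h : R -> C) : bounded_continuous h -> bohrC h -> almost_periodic h.
Proof.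
  intros [Hc [B HB]] Hh. split; [split; [exact Hc|exists B; exact HB]|].
  intros eps He. destruct (bochner_fejer h B eps Hc HB Hh He) as [l [L0 [HL0 H]]].
  exists (tpoly (weighted h L0 l)). split; [|intros x; apply H, Rle_refl].
  apply (trig_poly_tpoly (weighted h L0 l)). reflexivity.
Qed.

(** ** Means and Fourier coefficients *)

Lemma tends_to_C (f : R -> C) (l : C) :
  filterlim f (Rbar_locally p_infty) (locally l) <->
  forall eps, 0 < eps -> exists L0, 0 < L0 /\ forall L, L0 <= L -> Cmod (f L - l) <= eps.
Proof.
  split.
  - intros H eps He. assert (He2 : 0 < eps / 2) by lra.
    destruct (proj1 (filterlim_locally f l) H (mkposreal _ He2)) as [M HM].
    exists (Rmax M 0 + 1). split; [generalize (Rmax_r M 0); lra|]. intros L HL.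
    assert (HLM : M < L) by (generalize (Rmax_l M 0); lra).
    specialize (HM L HLM). apply (proj1 (ball_C _ _ _)) in HM. simpl (pos _) in HM.
    eapply Rle_trans; [apply Cmod_minus_le|]. lra.
  - intros H. apply filterlim_locally. intros eps.
    assert (He2 : 0 < eps / 2) by (generalize (cond_pos eps); lra).
    destruct (H _ He2) as [L0 [HL0 HL]]. exists L0. intros L HLL.
    specialize (HL L ltac:(lra)). apply (proj2 (ball_C _ _ _)).
    generalize (Re_minus_le (f L) l) (Im_minus_le (f L) l) (cond_pos eps). lra.
Qed.

Lemma fourier_coeff_unique (f : R -> C) (w : R) (l : C) :
  (forall x, continuous f x) ->
  filterlim (avg (fun t => f t * chi (- w) t)%C) (Rbar_locally p_infty) (locally l) ->
  fourier_coeff f w = l.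
Proof.
  intros Hc H. unfold fourier_coeff, mean.
  apply (iota_filterlim_locally (V := C_R_CompleteNormedModule) (F := Rbar_locally p_infty)).
  apply (filterlim_ext (avg (fun t => f t * chi (- w) t)%C)); [|exact H].
  intros L. unfold avg. f_equal. symmetry. apply RInt_C_eq_CI.
  apply cont_all_between. intros x. apply continuous_Cmult; [apply Hc|apply continuous_chi].
Qed.

(** The averages satisfy the Cauchy criterion, since those of trigonometric
    polynomials converge. *)
Lemma fourier_coeff_limit (f : R -> C) (w : R) : almost_periodic f ->
  filterlim (avg (fun t => f t * chi (- w) t)%C) (Rbar_locally p_infty) (locally (fourier_coeff f w)).
Proof.
  intros Hf. assert (Hc : forall x, continuous f x) by apply Hf.
  assert (Hex : exists y : C_R_CompleteNormedModule,
    filterlim (avg (fun t => f t * chi (- w) t)%C) (Rbar_locally p_infty) (locally y)).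
  { apply (filterlim_locally_cauchy (U := C_R_CompleteNormedModule) (F := Rbar_locally p_infty)).
    intros eps. assert (He : 0 < eps / 8) by (generalize (cond_pos eps); lra).
    destruct (almost_periodic_approx f (eps / 8) Hf He) as [l Hl].
    set (l' := tpoly_shift (RtoC 1, w) (map (fun p => (fst p, - snd p)) l)).
    assert (El : forall t, tpoly l' (0 - t) = (tpoly l t * chi (- w) t)%C).
    { intros t. unfold l'. rewrite tpoly_shift_eq. simpl.
      rewrite Rminus_0_l, chi_opp_r.
      assert (E : tpoly (map (fun p => (fst p, - snd p)) l) (- t) = tpoly l t).
      { clear. induction l as [|[a v] l IH]; simpl; [reflexivity|].
        rewrite IH, chi_opp_r, Ropp_involutive. reflexivity. }
      rewrite E. ring. }
    destruct (tpoly_mean l') as [m Hm]. destruct (Hm (eps / 8) He) as [L0 [HL0 H]].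
    assert (K : forall L, L0 < L -> Cmod (avg (fun t => f t * chi (- w) t)%C L - m) <= eps / 4).
    { intros L HL. specialize (H L 0 ltac:(lra)).
      rewrite (avg_ext _ _ L El) in H.
      replace (avg (fun t => f t * chi (- w) t)%C L - m)%C with
        ((avg (fun t => f t * chi (- w) t)%C L - avg (fun t => tpoly l t * chi (- w) t)%C L)
         + (avg (fun t => tpoly l t * chi (- w) t)%C L - m))%C by ring.
      eapply Rle_trans; [apply Cmod_triangle|].
      assert (Cmod (avg (fun t => f t * chi (- w) t)%C L - avg (fun t => tpoly l t * chi (- w) t)%C L) <= eps / 8).
      { rewrite <- avg_minus.
        - apply avg_norm_const; [lra| |].
          + intros t. apply continuous_Cminus; apply continuous_Cmult;
            first [apply Hc|apply continuous_chi|apply continuous_tpoly].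
          + intros t. replace (f t * chi (- w) t - tpoly l t * chi (- w) t)%C
              with ((f t - tpoly l t) * chi (- w) t)%C by ring.
            rewrite Cmod_mult, Cmod_chi, Rmult_1_r. apply Hl.
        - intros t. apply continuous_Cmult; [apply Hc|apply continuous_chi].
        - intros t. apply continuous_Cmult; [apply continuous_tpoly|apply continuous_chi]. }
      lra. }
    exists (fun L => L0 < L). split; [exists L0; trivial|].
    intros L L' HL HL'. apply K in HL. apply K in HL'.
    assert (HH := Cmod_triangle_minus (avg (fun t => f t * chi (- w) t)%C L') m (avg (fun t => f t * chi (- w) t)%C L)).
    rewrite (Cmod_minus_sym m) in HH. apply (proj2 (ball_C _ _ _)).
    match type of HH with Cmod (?p - ?q) <= _ => generalize (Re_minus_le p q) (Im_minus_le p q) end.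
    generalize (cond_pos eps). lra. }
  destruct Hex as [y Hy]. rewrite (fourier_coeff_unique f w y Hc Hy). exact Hy.
Qed.

(** The approximants only involve frequencies of the spectrum: in the limit of long
    intervals the Bochner-Fejer coefficients are multiples of Fourier coefficients. *)
Lemma spectral_approx (f : R -> C) (eps : R) : almost_periodic f -> 0 < eps ->
  exists l, (forall p, In p l -> spectrum f (snd p)) /\ forall x, Cmod (f x - tpoly l x) <= eps.
Proof.
  intros Hf He. destruct (proj1 Hf) as [Hc [B HB]].
  destruct (bochner_fejer f B eps Hc HB (almost_periodic_bohr f Hf) He) as [l [L0 [HL0 H]]].
  set (l1 := map (fun p => ((fst p * fourier_coeff f (snd p))%C, snd p)) l).
  set (keep := fun p : C * R => if Ceq_dec (fourier_coeff f (snd p)) 0 then false else true).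
  exists (map (fun p => ((fst p * fourier_coeff f (snd p))%C, snd p)) (filter keep l)). split.
  - intros p Hp. apply in_map_iff in Hp. destruct Hp as [q [<- Hq]]. apply filter_In in Hq.
    destruct Hq as [_ Hq]. unfold keep in Hq. simpl. unfold spectrum.
    destruct (Ceq_dec (fourier_coeff f (snd q)) 0); [discriminate|assumption].
  - intros x.
    assert (E : tpoly (map (fun p => ((fst p * fourier_coeff f (snd p))%C, snd p)) (filter keep l)) x = tpoly l1 x).
    { unfold l1. clear. induction l as [|p l IH]; [reflexivity|].
      simpl. destruct (keep p) eqn:Ek; simpl; rewrite IH; [reflexivity|].
      unfold keep in Ek. destruct (Ceq_dec (fourier_coeff f (snd p)) 0) as [E|]; [rewrite E; ring|discriminate]. }
    rewrite E. apply le_epsilon. intros e' He'.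
    assert (Hlim : forall e, 0 < e -> exists L1, 0 < L1 /\ forall L, L1 <= L ->
      Cmod (tpoly (weighted f L l) x - tpoly l1 x) <= e).
    { unfold l1. clear -Hf. induction l as [|p l IH]; intros e He.
      - exists 1. split; [lra|]. intros L _. simpl. replace (0 - 0)%C with (RtoC 0) by ring. rewrite Cmod_0. lra.
      - destruct (IH (e / 2) ltac:(lra)) as [L1 [HL1 H1]].
        assert (Hp := Cmod_ge_0 (fst p)).
        destruct (proj1 (tends_to_C _ _) (fourier_coeff_limit f (snd p) Hf) (e / (2 * (Cmod (fst p) + 1)))) as [L2 [HL2 H2]].
        { apply Rdiv_lt_0_compat; lra. }
        exists (L1 + L2). split; [lra|]. intros L HL. specialize (H1 L ltac:(lra)). specialize (H2 L ltac:(lra)).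
        match type of H1 with Cmod (?d - ?d') <= _ => match type of H2 with Cmod (?b - ?b') <= _ =>
          change (Cmod (fst p * b * chi (snd p) x + d - (fst p * b' * chi (snd p) x + d')) <= e);
          replace (fst p * b * chi (snd p) x + d - (fst p * b' * chi (snd p) x + d'))%C
            with (fst p * (b - b') * chi (snd p) x + (d - d'))%C by ring end end.
        eapply Rle_trans; [apply Cmod_triangle|]. rewrite !Cmod_mult, Cmod_chi, Rmult_1_r.
        assert (Cmod (fst p) * Cmod (avg (fun t => f t * chi (- snd p) t)%C L - fourier_coeff f (snd p)) <= e / 2).
        { apply Rle_trans with ((Cmod (fst p) + 1) * (e / (2 * (Cmod (fst p) + 1)))); [|right; field; lra].
          apply Rmult_le_compat; [exact Hp|apply Cmod_ge_0|lra|exact H2]. }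
        lra. }
    destruct (Hlim e' He') as [L1 [HL1 H1]].
    specialize (H1 (L0 + L1) ltac:(lra)). specialize (H (L0 + L1) x ltac:(lra)).
    generalize (Cmod_triangle_minus (f x) (tpoly (weighted f (L0 + L1) l) x) (tpoly l1 x)). lra.
Qed.

Lemma spectrum_bounded (f : R -> C) : Rbar_lt (bandwidth f) p_infty ->
  exists T, 0 <= T /\ forall w, spectrum f w -> Rabs w <= T.
Proof.
  intros H. destruct (classic (exists w, spectrum f w)) as [[w0 Hw0]|N].
  2: { exists 0. split; [lra|]. intros w Hw. exfalso. apply N. exists w; exact Hw. }
  unfold bandwidth in H.
  destruct (Lub_Rbar_correct (spectrum f)) as [U _]. destruct (Glb_Rbar_correct (spectrum f)) as [G _].
  assert (U0 := U w0 Hw0). assert (G0 := G w0 Hw0).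
  destruct (Lub_Rbar (spectrum f)) as [b| |]; destruct (Glb_Rbar (spectrum f)) as [a| |];
    simpl in H, U0, G0; try contradiction.
  exists (Rabs a + Rabs b). split; [generalize (Rabs_pos a) (Rabs_pos b); lra|].
  intros w Hw. assert (U1 := U w Hw). assert (G1 := G w Hw). simpl in U1, G1.
  apply Rabs_le. generalize (Rle_abs b) (Rle_abs (- a)) (Rabs_pos a) (Rabs_pos b). rewrite Rabs_Ropp. lra.
Qed.

Lemma bandwidth_finite (f : R -> C) (T : R) : (forall w, spectrum f w -> Rabs w <= T) ->
  Rbar_lt (bandwidth f) p_infty.
Proof.
  intros H. unfold bandwidth.
  destruct (Lub_Rbar_correct (spectrum f)) as [_ U]. destruct (Glb_Rbar_correct (spectrum f)) as [_ G].
  assert (U1 : Rbar_le (Lub_Rbar (spectrum f)) (Finite T)).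
  { apply U. intros w Hw. specialize (H w Hw). apply Rabs_le_between in H. simpl. lra. }
  assert (G1 : Rbar_le (Finite (- T)) (Glb_Rbar (spectrum f))).
  { apply G. intros w Hw. specialize (H w Hw). apply Rabs_le_between in H. simpl. lra. }
  destruct (Lub_Rbar (spectrum f)) as [b| |]; destruct (Glb_Rbar (spectrum f)) as [a| |];
    simpl in *; try contradiction; trivial.
Qed.

(** ** Bohr's theorem on the argument of an almost periodic function *)

Lemma Cmod_cis_minus_1 (s : R) : Cmod (cis s - 1) ^ 2 = 2 - 2 * cos s.
Proof.
  rewrite Cmod2_alt. unfold cis; simpl. generalize (sin2_cos2 s). unfold Rsqr. nra.
Qed.

Lemma cis_plus (s t : R) : cis (s + t) = (cis s * cis t)%C.
Proof. unfold cis. rewrite cos_plus, sin_plus. unfold Cmult; simpl. f_equal; ring. Qed.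

Lemma cis_dist (s t : R) : Cmod (cis s - cis t) = Cmod (cis (s - t) - 1).
Proof.
  replace (cis s - cis t)%C with ((cis (s - t) - 1) * cis t)%C.
  - rewrite Cmod_mult, Cmod_cis. ring.
  - replace (cis s) with (cis (s - t + t)) by (f_equal; ring). rewrite cis_plus. ring.
Qed.

Lemma cis_shift (s : R) (n : Z) : cis (s - 2 * PI * IZR n) = cis s.
Proof.
  assert (K : forall (k : nat) s, cis (s + 2 * PI * INR k) = cis s).
  { intros k t. unfold cis. replace (t + 2 * PI * INR k) with (t + 2 * INR k * PI) by ring.
    rewrite cos_period, sin_period. reflexivity. }
  destruct (Z_le_gt_dec 0 n) as [H|H].
  - rewrite <- (K (Z.to_nat n) (s - 2 * PI * IZR n)). f_equal.
    rewrite INR_IZR_INZ, Z2Nat.id by exact H. ring.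
  - rewrite <- (K (Z.to_nat (- n)) s). f_equal.
    rewrite INR_IZR_INZ, Z2Nat.id by lia. rewrite opp_IZR. ring.
Qed.

Lemma cos_small_arc (s e : R) : 0 <= e <= PI -> Rabs s <= PI -> cos e < cos s -> Rabs s < e.
Proof.
  intros He Hs Hc. apply Rnot_le_lt. intros H.
  assert (E : cos s = cos (Rabs s)).
  { unfold Rabs. destruct (Rcase_abs s); [rewrite cos_neg|]; reflexivity. }
  rewrite E in Hc. assert (0 <= Rabs s) by apply Rabs_pos.
  assert (cos (Rabs s) <= cos e) by (apply cos_decr_1; lra). lra.
Qed.

Lemma cis_near_1 (e : R) : 0 < e <= PI -> exists d, 0 < d /\
  forall s, Cmod (cis s - 1) <= d -> exists n : Z, Rabs (s - 2 * PI * IZR n) < e.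
Proof.
  intros He. assert (HPI := PI_RGT_0).
  assert (Hc : cos e < 1) by (rewrite <- cos_0; apply cos_decreasing_1; lra).
  exists (sqrt (1 - cos e)). split; [apply sqrt_lt_R0; lra|].
  intros s Hs. set (y := s / (2 * PI) + / 2). exists (Int_part y).
  assert (B := base_Int_part y). set (n := Int_part y) in *.
  assert (E : s = 2 * PI * (y - / 2)) by (unfold y; field; lra).
  apply cos_small_arc; [lra| |].
  - apply Rabs_le. rewrite E. split; nra.
  - assert (H2 : Cmod (cis s - 1) ^ 2 <= 1 - cos e).
    { rewrite <- (sqrt_sqrt (1 - cos e)) by lra.
      replace (sqrt (1 - cos e) * sqrt (1 - cos e)) with (sqrt (1 - cos e) ^ 2) by ring.
      apply pow_incr. split; [apply Cmod_ge_0|exact Hs]. }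
    rewrite Cmod_cis_minus_1 in H2.
    assert (Ec : cos (s - 2 * PI * IZR n) = cos s).
    { assert (K := cis_shift s n). unfold cis in K. injection K. trivial. }
    rewrite Ec. lra.
Qed.

(** A continuous function with [cis] values near [1] stays near one multiple of
    [2 pi]: to reach another one it would cross an odd multiple of [pi]. *)
Lemma constant_winding (D : R -> R) (e d s0 s1 : R) (n : Z) :
  0 < e <= 1 -> (forall s, continuous D s) ->
  (forall s, Cmod (cis s - 1) <= d -> exists n : Z, Rabs (s - 2 * PI * IZR n) < e) ->
  (forall s, Rmin s0 s1 <= s <= Rmax s0 s1 -> Cmod (cis (D s) - 1) <= d) ->
  Rabs (D s0 - 2 * PI * IZR n) < e -> Rabs (D s1 - 2 * PI * IZR n) < e.
Proof.
  intros He Hc Hd Hs H0.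
  destruct (Hd (D s1) (Hs s1 (proj2 (Rmin_le_Rmax_ends s0 s1)))) as [m Hm].
  destruct (Z.eq_dec m n) as [->|N]; [exact Hm|exfalso].
  assert (HPI := PI_RGT_0). assert (HPI3 : 3 < PI) by (generalize PI2_3_2; unfold PI2; lra).
  assert (Hcont : continuity D) by (intros s; apply continuity_pt_filterlim, Hc).
  apply Rabs_lt_between in Hm. apply Rabs_lt_between in H0.
  assert (cross : forall y, Rmin (D s0) (D s1) <= y <= Rmax (D s0) (D s1) ->
     exists k : Z, Rabs (y - 2 * PI * IZR k) < e).
  { intros y Hy. destruct (IVT_gen D s0 s1 y Hcont Hy) as [x [Hx <-]]. apply Hd, Hs, Hx. }
  assert (odd : forall (k : Z) (r : R), r = 1 \/ r = -1 ->
     ~ exists j : Z, Rabs (2 * PI * IZR k + r * PI - 2 * PI * IZR j) < e).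
  { intros k r Hr [j Hj]. apply Rabs_lt_between in Hj.
    destruct (Z_lt_le_dec j k) as [L|L].
    - assert (IZR (j + 1) <= IZR k) by (apply IZR_le; lia). rewrite plus_IZR in H.
      destruct Hr as [-> | ->]; nra.
    - destruct (Z.eq_dec j k) as [->|N'].
      + destruct Hr as [-> | ->]; lra.
      + assert (IZR (k + 1) <= IZR j) by (apply IZR_le; lia). rewrite plus_IZR in H.
        destruct Hr as [-> | ->]; nra. }
  destruct (Z_lt_le_dec m n) as [L|L].
  - assert (IZR (m + 1) <= IZR n) by (apply IZR_le; lia). rewrite plus_IZR in H.
    apply (odd n (-1)); [right; reflexivity|]. apply cross.
    rewrite Rmin_right, Rmax_left by nra. nra.
  - assert (IZR (n + 1) <= IZR m) by (apply IZR_le; lia). rewrite plus_IZR in H.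
    apply (odd n 1); [left; reflexivity|]. apply cross.
    rewrite Rmin_left, Rmax_right by nra. nra.
Qed.

Lemma tpoly_lipschitz (l : list (C * R)) : exists K, 0 <= K /\
  forall x y, Cmod (tpoly l x - tpoly l y) <= K * Rabs (x - y).
Proof.
  induction l as [|[a w] l [K [HK IH]]].
  - exists 0. split; [lra|]. intros x y. simpl. replace (0 - 0)%C with (RtoC 0) by ring.
    rewrite Cmod_0. lra.
  - assert (Hchi : forall x y, x <= y -> Cmod (chi w y - chi w x) <= Rabs w * (y - x)).
    { intros x y Hxy. apply (path_mean_value (chi w) (fun t => Ci * RtoC w * chi w t)%C); [exact Hxy| |].
      - intros t _. apply rderiv_chi.
      - intros t _. rewrite !Cmod_mult, Cmod_Ci, Cmod_R, Cmod_chi. lra. }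
    assert (Ha := Cmod_ge_0 a). assert (Hw := Rabs_pos w).
    exists (Cmod a * Rabs w + K). split; [nra|]. intros x y. simpl.
    replace (a * chi w x + tpoly l x - (a * chi w y + tpoly l y))%C
      with (a * (chi w x - chi w y) + (tpoly l x - tpoly l y))%C by ring.
    eapply Rle_trans; [apply Cmod_triangle|]. rewrite Cmod_mult, Rmult_plus_distr_r.
    apply Rplus_le_compat; [|apply IH]. rewrite Rmult_assoc. apply Rmult_le_compat_l; [exact Ha|].
    destruct (Rle_dec x y).
    + rewrite Cmod_minus_sym, Rabs_minus_sym, (Rabs_pos_eq (y - x)) by lra. apply Hchi; assumption.
    + rewrite (Rabs_pos_eq (x - y)) by lra. apply Hchi; lra.
Qed.

Lemma almost_periodic_uniformly_continuous (f : R -> C) (eps : R) :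
  almost_periodic f -> 0 < eps ->
  exists d, 0 < d /\ forall x y, Rabs (x - y) <= d -> Cmod (f x - f y) <= eps.
Proof.
  intros Hf He. destruct (almost_periodic_approx f (eps / 3) Hf ltac:(lra)) as [l Hl].
  destruct (tpoly_lipschitz l) as [K [HK HL]].
  exists (eps / (3 * (K + 1))). split; [apply Rdiv_lt_0_compat; lra|].
  intros x y Hxy. generalize (Hl x) (Hl y) (HL x y). intros H1 H2 H3.
  assert (H4 : K * Rabs (x - y) <= eps / 3).
  { apply Rle_trans with ((K + 1) * (eps / (3 * (K + 1)))); [|right; field; lra].
    apply Rmult_le_compat; [exact HK|apply Rabs_pos|lra|exact Hxy]. }
  replace (f x - f y)%C with ((f x - tpoly l x) + ((tpoly l x - tpoly l y) + - (f y - tpoly l y)))%C by ring.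
  eapply Rle_trans; [apply Cmod_triangle|].
  eapply Rle_trans; [apply Rplus_le_compat_l, Cmod_triangle|]. rewrite Cmod_opp. lra.
Qed.

(** An approximately additive sequence is within a bounded distance of a linear
    one: the quotients [(a n - K) / n] and [(a k + K) / k] are ordered. *)
Lemma approximately_additive_sequence (a : nat -> R) (K : R) :
  0 <= K -> (forall n m, Rabs (a (n + m)%nat - a n - a m) <= K) ->
  exists c, forall n, Rabs (a n - c * INR n) <= K.
Proof.
  intros HK H.
  assert (M : forall n k, Rabs (a (k * n)%nat - INR k * a n) <= (INR k + 1) * K).
  { intros n k. induction k as [|k IH].
    - simpl. specialize (H 0%nat 0%nat). simpl in H.
      replace (a 0%nat - a 0%nat - a 0%nat) with (- (a 0%nat)) in H by ring. rewrite Rabs_Ropp in H.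
      replace (a 0%nat - 0 * a n) with (a 0%nat) by ring. lra.
    - replace (S k * n)%nat with (n + k * n)%nat by lia. rewrite S_INR.
      specialize (H n (k * n)%nat). apply Rabs_le_between in H. apply Rabs_le_between in IH.
      apply Rabs_le. lra. }
  assert (M' : forall n k, Rabs (a (S k * n)%nat - INR (S k) * a n) <= INR (S k) * K).
  { intros n k. induction k as [|k IH].
    - simpl. rewrite Nat.add_0_r. replace (a n - 1 * a n) with 0 by ring. rewrite Rabs_R0. lra.
    - replace (S (S k) * n)%nat with (n + S k * n)%nat by lia. rewrite (S_INR (S k)).
      specialize (H n (S k * n)%nat). apply Rabs_le_between in H. apply Rabs_le_between in IH.
      apply Rabs_le. lra. }
  assert (O : forall n k, (a (S n) - K) / INR (S n) <= (a (S k) + K) / INR (S k)).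
  { intros n k. assert (Hn := lt_0_INR (S n) ltac:(lia)). assert (Hk := lt_0_INR (S k) ltac:(lia)).
    apply Rmult_le_reg_r with (INR (S n) * INR (S k)); [apply Rmult_lt_0_compat; assumption|].
    replace ((a (S n) - K) / INR (S n) * (INR (S n) * INR (S k))) with ((a (S n) - K) * INR (S k)) by (field; lra).
    replace ((a (S k) + K) / INR (S k) * (INR (S n) * INR (S k))) with ((a (S k) + K) * INR (S n)) by (field; lra).
    assert (A1 := M' (S n) k). assert (A2 := M' (S k) n).
    rewrite (Nat.mul_comm (S n) (S k)) in A2.
    apply Rabs_le_between in A1. apply Rabs_le_between in A2. nra. }
  destruct (completeness (fun y => exists n, y = (a (S n) - K) / INR (S n))) as [c [Hc1 Hc2]].
  - exists ((a 1%nat + K) / INR 1). intros y [n ->]. apply O.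
  - exists ((a 1%nat - K) / INR 1). exists 0%nat. reflexivity.
  - exists c. intros [|n].
    + simpl. specialize (H 0%nat 0%nat). simpl in H.
      replace (a 0%nat - a 0%nat - a 0%nat) with (- (a 0%nat)) in H by ring. rewrite Rabs_Ropp in H.
      replace (a 0%nat - c * 0) with (a 0%nat) by ring. exact H.
    + assert (Hn := lt_0_INR (S n) ltac:(lia)).
      assert (L1 : (a (S n) - K) / INR (S n) <= c) by (apply Hc1; exists n; reflexivity).
      assert (L2 : c <= (a (S n) + K) / INR (S n)) by (apply Hc2; intros y [k ->]; apply O).
      apply (Rmult_le_compat_r (INR (S n))) in L1; [|lra].
      apply (Rmult_le_compat_r (INR (S n))) in L2; [|lra].
      unfold Rdiv in L1, L2. rewrite Rmult_assoc, Rinv_l in L1, L2 by lra.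
      apply Rabs_le. lra.
Qed.

(** The linear approximation at the integers extends to the line because the function
    is bounded on the unit interval. *)
Lemma approximately_additive_linear (p : R -> R) (K : R) :
  (forall x, continuous p x) -> 0 <= K ->
  (forall x t, Rabs (p (x + t) - p x - p t) <= K) ->
  exists c M, forall x, Rabs (p x - c * x) <= M.
Proof.
  intros Hp HK H.
  destruct (approximately_additive_sequence (fun n => p (INR n)) K HK) as [c Hc].
  { intros n m. rewrite plus_INR. apply H. }
  destruct (continuity_ab_maj (fun t => Rabs (p t)) 0 1 ltac:(lra)) as [t0 [HB _]].
  { intros t Ht. apply continuity_pt_filterlim.
    apply (continuous_comp p Rabs); [apply Hp|apply continuous_Rabs]. }
  set (B := Rabs (p t0)) in *.
  assert (pos : forall x, 0 <= x -> Rabs (p x - c * x) <= 2 * K + B + Rabs c).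
  { intros x Hx. destruct (nfloor_ex x Hx) as [n Hn].
    assert (E := H (INR n) (x - INR n)). replace (INR n + (x - INR n)) with x in E by ring.
    specialize (Hc n). specialize (HB (x - INR n) ltac:(lra)).
    assert (Hcf : Rabs (c * (x - INR n)) <= Rabs c).
    { rewrite Rabs_mult, (Rabs_pos_eq (x - INR n)) by lra. generalize (Rabs_pos c). nra. }
    apply Rabs_le_between in E. apply Rabs_le_between in Hc. apply Rabs_le_between in HB.
    apply Rabs_le_between in Hcf. apply Rabs_le. lra. }
  exists c, (4 * K + B + Rabs c). intros x. destruct (Rle_dec 0 x) as [Hx|Hx].
  - specialize (pos x Hx). lra.
  - specialize (pos (- x) ltac:(lra)). assert (E := H x (- x)). assert (E0 := H 0 0).
    replace (x + - x) with 0 in E by ring. rewrite Rplus_0_r in E0.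
    apply Rabs_le_between in E. apply Rabs_le_between in E0. apply Rabs_le_between in pos.
    apply Rabs_le. lra.
Qed.

(** A near period [t] changes the argument by nearly
    the same multiple of [2 pi] everywhere; since near periods are relatively dense
    the argument is approximately additive, hence linear up to a bounded term, and
    iterating a near period shows that the bounded term hardly changes under it. *)
Lemma bohr_argument (p : R -> R) :
  (forall x, continuous p x) -> bohrC (fun x => cis (p x)) ->
  exists c M, (forall x, Rabs (p x - c * x) <= M) /\
    bohr (fun a b => Rabs (a - b)) (fun x => p x - c * x).
Proof.
  intros Hp Hq. assert (HPI3 : 3 < PI) by (generalize PI2_3_2; unfold PI2; lra).
  assert (Hqc : forall x, continuous (fun x => cis (p x)) x).
  { intros x. apply continuous_comp; [apply Hp|apply continuous_cis]. }
  assert (Hqap : almost_periodic (fun x => cis (p x))).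
  { apply bohr_almost_periodic; [|exact Hq]. split; [exact Hqc|]. exists 1. intros x. rewrite Cmod_cis. lra. }
  assert (HD : forall t s, continuous (fun x => p (x + t) - p x) s).
  { intros t s. apply (continuous_minus (V := R_NormedModule) (fun x => p (x + t)) p); [|apply Hp].
    apply (continuous_comp (fun x => x + t) p); [|apply Hp].
    apply @continuous_plus; [apply continuous_id|apply continuous_const]. }
  assert (wind : forall e, 0 < e <= 1 -> exists W d, 0 < d /\ forall t, near_period W d t ->
    exists n : Z, forall x, Rabs (p (x + t) - p x - 2 * PI * IZR n) < e).
  { intros e He. destruct (cis_near_1 e ltac:(lra)) as [r [Hr Hd]].
    destruct (Hq r Hr) as [W [d [Hd0 HW]]]. exists W, d. split; [exact Hd0|]. intros t Ht.
    assert (Hall : forall x, Cmod (cis (p (x + t) - p x) - 1) <= r).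
    { intros x. rewrite <- cis_dist. apply HW, Ht. }
    destruct (Hd _ (Hall 0)) as [n Hn]. exists n. intros x.
    apply (constant_winding (fun x => p (x + t) - p x) e r 0 x n); try assumption.
    - apply HD.
    - intros s _. apply Hall. }
  assert (incr : forall r, exists B, forall x, Rabs (p (x + r) - p x) <= B).
  { destruct (cis_near_1 1 ltac:(lra)) as [r [Hr Hd]].
    destruct (almost_periodic_uniformly_continuous _ r Hqap Hr) as [h [Hh Huc]].
    assert (small : forall x s, Rabs s <= h -> Rabs (p (x + s) - p x) <= 1).
    { intros x s Hs.
      assert (Hw : Rabs (p (x + s) - p x - 2 * PI * IZR 0) < 1).
      { apply (constant_winding (fun s => p (x + s) - p x) 1 r 0 s 0%Z); try assumption; [lra| | |].
        - intros u. apply (continuous_minus (V := R_NormedModule) (fun s => p (x + s)) (fun _ => p x));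
            [|apply continuous_const]. apply (continuous_comp (fun s => x + s) p); [|apply Hp].
          apply @continuous_plus; [apply continuous_const|apply continuous_id].
        - intros u Hu. rewrite <- cis_dist. apply Huc. replace (x + u - x) with u by ring.
          apply Rabs_le. apply Rabs_le_between in Hs.
          revert Hu. unfold Rmin, Rmax. destruct (Rle_dec 0 s); lra.
        - rewrite Rplus_0_r. replace (p x - p x - 2 * PI * 0) with 0 by ring. rewrite Rabs_R0. lra. }
      rewrite Rmult_0_r, Rminus_0_r in Hw. lra. }
    assert (multi : forall (k : nat) x s, Rabs s <= h -> Rabs (p (x + INR k * s) - p x) <= INR k).
    { intros k x s Hs. induction k as [|k IH].
      - simpl. replace (x + 0 * s) with x by ring. replace (p x - p x) with 0 by ring. rewrite Rabs_R0. lra.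
      - rewrite S_INR. replace (x + (INR k + 1) * s) with (x + INR k * s + s) by ring.
        assert (Hs1 := small (x + INR k * s) s Hs).
        apply Rabs_le_between in IH. apply Rabs_le_between in Hs1. apply Rabs_le. lra. }
    intros t. assert (Ht : 0 <= Rabs t / h) by (apply Rmult_le_pos; [apply Rabs_pos|left; apply Rinv_0_lt_compat, Hh]).
    destruct (nfloor_ex _ Ht) as [k Hk]. exists (INR (S k)). intros x.
    assert (Hk0 := lt_0_INR (S k) ltac:(lia)).
    replace t with (INR (S k) * (t / INR (S k))) at 1 by (field; lra).
    apply multi. unfold Rdiv. rewrite Rabs_mult, (Rabs_pos_eq (/ INR (S k))) by (left; apply Rinv_0_lt_compat, Hk0).
    apply Rmult_le_reg_r with (INR (S k)); [exact Hk0|]. rewrite Rmult_assoc, Rinv_l by lra.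
    rewrite S_INR. apply Rle_trans with (Rabs t / h * h); [right; field; lra|].
    rewrite (Rmult_comm h). apply Rmult_le_compat_r; lra. }
  assert (add : exists K, 0 <= K /\ forall x t, Rabs (p (x + t) - p x - (p t - p 0)) <= K).
  { destruct (wind 1 ltac:(lra)) as [W [d [Hd Hw]]].
    destruct (near_period_cover W d Hd) as [rs Hrs].
    assert (HB : exists B, 0 <= B /\ forall r, In r rs -> forall x, Rabs (p (x + r) - p x) <= B).
    { clear Hrs. induction rs as [|r rs [B [HB0 IH]]].
      - exists 0. split; [lra|]. intros r [].
      - destruct (incr r) as [B' HB']. exists (Rmax B B'). split; [eapply Rle_trans; [exact HB0|apply Rmax_l]|].
        intros r' [<-|Hr'] x.
        + eapply Rle_trans; [apply HB'|apply Rmax_r].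
        + eapply Rle_trans; [apply IH, Hr'|apply Rmax_l]. }
    destruct HB as [B [HB0 HB]]. exists (2 + 2 * B). split; [lra|]. intros x t.
    destruct (Hrs t) as [r [Hr Hnp]]. destruct (Hw _ Hnp) as [n Hn].
    assert (E1 := Hn (x + r)). assert (E2 := Hn (0 + r)).
    replace (x + r + (t - r)) with (x + t) in E1 by ring.
    replace (0 + r + (t - r)) with t in E2 by ring.
    assert (E3 := HB r Hr x). assert (E4 := HB r Hr 0).
    apply Rabs_lt_between in E1. apply Rabs_lt_between in E2.
    apply Rabs_le_between in E3. apply Rabs_le_between in E4. apply Rabs_le. lra. }
  destruct add as [K [HK add]].
  destruct (approximately_additive_linear (fun x => p x - p 0) K) as [c [M HM]]; [|exact HK| |].
  { intros x. apply (continuous_minus (V := R_NormedModule) p (fun _ => p 0)); [apply Hp|apply continuous_const]. }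
  { intros x t. replace (p (x + t) - p 0 - (p x - p 0) - (p t - p 0))
      with (p (x + t) - p x - (p t - p 0)) by ring. apply add. }
  set (th := fun x => p x - c * x).
  assert (Hb : forall x, Rabs (th x) <= M + Rabs (p 0)).
  { intros x. unfold th. specialize (HM x). replace (p x - c * x) with ((p x - p 0 - c * x) + p 0) by ring.
    eapply Rle_trans; [apply Rabs_triang|]. lra. }
  exists c, (M + Rabs (p 0)). split; [exact Hb|].
  set (M' := M + Rabs (p 0)) in *.
  assert (HM' : 0 <= M') by (eapply Rle_trans; [apply Rabs_pos|apply (Hb 0)]).
  intros eps Heps.
  set (e := Rmin (eps / 2) 1).
  assert (He : 0 < e <= 1) by (split; [apply Rmin_pos; lra|apply Rmin_r]).
  destruct (wind e He) as [W [d [Hd Hw]]]. exists W, d. split; [exact Hd|].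
  intros t Ht. destruct (Hw t Ht) as [n Hn].
  set (g := 2 * PI * IZR n - c * t).
  assert (step : forall x, Rabs (th (x + t) - th x - g) <= e).
  { intros x. left. unfold th, g. replace (p (x + t) - c * (x + t) - (p x - c * x) - (2 * PI * IZR n - c * t))
      with (p (x + t) - p x - 2 * PI * IZR n) by ring. apply Hn. }
  assert (iter : forall (k : nat) x, Rabs (th (x + INR k * t) - th x - INR k * g) <= INR k * e).
  { intros k x. induction k as [|k IH].
    - simpl. replace (x + 0 * t) with x by ring. replace (th x - th x - 0 * g) with 0 by ring.
      rewrite Rabs_R0. lra.
    - rewrite S_INR. replace (x + (INR k + 1) * t) with (x + INR k * t + t) by ring.
      assert (S1 := step (x + INR k * t)). apply Rabs_le_between in IH. apply Rabs_le_between in S1.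
      apply Rabs_le. lra. }
  assert (Hg : Rabs g <= e).
  { apply le_epsilon. intros e' He'.
    assert (H0 : 0 <= 2 * M' / e') by (apply Rmult_le_pos; [lra|left; apply Rinv_0_lt_compat, He']).
    destruct (nfloor_ex _ H0) as [k Hk]. assert (Hk0 := lt_0_INR (S k) ltac:(lia)).
    assert (Hk1 : 2 * M' <= INR (S k) * e').
    { rewrite S_INR. replace (2 * M') with (2 * M' / e' * e') by (field; lra).
      apply Rmult_le_compat_r; lra. }
    assert (I1 := iter (S k) 0). assert (B1 := Hb (0 + INR (S k) * t)). assert (B2 := Hb 0).
    assert (T : INR (S k) * Rabs g <= INR (S k) * (e + e')).
    { rewrite <- (Rabs_pos_eq (INR (S k))) at 1 by lra. rewrite <- Rabs_mult.
      apply Rabs_le_between in I1. apply Rabs_le_between in B1. apply Rabs_le_between in B2.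
      apply Rabs_le. lra. }
    apply Rmult_le_reg_l in T; [exact T|exact Hk0]. }
  intros x. specialize (step x). apply Rabs_le_between in step. apply Rabs_le_between in Hg.
  assert (2 * e <= eps) by (generalize (Rmin_l (eps / 2) 1); unfold e; lra).
  apply Rabs_le. fold (th x). fold (th (x + t)). lra.
Qed.

(** * Band-limited functions extend to entire functions of exponential type *)

Definition tpolyC (l : list (C * R)) (z : C) : C :=
  fold_right (fun p s => (fst p * Cexp (Ci * RtoC (snd p) * z) + s)%C) (RtoC 0) l.

Lemma Cexp_imag (y : R) : Cexp (Ci * RtoC y) = cis y.
Proof.
  unfold Cexp, cis. rewrite re_mult, im_mult. simpl.
  replace (0 * y - 1 * 0) with 0 by ring. replace (0 * 0 + 1 * y) with y by ring.
  rewrite exp_0, !Rmult_1_l. reflexivity.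
Qed.

Lemma Cexp_chi (w x : R) : Cexp (Ci * RtoC w * RtoC x) = chi w x.
Proof. rewrite <- Cmult_assoc, <- RtoC_mult. apply Cexp_imag. Qed.

Lemma Cmod_Cexp_line (w : R) (z : C) : Cmod (Cexp (Ci * RtoC w * z)) = exp (- (w * Im z)).
Proof.
  rewrite Cmod_Cexp. f_equal. rewrite !re_mult, im_mult. simpl. ring.
Qed.

Lemma cderiv_Cexp_line (k z : C) : cderiv (fun z => Cexp (k * z)) z (Cexp (k * z) * (0 * z + k * 1))%C.
Proof.
  apply (cderiv_comp Cexp (fun z => k * z)%C); [apply cderiv_Cexp|].
  apply (cderiv_mult (fun _ => k)); [apply cderiv_const|apply cderiv_id].
Qed.

Lemma tpolyC_real (l : list (C * R)) (x : R) : tpolyC l (RtoC x) = tpoly l x.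
Proof. induction l as [|p l IH]; simpl; [reflexivity|]. rewrite IH, Cexp_chi. reflexivity. Qed.

Lemma tpolyC_entire (l : list (C * R)) : entire_fun (tpolyC l).
Proof.
  intros z _. induction l as [|p l [m IH]]; simpl.
  - exists (RtoC 0). apply cderiv_const.
  - eexists. apply cderiv_plus; [|exact IH].
    apply (cderiv_mult (fun _ => fst p)); [apply cderiv_const|apply cderiv_Cexp_line].
Qed.

Lemma tpolyC_app (l l' : list (C * R)) (z : C) : tpolyC (l ++ l') z = (tpolyC l z + tpolyC l' z)%C.
Proof. induction l as [|p l IH]; simpl; [ring|]. rewrite IH. ring. Qed.

Lemma tpolyC_scal (c : C) (l : list (C * R)) (z : C) :
  tpolyC (map (fun p => ((c * fst p)%C, snd p)) l) z = (c * tpolyC l z)%C.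
Proof. induction l as [|p l IH]; simpl; [ring|]. rewrite IH. ring. Qed.

Lemma tpolyC_reverse (l : list (C * R)) (z : C) :
  tpolyC (map (fun p => (fst p, - snd p)) l) z = tpolyC l (- z).
Proof.
  induction l as [|p l IH]; simpl; [reflexivity|]. rewrite IH. do 3 f_equal.
  rewrite RtoC_opp. ring.
Qed.

Lemma tpolyC_crude (l : list (C * R)) (T : R) (z : C) :
  (forall p, In p l -> Rabs (snd p) <= T) -> 0 <= Im z ->
  Cmod (tpolyC l z) <= coeff_sum l * exp (T * Im z).
Proof.
  intros Hl Hz. induction l as [|p l IH]; simpl.
  - rewrite Cmod_0. lra.
  - eapply Rle_trans; [apply Cmod_triangle|]. rewrite Rmult_plus_distr_r.
    apply Rplus_le_compat.
    + rewrite Cmod_mult, Cmod_Cexp_line. apply Rmult_le_compat_l; [apply Cmod_ge_0|].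
      apply exp_le. assert (H := Hl p (or_introl eq_refl)). apply Rabs_le_between in H. nra.
    + apply IH. intros q Hq. apply Hl. right; exact Hq.
Qed.

(** Multiplied by [exp (i T z)] the polynomial is bounded in the upper half-plane,
    so the maximum over the line bounds it there. *)
Lemma tpolyC_growth_upper (l : list (C * R)) (T M : R) :
  (forall p, In p l -> Rabs (snd p) <= T) -> 0 < M -> (forall x, Cmod (tpoly l x) <= M) ->
  forall z, 0 <= Im z -> Cmod (tpolyC l z) <= M * exp (T * Im z).
Proof.
  intros Hl HM H [x y] Hy. simpl Im in Hy |- *.
  set (Q := fun z => (tpolyC l z * Cexp (Ci * RtoC T * z))%C).
  assert (EQ : forall z, Cmod (Q z) = Cmod (tpolyC l z) * exp (- (T * Im z))).
  { intros z. unfold Q. rewrite Cmod_mult, Cmod_Cexp_line. reflexivity. }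
  assert (K : Cmod (Q (x, y)) <= M).
  { apply (phragmen_lindelof_half_plane Q M (coeff_sum l)); try assumption.
    - intros w _. destruct (tpolyC_entire l w I) as [m Hm]. eexists.
      apply cderiv_mult; [exact Hm|apply cderiv_Cexp_line].
    - intros u v Hv. rewrite EQ. simpl Im.
      apply Rmult_le_reg_r with (exp (T * v)); [apply exp_pos|].
      rewrite Rmult_assoc, <- exp_plus. replace (- (T * v) + T * v) with 0 by ring.
      rewrite exp_0, Rmult_1_r. apply (tpolyC_crude l T (u, v)); assumption.
    - intros u. rewrite EQ. simpl Im. change (u, 0) with (RtoC u). rewrite tpolyC_real, Rmult_0_r, Ropp_0, exp_0, Rmult_1_r.
      apply H. }
  rewrite EQ in K. simpl Im in K.
  apply Rmult_le_reg_r with (exp (- (T * y))); [apply exp_pos|].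
  rewrite Rmult_assoc, <- exp_plus. replace (T * y + - (T * y)) with 0 by ring.
  rewrite exp_0, Rmult_1_r. exact K.
Qed.

(** Bernstein's inequality for the complex extension: the growth off the real line
    is controlled by the sup norm alone, not by the coefficients. *)
Lemma tpolyC_growth (l : list (C * R)) (T M : R) :
  (forall p, In p l -> Rabs (snd p) <= T) -> 0 < M -> (forall x, Cmod (tpoly l x) <= M) ->
  forall z, Cmod (tpolyC l z) <= M * exp (T * Rabs (Im z)).
Proof.
  intros Hl HM H z. destruct (Rle_dec 0 (Im z)) as [Hz|Hz].
  - rewrite Rabs_pos_eq by exact Hz. apply tpolyC_growth_upper; assumption.
  - rewrite Rabs_left by lra.
    replace z with (- - z)%C at 1 by ring. rewrite <- tpolyC_reverse.
    rewrite <- im_opp. apply tpolyC_growth_upper; [|exact HM| |rewrite im_opp; lra].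
    + intros p Hp. apply in_map_iff in Hp. destruct Hp as [q [<- Hq]]. simpl. rewrite Rabs_Ropp. apply Hl, Hq.
    + intros x. rewrite <- tpolyC_real, tpolyC_reverse, <- RtoC_opp, tpolyC_real. apply H.
Qed.

Lemma geometric_cauchy_limit (u : nat -> C) (K : R) : 0 <= K ->
  (forall n m, Cmod (u n - u m) <= K * ((/ 2) ^ n + (/ 2) ^ m)) ->
  exists w, forall n, Cmod (w - u n) <= 4 * K * (/ 2) ^ n.
Proof.
  intros HK H.
  assert (part : forall f : C -> R, (forall z w, Rabs (f z - f w) <= Cmod (z - w)) ->
    exists y, forall n, Rabs (y - f (u n)) <= 2 * K * (/ 2) ^ n).
  { intros f Hf.
    assert (Hex : ex_finite_lim_seq (fun n => f (u n))).
    { apply ex_lim_seq_cauchy_corr. intros eps.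
      destruct (half_pow_small (2 * K) eps ltac:(lra) (cond_pos eps)) as [N HN].
      exists N. intros n m Hn Hm. eapply Rle_lt_trans; [apply Hf|].
      eapply Rle_lt_trans; [apply H|].
      assert (Hpow : forall k, (N <= k)%nat -> (/ 2) ^ k <= (/ 2) ^ N).
      { intros k Hk. replace k with (N + (k - N))%nat by lia. rewrite pow_add.
        rewrite <- (Rmult_1_r ((/ 2) ^ N)) at 2. apply Rmult_le_compat_l; [apply pow_le; lra|].
        rewrite <- (pow1 (k - N)). apply pow_incr; lra. }
      generalize (Hpow n Hn) (Hpow m Hm). nra. }
    destruct Hex as [y Hy]. exists y. intros n. apply le_epsilon. intros e He.
    assert (He2 : 0 < e / 2) by lra.
    apply is_lim_seq_spec in Hy. destruct (Hy (mkposreal _ He2)) as [N HN]. simpl in HN.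
    destruct (half_pow_small K (e / 2) HK He2) as [N' HN'].
    set (m := (n + N + N')%nat).
    specialize (HN m ltac:(unfold m; lia)).
    assert (Hm : (/ 2) ^ m <= (/ 2) ^ n /\ K * (/ 2) ^ m < e / 2).
    { assert (E1 : (/ 2) ^ m = (/ 2) ^ n * (/ 2) ^ (N + N')) by (unfold m; rewrite <- pow_add; f_equal; lia).
      assert (E2 : (/ 2) ^ m = (/ 2) ^ N' * (/ 2) ^ (n + N)) by (unfold m; rewrite <- pow_add; f_equal; lia).
      assert (P : forall k, 0 < (/ 2) ^ k <= 1).
      { intros k. split; [apply pow_lt; lra|]. rewrite <- (pow1 k). apply pow_incr; lra. }
      generalize (P n) (P N') (P (N + N')%nat) (P (n + N)%nat). intros. split; [nra|].
      apply Rle_lt_trans with (2 := HN'). apply Rmult_le_compat_l; [exact HK|]. nra. }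
    assert (H2 := Hf (u m) (u n)). assert (H3 := H m n).
    replace (y - f (u n)) with ((y - f (u m)) + (f (u m) - f (u n))) by ring.
    eapply Rle_trans; [apply Rabs_triang|]. rewrite (Rabs_minus_sym y).
    nra. }
  destruct (part Re Re_minus_le) as [x Hx]. destruct (part Im Im_minus_le) as [y Hy].
  exists (x, y). intros n. eapply Rle_trans; [apply Cmod_minus_le|]. simpl Re. simpl Im.
  generalize (Hx n) (Hy n). lra.
Qed.

Lemma entire_continuous (F : C -> C) (z : C) : entire_fun F -> continuous F z.
Proof. intros H. destruct (H z I) as [l Hl]. exact (cderiv_continuous _ _ _ Hl). Qed.

(** Limits that are uniform on horizontal strips inherit continuity and vanishing
    integrals around rectangles; Morera's theorem applies. *)
Lemma strip_limit_entire (P : nat -> C -> C) (F : C -> C) (K T : R) :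
  0 <= K -> 0 <= T -> (forall n, entire_fun (P n)) ->
  (forall n z, Cmod (F z - P n z) <= K * (/ 2) ^ n * exp (T * Rabs (Im z))) ->
  entire_fun F.
Proof.
  intros HK HT HP H.
  assert (Hc : forall z, continuous F z).
  { intros z. apply continuous_C_eps. intros eps He.
    set (E := K * exp (T * (Rabs (Im z) + 1))).
    assert (HE : 0 <= E) by (apply Rmult_le_pos; [exact HK|left; apply exp_pos]).
    destruct (half_pow_small E (eps / 3) HE ltac:(lra)) as [n Hn].
    destruct (proj1 (continuous_C_eps (P n) z) (entire_continuous (P n) z (HP n)) (eps / 3) ltac:(lra)) as [d [Hd Hw]].
    exists (Rmin d 1). split; [apply Rmin_pos; lra|]. intros w Hwz.
    assert (near : forall v, Cmod (v - z) < 1 -> Cmod (F v - P n v) < eps / 3).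
    { intros v Hv. eapply Rle_lt_trans; [apply H|]. apply Rle_lt_trans with (2 := Hn).
      unfold E. replace (K * exp (T * (Rabs (Im z) + 1)) * (/ 2) ^ n)
        with (K * (/ 2) ^ n * exp (T * (Rabs (Im z) + 1))) by ring.
      apply Rmult_le_compat_l; [apply Rmult_le_pos; [exact HK|apply pow_le; lra]|].
      apply exp_le. apply Rmult_le_compat_l; [exact HT|].
      assert (E1 := Im_minus_le v z). assert (E2 := Rabs_triang (Im v - Im z) (Im z)).
      replace (Im v - Im z + Im z) with (Im v) in E2 by ring. lra. }
    assert (N1 := near w ltac:(generalize (Rmin_r d 1); lra)).
    assert (N2 : Cmod (F z - P n z) < eps / 3).
    { apply near. replace (z - z)%C with (RtoC 0) by ring. rewrite Cmod_0. lra. }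
    assert (N3 := Hw w ltac:(generalize (Rmin_l d 1); lra)).
    replace (F w - F z)%C with ((F w - P n w) + ((P n w - P n z) + - (F z - P n z)))%C by ring.
    eapply Rle_lt_trans; [apply Cmod_triangle|].
    eapply Rle_lt_trans; [apply Rplus_le_compat_l, Cmod_triangle|]. rewrite Cmod_opp. lra. }
  apply morera; [apply box_domain_plane|]. split; [intros z _; apply Hc|].
  intros a b c d _ _. apply Cmod_eq_0. apply Rle_antisym; [|apply Cmod_ge_0].
  apply le_epsilon. intros e He. rewrite Rplus_0_l.
  set (Y := Rabs c + Rabs d).
  set (E := K * exp (T * Y) * (2 * (Rabs (b - a) + Rabs (d - c)))).
  assert (HE : 0 <= E).
  { unfold E. apply Rmult_le_pos; [apply Rmult_le_pos; [exact HK|left; apply exp_pos]|].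
    generalize (Rabs_pos (b - a)) (Rabs_pos (d - c)). lra. }
  destruct (half_pow_small E e HE He) as [n Hn].
  assert (E0 : rect_int (P n) a b c d = RtoC 0).
  { apply (holo_rect_null (fun _ => True) (P n) box_domain_plane (HP n)); exact I. }
  replace (rect_int F a b c d) with (rect_int F a b c d - rect_int (P n) a b c d)%C by (rewrite E0; ring).
  rewrite <- rect_int_minus.
  - eapply Rle_trans.
    + apply (rect_int_norm _ a b c d (K * (/ 2) ^ n * exp (T * Y))).
      * intros x y _ _. apply continuous_Cminus; [apply Hc|apply entire_continuous, HP].
      * intros x y _ Hy. eapply Rle_trans; [apply H|]. simpl Im.
        apply Rmult_le_compat_l; [apply Rmult_le_pos; [exact HK|apply pow_le; lra]|].
        apply exp_le. apply Rmult_le_compat_l; [exact HT|].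
        unfold Y. revert Hy. unfold Rmin, Rmax. generalize (Rle_abs c) (Rle_abs (- c)) (Rle_abs d) (Rle_abs (- d)).
        rewrite !Rabs_Ropp. intros. apply Rabs_le. destruct (Rle_dec c d); generalize (Rabs_pos c) (Rabs_pos d); lra.
    + left. eapply Rle_lt_trans; [|exact Hn]. unfold E. right. ring.
  - intros x y _ _. apply Hc.
  - intros x y _ _. apply entire_continuous, HP.
Qed.

(** Approximants with frequencies in the spectrum form a Cauchy sequence on the line;
    by the growth bound they do so on every horizontal strip. *)
Lemma band_limited_entire_extension (f : R -> C) : band_limited f ->
  exists (F : C -> C) (T M : R), 0 <= T /\ 0 < M /\ entire_fun F /\ extends_line f F /\
    forall z, Cmod (F z) <= M * exp (T * Rabs (Im z)).
Proof.
  intros [Hf Hb]. destruct (spectrum_bounded f Hb) as [T [HT Hs]].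
  assert (Hex : forall n, exists l, (forall p, In p l -> Rabs (snd p) <= T) /\
     forall x, Cmod (f x - tpoly l x) <= (/ 2) ^ n).
  { intros n. destruct (spectral_approx f ((/ 2) ^ n) Hf ltac:(apply pow_lt; lra)) as [l [Hl H]].
    exists l. split; [|exact H]. intros p Hp. apply Hs, Hl, Hp. }
  set (L := fun n => proj1_sig (constructive_indefinite_description _ (Hex n))).
  assert (HL : forall n, (forall p, In p (L n) -> Rabs (snd p) <= T) /\
     forall x, Cmod (f x - tpoly (L n) x) <= (/ 2) ^ n).
  { intros n. exact (proj2_sig (constructive_indefinite_description _ (Hex n))). }
  assert (Hpos : forall n, 0 < (/ 2) ^ n) by (intros n; apply pow_lt; lra).
  assert (Hdiff : forall z n m, Cmod (tpolyC (L n) z - tpolyC (L m) z)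
     <= exp (T * Rabs (Im z)) * ((/ 2) ^ n + (/ 2) ^ m)).
  { intros z n m.
    set (l := L n ++ map (fun p => ((- (1) * fst p)%C, snd p)) (L m)).
    replace (tpolyC (L n) z - tpolyC (L m) z)%C with (tpolyC l z)
      by (unfold l; rewrite tpolyC_app, tpolyC_scal; ring).
    rewrite Rmult_comm. apply tpolyC_growth.
    - intros p Hp. unfold l in Hp. apply in_app_or in Hp. destruct Hp as [Hp|Hp]; [apply (HL n), Hp|].
      apply in_map_iff in Hp. destruct Hp as [q [<- Hq]]. exact (proj1 (HL m) q Hq).
    - generalize (Hpos n) (Hpos m). lra.
    - intros x. unfold l. rewrite tpoly_app, tpoly_scal_coeff.
      replace (tpoly (L n) x + - (1) * tpoly (L m) x)%C
        with (- (f x - tpoly (L n) x) + (f x - tpoly (L m) x))%C by ring.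
      eapply Rle_trans; [apply Cmod_triangle|]. rewrite Cmod_opp.
      generalize (proj2 (HL n) x) (proj2 (HL m) x). lra. }
  assert (Hlim : forall z, exists w, forall n, Cmod (w - tpolyC (L n) z) <= 4 * exp (T * Rabs (Im z)) * (/ 2) ^ n).
  { intros z. apply geometric_cauchy_limit; [left; apply exp_pos|apply Hdiff]. }
  set (F := fun z => proj1_sig (constructive_indefinite_description _ (Hlim z))).
  assert (HF : forall z n, Cmod (F z - tpolyC (L n) z) <= 4 * exp (T * Rabs (Im z)) * (/ 2) ^ n).
  { intros z. exact (proj2_sig (constructive_indefinite_description _ (Hlim z))). }
  exists F, T, (coeff_sum (L 0%nat) + 5).
  assert (HC := coeff_sum_ge_0 (L 0%nat)).
  split; [exact HT|]. split; [lra|]. split; [|split].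
  - apply (strip_limit_entire (fun n => tpolyC (L n)) F 4 T); [lra|exact HT|intros; apply tpolyC_entire|].
    intros n z. eapply Rle_trans; [apply HF|]. right. ring.
  - intros x. apply Ceq_minus. apply Cmod_eq_0. apply Rle_antisym; [|apply Cmod_ge_0].
    apply le_epsilon. intros e He. rewrite Rplus_0_l.
    destruct (half_pow_small 5 e ltac:(lra) He) as [n Hn].
    assert (H1 := HF (RtoC x) n). assert (H2 := proj2 (HL n) x).
    rewrite tpolyC_real in H1. simpl Im in H1. rewrite Rabs_R0, Rmult_0_r, exp_0 in H1.
    assert (H3 := Cmod_triangle_minus (F (RtoC x)) (tpoly (L n) x) (f x)).
    rewrite (Cmod_minus_sym (tpoly (L n) x)) in H3. lra.
  - intros z.
    assert (H1 := HF z 0%nat). simpl in H1.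
    assert (H2 : Cmod (tpolyC (L 0%nat) z) <= (coeff_sum (L 0%nat) + 1) * exp (T * Rabs (Im z))).
    { apply tpolyC_growth; [apply (HL 0%nat)|lra|].
      intros x. eapply Rle_trans; [apply Cmod_tpoly_le|]. lra. }
    assert (H3 := Cmod_reverse_triangle (F z) (tpolyC (L 0%nat) z)). lra.
Qed.

(** ** Exponential type *)

Lemma entire_bounded_on_disc (F : C -> C) (r : R) : entire_fun F ->
  exists M, 0 < M /\ forall z, Cmod z <= r -> Cmod (F z) <= M.
Proof.
  intros HF. destruct (Rle_dec 0 r) as [Hr|Hr].
  - destruct (rect_bounded F (- r) r (- r) r ltac:(lra) ltac:(lra)) as [M [HM H]].
    { intros x y _ _. apply entire_continuous, HF. }
    exists M. split; [exact HM|]. intros [x y] Hz.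
    assert (H1 := Re_le_Cmod (x, y)). assert (H2 := Im_le_Cmod (x, y)). simpl in H1, H2.
    apply H; apply Rabs_le_between; lra.
  - exists 1. split; [lra|]. intros z Hz. generalize (Cmod_ge_0 z). lra.
Qed.

Lemma max_modulus_bounds (F : C -> C) (r M : R) : 0 <= r ->
  (forall z, Cmod z <= r -> Cmod (F z) <= M) ->
  (forall z, Cmod z <= r -> Cmod (F z) <= max_modulus F r) /\ max_modulus F r <= M.
Proof.
  intros Hr HM. unfold max_modulus.
  set (E := fun y => exists z, Cmod z <= r /\ y = Cmod (F z)).
  destruct (Lub_Rbar_correct E) as [U L].
  assert (U0 : Rbar_le (Finite (Cmod (F 0))) (Lub_Rbar E)).
  { apply U. exists (RtoC 0). split; [rewrite Cmod_0; exact Hr|reflexivity]. }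
  assert (L0 : Rbar_le (Lub_Rbar E) (Finite M)).
  { apply L. intros y [z [Hz ->]]. simpl. apply HM, Hz. }
  destruct (Lub_Rbar E) as [b| |]; simpl in U0, L0; try contradiction.
  split; [|exact L0]. intros z Hz. apply (U (Cmod (F z))). exists z. split; [exact Hz|reflexivity].
Qed.

Lemma Rbar_glb_correct (E : Rbar -> Prop) : Rbar_is_glb E (Rbar_glb E).
Proof.
  destruct (Rbar_ex_glb E) as [l Hl]. rewrite (Rbar_is_glb_unique _ _ Hl). exact Hl.
Qed.

(** The infimum defining the upper limit is below [s], so some tail of the quotients
    is; the remaining disc is compact. *)
Lemma exp_type_growth (F : C -> C) (s : R) : entire_fun F -> is_finite (exp_type F) ->
  real (exp_type F) < s -> 0 <= s -> exists K, 0 < K /\ forall z, Cmod (F z) <= K * exp (s * Cmod z).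
Proof.
  intros HF Hfin Hs Hs0.
  unfold exp_type, LimSup_p_infty in *.
  set (E := fun l : Rbar => exists a : R, l = Lub_Rbar (fun y : R => exists r : R, a < r /\ y = / r * ln (max_modulus F r))) in *.
  assert (HG := Rbar_glb_correct E).
  destruct (classic (exists l, E l /\ Rbar_lt l (Finite s))) as [[l [[a Ha] Hl]]|N].
  - destruct (Lub_Rbar_correct (fun y : R => exists r : R, a < r /\ y = / r * ln (max_modulus F r))) as [U _].
    rewrite <- Ha in U.
    set (r0 := Rmax a 0 + 1).
    assert (Hr0 : 0 < r0 /\ a < r0) by (unfold r0; generalize (Rmax_l a 0) (Rmax_r a 0); lra).
    destruct (entire_bounded_on_disc F r0 HF) as [M [HM HB]].
    exists (M + 1). split; [lra|]. intros z.
    assert (Hz0 := Cmod_ge_0 z).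
    assert (He : 1 <= exp (s * Cmod z)).
    { rewrite <- exp_0. apply exp_le. apply Rmult_le_pos; lra. }
    destruct (Rle_dec (Cmod z) r0) as [Hz|Hz].
    + specialize (HB z Hz). nra.
    + assert (Hr : a < Cmod z) by lra.
      assert (U1 := U _ (ex_intro _ (Cmod z) (conj Hr eq_refl))).
      assert (U2 : / Cmod z * ln (max_modulus F (Cmod z)) < s).
      { destruct l as [l| |]; simpl in U1, Hl; try contradiction. lra. }
      destruct (entire_bounded_on_disc F (Cmod z) HF) as [M' [_ HB']].
      destruct (max_modulus_bounds F (Cmod z) M' Hz0 HB') as [HL _].
      specialize (HL z (Rle_refl _)).
      apply Rle_trans with (max_modulus F (Cmod z)); [exact HL|].
      destruct (Rle_dec (max_modulus F (Cmod z)) 0) as [Hm|Hm].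
      * apply Rle_trans with 0; [exact Hm|]. apply Rmult_le_pos; [lra|left; apply exp_pos].
      * rewrite <- (exp_ln (max_modulus F (Cmod z))) by lra.
        apply Rle_trans with (exp (s * Cmod z)).
        -- apply exp_le. apply Rmult_lt_compat_r with (r := Cmod z) in U2; [|lra].
           rewrite (Rmult_comm (/ Cmod z)), Rmult_assoc, Rinv_l in U2 by lra. lra.
        -- assert (0 < exp (s * Cmod z)) by apply exp_pos. nra.
  - exfalso. assert (HL : Rbar_le (Finite s) (Rbar_glb E)).
    { apply HG. intros l Hl. apply Rbar_not_lt_le. intros Hlt. apply N. exists l. split; assumption. }
    rewrite <- Hfin in HL. simpl in HL. lra.
Qed.

Lemma max_modulus_lower (F : C -> C) (t c : R) : entire_fun F ->
  (forall r, 0 <= r -> exists z, Cmod z <= r /\ c * exp (t * r) <= Cmod (F z)) ->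
  forall r, 0 <= r -> c * exp (t * r) <= max_modulus F r.
Proof.
  intros HF Hlow r Hr. destruct (Hlow r Hr) as [z [Hz Hcz]].
  destruct (entire_bounded_on_disc F r HF) as [M [_ HB]].
  destruct (max_modulus_bounds F r M Hr HB) as [HL _]. specialize (HL z Hz). lra.
Qed.

Lemma exp_type_ge (F : C -> C) (t c : R) : entire_fun F -> 0 < c ->
  (forall r, 0 <= r -> exists z, Cmod z <= r /\ c * exp (t * r) <= Cmod (F z)) ->
  Rbar_le (Finite t) (exp_type F).
Proof.
  intros HF Hc Hlow. assert (Hmm := max_modulus_lower F t c HF Hlow).
  unfold exp_type, LimSup_p_infty. apply Rbar_glb_correct.
  intros l [a ->].
  destruct (Lub_Rbar_correct (fun y : R => exists r : R, a < r /\ y = / r * ln (max_modulus F r))) as [U _].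
  assert (B : forall e, 0 < e -> Rbar_le (Finite (t - e)) (Lub_Rbar (fun y : R => exists r : R, a < r /\ y = / r * ln (max_modulus F r)))).
  { intros e He.
    set (r := Rmax a 0 + 1 + Rabs (ln c) / e).
    assert (Hq : 0 <= Rabs (ln c) / e) by (apply Rmult_le_pos; [apply Rabs_pos|left; apply Rinv_0_lt_compat, He]).
    assert (Hr : 0 < r /\ a < r) by (unfold r; generalize (Rmax_l a 0) (Rmax_r a 0); lra).
    apply Rbar_le_trans with (Finite (/ r * ln (max_modulus F r))).
    - simpl. assert (L1 : ln (c * exp (t * r)) <= ln (max_modulus F r)).
      { apply ln_le; [apply Rmult_lt_0_compat; [exact Hc|apply exp_pos]|apply Hmm; lra]. }
      rewrite ln_mult, ln_exp in L1 by (try apply exp_pos; exact Hc).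
      apply Rmult_le_reg_l with r; [lra|]. rewrite <- Rmult_assoc, Rinv_r, Rmult_1_l by lra.
      assert (L2 : Rabs (ln c) <= e * r).
      { unfold r. replace (Rabs (ln c)) with (e * (Rabs (ln c) / e)) at 1 by (field; lra).
        apply Rmult_le_compat_l; [lra|]. generalize (Rmax_r a 0). lra. }
      generalize (Rle_abs (- ln c)). rewrite Rabs_Ropp. lra.
    - apply U. exists r. split; [lra|reflexivity]. }
  destruct (Lub_Rbar (fun y : R => exists r : R, a < r /\ y = / r * ln (max_modulus F r))) as [b| |].
  + simpl. apply le_epsilon. intros e He. specialize (B e He). simpl in B. lra.
  + exact I.
  + exact (B 1 ltac:(lra)).
Qed.

Lemma exp_type_le (F : C -> C) (t : R) : entire_fun F -> 0 <= t ->
  (forall r, 0 <= r -> 0 < max_modulus F r) ->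
  (forall e, 0 < e -> exists K, 0 < K /\ forall z, Cmod (F z) <= K * exp ((t + e) * Cmod z)) ->
  Rbar_le (exp_type F) (Finite t).
Proof.
  intros HF Ht Hmp Hup. unfold exp_type, LimSup_p_infty.
  match goal with |- Rbar_le (Rbar_glb ?E) _ => assert (HG : Rbar_is_lower_bound E (Rbar_glb E)) by apply Rbar_glb_correct end.
  revert HG. match goal with |- _ -> Rbar_le ?l _ => generalize l end.
  intros l Hl.
  assert (B : forall e, 0 < e -> Rbar_le l (Finite (t + e))).
  { intros e He. destruct (Hup (e / 2) ltac:(lra)) as [K [HK HKz]].
    set (a := Rabs (ln K) / (e / 2) + 1).
    assert (Hq : 0 <= Rabs (ln K) / (e / 2)) by (apply Rmult_le_pos; [apply Rabs_pos|left; apply Rinv_0_lt_compat; lra]).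
    eapply Rbar_le_trans; [apply Hl; exists a; reflexivity|].
    apply Lub_Rbar_correct. intros y [r [Hr ->]]. simpl.
    assert (Hr0 : 0 < r) by (unfold a in Hr; lra).
    assert (HM : forall z, Cmod z <= r -> Cmod (F z) <= K * exp ((t + e / 2) * r)).
    { intros z Hz. eapply Rle_trans; [apply HKz|]. apply Rmult_le_compat_l; [lra|].
      apply exp_le. apply Rmult_le_compat_l; lra. }
    destruct (max_modulus_bounds F r _ ltac:(lra) HM) as [_ HU].
    assert (L1 : ln (max_modulus F r) <= ln (K * exp ((t + e / 2) * r))) by (apply ln_le; [apply Hmp; lra|exact HU]).
    rewrite ln_mult, ln_exp in L1 by (try apply exp_pos; exact HK).
    apply Rmult_le_reg_l with r; [exact Hr0|]. rewrite <- Rmult_assoc, Rinv_r, Rmult_1_l by lra.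
    assert (L2 : Rabs (ln K) <= e / 2 * r).
    { replace (Rabs (ln K)) with (e / 2 * (Rabs (ln K) / (e / 2))) by (field; lra).
      apply Rmult_le_compat_l; [lra|]. unfold a in Hr. lra. }
    generalize (Rle_abs (ln K)). lra. }
  destruct l as [l| |].
  + simpl. apply le_epsilon. intros e He. exact (B e He).
  + exact (B 1 ltac:(lra)).
  + exact I.
Qed.

Lemma exp_type_eq (F : C -> C) (t c : R) : entire_fun F -> 0 <= t -> 0 < c ->
  (forall e, 0 < e -> exists K, 0 < K /\ forall z, Cmod (F z) <= K * exp ((t + e) * Cmod z)) ->
  (forall r, 0 <= r -> exists z, Cmod z <= r /\ c * exp (t * r) <= Cmod (F z)) ->
  exp_type F = Finite t.
Proof.
  intros HF Ht Hc Hup Hlow. apply Rbar_le_antisym; [|exact (exp_type_ge F t c HF Hc Hlow)].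
  apply exp_type_le; try assumption. intros r Hr.
  eapply Rlt_le_trans; [|exact (max_modulus_lower F t c HF Hlow r Hr)].
  apply Rmult_lt_0_compat; [exact Hc|apply exp_pos].
Qed.

Lemma exp_type_finite (F : C -> C) (s K c : R) : entire_fun F -> 0 <= s -> 0 < K -> 0 < c ->
  (forall z, Cmod (F z) <= K * exp (s * Cmod z)) -> c <= Cmod (F (RtoC 0)) ->
  exists t, exp_type F = Finite t /\ 0 <= t.
Proof.
  intros HF Hs HK Hc Hup H0.
  assert (Hlow : forall r, 0 <= r -> exists z, Cmod z <= r /\ c * exp (0 * r) <= Cmod (F z)).
  { intros r Hr. exists (RtoC 0). rewrite Cmod_0, Rmult_0_l, exp_0. lra. }
  assert (L := exp_type_ge F 0 c HF Hc Hlow).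
  assert (U : Rbar_le (exp_type F) (Finite s)).
  { apply exp_type_le; try assumption.
    - intros r Hr. eapply Rlt_le_trans; [|exact (max_modulus_lower F 0 c HF Hlow r Hr)].
      apply Rmult_lt_0_compat; [exact Hc|apply exp_pos].
    - intros e He. exists K. split; [exact HK|]. intros z. eapply Rle_trans; [apply Hup|].
      apply Rmult_le_compat_l; [lra|]. apply exp_le. apply Rmult_le_compat_r; [apply Cmod_ge_0|lra]. }
  destruct (exp_type F) as [t| |]; simpl in L, U; try contradiction.
  exists t. split; [reflexivity|exact L].
Qed.

(** * The Poisson integral and its boundary behaviour *)

Lemma atan_near_PI2 (e : R) : 0 < e -> exists A, 0 < A /\ forall t, A <= t -> PI / 2 - e < atan t.
Proof.
  intros He. assert (HPI3 : 3 < PI) by (generalize PI2_3_2; unfold PI2; lra).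
  set (e' := Rmin (e / 2) 1).
  assert (H0 : 0 < e' <= 1) by (split; [apply Rmin_pos; lra|apply Rmin_r]).
  assert (H1 : e' <= e / 2) by apply Rmin_l.
  exists (tan (PI / 2 - e')). split.
  - apply tan_gt_0; lra.
  - intros t Ht. apply Rlt_le_trans with (PI / 2 - e'); [lra|].
    rewrite <- (atan_tan (PI / 2 - e')) by (unfold PI2 in *; lra).
    destruct Ht as [Ht| <-]; [left; apply atan_increasing, Ht|apply Rle_refl].
Qed.

Lemma RInt_ext_R (f g : R -> R) (a b : R) : (forall t, f t = g t) -> RInt f a b = RInt g a b.
Proof. intros H. apply RInt_ext. intros t _. apply H. Qed.

Lemma poisson_kernel_density (x y s : R) : 0 < y ->
  poisson_kernel y (x - s) = / PI * (y / ((s - x) ^ 2 + y ^ 2)).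
Proof.
  intros Hy. assert (HPI := PI_RGT_0). unfold poisson_kernel.
  assert (0 < (s - x) ^ 2 + y ^ 2) by (generalize (pow2_ge_0 (s - x)) (pow_lt y 2 Hy); lra).
  replace ((x - s) ^ 2) with ((s - x) ^ 2) by ring. field. split; lra.
Qed.

Lemma continuous_poisson_kernel (x y s : R) : 0 < y -> continuous (fun s => poisson_kernel y (x - s)) s.
Proof.
  intros Hy. apply (continuous_ext (fun s => / PI * (y / ((s - x) ^ 2 + y ^ 2)))).
  - intros t. symmetry. apply poisson_kernel_density, Hy.
  - apply (continuous_scal_r (V := R_NormedModule) (/ PI) (fun s => y / ((s - x) ^ 2 + y ^ 2))).
    apply continuous_poisson_density, Hy.
Qed.

Lemma is_RInt_poisson_kernel (x y a b : R) : 0 < y ->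
  is_RInt (fun s => poisson_kernel y (x - s)) a b (/ PI * (atan ((b - x) / y) - atan ((a - x) / y))).
Proof.
  intros Hy. apply (is_RInt_ext (fun s => / PI * (y / ((s - x) ^ 2 + y ^ 2)))).
  - intros t _. symmetry. apply poisson_kernel_density, Hy.
  - apply (is_RInt_scal (V := R_NormedModule)). apply RInt_poisson_density, Hy.
Qed.

Lemma poisson_kernel_pos (x y s : R) : 0 < y -> 0 <= poisson_kernel y (x - s).
Proof.
  intros Hy. rewrite poisson_kernel_density by exact Hy. assert (HPI := PI_RGT_0).
  apply Rmult_le_pos; [left; apply Rinv_0_lt_compat; lra|].
  apply Rmult_le_pos; [lra|]. left. apply Rinv_0_lt_compat.
  generalize (pow2_ge_0 (s - x)) (pow_lt y 2 Hy). lra.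
Qed.

Section PoissonIntegral.
Context (g : R -> R) (M : R).
Context (Hg : forall x, continuous g x) (HM : forall x, Rabs (g x) <= M).

Let f (x y s : R) : R := poisson_kernel y (x - s) * g s.

Lemma continuous_poisson_integrand (x y s : R) : 0 < y -> continuous (f x y) s.
Proof.
  intros Hy. apply (continuous_mult (fun s => poisson_kernel y (x - s)) g);
    [apply continuous_poisson_kernel, Hy|apply Hg].
Qed.

Lemma ex_RInt_poisson_integrand (x y a b : R) : 0 < y -> ex_RInt (f x y) a b.
Proof. intros Hy. apply @ex_RInt_continuous. intros. apply continuous_poisson_integrand, Hy. Qed.

Lemma poisson_tail (x y a b : R) : 0 < y ->
  Rabs (RInt (f x y) a b) <= M * Rabs (/ PI * (atan ((b - x) / y) - atan ((a - x) / y))).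
Proof.
  intros Hy.
  assert (HM0 : 0 <= M) by (eapply Rle_trans; [apply Rabs_pos|apply (HM 0)]).
  assert (main : forall a b, a <= b -> Rabs (RInt (f x y) a b) <=
     M * Rabs (/ PI * (atan ((b - x) / y) - atan ((a - x) / y)))).
  { intros c d Hcd. rewrite <- (is_RInt_unique _ _ _ _ (is_RInt_poisson_kernel x y c d Hy)).
    assert (Hex : ex_RInt (fun s => poisson_kernel y (x - s)) c d)
      by (eexists; apply is_RInt_poisson_kernel, Hy).
    assert (H0 : 0 <= RInt (fun s => poisson_kernel y (x - s)) c d).
    { apply RInt_ge_0; [exact Hcd|exact Hex|intros; apply poisson_kernel_pos, Hy]. }
    rewrite (Rabs_pos_eq (RInt (fun s => poisson_kernel y (x - s)) c d)) by exact H0.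
    eapply Rle_trans; [apply abs_RInt_le; [exact Hcd|apply ex_RInt_poisson_integrand, Hy]|].
    replace (M * RInt (fun s => poisson_kernel y (x - s)) c d)
      with (RInt (fun s => M * poisson_kernel y (x - s)) c d)
      by (apply (RInt_scal (V := R_CompleteNormedModule)); exact Hex).
    apply RInt_le; [exact Hcd| |apply (ex_RInt_scal (V := R_NormedModule)); exact Hex|].
    - apply @ex_RInt_continuous. intros s _. apply (continuous_comp (f x y) Rabs);
        [apply continuous_poisson_integrand, Hy|apply continuous_Rabs].
    - intros s _. unfold f. rewrite Rabs_mult, (Rabs_pos_eq (poisson_kernel y (x - s)))
        by apply poisson_kernel_pos, Hy. rewrite Rmult_comm.
      apply Rmult_le_compat_r; [apply poisson_kernel_pos, Hy|apply HM]. }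
  destruct (Rle_dec a b) as [Hab|Hab]; [apply main, Hab|].
  assert (E : RInt (f x y) a b = - RInt (f x y) b a).
  { symmetry. apply (opp_RInt_swap (V := R_CompleteNormedModule) (f x y) b a).
    apply ex_RInt_poisson_integrand, Hy. }
  rewrite E, Rabs_Ropp.
  eapply Rle_trans; [apply main; lra|]. right. f_equal.
  rewrite <- Rabs_Ropp. f_equal. ring.
Qed.

(** Cauchy's criterion: the kernel has total mass one, so the tails are small. *)
Lemma ex_poisson_integral (x y : R) : 0 < y ->
  exists l : R, is_RInt_gen (f x y) (Rbar_locally m_infty) (Rbar_locally p_infty) l.
Proof.
  intros Hy.
  assert (HM0 : 0 <= M) by (eapply Rle_trans; [apply Rabs_pos|apply (HM 0)]).
  assert (HPI := PI_RGT_0).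
  assert (Hex : exists l : R_CompleteNormedModule,
    filterlim (fun ab => RInt (f x y) (fst ab) (snd ab))
      (filter_prod (Rbar_locally m_infty) (Rbar_locally p_infty)) (locally l)).
  { apply (filterlim_locally_cauchy (U := R_CompleteNormedModule)
      (F := filter_prod (Rbar_locally m_infty) (Rbar_locally p_infty))).
    intros eps.
    destruct (atan_near_PI2 (PI * eps / (4 * (M + 1)))) as [A [HA HAt]].
    { apply Rdiv_lt_0_compat; [apply Rmult_lt_0_compat; [lra|apply cond_pos]|lra]. }
    set (Q := y * A).
    assert (far : forall s, x + Q < s -> A <= (s - x) / y).
    { intros s Hs. apply Rmult_le_reg_r with y; [exact Hy|]. unfold Rdiv.
      rewrite Rmult_assoc, Rinv_l by lra. unfold Q in Hs. lra. }
    assert (pair : forall p q, PI / 2 - PI * eps / (4 * (M + 1)) < p < PI / 2 ->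
       PI / 2 - PI * eps / (4 * (M + 1)) < q < PI / 2 -> M * Rabs (/ PI * (p - q)) <= eps / 4).
    { intros p q Hp Hq. rewrite Rabs_mult, Rabs_pos_eq by (left; apply Rinv_0_lt_compat, HPI).
      assert (Rabs (p - q) <= PI * eps / (4 * (M + 1))) by (apply Rabs_le; lra).
      apply Rle_trans with ((M + 1) * (/ PI * (PI * eps / (4 * (M + 1))))); [|right; field; split; lra].
      apply Rmult_le_compat; [lra| |lra|].
      - apply Rmult_le_pos; [left; apply Rinv_0_lt_compat, HPI|apply Rabs_pos].
      - apply Rmult_le_compat_l; [left; apply Rinv_0_lt_compat, HPI|assumption]. }
    exists (fun ab => fst ab < x - Q /\ x + Q < snd ab). split.
    - exists (fun a => a < x - Q) (fun b => x + Q < b); [exists (x - Q)|exists (x + Q)|]; trivial.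
      intros a b Ha Hb. split; assumption.
    - intros [a b] [a' b'] [Ha Hb] [Ha' Hb']. simpl in Ha, Hb, Ha', Hb'. simpl fst. simpl snd.
      change (Rabs (RInt (f x y) a' b' - RInt (f x y) a b) < eps).
      assert (E : RInt (f x y) a' b' - RInt (f x y) a b = RInt (f x y) a' a + RInt (f x y) b b').
      { assert (E1 := RInt_Chasles (f x y) a' a b' (ex_RInt_poisson_integrand x y a' a Hy) (ex_RInt_poisson_integrand x y a b' Hy)).
        assert (E2 := RInt_Chasles (f x y) a b b' (ex_RInt_poisson_integrand x y a b Hy) (ex_RInt_poisson_integrand x y b b' Hy)).
        rewrite <- E1, <- E2. change plus with Rplus. simpl. ring. }
      rewrite E. eapply Rle_lt_trans; [apply Rabs_triang|].
      assert (T1 : Rabs (RInt (f x y) b b') <= eps / 4).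
      { eapply Rle_trans; [apply poisson_tail, Hy|]. apply pair.
        - split; [apply HAt, far, Hb'|apply atan_bound].
        - split; [apply HAt, far, Hb|apply atan_bound]. }
      assert (T2 : Rabs (RInt (f x y) a' a) <= eps / 4).
      { eapply Rle_trans; [apply poisson_tail, Hy|].
        replace (atan ((a - x) / y) - atan ((a' - x) / y))
          with (atan ((x - a' + x - x) / y) - atan ((x - a + x - x) / y)).
        - apply pair; (split; [apply HAt, far; lra|apply atan_bound]).
        - replace ((x - a' + x - x) / y) with (- ((a' - x) / y)) by (field; lra).
          replace ((x - a + x - x) / y) with (- ((a - x) / y)) by (field; lra).
          rewrite !atan_opp. ring. }
      generalize (cond_pos eps). lra. }
  destruct Hex as [l Hl]. exists l. intros P HP. specialize (Hl P HP).
  change (filter_prod (Rbar_locally m_infty) (Rbar_locally p_infty)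
    (fun ab => exists v, is_RInt (f x y) (fst ab) (snd ab) v /\ P v)).
  apply (filter_imp (fun ab => P (RInt (f x y) (fst ab) (snd ab)))); [|exact Hl].
  intros [a b] HPab. exists (RInt (f x y) a b). split; [|exact HPab].
  apply (RInt_correct (V := R_CompleteNormedModule)), ex_RInt_poisson_integrand, Hy.
Qed.

Definition cauchy_density (t : R) : R := / (PI * (1 + t ^ 2)).

(** After the substitution [s = x + y t] the kernel no longer depends on the point,
    so properties of [g] stable under translation pass to the Poisson integral. *)
Lemma poisson_limit (x y : R) : 0 < y ->
  is_lim_seq (fun n => RInt (fun t => cauchy_density t * g (x + y * t)) (- INR n) (INR n))
    (poisson (V := R_CompleteNormedModule) g (x, y)).
Proof.
  intros Hy. assert (HPI := PI_RGT_0).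
  destruct (ex_poisson_integral x y Hy) as [l Hl].
  assert (E : poisson (V := R_CompleteNormedModule) g (x, y) = l).
  { unfold poisson. simpl. destruct (Rlt_dec 0 y) as [_|N]; [|contradiction].
    apply (is_RInt_gen_unique (V := R_CompleteNormedModule)). exact Hl. }
  rewrite E. apply is_lim_seq_spec. intros eps.
  destruct (Hl (ball (M := R_UniformSpace) l eps) (locally_ball l eps)) as [P Q HP HQ HPQ].
  destruct HP as [a Ha]. destruct HQ as [b Hb].
  assert (Hn : exists N, forall n, (N <= n)%nat -> y * - INR n + x < a /\ b < y * INR n + x).
  { assert (H0 : 0 <= (Rabs a + Rabs b + Rabs x) / y).
    { apply Rmult_le_pos; [generalize (Rabs_pos a) (Rabs_pos b) (Rabs_pos x); lra|left; apply Rinv_0_lt_compat, Hy]. }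
    destruct (nfloor_ex _ H0) as [N HN]. exists (S N). intros n Hn.
    assert (Hn' : INR (S N) <= INR n) by (apply le_INR, Hn). rewrite S_INR in Hn'.
    assert (K : Rabs a + Rabs b + Rabs x < y * INR n).
    { replace (Rabs a + Rabs b + Rabs x) with (y * ((Rabs a + Rabs b + Rabs x) / y)) by (field; lra).
      apply Rmult_lt_compat_l; lra. }
    generalize (Rle_abs a) (Rle_abs (- a)) (Rle_abs b) (Rle_abs (- b)) (Rle_abs x) (Rle_abs (- x))
      (Rabs_pos a) (Rabs_pos b).
    rewrite !Rabs_Ropp. lra. }
  destruct Hn as [N HN]. exists N. intros n Hn. destruct (HN n Hn) as [H1 H2].
  destruct (HPQ _ _ (Ha _ H1) (Hb _ H2)) as [v [Hv Hball]]. simpl in Hv.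
  apply (is_RInt_unique (V := R_CompleteNormedModule)) in Hv.
  assert (Ecv : RInt (fun t => cauchy_density t * g (x + y * t)) (- INR n) (INR n) = v).
  { rewrite <- Hv. rewrite <- (RInt_comp_lin (f x y) y x (- INR n) (INR n))
      by (apply ex_RInt_poisson_integrand, Hy).
    apply RInt_ext. intros t _. change (cauchy_density t * g (x + y * t) = y * f x y (y * t + x)).
    unfold f, cauchy_density. rewrite poisson_kernel_density by exact Hy.
    replace (y * t + x) with (x + y * t) by ring.
    assert (0 < 1 + t ^ 2) by (generalize (pow2_ge_0 t); lra).
    replace ((x + y * t - x) ^ 2 + y ^ 2) with (y ^ 2 * (1 + t ^ 2)) by ring.
    field. repeat split; lra. }
  rewrite Ecv. exact Hball.
Qed.
End PoissonIntegral.

Definition density_avg (p : R -> R) (n : nat) : R :=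
  RInt (fun t => cauchy_density t * p t) (- INR n) (INR n).

Lemma cauchy_density_pos (t : R) : 0 < cauchy_density t.
Proof.
  assert (HPI := PI_RGT_0). apply Rinv_0_lt_compat, Rmult_lt_0_compat; [lra|].
  generalize (pow2_ge_0 t). lra.
Qed.

Lemma cauchy_density_eq (t : R) : cauchy_density t = / PI * (1 / ((t - 0) ^ 2 + 1 ^ 2)).
Proof.
  assert (HPI := PI_RGT_0). unfold cauchy_density. rewrite Rminus_0_r.
  assert (0 < 1 + t ^ 2) by (generalize (pow2_ge_0 t); lra). field. split; lra.
Qed.

Lemma continuous_cauchy_density (t : R) : continuous cauchy_density t.
Proof.
  apply (continuous_ext (fun t => / PI * (1 / ((t - 0) ^ 2 + 1 ^ 2)))).
  - intros s. symmetry. apply cauchy_density_eq.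
  - apply (continuous_scal_r (V := R_NormedModule) (/ PI) (fun t => 1 / ((t - 0) ^ 2 + 1 ^ 2))).
    apply continuous_poisson_density. lra.
Qed.

Lemma ex_RInt_density_avg (p : R -> R) (a b : R) : (forall t, continuous p t) ->
  ex_RInt (fun t => cauchy_density t * p t) a b.
Proof.
  intros Hp. apply @ex_RInt_continuous. intros t _.
  apply (continuous_mult cauchy_density p); [apply continuous_cauchy_density|apply Hp].
Qed.

Lemma density_avg_le (p q : R -> R) (n : nat) :
  (forall t, continuous p t) -> (forall t, continuous q t) -> (forall t, p t <= q t) ->
  density_avg p n <= density_avg q n.
Proof.
  intros Hp Hq H. apply RInt_le; [generalize (pos_INR n); lra|apply ex_RInt_density_avg, Hp|
    apply ex_RInt_density_avg, Hq|].
  intros t _. apply Rmult_le_compat_l; [left; apply cauchy_density_pos|apply H].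
Qed.

Lemma density_avg_plus (p q : R -> R) (n : nat) :
  (forall t, continuous p t) -> (forall t, continuous q t) ->
  density_avg (fun t => p t + q t) n = density_avg p n + density_avg q n.
Proof.
  intros Hp Hq. unfold density_avg.
  rewrite (RInt_ext_R _ (fun t => cauchy_density t * p t + cauchy_density t * q t)) by (intros; ring).
  apply (RInt_plus (V := R_CompleteNormedModule)); apply ex_RInt_density_avg; assumption.
Qed.

Lemma density_avg_scal (c : R) (p : R -> R) (n : nat) :
  (forall t, continuous p t) -> density_avg (fun t => c * p t) n = c * density_avg p n.
Proof.
  intros Hp. unfold density_avg.
  rewrite (RInt_ext_R _ (fun t => c * (cauchy_density t * p t))) by (intros; ring).
  apply (RInt_scal (V := R_CompleteNormedModule)); apply ex_RInt_density_avg; assumption.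
Qed.

Lemma density_avg_1 (n : nat) : density_avg (fun _ => 1) n = 2 / PI * atan (INR n).
Proof.
  assert (HPI := PI_RGT_0). unfold density_avg.
  rewrite (RInt_ext_R _ (fun t => / PI * (1 / ((t - 0) ^ 2 + 1 ^ 2)))).
  - assert (H := is_RInt_scal (V := R_NormedModule) _ _ _ (/ PI) _ (RInt_poisson_density 0 1 (- INR n) (INR n) Rlt_0_1)).
    etransitivity; [exact (is_RInt_unique (V := R_CompleteNormedModule) _ _ _ _ H)|].
    change (/ PI * (atan ((INR n - 0) / 1) - atan ((- INR n - 0) / 1)) = 2 / PI * atan (INR n)).
    replace ((INR n - 0) / 1) with (INR n) by field.
    replace ((- INR n - 0) / 1) with (- INR n) by field. rewrite atan_opp. field. lra.
  - intros t. rewrite Rmult_1_r. apply cauchy_density_eq.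
Qed.

Lemma density_avg_const_lim (c : R) : is_lim_seq (density_avg (fun _ => c)) c.
Proof.
  assert (HPI := PI_RGT_0).
  apply is_lim_seq_ext with (fun n => c * density_avg (fun _ => 1) n).
  - intros n. rewrite <- density_avg_scal by (intros; apply continuous_const).
    unfold density_avg. apply RInt_ext_R. intros. ring.
  - replace (Finite c) with (Rbar_mult c 1) by (simpl; f_equal; ring).
    apply is_lim_seq_scal_l. apply is_lim_seq_spec. intros eps.
    destruct (atan_near_PI2 (PI / 2 * eps)) as [A [HA H]].
    { apply Rmult_lt_0_compat; [lra|apply cond_pos]. }
    destruct (nfloor_ex A ltac:(lra)) as [N HN]. exists (S N). intros n Hn.
    assert (Hn' : INR (S N) <= INR n) by (apply le_INR, Hn). rewrite S_INR in Hn'.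
    rewrite density_avg_1. specialize (H (INR n) ltac:(lra)).
    assert (H2 := proj2 (atan_bound (INR n))).
    apply Rabs_lt_between. generalize (cond_pos eps). intros Hp.
    assert (E : 2 / PI * atan (INR n) - 1 = 2 / PI * (atan (INR n) - PI / 2)) by (field; lra).
    rewrite E.
    assert (H3 : 0 < 2 / PI) by (apply Rdiv_lt_0_compat; lra).
    assert (E2 : 2 / PI * (PI / 2 * eps) = eps) by (field; lra).
    split; nra.
Qed.

Lemma density_avg_limit_bounds (p : R -> R) (l a b : R) :
  (forall t, continuous p t) -> is_lim_seq (density_avg p) l ->
  (forall t, a <= p t <= b) -> a <= l <= b.
Proof.
  intros Hp Hl H. split.
  - apply (is_lim_seq_le (density_avg (fun _ => a)) (density_avg p) a l);
      [|apply density_avg_const_lim|exact Hl].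
    intros n. apply density_avg_le; [intros; apply continuous_const|exact Hp|apply H].
  - apply (is_lim_seq_le (density_avg p) (density_avg (fun _ => b)) l b);
      [|exact Hl|apply density_avg_const_lim].
    intros n. apply density_avg_le; [exact Hp|intros; apply continuous_const|apply H].
Qed.

(** The mass of the density where [|t|] exceeds [1/w], smoothed to a rational
    function whose integral is explicit. *)
Lemma density_avg_tail (w : R) (n : nat) : 0 < w < / 2 ->
  density_avg (fun t => w ^ 2 * t ^ 2 / (1 + w ^ 2 * t ^ 2)) n <= 2 * w.
Proof.
  intros Hw. assert (HPI := PI_RGT_0). assert (Hn := pos_INR n).
  set (Phi := fun t => w / (PI * (1 - w ^ 2)) * (atan (w * t) - w * atan t)).
  assert (Hw2 : 0 < 1 - w ^ 2) by nra.
  assert (HI : is_RInt (fun t => cauchy_density t * (w ^ 2 * t ^ 2 / (1 + w ^ 2 * t ^ 2))) (- INR n) (INR n)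
     (Phi (INR n) - Phi (- INR n))).
  { apply (is_RInt_derive (V := R_CompleteNormedModule) Phi).
    - intros t _. assert (0 < 1 + t ^ 2) by (generalize (pow2_ge_0 t); lra).
      assert (0 < 1 + w ^ 2 * t ^ 2) by (generalize (pow2_ge_0 t) (pow2_ge_0 w); nra).
      unfold Phi, cauchy_density. auto_derive; [trivial|]. field. repeat split; try lra; nra.
    - intros t _. apply (continuous_mult cauchy_density); [apply continuous_cauchy_density|].
      apply @ex_derive_continuous. auto_derive.
      generalize (pow2_ge_0 t) (pow2_ge_0 w). intros. nra. }
  unfold density_avg. rewrite (is_RInt_unique _ _ _ _ HI). unfold Phi.
  replace (w * - INR n) with (- (w * INR n)) by ring. rewrite !atan_opp.
  assert (B1 := proj2 (atan_bound (w * INR n))).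
  assert (B2 : 0 <= atan (INR n)).
  { rewrite <- atan_0. destruct Hn as [Hn| <-]; [left; apply atan_increasing, Hn|apply Rle_refl]. }
  assert (E : w / (PI * (1 - w ^ 2)) * (atan (w * INR n) - w * atan (INR n)) -
     w / (PI * (1 - w ^ 2)) * (- atan (w * INR n) - w * - atan (INR n))
     = 2 * (w / (PI * (1 - w ^ 2))) * (atan (w * INR n) - w * atan (INR n))) by ring.
  rewrite E.
  assert (K : 0 < w / (PI * (1 - w ^ 2))) by (apply Rdiv_lt_0_compat; [lra|apply Rmult_lt_0_compat; lra]).
  apply Rle_trans with (2 * (w / (PI * (1 - w ^ 2))) * (PI / 2)).
  - apply Rmult_le_compat_l; [lra|]. nra.
  - replace (2 * (w / (PI * (1 - w ^ 2))) * (PI / 2)) with (w * / (1 - w ^ 2)) by (field; split; lra).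
    rewrite (Rmult_comm 2). apply Rmult_le_compat_l; [lra|].
    replace 2 with (/ / 2) by field. apply Rinv_le_contravar; nra.
Qed.

Lemma continuous_affine (g : R -> R) (x y t : R) : (forall s, continuous g s) ->
  continuous (fun t => g (x + y * t)) t.
Proof.
  intros Hg. apply (continuous_comp (fun t => x + y * t) g); [|apply Hg].
  apply (continuous_plus (V := R_NormedModule) (fun _ => x) (fun t => y * t)); [apply continuous_const|].
  apply (continuous_scal_r (V := R_NormedModule) y (fun t => t)), continuous_id.
Qed.

Lemma lipschitz_continuous (g : R -> R) (L : R) :
  (forall x y, Rabs (g x - g y) <= L * Rabs (x - y)) -> forall x, continuous g x.
Proof.
  intros H x. apply filterlim_locally. intros eps.
  assert (HL : 0 <= Rabs L) by apply Rabs_pos.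
  assert (Hd : 0 < eps / (Rabs L + 1)) by (apply Rdiv_lt_0_compat; [apply cond_pos|lra]).
  exists (mkposreal _ Hd). intros y Hy. change (Rabs (y - x) < eps / (Rabs L + 1)) in Hy.
  change (Rabs (g y - g x) < eps). eapply Rle_lt_trans; [apply H|].
  apply Rle_lt_trans with ((Rabs L + 1) * Rabs (y - x)).
  - apply Rmult_le_compat_r; [apply Rabs_pos|]. generalize (Rle_abs L). lra.
  - apply Rlt_le_trans with ((Rabs L + 1) * (eps / (Rabs L + 1))); [|right; field; lra].
    apply Rmult_lt_compat_l; lra.
Qed.

Section PoissonProperties.
Context (g : R -> R) (M L : R).
Context (HM : forall x, Rabs (g x) <= M).
Context (HL : forall x y, Rabs (g x - g y) <= L * Rabs (x - y)).

Let u : C -> R := poisson (V := R_CompleteNormedModule) g.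

Lemma poisson_density_limit (x y : R) : 0 < y -> is_lim_seq (density_avg (fun t => g (x + y * t))) (u (x, y)).
Proof. intros Hy. apply (poisson_limit g M (lipschitz_continuous g L HL) HM), Hy. Qed.

Lemma poisson_real (x : R) : u (RtoC x) = g x.
Proof. unfold u, poisson. simpl. destruct (Rlt_dec 0 0); [lra|reflexivity]. Qed.

Lemma poisson_bounds (a b : R) (z : C) : (forall x, a <= g x <= b) -> 0 <= Im z -> a <= u z <= b.
Proof.
  intros H Hz. destruct z as [x y]. simpl in Hz. destruct Hz as [Hy| <-].
  - apply (density_avg_limit_bounds (fun t => g (x + y * t))).
    + intros t. apply continuous_affine, (lipschitz_continuous g L HL).
    + apply poisson_density_limit, Hy.
    + intros t. apply H.
  - change (x, 0) with (RtoC x). rewrite poisson_real. apply H.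
Qed.

(** The second difference of the Poisson integral is the Poisson integral of the
    second difference. *)
Lemma poisson_second_difference (K x y h : R) : 0 < y ->
  (forall x h, Rabs (g (x + h) + g (x - h) - 2 * g x) <= K * h ^ 2) ->
  Rabs (u (x + h, y) + u (x - h, y) - 2 * u (x, y)) <= K * h ^ 2.
Proof.
  intros Hy HK.
  assert (Hc := lipschitz_continuous g L HL).
  assert (Hp : forall x t, continuous (fun t => g (x + y * t)) t) by (intros; apply continuous_affine, Hc).
  assert (Hlim : is_lim_seq (density_avg (fun t => g (x + h + y * t) + g (x - h + y * t) + -2 * g (x + y * t)))
     (u (x + h, y) + u (x - h, y) + -2 * u (x, y))).
  { assert (Hs : forall t, continuous (fun t => g (x + h + y * t) + g (x - h + y * t)) t)
      by (intros; apply (continuous_plus (V := R_NormedModule) (fun t => g (x + h + y * t)) (fun t => g (x - h + y * t))); apply Hp).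
    assert (Hm : forall t, continuous (fun t => -2 * g (x + y * t)) t)
      by (intros; apply (continuous_scal_r (V := R_NormedModule) (-2) (fun t => g (x + y * t))), Hp).
    apply is_lim_seq_ext with (fun n => density_avg (fun t => g (x + h + y * t)) n
      + density_avg (fun t => g (x - h + y * t)) n + -2 * density_avg (fun t => g (x + y * t)) n).
    - intros n. rewrite (density_avg_plus (fun t => g (x + h + y * t) + g (x - h + y * t)) (fun t => -2 * g (x + y * t))) by assumption.
      rewrite density_avg_plus, density_avg_scal by apply Hp. reflexivity.
    - apply (is_lim_seq_plus' _ _ (u (x + h, y) + u (x - h, y)) (-2 * u (x, y))).
      + apply is_lim_seq_plus'; apply poisson_density_limit, Hy.
      + apply (is_lim_seq_scal_l _ (-2) (u (x, y))), poisson_density_limit, Hy. }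
  assert (B : - (K * h ^ 2) <= u (x + h, y) + u (x - h, y) + -2 * u (x, y) <= K * h ^ 2).
  { apply (density_avg_limit_bounds _ _ _ _) with (2 := Hlim).
    - intros t. apply (continuous_plus (V := R_NormedModule) (fun t => g (x + h + y * t) + g (x - h + y * t)) (fun t => -2 * g (x + y * t))).
      + apply (continuous_plus (V := R_NormedModule) (fun t => g (x + h + y * t)) (fun t => g (x - h + y * t))); apply Hp.
      + apply (continuous_scal_r (V := R_NormedModule) (-2) (fun t => g (x + y * t))), Hp.
    - intros t. specialize (HK (x + y * t) h). apply Rabs_le_between in HK.
      replace (x + h + y * t) with (x + y * t + h) by ring.
      replace (x - h + y * t) with (x + y * t - h) by ring. lra. }
  apply Rabs_le. lra.
Qed.

Lemma poisson_lipschitz_x (x x' y : R) : 0 < y -> Rabs (u (x', y) - u (x, y)) <= L * Rabs (x' - x).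
Proof.
  intros Hy.
  assert (Hc := lipschitz_continuous g L HL).
  assert (Hp : forall x t, continuous (fun t => g (x + y * t)) t) by (intros; apply continuous_affine, Hc).
  assert (Hm : forall t, continuous (fun t => -1 * g (x + y * t)) t)
      by (intros; apply (continuous_scal_r (V := R_NormedModule) (-1) (fun t => g (x + y * t))), Hp).
  assert (Hlim : is_lim_seq (density_avg (fun t => g (x' + y * t) + -1 * g (x + y * t))) (u (x', y) + -1 * u (x, y))).
  { apply is_lim_seq_ext with (fun n => density_avg (fun t => g (x' + y * t)) n + -1 * density_avg (fun t => g (x + y * t)) n).
    - intros n. rewrite (density_avg_plus (fun t => g (x' + y * t)) (fun t => -1 * g (x + y * t))) by (assumption || apply Hp).
      rewrite density_avg_scal by apply Hp. reflexivity.
    - apply (is_lim_seq_plus' _ _ (u (x', y)) (-1 * u (x, y))).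
      + apply poisson_density_limit, Hy.
      + apply (is_lim_seq_scal_l _ (-1) (u (x, y))), poisson_density_limit, Hy. }
  assert (B : - (L * Rabs (x' - x)) <= u (x', y) + -1 * u (x, y) <= L * Rabs (x' - x)).
  { apply (density_avg_limit_bounds _ _ _ _) with (2 := Hlim).
    - intros t. apply (continuous_plus (V := R_NormedModule) (fun t => g (x' + y * t)) (fun t => -1 * g (x + y * t)));
        [apply Hp|apply Hm].
    - intros t. assert (H := HL (x' + y * t) (x + y * t)). apply Rabs_le_between in H.
      replace (x' + y * t - (x + y * t)) with (x' - x) in H by ring. lra. }
  apply Rabs_le. lra.
Qed.

(** Where [|t| <= 1/w] with [w = sqrt y] the Lipschitz bound gives [L w]; elsewhere
    boundedness and the small mass of the tail suffice. *)
Lemma poisson_vertical_limit (x y : R) : 0 < y < / 4 ->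
  Rabs (u (x, y) - g x) <= 3 * (Rabs L + 4 * M) * sqrt y.
Proof.
  intros Hy. set (w := sqrt y).
  assert (Hw2 : w * w = y) by (apply sqrt_sqrt; lra).
  assert (Hw0 : 0 < w) by (apply sqrt_lt_R0; lra).
  assert (Hw : 0 < w < / 2) by (split; [exact Hw0|nra]).
  assert (HM0 : 0 <= M) by (eapply Rle_trans; [apply Rabs_pos|apply (HM 0)]).
  set (K := Rabs L + 4 * M). assert (HK : 0 <= K) by (unfold K; generalize (Rabs_pos L); lra).
  assert (Hc := lipschitz_continuous g L HL).
  assert (Hp : forall t, continuous (fun t => g (x + y * t)) t) by (intros; apply continuous_affine, Hc).
  set (tail := fun t => w ^ 2 * t ^ 2 / (1 + w ^ 2 * t ^ 2)).
  assert (Hden : forall t, 0 < 1 + w ^ 2 * t ^ 2) by (intros t; generalize (pow2_ge_0 t) (pow2_ge_0 w); nra).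
  assert (Htc : forall t, continuous tail t).
  { intros t. apply @ex_derive_continuous. unfold tail. auto_derive. specialize (Hden t). lra. }
  assert (Hpt : forall t, Rabs (g (x + y * t) - g x) <= K * w + K * tail t).
  { intros t. assert (Ht : 0 <= tail t).
    { unfold tail. apply Rmult_le_pos; [generalize (pow2_ge_0 t) (pow2_ge_0 w); nra|].
      left. apply Rinv_0_lt_compat, Hden. }
    destruct (Rle_dec (w * Rabs t) 1) as [Hs|Hs].
    - assert (B := HL (x + y * t) x). replace (x + y * t - x) with (y * t) in B by ring.
      rewrite Rabs_mult, (Rabs_pos_eq y) in B by lra.
      assert (Rabs t >= 0) by (apply Rle_ge, Rabs_pos).
      assert (y * Rabs t <= w) by (rewrite <- Hw2; nra).
      assert (L * (y * Rabs t) <= Rabs L * w).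
      { apply Rle_trans with (Rabs L * (y * Rabs t)).
        - apply Rmult_le_compat_r; [nra|apply Rle_abs].
        - apply Rmult_le_compat_l; [apply Rabs_pos|assumption]. }
      assert (0 <= K * tail t) by (apply Rmult_le_pos; assumption).
      assert (K * w = Rabs L * w + 4 * M * w) by (unfold K; ring).
      assert (0 <= 4 * M * w) by (apply Rmult_le_pos; lra). lra.
    - assert (B : Rabs (g (x + y * t) - g x) <= 2 * M).
      { unfold Rminus. eapply Rle_trans; [apply Rabs_triang|]. rewrite Rabs_Ropp.
        generalize (HM (x + y * t)) (HM x). lra. }
      assert (H2 : / 2 <= tail t).
      { unfold tail. apply Rmult_le_reg_r with (1 + w ^ 2 * t ^ 2); [apply Hden|].
        unfold Rdiv. rewrite Rmult_assoc, Rinv_l by (specialize (Hden t); lra).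
        assert (1 <= w ^ 2 * t ^ 2).
        { replace (w ^ 2 * t ^ 2) with ((w * Rabs t) ^ 2) by (rewrite Rpow_mult_distr, pow2_abs; ring).
          rewrite <- (pow1 2) at 1. apply pow_incr. lra. }
        lra. }
      assert (0 <= K * w) by (apply Rmult_le_pos; lra).
      assert (K * / 2 <= K * tail t) by (apply Rmult_le_compat_l; assumption).
      unfold K in *. generalize (Rabs_pos L). lra. }
  assert (Hlim : is_lim_seq (density_avg (fun t => g (x + y * t) + - g x)) (u (x, y) + - g x)).
  { apply is_lim_seq_ext with (fun n => density_avg (fun t => g (x + y * t)) n + density_avg (fun _ => - g x) n).
    - intros n. rewrite density_avg_plus; [reflexivity|exact Hp|intros; apply continuous_const].
    - apply is_lim_seq_plus'; [apply poisson_density_limit; lra|apply density_avg_const_lim]. }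
  assert (Hdc : forall t, continuous (fun t => g (x + y * t) + - g x) t).
  { intros t. apply (continuous_plus (V := R_NormedModule) (fun t => g (x + y * t)) (fun _ => - g x)); [apply Hp|apply continuous_const]. }
  assert (Hbc : forall c t, continuous (fun t => c * (K * w) + c * K * tail t) t).
  { intros c t. apply (continuous_plus (V := R_NormedModule) (fun _ => c * (K * w)) (fun t => c * K * tail t)); [apply continuous_const|].
    apply (continuous_scal_r (V := R_NormedModule) (c * K) tail), Htc. }
  assert (Hb : forall c n, density_avg (fun t => c * (K * w) + c * K * tail t) n =
     c * (K * w * density_avg (fun _ => 1) n + K * density_avg tail n)).
  { intros c n. rewrite (density_avg_plus (fun _ => c * (K * w)) (fun t => c * K * tail t)).
    - rewrite (density_avg_scal (c * K) tail) by exact Htc.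
      replace (density_avg (fun _ => c * (K * w)) n) with (c * (K * w) * density_avg (fun _ => 1) n); [ring|].
      rewrite <- (density_avg_scal (c * (K * w)) (fun _ => 1)) by (intros; apply continuous_const).
      unfold density_avg. apply RInt_ext_R. intros. ring.
    - intros; apply continuous_const.
    - intros. apply (continuous_scal_r (V := R_NormedModule) (c * K) tail), Htc. }
  assert (Hfin : forall n, Rabs (density_avg (fun t => g (x + y * t) + - g x) n) <= 3 * K * w).
  { intros n. assert (HPI := PI_RGT_0).
    assert (D1 : density_avg (fun _ => 1) n <= 1).
    { rewrite density_avg_1. assert (B := proj2 (atan_bound (INR n))).
      apply Rle_trans with (2 / PI * (PI / 2)); [|right; field; lra].
      apply Rmult_le_compat_l; [|lra]. left. apply Rdiv_lt_0_compat; lra. }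
    assert (D2 := density_avg_tail w n Hw). fold tail in D2.
    assert (D3 : K * w * density_avg (fun _ => 1) n + K * density_avg tail n <= 3 * K * w).
    { assert (0 <= K * w) by (apply Rmult_le_pos; lra). nra. }
    apply Rabs_le. split.
    - apply Rle_trans with (density_avg (fun t => -1 * (K * w) + -1 * K * tail t) n); [rewrite Hb; lra|].
      apply density_avg_le; [apply Hbc|exact Hdc|]. intros t. specialize (Hpt t).
      apply Rabs_le_between in Hpt. lra.
    - apply Rle_trans with (density_avg (fun t => 1 * (K * w) + 1 * K * tail t) n); [|rewrite Hb; lra].
      apply density_avg_le; [exact Hdc|apply Hbc|]. intros t. specialize (Hpt t).
      apply Rabs_le_between in Hpt. lra. }
  assert (B : - (3 * K * w) <= u (x, y) + - g x <= 3 * K * w).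
  { split.
    - apply (is_lim_seq_le (fun _ => - (3 * K * w)) _ (- (3 * K * w)) _) with (3 := Hlim); [|apply is_lim_seq_const].
      intros n. generalize (Hfin n). intros H. apply Rabs_le_between in H. lra.
    - apply (is_lim_seq_le _ (fun _ => 3 * K * w) _ (3 * K * w)) with (2 := Hlim); [|apply is_lim_seq_const].
      intros n. generalize (Hfin n). intros H. apply Rabs_le_between in H. lra. }
  apply Rabs_le. lra.
Qed.
End PoissonProperties.

(** ** Extension of the conjugate function to the real line *)

Lemma real_mean_value (p dp : R -> R) (a b M : R) :
  a <= b -> (forall t, a <= t <= b -> is_derive p t (dp t)) ->
  (forall t, a <= t <= b -> Rabs (dp t) <= M) -> Rabs (p b - p a) <= M * (b - a).
Proof.
  intros Hab Hd HM. rewrite <- Cmod_R, RtoC_minus.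
  apply (path_mean_value (fun t => RtoC (p t)) (fun t => RtoC (dp t))); [exact Hab| |].
  - intros t Ht. apply rderiv_split. simpl. split; [apply Hd, Ht|apply @is_derive_const].
  - intros t Ht. rewrite Cmod_R. apply HM, Ht.
Qed.

Lemma real_lipschitz (p dp : R -> R) (M : R) :
  (forall t, is_derive p t (dp t)) -> (forall t, Rabs (dp t) <= M) ->
  forall x y, Rabs (p x - p y) <= M * Rabs (x - y).
Proof.
  intros Hd HM x y. destruct (Rle_dec y x).
  - rewrite (Rabs_pos_eq (x - y)) by lra. apply (real_mean_value p dp); intros; try apply Hd; try apply HM; lra.
  - rewrite Rabs_minus_sym, (Rabs_minus_sym x), (Rabs_pos_eq (y - x)) by lra.
    apply (real_mean_value p dp); intros; try apply Hd; try apply HM; lra.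
Qed.

Lemma second_difference_bound (p dp ddp : R -> R) (M : R) :
  (forall t, is_derive p t (dp t)) -> (forall t, is_derive dp t (ddp t)) ->
  (forall t, Rabs (ddp t) <= M) ->
  forall x h, Rabs (p (x + h) + p (x - h) - 2 * p x) <= 2 * M * h ^ 2.
Proof.
  intros H1 H2 HM.
  assert (HM0 : 0 <= M) by (eapply Rle_trans; [apply Rabs_pos|apply (HM 0)]).
  assert (main : forall x h, 0 <= h -> Rabs (p (x + h) + p (x - h) - 2 * p x) <= 2 * M * h ^ 2).
  { intros x h Hh.
    assert (B : Rabs ((p (x + h) + p (x - h)) - (p (x + 0) + p (x - 0))) <= (2 * M * h) * (h - 0)).
    { apply (real_mean_value (fun t => p (x + t) + p (x - t)) (fun t => dp (x + t) - dp (x - t))); [exact Hh| |].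
      - intros t _. apply (is_derive_plus (V := R_NormedModule) (fun t => p (x + t)) (fun t => p (x - t)) t (dp (x + t)) (- dp (x - t))).
        + replace (dp (x + t)) with (1 * dp (x + t)) by ring.
          apply (is_derive_comp p (fun t => x + t)); [apply H1|]. auto_derive; [trivial|ring].
        + replace (- dp (x - t)) with (-1 * dp (x - t)) by ring.
          apply (is_derive_comp p (fun t => x - t)); [apply H1|]. auto_derive; [trivial|ring].
      - intros t Ht. eapply Rle_trans; [apply (real_lipschitz dp ddp M H2 HM)|].
        replace (x + t - (x - t)) with (2 * t) by ring. rewrite Rabs_pos_eq by lra.
        replace (2 * M * h) with (M * (2 * h)) by ring. apply Rmult_le_compat_l; [exact HM0|lra]. }
    rewrite Rplus_0_r, !Rminus_0_r in B.
    replace (p (x + h) + p (x - h) - 2 * p x) with (p (x + h) + p (x - h) - (p x + p x)) by ring.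
    eapply Rle_trans; [exact B|]. right. ring. }
  intros x h. destruct (Rle_dec 0 h) as [Hh|Hh]; [apply main, Hh|].
  specialize (main x (- h) ltac:(lra)).
  replace (x + - h) with (x - h) in main by ring. replace (x - - h) with (x + h) in main by ring.
  replace ((- h) ^ 2) with (h ^ 2) in main by ring.
  rewrite (Rplus_comm (p (x + h))). exact main.
Qed.

Lemma rderiv_affine (z d : C) (t : R) : rderiv (fun t => z + RtoC t * d)%C t d.
Proof.
  exists (fun _ => d). split; [|split; [reflexivity|apply continuous_const]].
  intros s. rewrite RtoC_minus. ring.
Qed.

Lemma Re_derivative_horizontal (H H' : C -> C) (z : C) (t : R) :
  cderiv H (z + RtoC t)%C (H' (z + RtoC t)%C) ->
  is_derive (fun t => Re (H (z + RtoC t)%C)) t (Re (H' (z + RtoC t)%C)).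
Proof.
  intros Hd.
  assert (K : rderiv (fun t => H (z + RtoC t * 1)%C) t (H' (z + RtoC t)%C * 1)%C).
  { apply (rderiv_comp H (fun t => z + RtoC t * 1)%C); [|apply rderiv_affine].
    rewrite Cmult_1_r. exact Hd. }
  apply rderiv_split in K. destruct K as [K _]. rewrite Cmult_1_r in K.
  apply is_derive_ext with (2 := K). intros s. rewrite Cmult_1_r. reflexivity.
Qed.

(** A bound on second differences of [Re H] along horizontals bounds the real part
    of [H'']: subtract the second order Taylor polynomial. *)
Lemma Re_second_derivative_bound (H H' : C -> C) (z l : C) (r C0 : R) :
  0 < r -> (forall w, Cmod (w - z) < r -> cderiv H w (H' w)) -> cderiv H' z l ->
  (forall h, 0 < h < r -> Rabs (Re (H (z + RtoC h)%C) + Re (H (z - RtoC h)%C) - 2 * Re (H z)) <= C0 * h ^ 2) ->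
  Rabs (Re l) <= C0.
Proof.
  intros Hr HH Hl HC. apply le_epsilon. intros eps He.
  destruct (proj1 (cderiv_eps H' z l) Hl (eps / 2) ltac:(lra)) as [d [Hd Hw]].
  set (h := Rmin d r / 2).
  assert (Hh : 0 < h < r /\ h < d).
  { unfold h. generalize (Rmin_pos d r Hd Hr) (Rmin_l d r) (Rmin_r d r). lra. }
  assert (near : forall t s, 0 <= t <= h -> Rabs s = t -> Cmod (z + RtoC s - z) = t).
  { intros t s Ht Hs. replace (z + RtoC s - z)%C with (RtoC s) by ring. rewrite Cmod_R. exact Hs. }
  set (p := fun t => Re (H (z + RtoC t)%C) + Re (H (z + RtoC (- t))%C) - Re l * t ^ 2).
  set (dp := fun t => Re (H' (z + RtoC t)%C) - Re (H' (z + RtoC (- t))%C) - Re l * (2 * t)).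
  assert (B : Rabs (p h - p 0) <= eps * h * (h - 0)).
  { apply (real_mean_value p dp); [lra| |].
    - intros t Ht. unfold p, dp.
      assert (N1 : Cmod (z + RtoC t - z) = t) by (apply near; [exact Ht|apply Rabs_pos_eq; lra]).
      assert (N2 : Cmod (z + RtoC (- t) - z) = t) by (apply near; [exact Ht|rewrite Rabs_Ropp; apply Rabs_pos_eq; lra]).
      apply (is_derive_minus (V := R_NormedModule) (fun t => Re (H (z + RtoC t)%C) + Re (H (z + RtoC (- t))%C)) (fun t => Re l * t ^ 2)).
      + apply (is_derive_plus (V := R_NormedModule) (fun t => Re (H (z + RtoC t)%C)) (fun t => Re (H (z + RtoC (- t))%C)) t
          (Re (H' (z + RtoC t)%C)) (- Re (H' (z + RtoC (- t))%C))).
        * apply Re_derivative_horizontal, HH. lra.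
        * replace (- Re (H' (z + RtoC (- t))%C)) with (-1 * Re (H' (z + RtoC (- t))%C)) by ring.
          apply (is_derive_comp (fun t => Re (H (z + RtoC t)%C)) (fun t => - t)).
          -- apply Re_derivative_horizontal, HH. lra.
          -- auto_derive; [trivial|ring].
      + auto_derive; [trivial|ring].
    - intros t Ht. unfold dp.
      assert (N1 : Cmod (z + RtoC t - z) = t) by (apply near; [exact Ht|apply Rabs_pos_eq; lra]).
      assert (N2 : Cmod (z + RtoC (- t) - z) = t) by (apply near; [exact Ht|rewrite Rabs_Ropp; apply Rabs_pos_eq; lra]).
      assert (W1 := Hw (z + RtoC t)%C ltac:(lra)). assert (W2 := Hw (z + RtoC (- t))%C ltac:(lra)).
      rewrite N1 in W1. rewrite N2 in W2.
      set (e1 := (H' (z + RtoC t) - H' z - l * (z + RtoC t - z))%C) in *.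
      set (e2 := (H' (z + RtoC (- t)) - H' z - l * (z + RtoC (- t) - z))%C) in *.
      assert (E : Re (H' (z + RtoC t)%C) - Re (H' (z + RtoC (- t))%C) - Re l * (2 * t) = Re (e1 - e2)).
      { unfold e1, e2.
        replace (H' (z + RtoC t) - H' z - l * (z + RtoC t - z) - (H' (z + RtoC (- t)) - H' z - l * (z + RtoC (- t) - z)))%C
          with (H' (z + RtoC t) + - H' (z + RtoC (- t)) + - (l * RtoC (2 * t)))%C.
        - rewrite !re_plus, !re_opp, re_scal_r. ring.
        - rewrite RtoC_opp, RtoC_mult. ring. }
      rewrite E. eapply Rle_trans; [apply Re_le_Cmod|].
      eapply Rle_trans; [apply Cmod_triangle|]. rewrite Cmod_opp.
      assert (eps / 2 * t <= eps / 2 * h) by (apply Rmult_le_compat_l; lra). lra. }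
  assert (HCh := HC h ltac:(lra)).
  assert (E0 : p h - p 0 = (Re (H (z + RtoC h)%C) + Re (H (z - RtoC h)%C) - 2 * Re (H z)) - Re l * h ^ 2).
  { unfold p. rewrite Ropp_0. rewrite (Cplus_0_r z).
    replace (z + RtoC (- h))%C with (z - RtoC h)%C by (rewrite RtoC_opp; ring). ring. }
  rewrite E0 in B. rewrite Rminus_0_r in B.
  assert (Hh2 : 0 < h ^ 2) by (apply pow_lt; lra).
  apply Rmult_le_reg_r with (h ^ 2); [exact Hh2|].
  rewrite <- (Rabs_pos_eq (h ^ 2)) at 1 by lra. rewrite <- Rabs_mult.
  apply Rabs_le_between in B. apply Rabs_le_between in HCh. apply Rabs_le. lra.
Qed.

Lemma Re_derivative_bound (H : C -> C) (z l : C) (L : R) :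
  cderiv H z l -> (forall h, 0 < h -> Rabs (Re (H (z + RtoC h)%C) - Re (H z)) <= L * h) -> Rabs (Re l) <= L.
Proof.
  intros Hl HL. apply le_epsilon. intros eps He.
  destruct (proj1 (cderiv_eps H z l) Hl eps He) as [d [Hd Hw]].
  assert (Hh : 0 < d / 2) by lra. set (h := d / 2) in *.
  assert (N : Cmod (z + RtoC h - z) = h).
  { replace (z + RtoC h - z)%C with (RtoC h) by ring. rewrite Cmod_R. apply Rabs_pos_eq. lra. }
  assert (W := Hw (z + RtoC h)%C ltac:(unfold h in *; lra)). rewrite N in W.
  specialize (HL h Hh).
  assert (R1 := Re_le_Cmod (H (z + RtoC h) - H z - l * (z + RtoC h - z))%C).
  replace (z + RtoC h - z)%C with (RtoC h) in R1, W by ring.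
  unfold Cminus in R1. rewrite !re_plus, !re_opp, re_scal_r in R1.
  unfold Cminus in W.
  apply Rmult_le_reg_r with h; [exact Hh|].
  rewrite <- (Rabs_pos_eq h) at 1 by lra. rewrite <- Rabs_mult.
  assert (R2 := Rle_trans _ _ _ R1 W).
  apply Rabs_le_between in R2. apply Rabs_le_between in HL. apply Rabs_le. lra.
Qed.

Lemma open_uhp_box_domain : box_domain open_uhp.
Proof. apply (box_domain_above 0). Qed.

(** If [Re H] has bounded first and second differences along horizontals, then
    [Re H'] and [Re H''] are bounded.  Since [Re H''] is the vertical derivative
    of [Im H'], the latter stays bounded on approach to the real line too. *)
Lemma holomorphic_lipschitz_near_line (H : C -> C) (L C0 : R) :
  holo open_uhp H -> 0 <= L -> 0 <= C0 ->
  (forall x y h, 0 < y -> Rabs (Re (H (x + h, y)) - Re (H (x, y))) <= L * Rabs h) ->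
  (forall x y h, 0 < y -> Rabs (Re (H (x + h, y)) + Re (H (x - h, y)) - 2 * Re (H (x, y))) <= C0 * h ^ 2) ->
  forall r, 0 < r -> exists K, 0 < K /\ forall z w,
    Rabs (Re z) <= r -> 0 < Im z <= 1 -> Rabs (Re w) <= r -> 0 < Im w <= 1 ->
    Cmod (H z - H w) <= K * Cmod (z - w).
Proof.
  intros HH HL HC0 H1 H2 r Hr.
  destruct (holo_choose open_uhp H HH) as [H' HH'].
  assert (HH'h := holo_derivative open_uhp H H' open_uhp_box_domain HH').
  destruct (holo_choose open_uhp H' HH'h) as [H'' HH''].
  assert (B1 : forall z, open_uhp z -> Rabs (Re (H' z)) <= L).
  { intros [x y] Hz. apply (Re_derivative_bound H (x, y)); [apply HH', Hz|].
    intros h Hh. replace ((x, y) + RtoC h)%C with (x + h, y) by (unfold RtoC, Cplus; simpl; f_equal; ring).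
    eapply Rle_trans; [apply H1, Hz|]. rewrite Rabs_pos_eq by lra. apply Rle_refl. }
  assert (B2 : forall z, open_uhp z -> Rabs (Re (H'' z)) <= C0).
  { intros [x y] Hz. destruct (small_disc open_uhp (x, y) open_uhp_box_domain Hz) as [d [Hd Hdisc]].
    apply (Re_second_derivative_bound H H' (x, y) _ d); [exact Hd| |apply HH'', Hz|].
    - intros w Hw. apply HH', Hdisc. lra.
    - intros h Hh.
      replace ((x, y) + RtoC h)%C with (x + h, y) by (unfold RtoC, Cplus; simpl; f_equal; ring).
      replace ((x, y) - RtoC h)%C with (x - h, y) by (unfold RtoC, Cminus, Copp, Cplus; simpl; f_equal; ring).
      apply H2, Hz. }
  destruct (rect_bounded H' (- r) r 1 1 ltac:(lra) ltac:(lra)) as [K1 [HK1 HB1]].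
  { intros x y _ Hy. destruct (HH'h (x, y)) as [m Hm]; [unfold open_uhp; simpl; lra|].
    exact (cderiv_continuous _ _ _ Hm). }
  set (K := L + (K1 + C0)). exists K. split; [unfold K; lra|].
  assert (BH' : forall z, Rabs (Re z) <= r -> 0 < Im z <= 1 -> Cmod (H' z) <= K).
  { intros [x y] Hx Hy. simpl in Hx, Hy.
    assert (V : Rabs (Im (H' (x, 1)) - Im (H' (x, y))) <= C0 * (1 - y)).
    { apply (real_mean_value (fun t => Im (H' (x, t))) (fun t => Re (H'' (x, t)))); [lra| |].
      - intros t Ht.
        assert (Kd : rderiv (fun t => H' (x, t)) t (H'' (x, t) * Ci)%C).
        { apply (rderiv_comp H' (fun t => (x, t))); [|apply rderiv_vertical].
          apply HH''. unfold open_uhp; simpl; lra. }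
        apply rderiv_split in Kd. destruct Kd as [_ Kd].
        replace (Im (H'' (x, t) * Ci)) with (Re (H'' (x, t))) in Kd by (rewrite im_mult; simpl; ring).
        exact Kd.
      - intros t Ht. apply B2. unfold open_uhp; simpl; lra. }
    assert (T : Cmod (H' (x, 1)) <= K1) by (apply HB1; [apply Rabs_le_between, Hx|lra]).
    assert (T2 := Im_le_Cmod (H' (x, 1))).
    assert (T3 : open_uhp (x, y)) by (unfold open_uhp; simpl; lra).
    specialize (B1 _ T3).
    eapply Rle_trans; [apply Cmod_le_Re_Im|].
    assert (C0 * (1 - y) <= C0) by nra.
    assert (Rabs (Im (H' (x, y))) <= K1 + C0).
    { apply Rabs_le_between in V. apply Rabs_le_between in T2. apply Rabs_le. lra. }
    unfold K. lra. }
  intros z w Hz1 Hz2 Hw1 Hw2.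
  assert (B : Cmod (H (w + RtoC 1 * (z - w))%C - H (w + RtoC 0 * (z - w))%C) <= K * Cmod (z - w) * (1 - 0)).
  { assert (seg : forall t, 0 <= t <= 1 -> Rabs (Re (w + RtoC t * (z - w))) <= r /\ 0 < Im (w + RtoC t * (z - w)) <= 1).
    { intros t Ht. unfold Cminus. rewrite re_plus, im_plus, re_scal_l, im_scal_l, re_plus, im_plus, re_opp, im_opp.
      apply Rabs_le_between in Hz1. apply Rabs_le_between in Hw1. split; [apply Rabs_le|]; nra. }
    apply (path_mean_value (fun t => H (w + RtoC t * (z - w))%C) (fun t => H' (w + RtoC t * (z - w))%C * (z - w))%C); [lra| |].
    - intros t Ht. apply (rderiv_comp H (fun t => w + RtoC t * (z - w))%C); [|apply rderiv_affine].
      apply HH'. unfold open_uhp. apply seg, Ht.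
    - intros t Ht. rewrite Cmod_mult. apply Rmult_le_compat_r; [apply Cmod_ge_0|]. apply BH'; apply seg, Ht. }
  replace (w + RtoC 1 * (z - w))%C with z in B by ring.
  replace (w + RtoC 0 * (z - w))%C with w in B by ring. lra.
Qed.

Lemma lipschitz_boundary_value (v : R -> R) (K : R) : 0 < K ->
  (forall y y', 0 < y <= 1 -> 0 < y' <= 1 -> Rabs (v y - v y') <= K * Rabs (y - y')) ->
  exists l, forall y, 0 < y <= 1 -> Rabs (v y - l) <= K * y.
Proof.
  intros HK H.
  assert (O : forall y y', 0 < y <= 1 -> 0 < y' <= 1 -> v y - K * y <= v y' + K * y').
  { intros y y' Hy Hy'. specialize (H y y' Hy Hy'). apply Rabs_le_between in H.
    assert (Rabs (y - y') <= y + y') by (apply Rabs_le; lra). nra. }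
  destruct (completeness (fun a => exists y, 0 < y <= 1 /\ a = v y - K * y)) as [l [Hl1 Hl2]].
  - exists (v 1 + K * 1). intros a [y [Hy ->]]. apply O; lra.
  - exists (v 1 - K * 1), 1. split; [lra|reflexivity].
  - exists l. intros y Hy.
    assert (L1 : v y - K * y <= l) by (apply Hl1; exists y; split; [exact Hy|reflexivity]).
    assert (L2 : l <= v y + K * y) by (apply Hl2; intros a [y' [Hy' ->]]; apply O; assumption).
    apply Rabs_le. lra.
Qed.

Lemma continuous_on_uhp_eps (v : C -> R) :
  continuous_on closed_uhp v <->
  forall z, 0 <= Im z -> forall eps, 0 < eps -> exists d, 0 < d /\
    forall w, 0 <= Im w -> Cmod (w - z) < d -> Rabs (v w - v z) < eps.
Proof.
  split.
  - intros H z Hz eps He.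
    destruct (proj1 (filterlim_locally v (v z)) (H z Hz) (mkposreal _ He)) as [d Hd].
    exists d. split; [apply cond_pos|]. intros w Hw Hwz. apply (Hd w); [|exact Hw].
    apply (proj2 (ball_C _ _ _)). generalize (Re_minus_le w z) (Im_minus_le w z). lra.
  - intros H z Hz. apply filterlim_locally. intros eps.
    destruct (H z Hz eps (cond_pos eps)) as [d [Hd Hw]].
    assert (Hd2 : 0 < d / 2) by lra. exists (mkposreal _ Hd2). intros w Hb Hw0.
    apply (proj1 (ball_C _ _ _)) in Hb. simpl (pos _) in Hb. apply Hw; [exact Hw0|].
    eapply Rle_lt_trans; [apply Cmod_minus_le|]. lra.
Qed.

(** A function that is Lipschitz near each bounded piece of the line has vertical
    limits there, and these are attained continuously. *)
Lemma continuous_extension_exists (vo : C -> R) :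
  (forall z, open_uhp z -> forall eps, 0 < eps -> exists d, 0 < d /\
     forall w, Cmod (w - z) < d -> Rabs (vo w - vo z) < eps) ->
  (forall r, 0 < r -> exists K, 0 < K /\ forall z w,
    Rabs (Re z) <= r -> 0 < Im z <= 1 -> Rabs (Re w) <= r -> 0 < Im w <= 1 ->
    Rabs (vo z - vo w) <= K * Cmod (z - w)) ->
  exists v, continuous_extension vo v.
Proof.
  intros Hc HL.
  assert (Hb : forall x, exists l, exists K, 0 < K /\ forall y, 0 < y <= 1 -> Rabs (vo (x, y) - l) <= K * y).
  { intros x. destruct (HL (Rabs x + 1) ltac:(generalize (Rabs_pos x); lra)) as [K [HK H]].
    destruct (lipschitz_boundary_value (fun y => vo (x, y)) K HK) as [l Hl].
    - intros y y' Hy Hy'. eapply Rle_trans; [apply H; simpl; lra|].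
      apply Rmult_le_compat_l; [lra|]. eapply Rle_trans; [apply Cmod_minus_le|]. simpl.
      replace (x - x) with 0 by ring. rewrite Rabs_R0. lra.
    - exists l, K. split; assumption. }
  set (bv := fun x => proj1_sig (constructive_indefinite_description _ (Hb x))).
  assert (Hbv : forall x, exists K, 0 < K /\ forall y, 0 < y <= 1 -> Rabs (vo (x, y) - bv x) <= K * y).
  { intros x. exact (proj2_sig (constructive_indefinite_description _ (Hb x))). }
  exists (fun z => if Rlt_dec 0 (Im z) then vo z else bv (Re z)). split.
  - intros z Hz. destruct (Rlt_dec 0 (Im z)); [reflexivity|contradiction].
  - apply continuous_on_uhp_eps. intros z Hz eps He.
    destruct (Rlt_dec 0 (Im z)) as [Hz0|Hz0].
    + destruct (Hc z Hz0 eps He) as [d [Hd H]].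
      exists (Rmin d (Im z)). split; [apply Rmin_pos; assumption|]. intros w Hw Hwz.
      assert (Im w > 0).
      { generalize (Im_minus_le w z) (Rmin_r d (Im z)) (Rle_abs (- (Im w - Im z))). rewrite Rabs_Ropp. lra. }
      destruct (Rlt_dec 0 (Im w)); [|lra]. apply H. generalize (Rmin_l d (Im z)). lra.
    + assert (Ez : Im z = 0) by lra. clear Hz Hz0.
      destruct z as [x0 y0]. simpl in Ez. subst y0. simpl Re.
      destruct (HL (Rabs x0 + 1) ltac:(generalize (Rabs_pos x0); lra)) as [K [HK HLK]].
      destruct (Hbv x0) as [K0 [HK0 H0]].
      set (d := Rmin 1 (eps / (2 * (K + K0 + 1)))).
      assert (Hd : 0 < d) by (apply Rmin_pos; [lra|apply Rdiv_lt_0_compat; lra]).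
      exists d. split; [exact Hd|]. intros [x y] Hy Hw. simpl Im in *. simpl Re in *.
      assert (Hd1 : d <= 1) by apply Rmin_l.
      assert (R1 := Re_minus_le (x, y) (x0, 0)). assert (R2 := Im_minus_le (x, y) (x0, 0)). simpl in R1, R2.
      rewrite Rminus_0_r in R2.
      assert (Hx : Rabs x <= Rabs x0 + 1).
      { replace x with ((x - x0) + x0) by ring. eapply Rle_trans; [apply Rabs_triang|]. lra. }
      assert (near : forall t, 0 < t <= 1 -> Rabs (vo (x, t) - bv x0) <= K * Rabs (x - x0) + K0 * t).
      { intros t Ht. replace (vo (x, t) - bv x0) with ((vo (x, t) - vo (x0, t)) + (vo (x0, t) - bv x0)) by ring.
        eapply Rle_trans; [apply Rabs_triang|]. apply Rplus_le_compat; [|apply H0, Ht].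
        eapply Rle_trans; [apply HLK; simpl; try lra|].
        apply Rmult_le_compat_l; [lra|]. eapply Rle_trans; [apply Cmod_minus_le|]. simpl.
        replace (t - t) with 0 by ring. rewrite Rabs_R0. lra. }
      assert (Hfin : K * Rabs (x - x0) + K0 * Rabs y < eps).
      { assert (d <= eps / (2 * (K + K0 + 1))) by apply Rmin_r.
        apply Rle_lt_trans with ((K + K0) * d); [assert (0 <= Rabs y) by apply Rabs_pos; nra|].
        apply Rle_lt_trans with ((K + K0 + 1) * (eps / (2 * (K + K0 + 1)))).
        - apply Rmult_le_compat; lra.
        - replace ((K + K0 + 1) * (eps / (2 * (K + K0 + 1)))) with (eps / 2) by (field; lra). lra. }
      destruct (Rlt_dec 0 y) as [Hy0|Hy0].
      * eapply Rle_lt_trans; [apply near|].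
        -- rewrite Rabs_pos_eq in R2 by lra. lra.
        -- rewrite (Rabs_pos_eq y) in Hfin by lra. exact Hfin.
      * destruct (Hbv x) as [K2 [HK2 H2]].
        apply Rle_lt_trans with (2 := Hfin).
        apply Rle_trans with (K * Rabs (x - x0)); [|generalize (Rabs_pos y); nra].
        apply le_epsilon. intros e He'.
        set (t := Rmin 1 (e / (K0 + K2))).
        assert (Ht : 0 < t <= 1).
        { split; [apply Rmin_pos; [lra|apply Rdiv_lt_0_compat; lra]|apply Rmin_l]. }
        assert (Ht2 : (K0 + K2) * t <= e).
        { apply Rle_trans with ((K0 + K2) * (e / (K0 + K2))); [|right; field; lra].
          apply Rmult_le_compat_l; [lra|apply Rmin_r]. }
        specialize (near t Ht). specialize (H2 t Ht).
        replace (bv x - bv x0) with ((vo (x, t) - bv x0) - (vo (x, t) - bv x)) by ring.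
        unfold Rminus at 1. eapply Rle_trans; [apply Rabs_triang|]. rewrite Rabs_Ropp. lra.
Qed.

(** ** Schwarz reflection *)

Definition rel_continuous_uhp (A : C -> C) : Prop :=
  forall z, 0 <= Im z -> forall eps, 0 < eps -> exists d, 0 < d /\
    forall w, 0 <= Im w -> Cmod (w - z) < d -> Cmod (A w - A z) < eps.

(** If [|A|^2 = F] on the line, [F / conj A] is the value of [A] there: with
    [F = 1] this is reflection in the unit circle. *)
Definition reflect_glue (A F : C -> C) (z : C) : C :=
  if Rle_dec 0 (Im z) then A z else (F z * / Cconj (A (Cconj z)))%C.

(** The two halves agree on the line, where [A * conj A = F], so the glued function
    is continuous and holomorphic off the line. *)
Lemma reflect_glue_entire (A F : C -> C) :
  rel_continuous_uhp A -> holo open_uhp A -> (forall z, 0 <= Im z -> A z <> RtoC 0) ->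
  entire_fun F -> (forall x : R, F (RtoC x) = (A (RtoC x) * Cconj (A (RtoC x)))%C) ->
  entire_fun (reflect_glue A F).
Proof.
  intros Hc HA Hnz HF HE.
  assert (Hcn : forall z, 0 <= Im z -> Cconj (A z) <> RtoC 0).
  { intros z Hz E. apply (Hnz z Hz). apply Cmod_eq_0. rewrite <- Cmod_conj, E. apply Cmod_0. }
  assert (off : forall z, Im z <> 0 -> exists m, cderiv (reflect_glue A F) z m).
  { intros z Hz. destruct (Rlt_dec 0 (Im z)) as [Hp|Hp].
    - destruct (HA z Hp) as [m Hm]. exists m.
      apply (cderiv_ext_loc A _ _ _ (Im z)); [exact Hp| |exact Hm].
      intros w Hw. unfold reflect_glue. destruct (Rle_dec 0 (Im w)) as [_|N]; [reflexivity|exfalso].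
      apply N. generalize (Im_minus_le w z) (Rle_abs (- (Im w - Im z))). rewrite Rabs_Ropp. lra.
    - assert (Hn : Im z < 0) by lra.
      assert (Hu : open_uhp (Cconj z)) by (unfold open_uhp; rewrite im_conj; lra).
      destruct (HA _ Hu) as [m Hm]. destruct (HF z I) as [l Hl].
      eexists. apply (cderiv_ext_loc (fun w => F w * / Cconj (A (Cconj w)))%C _ _ _ (- Im z)); [lra| |].
      + intros w Hw. unfold reflect_glue. destruct (Rle_dec 0 (Im w)) as [N|_]; [exfalso|reflexivity].
        generalize (Im_minus_le w z) (Rle_abs (Im w - Im z)). lra.
      + apply cderiv_mult; [exact Hl|].
        apply (cderiv_inv (fun w => Cconj (A (Cconj w)))).
        * apply Hcn. unfold open_uhp in Hu. lra.
        * apply cderiv_conj. exact Hm. }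
  apply (holo_off_line _ _ 0 box_domain_plane); [|intros z _; apply off].
  intros z _. destruct (Req_dec (Im z) 0) as [Ez|Nz].
  2: { destruct (off z Nz) as [m Hm]. exact (cderiv_continuous _ _ _ Hm). }
  assert (Ezr : z = RtoC (Re z)) by (destruct z as [a b]; simpl in *; rewrite Ez; reflexivity).
  assert (Ec : Cconj z = z) by (rewrite Ezr; unfold Cconj, RtoC; simpl; f_equal; ring).
  apply continuous_C_eps. intros eps He.
  destruct (Hc z ltac:(lra) eps He) as [d1 [Hd1 H1]].
  (* extend [A] to the lower half-plane by its value at [z] to state continuity there *)
  set (A1 := fun w => if Rle_dec 0 (Im w) then A w else A z).
  assert (HA1 : continuous A1 z).
  { apply continuous_C_eps. intros e He'. destruct (Hc z ltac:(lra) e He') as [d [Hd Hw]].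
    exists d. split; [exact Hd|]. intros w Hwz. unfold A1.
    destruct (Rle_dec 0 (Im z)); [|lra]. destruct (Rle_dec 0 (Im w)).
    - apply Hw; assumption.
    - replace (A z - A z)%C with (RtoC 0) by ring. rewrite Cmod_0. exact He'. }
  assert (HB : continuous (fun w => F w * / Cconj (A1 (Cconj w)))%C z).
  { apply continuous_Cmult; [apply entire_continuous, HF|].
    apply continuous_Cinv.
    - rewrite Ec. unfold A1. destruct (Rle_dec 0 (Im z)); [|lra]. apply Hcn. lra.
    - apply continuous_Cconj. apply (continuous_comp Cconj A1).
      + apply (continuous_Cconj (fun w => w)), continuous_id.
      + rewrite Ec. exact HA1. }
  destruct (proj1 (continuous_C_eps _ _) HB eps He) as [d2 [Hd2 H2]].
  exists (Rmin d1 d2). split; [apply Rmin_pos; assumption|]. intros w Hw.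
  assert (EBz : (F z * / Cconj (A1 (Cconj z)))%C = A z).
  { rewrite Ec. unfold A1. destruct (Rle_dec 0 (Im z)); [|lra].
    rewrite Ezr at 1. rewrite HE, <- Ezr. field. apply Hcn. lra. }
  unfold reflect_glue at 2. destruct (Rle_dec 0 (Im z)) as [_|N]; [|lra].
  unfold reflect_glue. destruct (Rle_dec 0 (Im w)) as [Hw0|Hw0].
  - apply H1; [exact Hw0|]. generalize (Rmin_l d1 d2). lra.
  - specialize (H2 w ltac:(generalize (Rmin_r d1 d2); lra)). cbv beta in H2. rewrite EBz in H2.
    unfold A1 in H2. destruct (Rle_dec 0 (Im (Cconj w))) as [_|N]; [exact H2|].
    exfalso. apply N. rewrite im_conj. lra.
Qed.

(** ** Regularity of the logarithm of a band-limited function *)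

Lemma entire_derivative_strip_bound (F F' : C -> C) (M T : R) :
  (forall z, cderiv F z (F' z)) -> 0 <= T ->
  (forall z, Cmod (F z) <= M * exp (T * Rabs (Im z))) -> 0 <= M ->
  forall z, Cmod (F' z) <= M * exp T * exp (T * Rabs (Im z)).
Proof.
  intros HF HT HM HM0 z.
  replace (M * exp T * exp (T * Rabs (Im z))) with ((M * exp (T * (1 + Rabs (Im z)))) / 1).
  - apply (cauchy_estimate (fun _ => True) F F' z 1); [apply box_domain_plane|intros; apply HF|lra|intros w _; exact I|].
    intros w Hw. eapply Rle_trans; [apply HM|]. apply Rmult_le_compat_l; [exact HM0|].
    apply exp_le. apply Rmult_le_compat_l; [exact HT|].
    assert (H := Im_minus_le w z). assert (H2 := Rabs_triang (Im w - Im z) (Im z)).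
    replace (Im w - Im z + Im z) with (Im w) in H2 by ring. lra.
  - rewrite Rmult_assoc, <- exp_plus. rewrite Rdiv_1_r. do 2 f_equal. ring.
Qed.

Lemma Re_derivative_real_line (F F' : C -> C) (x : R) :
  cderiv F (RtoC x) (F' (RtoC x)) -> is_derive (fun t => Re (F (RtoC t))) x (Re (F' (RtoC x))).
Proof.
  intros H. assert (K := rderiv_comp F (fun t => (t, 0)) x _ _ H (rderiv_horizontal 0 x)).
  apply rderiv_split in K. destruct K as [K _]. rewrite Cmult_1_r in K. exact K.
Qed.

(** The first two derivatives of [f] are bounded on the line, by Cauchy's estimates
    for its entire extension; as [f >= m] the same holds for its logarithm. *)
Lemma log_regularity (f : R -> C) (m : R) :
  band_limited f -> 0 < m -> (forall x, Im (f x) = 0 /\ m <= Re (f x)) ->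
  exists M L C0, 0 <= L /\ 0 <= C0 /\
    (forall x, 1 / 2 * ln m <= 1 / 2 * ln (Re (f x)) <= M) /\
    (forall x y, Rabs (1 / 2 * ln (Re (f x)) - 1 / 2 * ln (Re (f y))) <= L * Rabs (x - y)) /\
    (forall x h, Rabs (1 / 2 * ln (Re (f (x + h))) + 1 / 2 * ln (Re (f (x - h)))
       - 2 * (1 / 2 * ln (Re (f x)))) <= C0 * h ^ 2).
Proof.
  intros Hf Hm Hpos.
  destruct (band_limited_entire_extension f Hf) as [F [T [M [HT [HM [HF [Hext HB]]]]]]].
  destruct (holo_choose _ F HF) as [F' HF'0]. assert (HF' : forall z, cderiv F z (F' z)) by (intros; apply HF'0, I).
  assert (HF'h := holo_derivative _ F F' box_domain_plane HF'0).
  destruct (holo_choose _ F' HF'h) as [F'' HF''0]. assert (HF'' : forall z, cderiv F' z (F'' z)) by (intros; apply HF''0, I).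
  assert (HB' := entire_derivative_strip_bound F F' M T HF' HT HB ltac:(lra)).
  assert (HM1 : 0 <= M * exp T) by (apply Rmult_le_pos; [lra|left; apply exp_pos]).
  assert (HB'' := entire_derivative_strip_bound F' F'' (M * exp T) T HF'' HT HB' HM1).
  set (p := fun x => Re (F (RtoC x))). set (p1 := fun x => Re (F' (RtoC x))). set (p2 := fun x => Re (F'' (RtoC x))).
  assert (Ep : forall x, Re (f x) = p x) by (intros x; unfold p; rewrite Hext; reflexivity).
  assert (Hp : forall x, m <= p x) by (intros x; rewrite <- Ep; apply Hpos).
  assert (D1 : forall x, is_derive p x (p1 x)) by (intros; apply Re_derivative_real_line, HF').
  assert (D2 : forall x, is_derive p1 x (p2 x)) by (intros; apply Re_derivative_real_line, HF'').
  assert (real_bound : forall G K, (forall z, Cmod (G z) <= K * exp (T * Rabs (Im z))) -> forall x, Rabs (Re (G (RtoC x))) <= K).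
  { intros G K HG x. eapply Rle_trans; [apply Re_le_Cmod|]. eapply Rle_trans; [apply HG|].
    simpl. rewrite Rabs_R0, Rmult_0_r, exp_0. lra. }
  assert (B0 := real_bound F M HB : forall x, Rabs (p x) <= M).
  assert (B1 := real_bound F' _ HB' : forall x, Rabs (p1 x) <= M * exp T).
  assert (B2 := real_bound F'' _ HB'' : forall x, Rabs (p2 x) <= M * exp T * exp T).
  set (N1 := M * exp T) in *. set (N2 := N1 * exp T) in *.
  set (g := fun x => 1 / 2 * ln (p x)). set (g1 := fun x => 1 / 2 * (p1 x / p x)).
  set (g2 := fun x => 1 / 2 * ((p2 x * p x - p1 x * p1 x) / p x ^ 2)).
  assert (G1d : forall x, is_derive g x (g1 x)).
  { intros x. assert (Hx := Hp x). unfold g, g1. apply is_derive_scal.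
    apply (is_derive_comp (V := R_NormedModule) ln p x (/ p x) (p1 x)); [|apply D1].
    apply is_derive_Reals, derivable_pt_lim_ln. lra. }
  assert (G2d : forall x, is_derive g1 x (g2 x)).
  { intros x. assert (Hx := Hp x). unfold g1, g2. apply is_derive_scal.
    apply is_derive_div; [apply D2|apply D1|lra]. }
  set (L := 1 / 2 * (N1 / m)). set (C0 := 1 / 2 * ((N2 * M + N1 * N1) / (m * m))).
  assert (HN2 : 0 <= N2) by (apply Rmult_le_pos; [exact HM1|left; apply exp_pos]).
  assert (Him : 0 < / m) by (apply Rinv_0_lt_compat, Hm).
  assert (Hip : forall x, 0 < / p x <= / m).
  { intros x. assert (Hx := Hp x). split; [apply Rinv_0_lt_compat; lra|apply Rinv_le_contravar; lra]. }
  assert (BL : forall x, Rabs (g1 x) <= L).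
  { intros x. unfold g1, L. rewrite Rabs_mult, (Rabs_pos_eq (1 / 2)) by lra.
    apply Rmult_le_compat_l; [lra|]. unfold Rdiv. rewrite Rabs_mult, (Rabs_pos_eq (/ p x)) by (left; apply Hip).
    apply Rmult_le_compat; [apply Rabs_pos|left; apply Hip|apply B1|apply Hip]. }
  assert (BC : forall x, Rabs (g2 x) <= C0).
  { intros x. unfold g2, C0. rewrite Rabs_mult, (Rabs_pos_eq (1 / 2)) by lra.
    apply Rmult_le_compat_l; [lra|]. unfold Rdiv.
    assert (H0 : 0 < / p x ^ 2) by (apply Rinv_0_lt_compat, pow_lt; generalize (Hp x); lra).
    rewrite Rabs_mult, (Rabs_pos_eq (/ p x ^ 2)) by lra.
    apply Rmult_le_compat; [apply Rabs_pos|lra| |].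
    - unfold Rminus. eapply Rle_trans; [apply Rabs_triang|]. rewrite Rabs_Ropp, !Rabs_mult.
      apply Rplus_le_compat; apply Rmult_le_compat; try apply Rabs_pos; [apply B2|apply B0|apply B1|apply B1].
    - apply Rinv_le_contravar; [nra|]. specialize (Hp x). simpl. nra. }
  exists (1 / 2 * ln M), L, (2 * C0). split; [|split; [|split; [|split]]].
  - unfold L. apply Rmult_le_pos; [lra|]. apply Rmult_le_pos; lra.
  - assert (0 <= C0); [|lra]. eapply Rle_trans; [apply Rabs_pos|apply (BC 0)].
  - intros x. rewrite Ep. assert (Hx := Hp x). assert (H0 := B0 x). apply Rabs_le_between in H0.
    assert (ln m <= ln (p x)) by (apply ln_le; lra). assert (ln (p x) <= ln M) by (apply ln_le; lra). lra.
  - intros x y. rewrite !Ep. exact (real_lipschitz g g1 L G1d BL x y).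
  - intros x h. rewrite !Ep. exact (second_difference_bound g g1 g2 C0 G1d G2d BC x h).
Qed.

(** ** The outer function [exp (u + i v)] *)

Definition uhp_retract (z : C) : C := (Re z, (Im z + Rabs (Im z)) / 2).

Lemma uhp_retract_in (z : C) : 0 <= Im (uhp_retract z).
Proof. simpl. generalize (Rle_abs (- Im z)). rewrite Rabs_Ropp. lra. Qed.

Lemma uhp_retract_id (z : C) : 0 <= Im z -> uhp_retract z = z.
Proof.
  intros Hz. destruct z as [x y]. unfold uhp_retract; simpl in *. rewrite Rabs_pos_eq by exact Hz.
  f_equal. lra.
Qed.

Lemma continuous_uhp_retract (z : C) : continuous uhp_retract z.
Proof.
  apply continuous_C_split. split; simpl; [apply continuous_fst|].
  apply (continuous_ext (fun w : C => / 2 * (Im w + Rabs (Im w)))); [intros; simpl; field|].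
  apply (continuous_scal_r (V := R_NormedModule) (/ 2) (fun w : C => Im w + Rabs (Im w))).
  apply (continuous_plus (V := R_NormedModule) Im (fun w : C => Rabs (Im w))); [apply continuous_snd|].
  apply (continuous_comp Im Rabs); [apply continuous_snd|apply continuous_Rabs].
Qed.

(** Continuity relative to the closed half-plane is plain continuity after the
    retraction onto it, so the usual closure rules apply. *)
Lemma rel_continuous_retract (A : C -> C) :
  rel_continuous_uhp A <-> forall z, continuous (fun w => A (uhp_retract w)) z.
Proof.
  split.
  - intros H z. apply continuous_C_eps. intros eps He.
    destruct (H _ (uhp_retract_in z) eps He) as [d [Hd HA]].
    destruct (proj1 (continuous_C_eps _ _) (continuous_uhp_retract z) d Hd) as [r [Hr Hw]].
    exists r. split; [exact Hr|]. intros w Hwz. apply HA; [apply uhp_retract_in|apply Hw, Hwz].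
  - intros H z Hz eps He.
    destruct (proj1 (continuous_C_eps _ _) (H z) eps He) as [d [Hd HA]].
    exists d. split; [exact Hd|]. intros w Hw Hwz. specialize (HA w Hwz).
    rewrite !uhp_retract_id in HA by assumption. exact HA.
Qed.

(** What both directions use of [E = exp (u + i v)]; its boundary values carry the
    argument [v]. *)
Record outer (f : R -> C) (g : R -> R) (v : C -> R) (E : C -> C) (c1 c2 : R) : Prop := {
  outer_pos : 0 < c1 <= c2;
  outer_cont : rel_continuous_uhp E;
  outer_holo : holo open_uhp E;
  outer_bounds : forall z, 0 <= Im z -> c1 <= Cmod (E z) <= c2;
  outer_real : forall x, E (RtoC x) = Cexp (g x, v (RtoC x));
  outer_square : forall x, f x = (E (RtoC x) * Cconj (E (RtoC x)))%C;
  outer_conj_cont : forall x, continuous (fun t => v (RtoC t)) x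
}.

Lemma log_abs_bound (g : R -> R) (a b : R) : (forall x, a <= g x <= b) ->
  forall x, Rabs (g x) <= Rabs a + Rabs b.
Proof.
  intros H x. specialize (H x). generalize (Rle_abs b) (Rle_abs (- a)) (Rabs_pos a) (Rabs_pos b).
  rewrite Rabs_Ropp. intros. apply Rabs_le. lra.
Qed.

(** The Lipschitz bounds of the Poisson integral make [u + i v] Lipschitz near the
    line. *)
Lemma conjugate_extension_exists (f : R -> C) (m : R) (vo : C -> R) :
  band_limited f -> 0 < m -> (forall x, Im (f x) = 0 /\ m <= Re (f x)) ->
  harmonic_conjugate (poisson (V := R_CompleteNormedModule) (fun x => 1 / 2 * ln (Re (f x)))) vo ->
  exists v, continuous_extension vo v.
Proof.
  intros Hf Hm Hpos Hconj.
  destruct (log_regularity f m Hf Hm Hpos) as [M [L [C0 [HL [HC0 [Hb [Hlip Hsd]]]]]]].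
  set (g := fun x => 1 / 2 * ln (Re (f x))) in *.
  set (u := poisson (V := R_CompleteNormedModule) g) in *.
  assert (HMg := log_abs_bound g _ _ Hb).
  set (H := fun z : C => (u z, vo z) : C).
  assert (HH : holo open_uhp H).
  { intros z Hz. apply ex_derive_cderiv. apply Hconj, Hz. }
  apply continuous_extension_exists.
  - intros z Hz eps He. destruct (HH z Hz) as [l Hl].
    destruct (proj1 (continuous_C_eps H z) (cderiv_continuous _ _ _ Hl) eps He) as [d [Hd Hw]].
    exists d. split; [exact Hd|]. intros w Hwz. eapply Rle_lt_trans; [|apply (Hw w Hwz)].
    apply (Im_minus_le (H w) (H z)).
  - intros r Hr.
    destruct (holomorphic_lipschitz_near_line H L C0 HH HL HC0) with (r := r) as [K [HK HLip]]; [| |exact Hr|].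
    + intros x y h Hy. simpl. eapply Rle_trans.
      * apply (poisson_lipschitz_x g _ L HMg Hlip x (x + h) y Hy).
      * replace (x + h - x) with h by ring. apply Rle_refl.
    + intros x y h Hy. simpl. apply (poisson_second_difference g _ L HMg Hlip C0 x y h Hy).
      intros x' h'. apply Hsd.
    + exists K. split; [exact HK|]. intros z w Hz1 Hz2 Hw1 Hw2.
      eapply Rle_trans; [|apply (HLip z w); assumption]. apply (Im_minus_le (H z) (H w)).
Qed.

Lemma outer_exists (f : R -> C) (m : R) (vo v : C -> R) :
  band_limited f -> 0 < m -> (forall x, Im (f x) = 0 /\ m <= Re (f x)) ->
  harmonic_conjugate (poisson (V := R_CompleteNormedModule) (fun x => 1 / 2 * ln (Re (f x)))) vo ->
  continuous_extension vo v ->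
  exists E c1 c2, outer f (fun x => 1 / 2 * ln (Re (f x))) v E c1 c2.
Proof.
  intros Hf Hm Hpos Hconj [Hv Hvc].
  destruct (log_regularity f m Hf Hm Hpos) as [M [L [C0 [HL [HC0 [Hb [Hlip _]]]]]]].
  set (g := fun x => 1 / 2 * ln (Re (f x))) in *.
  set (u := poisson (V := R_CompleteNormedModule) g) in *.
  assert (HMg := log_abs_bound g _ _ Hb).
  set (M' := Rabs (1 / 2 * ln m) + Rabs M) in *.
  assert (HM' : 0 <= M') by (unfold M'; generalize (Rabs_pos (1 / 2 * ln m)) (Rabs_pos M); lra).
  assert (Hureal : forall x, u (RtoC x) = g x) by (intros x; apply (poisson_real g)).
  set (H := fun z : C => (u z, v z) : C).
  assert (HH : holo open_uhp H).
  { intros z Hz. destruct (proj1 (ex_derive_cderiv _ _) (Hconj z Hz)) as [l Hl]. exists l.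
    apply (cderiv_ext_loc (fun z => (u z, vo z)) _ _ _ (Im z)); [exact Hz| |exact Hl].
    intros w Hw. unfold H. rewrite Hv; [reflexivity|]. unfold open_uhp in *.
    generalize (Im_minus_le w z) (Rle_abs (- (Im w - Im z))). rewrite Rabs_Ropp. lra. }
  assert (Hucont : forall z, 0 <= Im z -> forall eps, 0 < eps -> exists d, 0 < d /\
    forall w, 0 <= Im w -> Cmod (w - z) < d -> Rabs (u w - u z) < eps).
  { intros z Hz eps He. destruct Hz as [Hz|Hz].
    - destruct (HH z Hz) as [l Hl].
      destruct (proj1 (continuous_C_eps H z) (cderiv_continuous _ _ _ Hl) eps He) as [d [Hd Hw]].
      exists d. split; [exact Hd|]. intros w _ Hwz. eapply Rle_lt_trans; [|apply (Hw w Hwz)].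
      apply (Re_minus_le (H w) (H z)).
    - destruct z as [x0 y0]. simpl in Hz. subst y0. change (x0, 0) with (RtoC x0). rewrite Hureal.
      set (K := 3 * (Rabs L + 4 * M')). assert (HK : 0 <= K) by (unfold K; generalize (Rabs_pos L); lra).
      set (r := eps / (2 * (K + 1))). assert (Hr : 0 < r) by (apply Rdiv_lt_0_compat; lra).
      set (d := Rmin (/ 4) (Rmin (r * r) (eps / (2 * (L + 1))))).
      assert (Hd : 0 < d).
      { unfold d. repeat apply Rmin_pos; [lra|apply Rmult_lt_0_compat; exact Hr|apply Rdiv_lt_0_compat; lra]. }
      exists d. split; [exact Hd|]. intros [x y] Hy Hw. simpl in Hy.
      assert (R1 := Re_minus_le (x, y) (RtoC x0)). assert (R2 := Im_minus_le (x, y) (RtoC x0)). simpl in R1, R2.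
      rewrite Rminus_0_r, Rabs_pos_eq in R2 by exact Hy.
      assert (d1 : d <= / 4) by apply Rmin_l.
      assert (d2 : d <= r * r) by (eapply Rle_trans; [apply Rmin_r|apply Rmin_l]).
      assert (d3 : d <= eps / (2 * (L + 1))) by (eapply Rle_trans; [apply Rmin_r|apply Rmin_r]).
      assert (T1 : Rabs (g x - g x0) < eps / 2).
      { eapply Rle_lt_trans; [apply Hlip|]. apply Rle_lt_trans with (L * d).
        - apply Rmult_le_compat_l; lra.
        - apply Rlt_le_trans with ((L + 1) * d); [lra|].
          apply Rle_trans with ((L + 1) * (eps / (2 * (L + 1)))); [apply Rmult_le_compat_l; lra|right; field; lra]. }
      assert (T2 : Rabs (u (x, y) - g x) < eps / 2).
      { destruct Hy as [Hy| <-].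
        - eapply Rle_lt_trans; [apply (poisson_vertical_limit g M' L HMg Hlip x y); lra|]. fold K.
          assert (sqrt y <= r).
          { rewrite <- (sqrt_Rsqr r) by lra. apply sqrt_le_1; unfold Rsqr; lra. }
          apply Rle_lt_trans with (K * r); [apply Rmult_le_compat_l; assumption|].
          apply Rlt_le_trans with ((K + 1) * r); [lra|]. unfold r. right. field. lra.
        - change (x, 0) with (RtoC x). rewrite Hureal. replace (g x - g x) with 0 by ring. rewrite Rabs_R0. lra. }
      replace (u (x, y) - g x0) with ((u (x, y) - g x) + (g x - g x0)) by ring.
      eapply Rle_lt_trans; [apply Rabs_triang|]. lra. }
  assert (HcH : rel_continuous_uhp H).
  { intros z Hz eps He. destruct (Hucont z Hz (eps / 2) ltac:(lra)) as [d1 [Hd1 H1]].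
    destruct (proj1 (continuous_on_uhp_eps v) Hvc z Hz (eps / 2) ltac:(lra)) as [d2 [Hd2 H2]].
    exists (Rmin d1 d2). split; [apply Rmin_pos; assumption|]. intros w Hw Hwz.
    specialize (H1 w Hw ltac:(generalize (Rmin_l d1 d2); lra)).
    specialize (H2 w Hw ltac:(generalize (Rmin_r d1 d2); lra)).
    eapply Rle_lt_trans; [apply Cmod_minus_le|]. simpl. lra. }
  assert (Hub : forall z, 0 <= Im z -> 1 / 2 * ln m <= u z <= M).
  { intros z Hz. apply (poisson_bounds g M' L HMg Hlip); assumption. }
  exists (fun z => Cexp (H z)), (exp (1 / 2 * ln m)), (exp M). constructor.
  - split; [apply exp_pos|]. apply exp_le. specialize (Hb 0). lra.
  - apply rel_continuous_retract. intros z. apply (continuous_comp (fun w => H (uhp_retract w)) Cexp).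
    + apply (proj1 (rel_continuous_retract H) HcH).
    + apply continuous_Cexp.
  - intros z Hz. destruct (HH z Hz) as [l Hl]. eexists. apply (cderiv_comp Cexp H); [apply cderiv_Cexp|exact Hl].
  - intros z Hz. rewrite Cmod_Cexp. simpl. specialize (Hub z Hz). split; apply exp_le; lra.
  - intros x. unfold H. rewrite Hureal. reflexivity.
  - intros x. unfold H. rewrite Hureal.
    assert (Hx := Hpos x). apply C_eq_Re_Im.
    + rewrite re_mult, re_conj, im_conj. unfold Cexp; simpl.
      transitivity (exp (g x) * exp (g x) * (sin (v (RtoC x)) * sin (v (RtoC x)) + cos (v (RtoC x)) * cos (v (RtoC x)))).
      * assert (E2 := sin2_cos2 (v (RtoC x))). unfold Rsqr in E2. rewrite E2, Rmult_1_r, <- exp_plus.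
        unfold g. replace (1 / 2 * ln (Re (f x)) + 1 / 2 * ln (Re (f x))) with (ln (Re (f x))) by field.
        rewrite exp_ln by lra. reflexivity.
      * ring.
    + rewrite im_mult, re_conj, im_conj. rewrite (proj1 Hx). ring.
  - intros x. assert (HR := proj1 (rel_continuous_retract H) HcH (RtoC x)).
    apply (continuous_ext (fun t => Im (H (uhp_retract (RtoC t))))).
    + intros t. rewrite uhp_retract_id by (simpl; lra). reflexivity.
    + apply (continuous_comp (fun t : R => RtoC t) (fun w => Im (H (uhp_retract w)))); [apply continuous_horizontal|].
      exact (proj2 (proj1 (continuous_C_split _ _) HR)).
Qed.

(** * From an almost periodic argument to a band-limited spectral factor *)

Lemma entire_reverse (Q : C -> C) : entire_fun Q -> entire_fun (fun z => Q (- z)%C).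
Proof.
  intros H z _. destruct (H (- z)%C I) as [l Hl]. eexists.
  apply (cderiv_comp Q (fun z => - z)%C); [exact Hl|]. apply cderiv_opp, cderiv_id.
Qed.

Lemma entire_conj (Q : C -> C) : entire_fun Q -> entire_fun (fun z => Cconj (Q (Cconj z))).
Proof. intros H z _. destruct (H (Cconj z) I) as [l Hl]. exists (Cconj l). apply cderiv_conj, Hl. Qed.

(** The quadrant estimate, applied to the four reflections of [Q]. *)
Lemma type_growth_off_line (Q : C -> C) (K T s : R) :
  entire_fun Q -> 0 < K -> 0 <= T -> 0 <= s ->
  (forall z, Cmod (Q z) <= K * exp (T * Rabs (Im z))) ->
  (forall z, Cmod (Q z) <= K * exp (s * Cmod z)) ->
  forall z, Cmod (Q z) <= K * exp (s * Rabs (Im z)).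
Proof.
  intros HQ HK HT Hs HB HE.
  assert (right_half : forall P, entire_fun P -> (forall z, Cmod (P z) <= K * exp (T * Rabs (Im z))) ->
    (forall z, Cmod (P z) <= K * exp (s * Cmod z)) ->
    forall z, 0 <= Re z -> Cmod (P z) <= K * exp (s * Rabs (Im z))).
  { intros P HP HPB HPE [x y] Hx. simpl in Hx. simpl Im.
    destruct (Rle_dec 0 y) as [Hy|Hy].
    - rewrite Rabs_pos_eq by exact Hy. apply (phragmen_lindelof_type P K T s); try assumption.
      intros a b Ha Hb. eapply Rle_trans; [apply HPB|]. simpl. rewrite Rabs_pos_eq by exact Hb. apply Rle_refl.
    - rewrite Rabs_left by lra.
      replace (Cmod (P (x, y))) with (Cmod (Cconj (P (Cconj (x, - y))))).
      + apply (phragmen_lindelof_type (fun z => Cconj (P (Cconj z))) K T s); try assumption; try lra.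
        * apply entire_conj, HP.
        * intros a b Ha Hb. rewrite Cmod_conj. eapply Rle_trans; [apply HPB|].
          rewrite im_conj, Rabs_Ropp. simpl. rewrite Rabs_pos_eq by exact Hb. apply Rle_refl.
        * intros z. rewrite Cmod_conj. eapply Rle_trans; [apply HPE|]. rewrite Cmod_conj. apply Rle_refl.
      + rewrite Cmod_conj. unfold Cconj; simpl. rewrite Ropp_involutive. reflexivity. }
  intros z. destruct (Rle_dec 0 (Re z)) as [Hx|Hx]; [apply right_half; assumption|].
  replace z with (- - z)%C at 1 by ring. rewrite <- (Rabs_Ropp (Im z)), <- im_opp.
  apply (right_half (fun z => Q (- z)%C)).
  - apply entire_reverse, HQ.
  - intros w. eapply Rle_trans; [apply HB|]. rewrite im_opp, Rabs_Ropp. apply Rle_refl.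
  - intros w. eapply Rle_trans; [apply HE|]. rewrite Cmod_opp. apply Rle_refl.
  - rewrite re_opp. lra.
Qed.

(** Shifting the contour to height [sg * Y], where [G] is small, costs only the two
    vertical sides, which are negligible against the length of the interval. *)
Lemma mean_zero_of_decay (G : C -> C) (K eta sg : R) :
  entire_fun G -> 0 < eta -> (sg = 1 \/ sg = -1) -> 0 < K ->
  (forall x y, 0 <= y -> Cmod (G (x, sg * y)) <= K * exp (- (eta * y))) ->
  filterlim (avg (fun t => G (RtoC t))) (Rbar_locally p_infty) (locally (RtoC 0)).
Proof.
  intros HG Heta Hsg HK HB. apply tends_to_C. intros eps He.
  set (Y := 2 * K / (eps * eta) + 1).
  assert (HY : 0 < Y) by (unfold Y; assert (0 < 2 * K / (eps * eta)); [apply Rdiv_lt_0_compat; [lra|apply Rmult_lt_0_compat; assumption]|lra]).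
  assert (HYe : K * exp (- (eta * Y)) <= eps / 2).
  { assert (H1 := exp_ineq1 (eta * Y) ltac:(assert (0 < eta * Y) by (apply Rmult_lt_0_compat; assumption); lra)).
    rewrite exp_Ropp. apply Rmult_le_reg_r with (exp (eta * Y)); [apply exp_pos|].
    rewrite Rmult_assoc, Rinv_l by (generalize (exp_pos (eta * Y)); lra).
    apply Rle_trans with (eps / 2 * (eta * Y)).
    - unfold Y. replace (eps / 2 * (eta * (2 * K / (eps * eta) + 1))) with (K + eps / 2 * eta) by (field; split; lra).
      assert (0 < eps / 2 * eta) by (apply Rmult_lt_0_compat; lra). lra.
    - apply Rmult_le_compat_l; lra. }
  set (L0 := 2 * K * Y / eps + 1).
  assert (HL0 : 0 < L0) by (unfold L0; assert (0 < 2 * K * Y / eps); [apply Rdiv_lt_0_compat; [|lra]; apply Rmult_lt_0_compat; lra|lra]).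
  exists L0. split; [exact HL0|]. intros L HL.
  replace (avg (fun t => G (RtoC t)) L - RtoC 0)%C with (avg (fun t => G (RtoC t)) L) by ring.
  assert (E := proj2 (holo_rect_null _ G box_domain_plane HG) (- L) L 0 (sg * Y) I I).
  unfold rect_int in E.
  set (top := CI (fun t => G (t, sg * Y)) (- L) L) in *.
  set (rgt := CI (fun t => G (L, t)) 0 (sg * Y)) in *. set (lft := CI (fun t => G (- L, t)) 0 (sg * Y)) in *.
  assert (Ebot : CI (fun t => G (RtoC t)) (- L) L = (top + (Ci * lft + - (Ci * rgt)))%C).
  { change (CI (fun t => G (RtoC t)) (- L) L) with (CI (fun t => G (t, 0)) (- L) L).
    match type of E with ?l = _ => replace (CI (fun t => G (t, 0)) (- L) L)
      with (l + (top + (Ci * lft + - (Ci * rgt))))%C by ring end. rewrite E. ring. }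
  assert (Hside : forall x, Cmod (CI (fun t => G (x, t)) 0 (sg * Y)) <= K * Y).
  { intros x. replace (K * Y) with (K * Rabs (sg * Y - 0)).
    - apply CI_norm_const.
      + intros t _. apply continuous_comp; [apply continuous_vertical|apply entire_continuous, HG].
      + intros t Ht. assert (Hy : exists y, 0 <= y /\ t = sg * y).
        { destruct Hsg as [-> | ->].
          - exists t. rewrite Rmin_left, Rmax_right in Ht by lra. lra.
          - exists (- t). rewrite Rmin_right, Rmax_left in Ht by lra. lra. }
        destruct Hy as [y [Hy ->]]. eapply Rle_trans; [apply HB, Hy|].
        rewrite <- (Rmult_1_r K) at 2. apply Rmult_le_compat_l; [lra|]. rewrite <- exp_0. apply exp_le.
        assert (0 <= eta * y) by (apply Rmult_le_pos; lra). lra.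
    - f_equal. rewrite Rminus_0_r, Rabs_mult, (Rabs_pos_eq Y) by lra.
      destruct Hsg as [-> | ->]; [rewrite Rabs_R1|rewrite Rabs_left by lra]; ring. }
  assert (Htop : Cmod top <= K * exp (- (eta * Y)) * Rabs (L - - L)).
  { apply CI_norm_const.
    - intros t _. apply continuous_comp; [apply continuous_horizontal|apply entire_continuous, HG].
    - intros t _. apply HB. lra. }
  unfold avg. rewrite Ebot, Cmod_mult, Cmod_R, Rabs_pos_eq by (left; apply Rinv_0_lt_compat; lra).
  apply Rmult_le_reg_l with (2 * L); [lra|]. rewrite <- Rmult_assoc, Rinv_r, Rmult_1_l by lra.
  eapply Rle_trans; [apply Cmod_triangle|].
  eapply Rle_trans; [apply Rplus_le_compat_l, Cmod_triangle|].
  rewrite Cmod_opp, !Cmod_mult, Cmod_Ci, !Rmult_1_l.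
  assert (H1 := Hside L). assert (H2 := Hside (- L)). fold rgt in H1. fold lft in H2.
  rewrite Rabs_pos_eq in Htop by lra.
  assert (HLK : 2 * K * Y <= eps * L).
  { apply Rle_trans with (eps * L0); [|apply Rmult_le_compat_l; lra]. unfold L0.
    replace (eps * (2 * K * Y / eps + 1)) with (2 * K * Y + eps) by (field; lra). lra. }
  assert (K * exp (- (eta * Y)) * (L - - L) <= eps / 2 * (2 * L)).
  { replace (L - - L) with (2 * L) by ring. apply Rmult_le_compat_r; lra. }
  lra.
Qed.

Lemma entire_times_exp (S : C -> C) (k : C) : entire_fun S -> entire_fun (fun z => S z * Cexp (k * z))%C.
Proof.
  intros HS z _. destruct (HS z I) as [l Hl]. eexists.
  apply cderiv_mult; [exact Hl|apply cderiv_Cexp_line].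
Qed.

(** For [|w| > a] the function [S (z) exp (- i w z)] decays exponentially in one of
    the two half-planes, so its mean value on the line is zero. *)
Lemma spectrum_of_exponential_growth (S : C -> C) (s : R -> C) (K a : R) :
  entire_fun S -> extends_line s S -> 0 < K ->
  (forall z, Cmod (S z) <= K * exp (a * Rabs (Im z))) ->
  forall w, spectrum s w -> Rabs w <= a.
Proof.
  intros HS Hext HK HB w Hw. apply Rnot_lt_le. intros Hlt. apply Hw.
  assert (Hsc : forall x, continuous s x).
  { intros x. apply (continuous_ext (fun t => S (RtoC t))); [intros; apply Hext|].
    apply (continuous_comp (fun t : R => RtoC t) S); [apply continuous_horizontal|apply entire_continuous, HS]. }
  apply fourier_coeff_unique; [exact Hsc|].
  set (G := fun z => (S z * Cexp (Ci * RtoC (- w) * z))%C).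
  apply (filterlim_ext (avg (fun t => G (RtoC t)))).
  { intros L. apply avg_ext. intros t. unfold G. rewrite Hext, Cexp_chi. reflexivity. }
  assert (EG : forall z, Cmod (G z) <= K * exp (a * Rabs (Im z) + w * Im z)).
  { intros z. unfold G. rewrite Cmod_mult, Cmod_Cexp_line, exp_plus, <- Rmult_assoc.
    replace (- (- w * Im z)) with (w * Im z) by ring.
    apply Rmult_le_compat_r; [left; apply exp_pos|apply HB]. }
  assert (HGe : entire_fun G) by (apply entire_times_exp, HS).
  destruct (Rle_dec 0 w) as [Hw0|Hw0].
  - rewrite Rabs_pos_eq in Hlt by exact Hw0.
    apply (mean_zero_of_decay G K (w - a) (-1)); [exact HGe|lra|right; reflexivity|exact HK|].
    intros x y Hy. eapply Rle_trans; [apply EG|]. apply Rmult_le_compat_l; [lra|]. apply exp_le. simpl.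
    replace (-1 * y) with (- y) by ring. rewrite Rabs_Ropp, Rabs_pos_eq by exact Hy. lra.
  - rewrite Rabs_left in Hlt by lra.
    apply (mean_zero_of_decay G K (- w - a) 1); [exact HGe|lra|left; reflexivity|exact HK|].
    intros x y Hy. eapply Rle_trans; [apply EG|]. apply Rmult_le_compat_l; [lra|]. apply exp_le. simpl.
    rewrite Rmult_1_l, Rabs_pos_eq by exact Hy. lra.
Qed.

Lemma Cexp_lipschitz (z w : C) (b : R) : Re z <= b -> Re w <= b ->
  Cmod (Cexp z - Cexp w) <= exp b * Cmod (z - w).
Proof.
  intros Hz Hw.
  assert (B : Cmod (Cexp (w + RtoC 1 * (z - w)) - Cexp (w + RtoC 0 * (z - w))) <= exp b * Cmod (z - w) * (1 - 0)).
  { apply (path_mean_value (fun t => Cexp (w + RtoC t * (z - w))) (fun t => Cexp (w + RtoC t * (z - w)) * (z - w))%C); [lra| |].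
    - intros t _. apply (rderiv_comp Cexp (fun t => w + RtoC t * (z - w))%C); [apply cderiv_Cexp|apply rderiv_affine].
    - intros t Ht. rewrite Cmod_mult, Cmod_Cexp. apply Rmult_le_compat_r; [apply Cmod_ge_0|].
      apply exp_le. unfold Cminus. rewrite re_plus, re_scal_l, re_plus, re_opp. nra. }
  replace (w + RtoC 1 * (z - w))%C with z in B by ring.
  replace (w + RtoC 0 * (z - w))%C with w in B by ring. lra.
Qed.

Lemma half_log_lipschitz (a b m : R) : 0 < m -> m <= a -> m <= b ->
  Rabs (1 / 2 * ln a - 1 / 2 * ln b) <= / m * Rabs (a - b).
Proof.
  intros Hm Ha Hb.
  assert (main : forall a b, m <= a -> a <= b -> Rabs (ln b - ln a) <= / m * (b - a)).
  { intros p q Hp Hpq. apply (real_mean_value ln (fun t => / t)); [exact Hpq| |].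
    - intros t Ht. apply is_derive_Reals, derivable_pt_lim_ln. lra.
    - intros t Ht. rewrite Rabs_pos_eq by (left; apply Rinv_0_lt_compat; lra). apply Rinv_le_contravar; lra. }
  replace (1 / 2 * ln a - 1 / 2 * ln b) with (1 / 2 * (ln a - ln b)) by ring.
  rewrite Rabs_mult, (Rabs_pos_eq (1 / 2)) by lra.
  assert (H : Rabs (ln a - ln b) <= / m * Rabs (a - b)).
  { destruct (Rle_dec a b).
    - rewrite Rabs_minus_sym, (Rabs_minus_sym a), (Rabs_pos_eq (b - a)) by lra. apply main; lra.
    - rewrite (Rabs_pos_eq (a - b)) by lra. apply main; lra. }
  generalize (Rabs_pos (ln a - ln b)). lra.
Qed.

Lemma entire_of_holo (F : C -> C) : entire_fun F <-> entire F.
Proof. split; intros H z Hz; apply ex_derive_cderiv, H, Hz. Qed.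

(** The glued function [S0] is bounded above and below in the upper half-plane and
    grows like [F] below; the factor [exp (- i tau z / 2)] distributes the type
    [tau] of [F] evenly between the two half-planes. *)
Lemma spectral_factor_of_argument (f : R -> C) (m : R) (v : C -> R) (E : C -> C) (c1 c2 c : R) (theta : R -> C) :
  band_limited f -> 0 < m -> (forall x, Im (f x) = 0 /\ m <= Re (f x)) ->
  outer f (fun x => 1 / 2 * ln (Re (f x))) v E c1 c2 ->
  almost_periodic theta -> (forall x, RtoC (v (RtoC x)) = (RtoC (c * x) + theta x)%C) ->
  exists s, band_limited s /\ spectral_factor f s.
Proof.
  intros Hf Hm Hpos [[Hc1 Hc12] HEc HEh HEb HEr HEs _] Hth Hv.
  destruct (band_limited_entire_extension f Hf) as [F [T [M [HT [HM [HF [Hext HB]]]]]]].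
  assert (HEnz : forall z, 0 <= Im z -> E z <> RtoC 0).
  { intros z Hz. apply Cmod_gt_0. specialize (HEb z Hz). lra. }
  set (S0 := reflect_glue E F).
  assert (HS0 : entire_fun S0).
  { apply reflect_glue_entire; try assumption. intros x. rewrite Hext. apply HEs. }
  assert (Hgrow : forall z, Cmod (F z) <= M * exp (T * Cmod z)).
  { intros z. eapply Rle_trans; [apply HB|]. apply Rmult_le_compat_l; [lra|]. apply exp_le.
    apply Rmult_le_compat_l; [exact HT|apply Im_le_Cmod]. }
  destruct (exp_type_finite F T M m HF HT HM Hm Hgrow) as [tau [Htau Htau0]].
  { rewrite Hext. eapply Rle_trans; [|apply Re_le_Cmod]. eapply Rle_trans; [|apply Rle_abs]. apply Hpos. }
  assert (HFtype : forall e, 0 < e -> exists K, 0 < K /\ forall z, Cmod (F z) <= K * exp ((tau + e) * Rabs (Im z))).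
  { intros e He.
    destruct (exp_type_growth F (tau + e) HF) as [K1 [HK1 HK]]; [rewrite Htau; reflexivity|rewrite Htau; simpl; lra|lra|].
    exists (M + K1). split; [lra|]. apply (type_growth_off_line F (M + K1) T); try assumption; try lra.
    - intros z. eapply Rle_trans; [apply HB|]. apply Rmult_le_compat_r; [left; apply exp_pos|lra].
    - intros z. eapply Rle_trans; [apply HK|]. apply Rmult_le_compat_r; [left; apply exp_pos|lra]. }
  set (a := tau / 2).
  set (S := fun z => (S0 z * Cexp (Ci * RtoC (- a) * z))%C).
  assert (HS : entire_fun S) by (apply entire_times_exp, HS0).
  assert (ES : forall z, Cmod (S z) = Cmod (S0 z) * exp (a * Im z)).
  { intros z. unfold S. rewrite Cmod_mult, Cmod_Cexp_line. do 2 f_equal. ring. }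
  assert (S0up : forall z, 0 <= Im z -> S0 z = E z).
  { intros z Hz. unfold S0, reflect_glue. destruct (Rle_dec 0 (Im z)); [reflexivity|contradiction]. }
  assert (S0low : forall z, Im z < 0 -> Cmod (S0 z) <= / c1 * Cmod (F z)).
  { intros z Hz. unfold S0, reflect_glue. destruct (Rle_dec 0 (Im z)) as [N|_]; [lra|].
    assert (Hz' : 0 <= Im (Cconj z)) by (rewrite im_conj; lra).
    assert (Hb := HEb _ Hz').
    rewrite Cmod_mult, Cmod_inv, Cmod_conj, Rmult_comm.
    - apply Rmult_le_compat_r; [apply Cmod_ge_0|]. apply Rinv_le_contravar; lra.
    - apply Cmod_gt_0. rewrite Cmod_conj. lra. }
  assert (Hic : 0 < / c1) by (apply Rinv_0_lt_compat, Hc1).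
  assert (HSgrow : forall e, 0 < e -> exists K, 0 < K /\ forall z, Cmod (S z) <= K * exp ((a + e) * Rabs (Im z))).
  { intros e He. destruct (HFtype e He) as [K [HK HKz]].
    exists (c2 + / c1 * K). assert (0 < / c1 * K) by (apply Rmult_lt_0_compat; assumption).
    split; [lra|]. intros z. rewrite ES. destruct (Rle_dec 0 (Im z)) as [Hz|Hz].
    - rewrite S0up, Rabs_pos_eq by exact Hz. specialize (HEb z Hz).
      apply Rmult_le_compat; [apply Cmod_ge_0|left; apply exp_pos|lra|].
      apply exp_le. apply Rmult_le_compat_r; lra.
    - rewrite Rabs_left by lra.
      apply Rle_trans with (/ c1 * K * exp ((tau + e) * - Im z) * exp (a * Im z)).
      + apply Rmult_le_compat_r; [left; apply exp_pos|]. eapply Rle_trans; [apply S0low; lra|].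
        rewrite Rmult_assoc. apply Rmult_le_compat_l; [lra|]. eapply Rle_trans; [apply HKz|].
        rewrite Rabs_left by lra. apply Rle_refl.
      + rewrite Rmult_assoc, <- exp_plus. apply Rmult_le_compat; [lra|left; apply exp_pos|lra|].
        apply exp_le. unfold a. lra. }
  assert (HStype : exp_type S = Finite a).
  { apply (exp_type_eq S a c1 HS); [unfold a; lra|exact Hc1| |].
    - intros e He. destruct (HSgrow e He) as [K [HK HKz]]. exists K. split; [exact HK|].
      intros z. eapply Rle_trans; [apply HKz|]. apply Rmult_le_compat_l; [lra|]. apply exp_le.
      apply Rmult_le_compat_l; [unfold a; lra|apply Im_le_Cmod].
    - intros r Hr. exists (0, r). split.
      + eapply Rle_trans; [apply Cmod_le_Re_Im|]. simpl. rewrite Rabs_R0, Rabs_pos_eq by exact Hr. lra.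
      + rewrite ES, S0up by exact Hr. simpl Im. apply Rmult_le_compat_r; [left; apply exp_pos|].
        apply (HEb (0, r)). exact Hr. }
  assert (Hnz : exists z, S z <> RtoC 0).
  { exists (RtoC 0). unfold S. apply Cmult_neq_0; [|apply Cexp_neq_0]. rewrite S0up by (simpl; lra).
    apply HEnz. simpl; lra. }
  set (s := fun x : R => S (RtoC x)).
  set (g := fun x => 1 / 2 * ln (Re (f x))) in *.
  assert (HEr' : forall x, E (RtoC x) = Cexp (g x, v (RtoC x))) by exact HEr.
  exists s. split.
  - assert (Hsap : almost_periodic s).
    { (* [s = exp (g + i theta)] times a character *)
      set (q := fun x => Cexp (g x, Re (theta x))).
      assert (Es : forall x, s x = (q x * chi (c - a) x)%C).
      { intros x. unfold s, S. rewrite S0up by (simpl; lra). rewrite HEr', Cexp_chi. unfold q.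
        assert (Hvx : v (RtoC x) = c * x + Re (theta x)).
        { assert (Hx := Hv x). apply (f_equal Re) in Hx. rewrite re_plus in Hx. exact Hx. }
        rewrite Hvx.
        replace ((g x, c * x + Re (theta x)) : C) with ((g x, Re (theta x)) + Ci * RtoC c * RtoC x)%C.
        - rewrite Cexp_plus, Cexp_chi, <- Cmult_assoc, <- chi_plus_l. reflexivity.
        - unfold Ci, RtoC, Cmult, Cplus; simpl. f_equal; ring. }
      assert (Hgb : forall x, exp (g x) <= c2).
      { intros x. assert (H := HEb (RtoC x) ltac:(simpl; lra)). rewrite HEr', Cmod_Cexp in H. simpl in H. lra. }
      assert (Hgl : forall x, g x <= ln c2).
      { intros x. rewrite <- (ln_exp (g x)). apply ln_le; [apply exp_pos|apply Hgb]. }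
      assert (Hqb : bohrC q).
      { apply (bohr_combine (fun z w => Cmod (z - w)) (fun z w => Cmod (z - w)) _ f theta q (c2 * (/ m + 1))).
        - apply Rmult_le_pos; [lra|]. assert (0 < / m) by (apply Rinv_0_lt_compat, Hm). lra.
        - apply almost_periodic_bohr, Hf.
        - apply almost_periodic_bohr, Hth.
        - intros x y. unfold q. eapply Rle_trans; [apply (Cexp_lipschitz _ _ (ln c2)); apply Hgl|].
          rewrite exp_ln by lra. rewrite Rmult_assoc. apply Rmult_le_compat_l; [lra|].
          eapply Rle_trans; [apply Cmod_minus_le|]. simpl Re. simpl Im.
          assert (G1 := half_log_lipschitz (Re (f x)) (Re (f y)) m Hm (proj2 (Hpos x)) (proj2 (Hpos y))).
          fold (g x) in G1. fold (g y) in G1.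
          assert (G2 := Re_minus_le (f x) (f y)). assert (G3 := Re_minus_le (theta x) (theta y)).
          assert (Him : 0 < / m) by (apply Rinv_0_lt_compat, Hm).
          assert (H4 : / m * Rabs (Re (f x) - Re (f y)) <= / m * Cmod (f x - f y)) by (apply Rmult_le_compat_l; lra).
          assert (0 <= Cmod (f x - f y)) by apply Cmod_ge_0.
          assert (0 <= / m * Cmod (theta x - theta y)) by (apply Rmult_le_pos; [lra|apply Cmod_ge_0]).
          lra. }
      apply bohr_almost_periodic.
      - split.
        + intros x. apply (continuous_comp (fun t : R => RtoC t) S); [apply continuous_horizontal|apply entire_continuous, HS].
        + exists c2. intros x. unfold s. rewrite ES, S0up by (simpl; lra). simpl Im.
          rewrite Rmult_0_r, exp_0, Rmult_1_r. apply (HEb (RtoC x)). simpl; lra.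
      - apply (bohr_combine (fun z w => Cmod (z - w)) (fun z w => Cmod (z - w)) _ q
          (tpoly ((RtoC 1, c - a) :: nil)) s (1 + c2)); [lra|exact Hqb|apply tpoly_bohr|].
        intros x y. rewrite !Es.
        assert (Et : forall t, tpoly ((RtoC 1, c - a) :: nil) t = chi (c - a) t) by (intros t; simpl; ring).
        rewrite !Et.
        replace (q x * chi (c - a) x - q y * chi (c - a) y)%C
          with ((q x - q y) * chi (c - a) x + q y * (chi (c - a) x - chi (c - a) y))%C by ring.
        eapply Rle_trans; [apply Cmod_triangle|]. rewrite !Cmod_mult, Cmod_chi.
        assert (Hq : Cmod (q y) <= c2) by (unfold q; rewrite Cmod_Cexp; apply Hgb).
        assert (0 <= Cmod (q x - q y)) by apply Cmod_ge_0.
        assert (0 <= Cmod (chi (c - a) x - chi (c - a) y)) by apply Cmod_ge_0.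
        nra. }
    split; [exact Hsap|].
    destruct (HSgrow 1 ltac:(lra)) as [K [HK HKz]].
    apply (bandwidth_finite s (a + 1)).
    apply (spectrum_of_exponential_growth S s K (a + 1)); try assumption. intros x; reflexivity.
  - split.
    + intros x. unfold s. rewrite ES, S0up by (simpl; lra). simpl Im. rewrite Rmult_0_r, exp_0, Rmult_1_r.
      rewrite HEs. rewrite <- Cmod2_conj. reflexivity.
    + exists F, S. split; [exact Hext|]. split; [|split; [intros x; reflexivity|split; [|split]]].
      * split; [apply entire_of_holo, HF|]. split; [|rewrite Htau; reflexivity].
        exists (RtoC 0). rewrite Hext. intros E0. assert (Hx := proj2 (Hpos 0)). rewrite E0 in Hx. simpl in Hx. lra.
      * split; [apply entire_of_holo, HS|]. split; [exact Hnz|rewrite HStype; reflexivity].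
      * rewrite HStype, Htau. reflexivity.
      * intros z Hz. unfold S. apply Cmult_neq_0; [|apply Cexp_neq_0]. unfold open_uhp in Hz.
        rewrite S0up by lra. apply HEnz. lra.
Qed.

(** * From a spectral factor to an almost periodic argument *)

Definition circle_moment (W : C -> C) (r : R) (c : R -> C) : C :=
  CI (fun t => W (RtoC r * cis t)%C * c t)%C 0 (2 * PI).

Lemma circle_0 (r t : R) : circle (RtoC 0) r t = (RtoC r * cis t)%C.
Proof. unfold circle. ring. Qed.

Lemma cis_mult_opp (t : R) : (cis t * cis (- t))%C = RtoC 1.
Proof.
  rewrite <- cis_plus. replace (t + - t) with 0 by ring. unfold cis. rewrite cos_0, sin_0. reflexivity.
Qed.

Lemma cis_opp_inv (t : R) : cis (- t) = (/ cis t)%C.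
Proof.
  replace (cis (- t)) with (/ cis t * (cis t * cis (- t)))%C by (field; apply cis_neq_0).
  rewrite cis_mult_opp. ring.
Qed.

Lemma continuous_circle_moment (W : C -> C) (r : R) (c : R -> C) (t : R) :
  entire_fun W -> continuous c t -> continuous (fun t => W (RtoC r * cis t)%C * c t)%C t.
Proof.
  intros HW Hc. apply continuous_Cmult; [|exact Hc].
  apply (continuous_comp (fun t => RtoC r * cis t)%C W); [|apply entire_continuous, HW].
  apply continuous_Cmult; [apply continuous_const|apply continuous_cis].
Qed.

Lemma continuous_cis_opp (k t : R) : continuous (fun t => cis (k * t)) t.
Proof. apply (continuous_ext (chi k)); [intros; reflexivity|apply continuous_chi]. Qed.

(** The first Taylor coefficients of an entire function as Fourier coefficients of
    its values on a circle; those of index [-1] and [-2] vanish. *)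
Lemma circle_moments (W W' : C -> C) (r : R) :
  (forall z, cderiv W z (W' z)) -> 0 < r ->
  circle_moment W r cis = RtoC 0 /\
  circle_moment W r (fun t => cis (2 * t)) = RtoC 0 /\
  circle_moment W r (fun t => cis (- t)) = (RtoC (2 * PI * r) * W' (RtoC 0))%C /\
  exists l, cderiv W' (RtoC 0) l /\
    circle_moment W r (fun t => cis (-2 * t)) = (RtoC (PI * r ^ 2) * l)%C.
Proof.
  intros HW' Hr.
  assert (HW : entire_fun W) by (intros z _; exists (W' z); apply HW').
  assert (HPI := PI_RGT_0).
  assert (Hr0 : RtoC r <> RtoC 0) by (intros E; apply RtoC_inj in E; lra).
  assert (HCi : Ci <> RtoC 0) by apply Ci_nz.
  assert (Hc2 : forall t, cis (2 * t) = (cis t * cis t)%C).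
  { intros t. rewrite <- cis_plus. f_equal. ring. }
  assert (H0 : Cmod (RtoC 0 - RtoC 0) < r).
  { replace (RtoC 0 - RtoC 0)%C with (RtoC 0) by ring. rewrite Cmod_0. exact Hr. }
  assert (Hdisc : disc_in (fun _ => True) (RtoC 0) r) by (intros w _; exact I).
  assert (scal_int : forall (k : C) (c : R -> C) (f : R -> C), (forall t, continuous c t) ->
    (forall t, f t = (k * (W (RtoC r * cis t) * c t))%C) -> CI f 0 (2 * PI) = (k * circle_moment W r c)%C).
  { intros k c f Hc Hf. unfold circle_moment. rewrite <- CI_scal.
    - apply CI_ext. intros t _. apply Hf.
    - apply cont_all_between. intros t. apply continuous_circle_moment; [exact HW|apply Hc]. }
  assert (cancel : forall k x : C, k <> RtoC 0 -> (k * x)%C = RtoC 0 -> x = RtoC 0).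
  { intros k x Hk E. replace x with (/ k * (k * x))%C by (field; exact Hk). rewrite E. ring. }
  split; [|split; [|split]].
  - assert (HzW : entire_fun (fun z => z * W z)%C).
    { intros z _. eexists. apply (cderiv_mult (fun z => z) W); [apply cderiv_id|apply HW']. }
    assert (E := cauchy_formula _ _ (RtoC 0) (RtoC 0) r box_domain_plane HzW Hr Hdisc H0).
    unfold circle_int in E. rewrite (scal_int (RtoC r * Ci)%C cis) in E.
    + apply cancel with (RtoC r * Ci)%C; [apply Cmult_neq_0; assumption|]. rewrite E. ring.
    + intros t. apply continuous_cis.
    + intros t. rewrite circle_0. field. split; [apply cis_neq_0|exact Hr0].
  - assert (HzW : entire_fun (fun z => z * (z * W z))%C).
    { intros z _. eexists. apply (cderiv_mult (fun z => z) (fun z => z * W z)%C); [apply cderiv_id|].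
      apply (cderiv_mult (fun z => z) W); [apply cderiv_id|apply HW']. }
    assert (E := cauchy_formula _ _ (RtoC 0) (RtoC 0) r box_domain_plane HzW Hr Hdisc H0).
    unfold circle_int in E. rewrite (scal_int (RtoC r * RtoC r * Ci)%C (fun t => cis (2 * t))) in E.
    + apply cancel with (RtoC r * RtoC r * Ci)%C; [repeat apply Cmult_neq_0; assumption|]. rewrite E. ring.
    + intros t. apply continuous_cis_opp.
    + intros t. rewrite circle_0, Hc2. field. split; [apply cis_neq_0|exact Hr0].
  - destruct (cauchy_formula_derivatives (fun _ => True) W W' (RtoC 0) r box_domain_plane
      (fun z _ => HW' z) Hr Hdisc) as [E _].
    specialize (E _ H0). unfold cauchy_transform in E.
    rewrite (scal_int (Ci / RtoC r)%C (fun t => cis (- t))) in E.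
    + replace (circle_moment W r (fun t => cis (- t)))
        with (RtoC r / Ci * (Ci / RtoC r * circle_moment W r (fun t => cis (- t))))%C by (field; repeat split; assumption).
      rewrite <- E. rewrite !RtoC_mult. field. exact HCi.
    + intros t. apply (continuous_ext (fun t => cis (-1 * t))); [intros s; f_equal; ring|apply continuous_cis_opp].
    + intros t. unfold circle_density. rewrite circle_0, cis_opp_inv.
      replace (RtoC r * cis t - RtoC 0)%C with (RtoC r * cis t)%C by ring.
      field. repeat split; first [exact Hr0|apply cis_neq_0].
  - destruct (cauchy_formula_derivatives (fun _ => True) W W' (RtoC 0) r box_domain_plane
      (fun z _ => HW' z) Hr Hdisc) as [_ [l [Hl E]]].
    exists l. split; [exact Hl|]. unfold cauchy_transform in E.
    rewrite (scal_int (Ci / (RtoC r * RtoC r))%C (fun t => cis (-2 * t))) in E.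
    + set (J := circle_moment W r (fun t => cis (-2 * t))) in *.
      replace J with (RtoC r * RtoC r / (2 * Ci) * (2 * (Ci / (RtoC r * RtoC r) * J)))%C.
      * rewrite <- E. replace (PI * r ^ 2) with (PI * (r * r)) by ring. rewrite !RtoC_mult. field.
        exact HCi.
      * field. repeat split; assumption.
    + intros t. apply continuous_cis_opp.
    + intros t. unfold circle_density. rewrite circle_0.
      replace (cis (-2 * t)) with (/ (cis t * cis t))%C.
      * replace (RtoC r * cis t - RtoC 0)%C with (RtoC r * cis t)%C by ring.
        field. repeat split; first [exact Hr0|apply cis_neq_0].
      * rewrite <- Hc2, <- cis_opp_inv. f_equal. ring.
Qed.

Lemma CI_conj (f : R -> C) (a b : R) : cont_between f a b ->
  CI (fun t => Cconj (f t)) a b = Cconj (CI f a b).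
Proof.
  intros Hf. apply C_eq_Re_Im; [reflexivity|]. rewrite im_conj.
  change (RInt (fun t => - Im (f t)) a b = - RInt (fun t => Im (f t)) a b).
  apply (RInt_opp (V := R_CompleteNormedModule)), ex_RInt_Im, Hf.
Qed.

(** Only the real part of [W] matters: the conjugate of [W] contributes the
    conjugate of a moment with negative index, which is zero. *)
Lemma Re_circle_moment (W : C -> C) (r k : R) : entire_fun W ->
  circle_moment W r (fun t => cis (k * t)) = RtoC 0 ->
  RInt (fun t => Re (W (RtoC r * cis t)%C) * sin (k * t)) 0 (2 * PI) =
  - (1 / 2) * Im (circle_moment W r (fun t => cis (- k * t))).
Proof.
  intros HW H0.
  set (w := fun t => W (RtoC r * cis t)%C).
  assert (Hw : forall c t, continuous c t -> continuous (fun t => w t * c t)%C t)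
    by (intros; apply continuous_circle_moment; assumption).
  assert (Hck : forall j, cont_between (fun t => w t * cis (j * t))%C 0 (2 * PI)).
  { intros j. apply cont_all_between. intros t. apply Hw, continuous_cis_opp. }
  assert (E1 : CI (fun t => Cconj (w t * cis (k * t))%C) 0 (2 * PI) = RtoC 0).
  { rewrite CI_conj by apply Hck. change (CI (fun t => w t * cis (k * t))%C 0 (2 * PI)) with (circle_moment W r (fun t => cis (k * t))).
    rewrite H0. unfold Cconj, RtoC; simpl. f_equal. ring. }
  assert (E2 : Im (CI (fun t => w t * cis (- k * t) + Cconj (w t * cis (k * t)))%C 0 (2 * PI))
     = Im (circle_moment W r (fun t => cis (- k * t)))).
  { rewrite CI_plus.
    - rewrite E1, Cplus_0_r. reflexivity.
    - apply Hck.
    - intros t Ht. apply continuous_Cconj, Hck, Ht. }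
  rewrite <- E2.
  assert (E3 : Im (CI (fun t => w t * cis (- k * t) + Cconj (w t * cis (k * t)))%C 0 (2 * PI)) =
    RInt (fun t => -2 * (Re (w t) * sin (k * t))) 0 (2 * PI)).
  { change (RInt (fun t => Im (w t * cis (- k * t) + Cconj (w t * cis (k * t)))%C) 0 (2 * PI) =
      RInt (fun t => -2 * (Re (w t) * sin (k * t))) 0 (2 * PI)).
    apply RInt_ext_R. intros t. rewrite im_plus, im_conj, !im_mult. unfold cis; simpl.
    replace (- k * t) with (- (k * t)) by ring. rewrite cos_neg, sin_neg. ring. }
  rewrite E3.
  assert (Hex : ex_RInt (fun t => Re (w t) * sin (k * t)) 0 (2 * PI)).
  { apply @ex_RInt_continuous. intros t _.
    apply (continuous_mult (fun t => Re (w t)) (fun t => sin (k * t))).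
    - assert (Hc := Hw (fun _ => RtoC 1) t (continuous_const _ _)).
      apply continuous_C_split in Hc. destruct Hc as [Hc _].
      apply (continuous_ext (fun t => Re (w t * 1))); [intros; rewrite Cmult_1_r; reflexivity|exact Hc].
    - exact (proj2 (proj1 (continuous_C_split _ _) (continuous_cis_opp k t))). }
  assert (E4 : RInt (fun t => -2 * (Re (w t) * sin (k * t))) 0 (2 * PI) = -2 * RInt (fun t => Re (w t) * sin (k * t)) 0 (2 * PI)).
  { apply (RInt_scal (V := R_CompleteNormedModule)). exact Hex. }
  rewrite E4. unfold w. lra.
Qed.

(** A one-sided bound suffices because [Re W] is odd under conjugation.  With
    [a = Re W sin t <= B] on the circle, [|Re W sin 2t| <= 2|a| <= 2(2B - a)]:
    the integral of the right side is [O(r)] and that of the left side is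
    [pi r^2 |Im W''(0)| / 2]. *)
Lemma second_derivative_vanishes (W W' : C -> C) (l : C) (s b : R) :
  (forall z, cderiv W z (W' z)) -> cderiv W' (RtoC 0) l -> 0 <= s -> 0 <= b ->
  (forall z, 0 <= Im z -> Re (W z) <= s * Cmod z + b) ->
  (forall z, Im z <= 0 -> - (s * Cmod z + b) <= Re (W z)) ->
  Im l = 0.
Proof.
  intros HW' Hl Hs Hb Hup Hlow. assert (HPI := PI_RGT_0).
  assert (HW : entire_fun W) by (intros z _; exists (W' z); apply HW').
  assert (key : forall r, 1 <= r -> r * Rabs (Im l) <= 16 * (s + b) + 4 * Rabs (Im (W' (RtoC 0)))).
  { intros r Hr1. assert (Hr : 0 < r) by lra.
    destruct (circle_moments W W' r HW' Hr) as [M1 [M2 [P1 [l' [Hl' P2]]]]].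
    assert (El : l' = l) by (apply (cderiv_unique W' (RtoC 0)); assumption). subst l'.
    set (w := fun t => Re (W (RtoC r * cis t)%C)).
    set (Bd := s * r + b). assert (HBd : 0 <= Bd) by (unfold Bd; nra).
    assert (I1 : RInt (fun t => w t * sin t) 0 (2 * PI) = - (PI * r * Im (W' (RtoC 0)))).
    { assert (E := Re_circle_moment W r 1 HW).
      assert (Ec : circle_moment W r (fun t => cis (1 * t)) = RtoC 0).
      { rewrite <- M1. unfold circle_moment. apply CI_ext. intros t _. rewrite Rmult_1_l. reflexivity. }
      specialize (E Ec).
      assert (Ec2 : circle_moment W r (fun t => cis (-1 * t)) = (RtoC (2 * PI * r) * W' (RtoC 0))%C).
      { rewrite <- P1. unfold circle_moment. apply CI_ext. intros t _. do 2 f_equal. ring. }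
      replace (- (1)) with (-1) in E by ring. rewrite Ec2, im_scal_l in E.
      transitivity (- (1 / 2) * (2 * PI * r * Im (W' (RtoC 0)))); [|lra].
      rewrite <- E. apply RInt_ext_R. intros t. rewrite Rmult_1_l. reflexivity. }
    assert (I2 : RInt (fun t => w t * sin (2 * t)) 0 (2 * PI) = - (1 / 2) * (PI * r ^ 2 * Im l)).
    { assert (E := Re_circle_moment W r 2 HW M2).
      replace (- (2)) with (-2) in E by ring. rewrite P2, im_scal_l in E. exact E. }
    assert (Hwc : forall t, continuous w t).
    { intros t. assert (Hc := continuous_circle_moment W r (fun _ => RtoC 1) t HW (continuous_const _ _)).
      apply continuous_C_split in Hc. destruct Hc as [Hc _].
      apply (continuous_ext (fun t => Re (W (RtoC r * cis t)%C * 1))); [intros; rewrite Cmult_1_r; reflexivity|exact Hc]. }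
    assert (Hsin : forall k t, continuous (fun t => sin (k * t)) t)
      by (intros k t; exact (proj2 (proj1 (continuous_C_split _ _) (continuous_cis_opp k t)))).
    assert (Hc1 : forall t, continuous (fun t => w t * sin t) t).
    { intros t. apply (continuous_mult w sin); [apply Hwc|apply continuous_sin]. }
    assert (Hc2 : forall t, continuous (fun t => w t * sin (2 * t)) t).
    { intros t. apply (continuous_mult w (fun t => sin (2 * t))); [apply Hwc|apply Hsin]. }
    assert (Hwb : forall t, w t * sin t <= Bd).
    { intros t. assert (Em : Cmod (RtoC r * cis t) = r).
      { rewrite Cmod_mult, Cmod_cis, Cmod_R, Rabs_pos_eq by lra. ring. }
      assert (Ei : Im (RtoC r * cis t) = r * sin t) by (rewrite im_scal_l; reflexivity).
      assert (Hsb := SIN_bound t).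
      destruct (Rle_dec 0 (sin t)) as [Hp|Hp].
      - assert (H := Hup (RtoC r * cis t)%C). rewrite Em, Ei in H. fold Bd in H.
        specialize (H ltac:(apply Rmult_le_pos; lra)). fold (w t) in H.
        apply Rle_trans with (Bd * sin t); [apply Rmult_le_compat_r; assumption|nra].
      - assert (H := Hlow (RtoC r * cis t)%C). rewrite Em, Ei in H. fold Bd in H.
        specialize (H ltac:(nra)). fold (w t) in H. nra. }
    set (h := fun t => 4 * Bd + -2 * (w t * sin t)).
    assert (Hhc : forall t, continuous h t).
    { intros t. apply (continuous_plus (V := R_NormedModule) (fun _ => 4 * Bd) (fun t => -2 * (w t * sin t))); [apply continuous_const|].
      apply (continuous_scal_r (V := R_NormedModule) (-2) (fun t => w t * sin t)), Hc1. }
    assert (Ih : RInt h 0 (2 * PI) = 4 * Bd * (2 * PI) + 2 * (PI * r * Im (W' (RtoC 0)))).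
    { apply is_RInt_unique.
      replace (4 * Bd * (2 * PI) + 2 * (PI * r * Im (W' (RtoC 0))))
        with ((2 * PI - 0) * (4 * Bd) + -2 * RInt (fun t => w t * sin t) 0 (2 * PI)) by (rewrite I1; ring).
      apply (is_RInt_plus (V := R_NormedModule)); [apply (is_RInt_const (V := R_NormedModule))|].
      apply (is_RInt_scal (V := R_NormedModule)).
      apply (RInt_correct (V := R_CompleteNormedModule)). apply @ex_RInt_continuous. intros; apply Hc1. }
    assert (Hle : Rabs (RInt (fun t => w t * sin (2 * t)) 0 (2 * PI)) <= RInt h 0 (2 * PI)).
    { eapply Rle_trans; [apply abs_RInt_le; [lra|apply @ex_RInt_continuous; intros; apply Hc2]|].
      apply RInt_le; [lra| |apply @ex_RInt_continuous; intros; apply Hhc|].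
      - apply @ex_RInt_continuous. intros t _. apply (continuous_comp (fun t => w t * sin (2 * t)) Rabs); [apply Hc2|apply continuous_Rabs].
      - intros t _. rewrite sin_2a. replace (w t * (2 * sin t * cos t)) with (2 * (w t * sin t) * cos t) by ring.
        rewrite Rabs_mult, (Rabs_mult 2), (Rabs_pos_eq 2) by lra.
        assert (Hcb : Rabs (cos t) <= 1) by (apply Rabs_le, COS_bound).
        specialize (Hwb t). unfold h. set (a := w t * sin t) in *.
        assert (Ha : Rabs a <= 2 * Bd - a) by (apply Rabs_le; lra).
        assert (0 <= Rabs a) by apply Rabs_pos. assert (0 <= Rabs (cos t)) by apply Rabs_pos. nra. }
    rewrite I2, Ih in Hle.
    assert (Ea : Rabs (- (1 / 2) * (PI * r ^ 2 * Im l)) = PI * r / 2 * (r * Rabs (Im l))).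
    { replace (- (1 / 2) * (PI * r ^ 2 * Im l)) with (- (PI * r / 2 * (r * Im l))) by field.
      rewrite Rabs_Ropp, !Rabs_mult, (Rabs_pos_eq r) by lra.
      rewrite (Rabs_pos_eq (PI * r / 2)); [reflexivity|].
      assert (0 < PI * r) by (apply Rmult_lt_0_compat; lra). lra. }
    rewrite Ea in Hle.
    assert (HBr : Bd <= r * (s + b)) by (unfold Bd; nra).
    assert (Hi := Rle_abs (Im (W' (RtoC 0)))).
    apply Rmult_le_reg_l with (PI * r / 2).
    - assert (0 < PI * r) by (apply Rmult_lt_0_compat; lra). lra.
    - eapply Rle_trans; [exact Hle|].
      replace (PI * r / 2 * (16 * (s + b) + 4 * Rabs (Im (W' (RtoC 0)))))
        with (8 * PI * (r * (s + b)) + 2 * (PI * r * Rabs (Im (W' (RtoC 0))))) by field.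
      assert (4 * Bd * (2 * PI) <= 8 * PI * (r * (s + b))) by nra.
      assert (PI * r * Im (W' (RtoC 0)) <= PI * r * Rabs (Im (W' (RtoC 0)))).
      { apply Rmult_le_compat_l; [|exact Hi]. apply Rmult_le_pos; lra. }
      lra. }
  destruct (Req_dec (Im l) 0) as [E|N]; [exact E|exfalso].
  assert (Hp : 0 < Rabs (Im l)) by (apply Rabs_pos_lt, N).
  set (Q := 16 * (s + b) + 4 * Rabs (Im (W' (RtoC 0)))) in *.
  assert (HQ : 0 <= Q) by (unfold Q; generalize (Rabs_pos (Im (W' (RtoC 0)))); lra).
  specialize (key (Q / Rabs (Im l) + 1)).
  assert (H1 : 0 <= Q / Rabs (Im l)) by (apply Rmult_le_pos; [exact HQ|left; apply Rinv_0_lt_compat, Hp]).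
  specialize (key ltac:(lra)). rewrite Rmult_plus_distr_r in key.
  replace (Q / Rabs (Im l) * Rabs (Im l)) with Q in key by (field; lra). lra.
Qed.

(** A harmonic function in the half-plane that vanishes on the line and grows at
    most linearly is a multiple of [y]; here through the entire function [W] of
    which it is the real part. *)
Lemma linear_on_real_line (W : C -> C) (s b : R) :
  entire_fun W -> 0 <= s -> 0 <= b -> (forall x : R, Re (W (RtoC x)) = 0) ->
  (forall z, 0 <= Im z -> Re (W z) <= s * Cmod z + b) ->
  (forall z, Im z <= 0 -> - (s * Cmod z + b) <= Re (W z)) ->
  exists beta, forall x : R, Im (W (RtoC x)) = Im (W (RtoC 0)) + beta * x.
Proof.
  intros HW Hs Hb Hreal Hup Hlow.
  destruct (holo_choose _ W HW) as [W' HW'0]. assert (HW' : forall z, cderiv W z (W' z)) by (intros; apply HW'0, I).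
  destruct (holo_choose _ W' (holo_derivative _ W W' box_domain_plane HW'0)) as [W2 HW20].
  assert (HW2 : forall z, cderiv W' z (W2 z)) by (intros; apply HW20, I).
  assert (Him : forall x, Im (W2 (RtoC x)) = 0).
  { intros x0.
    set (V := fun z => W (z + RtoC x0)%C). set (V' := fun z => W' (z + RtoC x0)%C).
    assert (shift : forall z, cderiv (fun z => z + RtoC x0)%C z (1 + 0)%C).
    { intros z. apply cderiv_plus; [apply cderiv_id|apply cderiv_const]. }
    assert (E0 : W2 (RtoC x0) = (W2 (RtoC 0 + RtoC x0) * (1 + 0))%C).
    { replace (RtoC 0 + RtoC x0)%C with (RtoC x0) by ring. ring. }
    rewrite E0.
    assert (norm_shift : forall z, s * Cmod (z + RtoC x0) + b <= s * Cmod z + (s * Rabs x0 + b)).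
    { intros z. assert (H := Cmod_triangle z (RtoC x0)). rewrite Cmod_R in H.
      assert (s * Cmod (z + RtoC x0) <= s * (Cmod z + Rabs x0)) by (apply Rmult_le_compat_l; assumption). lra. }
    apply (second_derivative_vanishes V (fun z => V' z * (1 + 0))%C _ s (s * Rabs x0 + b)).
    - intros z. apply (cderiv_comp W (fun z => z + RtoC x0)%C); [apply HW'|apply shift].
    - apply (cderiv_ext V'); [intros; ring|].
      apply (cderiv_comp W' (fun z => z + RtoC x0)%C); [apply HW2|apply shift].
    - exact Hs.
    - assert (0 <= s * Rabs x0) by (apply Rmult_le_pos; [exact Hs|apply Rabs_pos]). lra.
    - intros z Hz. eapply Rle_trans; [apply Hup|apply norm_shift]. rewrite im_plus. simpl. lra.
    - intros z Hz. specialize (norm_shift z).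
      assert (H := Hlow (z + RtoC x0)%C ltac:(rewrite im_plus; simpl; lra)). unfold V. lra. }
  assert (line : forall G G' : C -> C, (forall z, cderiv G z (G' z)) -> forall x,
    is_derive (fun t => Im (G (RtoC t))) x (Im (G' (RtoC x)))).
  { intros G G' HG x. assert (K := rderiv_comp G (fun t => (t, 0)) x _ _ (HG (RtoC x)) (rderiv_horizontal 0 x)).
    apply rderiv_split in K. destruct K as [_ K]. rewrite Cmult_1_r in K. exact K. }
  set (p1 := fun x => Im (W' (RtoC x))).
  assert (Hconst : forall x, p1 x = p1 0).
  { intros x. assert (H0' : forall t, Rabs (Im (W2 (RtoC t))) <= 0) by (intros t; rewrite Him, Rabs_R0; lra).
    assert (H := real_lipschitz p1 (fun x => Im (W2 (RtoC x))) 0 (line W' W2 HW2) H0' x 0).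
    rewrite Rmult_0_l in H. generalize (Rabs_pos (p1 x - p1 0)). intros H0.
    assert (E : Rabs (p1 x - p1 0) = 0) by lra. apply Rabs_eq_0 in E. lra. }
  exists (p1 0). intros x.
  assert (H := real_lipschitz (fun x => Im (W (RtoC x)) - p1 0 * x) (fun x => p1 x - p1 0) 0).
  assert (H1 : Rabs ((Im (W (RtoC x)) - p1 0 * x) - (Im (W (RtoC 0)) - p1 0 * 0)) <= 0 * Rabs (x - 0)).
  { apply H.
    - intros t. apply (is_derive_minus (V := R_NormedModule) (fun x => Im (W (RtoC x))) (fun x => p1 0 * x)); [apply (line W W' HW')|].
      auto_derive; [trivial|ring].
    - intros t. rewrite Hconst. replace (p1 0 - p1 0) with 0 by ring. rewrite Rabs_R0. lra. }
  rewrite Rmult_0_l in H1.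
  generalize (Rabs_pos ((Im (W (RtoC x)) - p1 0 * x) - (Im (W (RtoC 0)) - p1 0 * 0))). intros H0.
  assert (E : Rabs ((Im (W (RtoC x)) - p1 0 * x) - (Im (W (RtoC 0)) - p1 0 * 0)) = 0) by lra.
  apply Rabs_eq_0 in E. lra.
Qed.

(** A zero-free entire function is an exponential: integrate [Q' / Q]. *)
Lemma entire_logarithm (Q : C -> C) : entire_fun Q -> (forall z, Q z <> RtoC 0) ->
  exists W, entire_fun W /\ W (RtoC 0) = RtoC 0 /\ forall z, Q z = (Q (RtoC 0) * Cexp (W z))%C.
Proof.
  intros HQ Hnz.
  destruct (holo_choose _ Q HQ) as [Q' HQ'0]. assert (HQ' : forall z, cderiv Q z (Q' z)) by (intros; apply HQ'0, I).
  assert (HQ'h := holo_derivative _ Q Q' box_domain_plane HQ'0).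
  set (G := fun z => (Q' z * / Q z)%C).
  assert (HG : entire_fun G).
  { intros z _. destruct (HQ'h z I) as [l Hl]. eexists. apply cderiv_mult; [exact Hl|].
    apply cderiv_inv; [apply Hnz|apply HQ']. }
  destruct (rect_null_primitive _ G box_domain_plane (holo_rect_null _ G box_domain_plane HG)) as [Phi HPhi].
  set (W := fun z => (Phi z - Phi (RtoC 0))%C).
  assert (HW : forall z, cderiv W z (G z - 0)%C).
  { intros z. apply cderiv_minus; [apply HPhi, I|apply cderiv_const]. }
  assert (HW0 : W (RtoC 0) = RtoC 0) by (unfold W; ring).
  exists W. split; [intros z _; eexists; apply HW|]. split; [exact HW0|].
  set (P := fun z => (Q z * Cexp (- W z))%C).
  assert (HP : forall z, cderiv P z (RtoC 0)).
  { intros z. replace (RtoC 0) with (Q' z * Cexp (- W z) + Q z * (Cexp (- W z) * - (G z - 0)))%C.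
    - apply (cderiv_mult Q (fun z => Cexp (- W z))); [apply HQ'|].
      apply (cderiv_comp Cexp (fun z => - W z)%C z (Cexp (- W z)) (- (G z - 0))%C); [apply cderiv_Cexp|].
      apply cderiv_opp, HW.
    - unfold G. field. apply Hnz. }
  assert (Hconst : forall z, P z = Q (RtoC 0)).
  { intros z. assert (B : Cmod (P (RtoC 0 + RtoC 1 * z)%C - P (RtoC 0 + RtoC 0 * z)%C) <= 0 * (1 - 0)).
    { apply (path_mean_value (fun t => P (RtoC 0 + RtoC t * z)%C) (fun _ => RtoC 0 * z)%C); [lra| |].
      - intros t _. apply (rderiv_comp P (fun t => RtoC 0 + RtoC t * z)%C); [apply HP|apply rderiv_affine].
      - intros t _. rewrite Cmod_mult, Cmod_0. lra. }
    replace (RtoC 0 + RtoC 1 * z)%C with z in B by ring.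
    replace (RtoC 0 + RtoC 0 * z)%C with (RtoC 0) in B by ring.
    assert (E : P z = P (RtoC 0)).
    { apply Ceq_minus, Cmod_eq_0, Rle_antisym; [lra|apply Cmod_ge_0]. }
    rewrite E. unfold P. rewrite HW0. replace (- RtoC 0)%C with (RtoC 0) by ring. rewrite Cexp_0. ring. }
  intros z. rewrite <- (Hconst z). unfold P. rewrite Cexp_opp. field. apply Cexp_neq_0.
Qed.

(** Passing to [s / |s|] preserves Bohr's criterion when [s] is bounded away from
    zero. *)
Lemma unit_direction_lipschitz (z w : C) (k : R) : 0 < k -> k <= Cmod z -> k <= Cmod w ->
  Cmod (z * / RtoC (Cmod z) - w * / RtoC (Cmod w)) <= 2 / k * Cmod (z - w).
Proof.
  intros Hk Hz Hw.
  assert (Hz0 : RtoC (Cmod z) <> RtoC 0) by (intros E; apply RtoC_inj in E; lra).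
  assert (Hw0 : RtoC (Cmod w) <> RtoC 0) by (intros E; apply RtoC_inj in E; lra).
  replace (z * / RtoC (Cmod z) - w * / RtoC (Cmod w))%C
    with (/ RtoC (Cmod z) * ((z - w) + w * / RtoC (Cmod w) * RtoC (Cmod w - Cmod z)))%C
    by (rewrite RtoC_minus; field; split; assumption).
  rewrite Cmod_mult, Cmod_inv, Cmod_R, Rabs_pos_eq by first [exact Hz0|apply Cmod_ge_0].
  assert (B : Cmod (z - w + w * / RtoC (Cmod w) * RtoC (Cmod w - Cmod z)) <= 2 * Cmod (z - w)).
  { eapply Rle_trans; [apply Cmod_triangle|].
    rewrite !Cmod_mult, Cmod_inv, !Cmod_R, (Rabs_pos_eq (Cmod w)), Rinv_r, Rmult_1_l
      by first [exact Hw0|apply Cmod_ge_0|lra].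
    assert (Rabs (Cmod w - Cmod z) <= Cmod (z - w)).
    { apply Rabs_le. generalize (Cmod_reverse_triangle z w) (Cmod_reverse_triangle w z).
      rewrite (Cmod_minus_sym w z). lra. }
    lra. }
  replace (2 / k * Cmod (z - w)) with (/ k * (2 * Cmod (z - w))) by (field; lra).
  apply Rmult_le_compat; [left; apply Rinv_0_lt_compat; lra|apply Cmod_ge_0|apply Rinv_le_contravar; lra|exact B].
Qed.

(** The quotient [S / E] has modulus one on the line, hence reflects to a zero-free
    entire function; its logarithm is linear there, so [v] is the argument of the
    spectral factor up to a linear function, and Bohr's theorem applies. *)
Lemma argument_of_spectral_factor (f : R -> C) (g : R -> R) (v : C -> R) (E : C -> C) (c1 c2 : R) (s : R -> C) :
  outer f g v E c1 c2 -> almost_periodic s -> spectral_factor f s ->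
  exists (c : R) (theta : R -> C), almost_periodic theta /\
    forall x : R, RtoC (v (RtoC x)) = Cplus (RtoC (c * x)) (theta x).
Proof.
  intros [[Hc1 Hc12] HEc HEh HEb HEr HEs Hvc] Hs [Hsq [F [S [_ [_ [HextS [HStype [_ HSnz]]]]]]]].
  destruct HStype as [HSe [_ HSfin]]. apply entire_of_holo in HSe.
  assert (HEnz : forall z, 0 <= Im z -> E z <> RtoC 0).
  { intros z Hz. apply Cmod_gt_0. specialize (HEb z Hz). lra. }
  assert (Hmod : forall x, Cmod (s x) = Cmod (E (RtoC x))).
  { intros x. assert (H := Hsq x). rewrite HEs, <- Cmod2_conj in H. apply RtoC_inj in H.
    generalize (Cmod_ge_0 (s x)) (Cmod_ge_0 (E (RtoC x))). intros. nra. }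
  assert (Hsmod : forall x, c1 <= Cmod (s x)).
  { intros x. rewrite Hmod. apply HEb. simpl; lra. }
  assert (HSnz' : forall z, 0 <= Im z -> S z <> RtoC 0).
  { intros [x y] [Hz|Hz]; [apply HSnz, Hz|]. simpl in Hz. subst y. change (x, 0) with (RtoC x).
    rewrite HextS. apply Cmod_gt_0. specialize (Hsmod x). lra. }
  set (Q0 := fun z => (S z * / E z)%C).
  assert (HQ0nz : forall z, 0 <= Im z -> Q0 z <> RtoC 0).
  { intros z Hz E0. apply (HSnz' z Hz). replace (S z) with (Q0 z * E z)%C by (unfold Q0; field; apply HEnz, Hz).
    rewrite E0. ring. }
  assert (HQ0mod : forall x : R, Cmod (Q0 (RtoC x)) = 1).
  { intros x. unfold Q0. rewrite Cmod_mult, Cmod_inv by (apply HEnz; simpl; lra).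
    rewrite HextS, Hmod. field. assert (H := HEb (RtoC x) ltac:(simpl; lra)). lra. }
  set (Q := reflect_glue Q0 (fun _ => RtoC 1)).
  assert (HQ : entire_fun Q).
  { apply reflect_glue_entire; [| |exact HQ0nz| |].
    - apply rel_continuous_retract. intros z. apply continuous_Cmult.
      + apply (continuous_comp uhp_retract S); [apply continuous_uhp_retract|apply entire_continuous, HSe].
      + apply continuous_Cinv; [apply HEnz, uhp_retract_in|].
        apply (proj1 (rel_continuous_retract E) HEc).
    - intros z Hz. destruct (HSe z I) as [l Hl]. destruct (HEh z Hz) as [k Hk]. eexists.
      apply cderiv_mult; [exact Hl|]. apply cderiv_inv; [|exact Hk]. apply HEnz. unfold open_uhp in Hz. lra.
    - intros z _. exists (RtoC 0). apply cderiv_const.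
    - intros x. rewrite <- Cmod2_conj, HQ0mod. f_equal. ring. }
  assert (Qup : forall z, 0 <= Im z -> Q z = Q0 z).
  { intros z Hz. unfold Q, reflect_glue. destruct (Rle_dec 0 (Im z)); [reflexivity|contradiction]. }
  assert (Qlow : forall z, Im z < 0 -> Cmod (Q z) * Cmod (Q0 (Cconj z)) = 1).
  { intros z Hz. unfold Q, reflect_glue. destruct (Rle_dec 0 (Im z)) as [N|_]; [lra|].
    assert (Hn : 0 < Cmod (Q0 (Cconj z))).
    { apply Cmod_gt_0, HQ0nz. rewrite im_conj. lra. }
    rewrite Cmod_mult, Cmod_inv, Cmod_conj, Cmod_1.
    - field. lra.
    - apply Cmod_gt_0. rewrite Cmod_conj. exact Hn. }
  assert (HQnz : forall z, Q z <> RtoC 0).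
  { intros z. destruct (Rle_dec 0 (Im z)) as [Hz|Hz]; [rewrite Qup by exact Hz; apply HQ0nz, Hz|].
    intros E0. assert (H := Qlow z ltac:(lra)). rewrite E0, Cmod_0 in H. lra. }
  destruct (entire_logarithm Q HQ HQnz) as [W [HW [HW0 HQW]]].
  assert (HQ0at0 : Cmod (Q (RtoC 0)) = 1) by (rewrite Qup by (simpl; lra); apply HQ0mod).
  assert (HReW : forall z, Cmod (Q z) = exp (Re (W z))).
  { intros z. rewrite HQW, Cmod_mult, HQ0at0, Cmod_Cexp. ring. }
  set (t0 := Rmax (real (exp_type S) + 1) 0).
  destruct (exp_type_growth S t0 HSe HSfin) as [K [HK HKz]].
  { unfold t0. generalize (Rmax_l (real (exp_type S) + 1) 0). lra. }
  { apply Rmax_r. }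
  set (b := Rabs (ln (K * / c1))).
  assert (HKc : 0 < K * / c1) by (apply Rmult_lt_0_compat; [exact HK|apply Rinv_0_lt_compat, Hc1]).
  assert (Hgrow : forall z, 0 <= Im z -> Cmod (Q0 z) <= exp (t0 * Cmod z + b)).
  { intros z Hz. unfold Q0. rewrite Cmod_mult, Cmod_inv by (apply HEnz, Hz).
    apply Rle_trans with (K * exp (t0 * Cmod z) * / c1).
    - apply Rmult_le_compat; [apply Cmod_ge_0|left; apply Rinv_0_lt_compat, Cmod_gt_0, HEnz, Hz|apply HKz|].
      apply Rinv_le_contravar; [exact Hc1|apply HEb, Hz].
    - replace (K * exp (t0 * Cmod z) * / c1) with (exp (t0 * Cmod z) * (K * / c1)) by ring.
      rewrite exp_plus. apply Rmult_le_compat_l; [left; apply exp_pos|].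
      rewrite <- (exp_ln (K * / c1)) at 1 by exact HKc. apply exp_le, Rle_abs. }
  destruct (linear_on_real_line W t0 b HW) as [beta Hbeta].
  - apply Rmax_r.
  - apply Rabs_pos.
  - intros x. assert (H := HReW (RtoC x)). rewrite Qup, HQ0mod in H by (simpl; lra).
    rewrite <- exp_0 in H. apply exp_inv in H. symmetry. exact H.
  - intros z Hz. specialize (Hgrow z Hz). rewrite <- Qup, HReW in Hgrow by exact Hz.
    apply Rnot_lt_le. intros Hlt. apply exp_increasing in Hlt. lra.
  - intros z Hz. destruct Hz as [Hz|Hz].
    + assert (Hc : 0 <= Im (Cconj z)) by (rewrite im_conj; lra).
      assert (H1 := Hgrow _ Hc). rewrite Cmod_conj in H1. assert (H2 := Qlow z Hz). rewrite HReW in H2.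
      apply Rnot_lt_le. intros Hlt. apply exp_increasing in Hlt. rewrite exp_Ropp in Hlt.
      assert (P1 := exp_pos (Re (W z))). assert (P2 := exp_pos (t0 * Cmod z + b)).
      apply (Rmult_lt_compat_r (exp (t0 * Cmod z + b))) in Hlt; [|exact P2].
      rewrite Rinv_l in Hlt by lra. nra.
    + assert (H := HReW z). destruct z as [x y]. simpl in Hz. subst y.
      change (x, 0) with (RtoC x) in *. rewrite Qup, HQ0mod in H by (simpl; lra).
      rewrite <- exp_0 in H. apply exp_inv in H. rewrite <- H.
      assert (0 <= t0 * Cmod (RtoC x)) by (apply Rmult_le_pos; [apply Rmax_r|apply Cmod_ge_0]).
      generalize (Rabs_pos (ln (K * / c1))). fold b. lra.
  - rewrite HW0 in Hbeta.
    set (p := fun x => v (RtoC x) + beta * x).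
    assert (Hdir : forall x, (s x * / RtoC (Cmod (s x)))%C = (Q (RtoC 0) * cis (p x))%C).
    { intros x.
      assert (HWx : Cexp (W (RtoC x)) = cis (beta * x)).
      { assert (H := HReW (RtoC x)). rewrite Qup, HQ0mod in H by (simpl; lra).
        unfold Cexp. rewrite <- H. rewrite Hbeta. unfold cis. simpl Im. do 2 f_equal; ring_simplify; f_equal; ring. }
      assert (Es : s x = (Q (RtoC 0) * cis (beta * x) * E (RtoC x))%C).
      { rewrite <- HWx, <- HQW, Qup by (simpl; lra). unfold Q0. rewrite HextS. field. apply HEnz. simpl; lra. }
      rewrite Hmod, HEr, Cmod_Cexp. simpl Re.
      rewrite Es, HEr.
      assert (Ee : Cexp (g x, v (RtoC x)) = (RtoC (exp (g x)) * cis (v (RtoC x)))%C).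
      { unfold Cexp, cis, RtoC, Cmult; simpl. f_equal; ring. }
      rewrite Ee. unfold p. rewrite cis_plus. field.
      intros E0. apply RtoC_inj in E0. generalize (exp_pos (g x)). lra. }
    assert (HQ0nz0 : Q (RtoC 0) <> RtoC 0) by apply HQnz.
    assert (Hpb : bohrC (fun x => cis (p x))).
    { apply (bohr_combine (fun z w => Cmod (z - w)) (fun z w => Cmod (z - w)) _ s s _ (2 / c1)).
      - left. apply Rdiv_lt_0_compat; lra.
      - apply almost_periodic_bohr, Hs.
      - apply almost_periodic_bohr, Hs.
      - intros x y.
        assert (H := unit_direction_lipschitz (s x) (s y) c1 Hc1 (Hsmod x) (Hsmod y)).
        rewrite !Hdir in H.
        replace (Q (RtoC 0) * cis (p x) - Q (RtoC 0) * cis (p y))%C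
          with (Q (RtoC 0) * (cis (p x) - cis (p y)))%C in H by ring.
        rewrite Cmod_mult, HQ0at0, Rmult_1_l in H.
        assert (0 < 2 / c1) by (apply Rdiv_lt_0_compat; lra).
        assert (0 <= 2 / c1 * Cmod (s x - s y)) by (apply Rmult_le_pos; [lra|apply Cmod_ge_0]). lra. }
    assert (Hpc : forall x, continuous p x).
    { intros x. apply (continuous_plus (V := R_NormedModule) (fun x => v (RtoC x)) (fun x => beta * x)); [apply Hvc|].
      apply (continuous_scal_r (V := R_NormedModule) beta (fun x => x)), continuous_id. }
    destruct (bohr_argument p Hpc Hpb) as [c [M [HM Hth]]].
    exists (c - beta), (fun x => RtoC (p x - c * x)). split.
    + apply bohr_almost_periodic.
      * split.
        -- intros x. apply continuous_RtoC.
           apply (continuous_minus (V := R_NormedModule) p (fun x => c * x)); [apply Hpc|].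
           apply (continuous_scal_r (V := R_NormedModule) c (fun x => x)), continuous_id.
        -- exists M. intros x. rewrite Cmod_R. apply HM.
      * intros eps He. destruct (Hth eps He) as [W1 [d [Hd H]]]. exists W1, d. split; [exact Hd|].
        intros t Ht x. rewrite <- RtoC_minus, Cmod_R. apply H, Ht.
    + intros x. rewrite <- RtoC_plus. f_equal. unfold p. ring.
Qed.

(** * Spectral factors and the conjugate function *)

Theorem theorem1 :
  forall (f : R -> C) (m : R),
    band_limited f ->
    0 < m ->
    (forall x : R, Im (f x) = 0 /\ m <= Re (f x)) ->
    let g : R -> R := fun x => 1 / 2 * ln (Re (f x)) in
    let u : C -> R := poisson (V := R_CompleteNormedModule) g in
    forall v_o : C -> R,
      harmonic_conjugate u v_o ->
      (exists v : C -> R, continuous_extension v_o v) /\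
      (forall v : C -> R,
         continuous_extension v_o v ->
         ((exists s : R -> C, band_limited s /\ spectral_factor f s) <->
          (exists (c : R) (theta : R -> C),
             almost_periodic theta /\
             forall x : R, RtoC (v (RtoC x)) = Cplus (RtoC (c * x)) (theta x)))).
Proof.
  intros f m Hf Hm Hpos g u v_o Hvo. split.
  - exact (conjugate_extension_exists f m v_o Hf Hm Hpos Hvo).
  - intros v Hv.
    destruct (outer_exists f m v_o v Hf Hm Hpos Hvo Hv) as [E [c1 [c2 HE]]]. split.
    + intros [s [[Hs _] Hsf]]. exact (argument_of_spectral_factor f _ v E c1 c2 s HE Hs Hsf).
    + intros [c [theta [Htheta Hv_eq]]].
      exact (spectral_factor_of_argument f m v E c1 c2 c theta Hf Hm Hpos HE Htheta Hv_eq).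
Qed.
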